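(* Variable hypercoherences (normal functors $\mathsf{HCohI}^n\to\mathsf{HCohI}$, $n\ge 0$) together with uniform families of cliques form a semantics of second-order linear logic, in which a formula with $n$ free variables is interpreted by an $n$-parameter variable hypercoherence, the propositional connectives pointwise and $\forall$ by the trace-based operation $\forall(-)$. Furthermore, by restricting to weakly finite variable hypercoherences, one obtains a finite semantics of MALL2.
   Context: $\mathcal{P}_{\mathrm{fin}}^*(S)$ is the set of finite non-empty subsets of $S$. A hypercoherence $X=(|X|,\Gamma(X))$ is a set $|X|$ with $\Gamma(X)\subseteq\mathcal{P}_{\mathrm{fin}}^*(|X|)$ containing all singletons; $\Gamma^{**}(X)=\Gamma(X)\setminus\{\{x\}\}$. A clique $c\sqsubset X$ is a subset with $\mathcal{P}_{\mathrm{fin}}^*(c)\subseteq\Gamma(X)$. $X^\perp=(|X|,\mathcal{P}_{\mathrm{fin}}^*(|X|)\setminus\Gamma^{**}(X))$; $X\otimes Y$ has web $|X|\times|Y|$ and $S$ coherent iff both projections of $S$ are coherent; $X\oplus Y$ has web $|X|+|Y|$ and $\Gamma=\mathrm{inl}(\Gamma(X))\cup\mathrm{inr}(\Gamma(Y))$. An embedding $X\hookrightarrow Y$ is an injection $\iota$ of webs with $S\in\Gamma(X)\iff\iota(S)\in\Gamma(Y)$; $\mathsf{HCohI}$ is the category of hypercoherences and embeddings. An $n$-parameter variable hypercoherence is a functor $\mathsf{HCohI}^n\to\mathsf{HCohI}$ preserving filtered colimits and finite pullbacks. Its normal forms are pairs $(\vec X,x)$, $x\in|F(\vec X)|$, not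 in the image of $F(\vec\iota)$ for any tuple of embeddings not all bijective; $\mathrm{NF}(F)$ is the set of iso classes; every $x\in|F(\vec Y)|$ has a normal form $\mathrm{NF}(x;F)$ (the class of $(\vec X,x')$ with $F(\vec\iota)(x')=x$), and $\mathrm{NF}(S;F)$ is the direct image of $S$. $F$ is weakly finite if $\mathrm{NF}(F)$ is finite. A uniform family of cliques: $c_{\vec X}\sqsubset F(\vec X)$ with $c_{\vec X}=F(\vec\iota)^{-1}(c_{\vec Y})$ for all embeddings $\vec\iota$. For one-parameter $F$, $N\in\mathcal{P}_{\mathrm{fin}}^*(\mathrm{NF}(F))$ is coherent if for all $X$ and $S\in\mathcal{P}_{\mathrm{fin}}^*(|F(X)|)$ with $\mathrm{NF}(S;F)=N$, $S\in\Gamma(F(X))$; $\Gamma\mathrm{NF}(F)$ is the set of coherent $N$; $\mathrm{Tr}(F)$ has web $\{x\in\mathrm{NF}(F)\mid\{x\}\in\Gamma\mathrm{NF}(F)\}$ and $\Gamma(\mathrm{Tr}(F))=\mathcal{P}_{\mathrm{fin}}^*(|\mathrm{Tr}(F)|)\cap\Gamma\mathrm{NF}(F)$; for $G:\mathsf{HCohI}^{n+1}\to\mathsf{HCohI}$, $\forall(G)(\vec X)=\mathrm{Tr}(G(\vec X,-))$. Exponentials are interpreted pointwise via Ehrhard's hypercoherence model. A finite semantics is one in which the set of possible denotations of proofs of each formula is finite. MALL2 is second-order linear logic without $!,?$. *)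

(* Defs.v *)
From mathcomp Require Import all_boot.
From mathcomp Require Import boolp classical_sets functions cardinality.

Set Implicit Arguments.
Unset Strict Implicit.
Unset Printing Implicit Defensive.

Local Open Scope classical_set_scope.

Record category := Category {
  ob :> Type;
  hom : ob -> ob -> Type;
  idm : forall x, hom x x;
  cmp : forall x y z, hom y z -> hom x y -> hom x z;
  cmp1m : forall x y (f : hom x y), cmp (idm y) f = f;
  cmpm1 : forall x y (f : hom x y), cmp f (idm x) = f;
  cmpA : forall x y z t (h : hom z t) (g : hom y z) (f : hom x y),
    cmp h (cmp g f) = cmp (cmp h g) f }.

Record functor (C D : category) := Functor {
  fob :> C -> D;
  fmap : forall x y, hom x y -> hom (fob x) (fob y);
  fmap1 : forall x, fmap (idm x) = idm (fob x);
  fmapM : forall x y z (g : hom y z) (f : hom x y),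
    fmap (cmp g f) = cmp (fmap g) (fmap f) }.

Lemma fcomp1 (C D E : category) (G : functor D E) (F : functor C D) (x : C) :
  fmap G (fmap F (idm x)) = idm (G (F x)).
Proof. by rewrite !fmap1. Qed.

Lemma fcompM (C D E : category) (G : functor D E) (F : functor C D) (x y z : C)
    (g : hom y z) (f : hom x y) :
  fmap G (fmap F (cmp g f)) = cmp (fmap G (fmap F g)) (fmap G (fmap F f)).
Proof. by rewrite !fmapM. Qed.

Definition fcomp (C D E : category) (G : functor D E) (F : functor C D) :
    functor C E :=
  @Functor C E (fun x => G (F x)) (fun x y f => fmap G (fmap F f))
    (fcomp1 G F) (fcompM G F).

Section Power.
Variables (I : Type) (C : category).

Let pow_hom (X Y : I -> C) := forall i, hom (X i) (Y i).
Let pow_id (X : I -> C) : pow_hom X X := fun i => idm (X i).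
Let pow_cmp (X Y Z : I -> C) (g : pow_hom Y Z) (f : pow_hom X Y) : pow_hom X Z :=
  fun i => cmp (g i) (f i).

Let pow_1m X Y (f : pow_hom X Y) : pow_cmp (pow_id Y) f = f.
Proof. by apply: functional_extensionality_dep => i; rewrite /pow_cmp cmp1m. Qed.
Let pow_m1 X Y (f : pow_hom X Y) : pow_cmp f (pow_id X) = f.
Proof. by apply: functional_extensionality_dep => i; rewrite /pow_cmp cmpm1. Qed.
Let pow_A X Y Z T (h : pow_hom Z T) (g : pow_hom Y Z) (f : pow_hom X Y) :
  pow_cmp h (pow_cmp g f) = pow_cmp (pow_cmp h g) f.
Proof. by apply: functional_extensionality_dep => i; rewrite /pow_cmp cmpA. Qed.

Definition power : category := Category pow_1m pow_m1 pow_A.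
End Power.

Definition filtered (J : category) :=
  [/\ exists j : J, True,
      forall i j : J, exists k, inhabited (hom i k) /\ inhabited (hom j k)
    & forall (i j : J) (f g : hom i j), exists k (h : hom j k), cmp h f = cmp h g].

(* No smallness condition is put on the indexing category. *)
Definition is_cocone (J C : category) (D : functor J C) (c : C)
    (k : forall j, hom (D j) c) :=
  forall i j (f : hom i j), cmp (k j) (fmap D f) = k i.

Definition is_colimit (J C : category) (D : functor J C) (c : C)
    (k : forall j, hom (D j) c) :=
  is_cocone k /\
  forall (d : C) (l : forall j, hom (D j) d), is_cocone l ->
    exists! u : hom c d, forall j, cmp u (k j) = l j.

Definition preserves_filtered_colimits (C C' : category) (F : functor C C') :=
  forall (J : category) (D : functor J C) (c : C) (k : forall j, hom (D j) c),
    filtered J -> is_colimit k ->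
    @is_colimit J C' (fcomp F D) (F c) (fun j => fmap F (k j)).

Definition is_pullback (C : category) (x y z p : C)
    (f : hom x z) (g : hom y z) (a : hom p x) (b : hom p y) :=
  cmp f a = cmp g b /\
  forall (q : C) (a' : hom q x) (b' : hom q y), cmp f a' = cmp g b' ->
    exists! u : hom q p, cmp a u = a' /\ cmp b u = b'.

Definition preserves_pullbacks (C C' : category) (F : functor C C') :=
  forall (x y z p : C) (f : hom x z) (g : hom y z) (a : hom p x) (b : hom p y),
    is_pullback f g a b ->
    is_pullback (fmap F f) (fmap F g) (fmap F a) (fmap F b).

Definition normal_functor (C C' : category) (F : functor C C') :=
  preserves_filtered_colimits F /\ preserves_pullbacks F.

Definition fin_ne (T : Type) (S : set T) := finite_set S /\ S !=set0.

(* Sets of web elements are written [T -> Prop], not [set T], whenever they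
   occur inside a type that has to be a web: the universe of webs must contain
   such powersets, which the fixed universes of the constant [set] forbid. *)
Record hcoh_on (T : Type) := HcohOn {
  coh : (T -> Prop) -> Prop;
  coh_fin_ne : forall S, coh S -> fin_ne S;
  coh_set1 : forall x, coh [set x] }.

#[projections(primitive)]
Record hcoh := Hcoh { web :> Type; str : hcoh_on web }.

Definition Gamma (X : hcoh) : (X -> Prop) -> Prop := coh (str X).

Definition clique (X : hcoh) (c : X -> Prop) :=
  forall S : X -> Prop, fin_ne S -> S `<=` c -> Gamma S.

Record emb (X Y : hcoh) := Emb {
  emb_fun :> X -> Y;
  emb_inj : injective emb_fun;
  emb_coh : forall S : X -> Prop, Gamma S <-> Gamma (emb_fun @` S) }.

Lemma emb_eq (X Y : hcoh) (f g : emb X Y) : emb_fun f = emb_fun g -> f = g.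
Proof.
case: f g => [f fi fc] [g gi gc] /= fg; case: _ / fg gi gc => gi gc.
by rewrite (Prop_irrelevance gi fi) (Prop_irrelevance gc fc).
Qed.

Lemma emb_id_coh (X : hcoh) (S : X -> Prop) : Gamma S <-> Gamma (id @` S).
Proof. by rewrite image_id. Qed.

Definition emb_id (X : hcoh) : emb X X := Emb (@inj_id X) (@emb_id_coh X).

Lemma emb_cmp_coh (X Y Z : hcoh) (g : emb Y Z) (f : emb X Y) (S : X -> Prop) :
  Gamma S <-> Gamma ((g \o f) @` S).
Proof. by rewrite -image_comp -!emb_coh. Qed.

Definition emb_cmp (X Y Z : hcoh) (g : emb Y Z) (f : emb X Y) : emb X Z :=
  Emb (inj_comp (@emb_inj _ _ g) (@emb_inj _ _ f)) (emb_cmp_coh g f).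

Lemma emb_1m X Y (f : emb X Y) : emb_cmp (emb_id Y) f = f.
Proof. exact: emb_eq. Qed.
Lemma emb_m1 X Y (f : emb X Y) : emb_cmp f (emb_id X) = f.
Proof. exact: emb_eq. Qed.
Lemma emb_A X Y Z T (h : emb Z T) (g : emb Y Z) (f : emb X Y) :
  emb_cmp h (emb_cmp g f) = emb_cmp (emb_cmp h g) f.
Proof. exact: emb_eq. Qed.

Definition HCohI : category := Category emb_1m emb_m1 emb_A.

Section HcohOps.
Variables (T U : Type) (X : hcoh_on T) (Y : hcoh_on U).

(* Gamma** *)
Definition strict_coh (S : T -> Prop) := coh X S /\ ~ exists x, S = [set x].

Definition perp_coh (S : T -> Prop) := fin_ne S /\ ~ strict_coh S.

Lemma perp_fin_ne S : perp_coh S -> fin_ne S. Proof. by case. Qed.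

Lemma fin_ne1 (V : Type) (x : V) : fin_ne [set x].
Proof. by split; [exact: finite_set1 | exists x]. Qed.

Lemma perp_set1 x : perp_coh [set x].
Proof. by split; [exact: fin_ne1 | case=> _; apply; exists x]. Qed.

Definition hperp : hcoh_on T := HcohOn perp_fin_ne perp_set1.

Definition tensor_coh (S : T * U -> Prop) :=
  [/\ fin_ne S, coh X (fst @` S) & coh Y (snd @` S)].

Lemma tensor_fin_ne S : tensor_coh S -> fin_ne S. Proof. by case. Qed.

Lemma tensor_set1 x : tensor_coh [set x].
Proof. by split; [exact: fin_ne1 | rewrite image_set1; exact: coh_set1 ..]. Qed.

Definition htensor : hcoh_on (T * U) := HcohOn tensor_fin_ne tensor_set1.

Definition plus_coh (S : T + U -> Prop) :=
  (exists2 S' : T -> Prop, coh X S' & S = inl @` S') \/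
  (exists2 S' : U -> Prop, coh Y S' & S = inr @` S').

Lemma plus_fin_ne S : plus_coh S -> fin_ne S.
Proof.
by case=> -[S' /coh_fin_ne[fS' [x S'x]] ->]; split;
  [exact: finite_image | exists (inl x); exists x
  |exact: finite_image | exists (inr x); exists x].
Qed.

Lemma plus_set1 x : plus_coh [set x].
Proof.
by case: x => x; [left|right]; exists [set x];
  rewrite ?image_set1 //; exact: coh_set1.
Qed.

Definition hplus : hcoh_on (T + U) := HcohOn plus_fin_ne plus_set1.

(* Ehrhard's exponential: the web consists of the finite cliques, and a
   non-empty finite set of them is coherent when all its multisections are. *)
Definition bang_web := {c : T -> Prop | finite_set c /\ clique (X := Hcoh X) c}.

Definition multisection (S : T -> Prop) (A : bang_web -> Prop) :=
  (forall c, A c -> exists2 x, S x & sval c x) /\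
  (forall x, S x -> exists2 c, A c & sval c x).

Definition bang_coh (A : bang_web -> Prop) :=
  fin_ne A /\ forall S : T -> Prop, fin_ne S -> multisection S A -> coh X S.

Lemma bang_fin_ne A : bang_coh A -> fin_ne A. Proof. by case. Qed.

Lemma bang_set1 c : bang_coh [set c].
Proof.
split=> [|S fS [_ Sc]]; first exact: fin_ne1.
by apply: (proj2 (proj2_sig c)) => // x /Sc[_ ->].
Qed.

Definition hbang : hcoh_on bang_web := HcohOn bang_fin_ne bang_set1.

End HcohOps.

Lemma unit_set1 (x : unit) : fin_ne [set x]. Proof. exact: fin_ne1. Qed.

Definition hone : hcoh_on unit := HcohOn (fun S H => H) unit_set1.

Definition hzero : hcoh_on void :=
  HcohOn (fun S H => H) (fun x : void => fin_ne1 x).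

(* [idx n] is an n-element type, and [idx n.+1] adds the parameter [None].  The
   ordinals 'I_n are not used because they do not live in [Set], see [finhc]. *)
Fixpoint idx (n : nat) : Set := if n is m.+1 then option (idx m) else void.

Definition hcohs n := idx n -> hcoh.
Definition embs n (X Y : hcohs n) := forall i, emb (X i) (Y i).
Definition rels n (X Y : hcohs n) := forall i, X i -> Y i -> Prop.

Definition graphs n (X Y : hcohs n) (f : embs X Y) : rels X Y :=
  fun i x y => f i x = y.

Definition ext n (X : hcohs n) (Z : hcoh) : hcohs n.+1 :=
  fun o => if o is Some i then X i else Z.

Definition ext_rel n (X Y : hcohs n) (Z W : hcoh) (R : rels X Y)
    (r : Z -> W -> Prop) : rels (ext X Z) (ext Y W) :=
  fun o => match o return ext X Z o -> ext Y W o -> Prop with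
           | Some i => R i
           | None => r
           end.

(* The data of an n-parameter variable hypercoherence, without its laws.  The
   action on morphisms is given in relational form, on arbitrary tuples of
   relations between webs: this makes every connective, including the
   quantifiers (whose action is a function only thanks to normality), a total
   operation on raw functors.  The laws are [variable_hypercoherence], which
   only looks at the action on (the graphs of) embeddings. *)
#[projections(primitive)]
Record rawfun (n : nat) := RawFun {
  rweb : hcohs n -> Type;
  rstr : forall X, hcoh_on (rweb X);
  ract : forall X Y : hcohs n, rels X Y -> rweb X -> rweb Y -> Prop }.

Definition robj n (F : rawfun n) (X : hcohs n) : hcoh := Hcoh (rstr F X).

Definition hact n (F : rawfun n) (X Y : hcohs n) (f : embs X Y) :
    robj F X -> robj F Y -> Prop := ract (graphs f).

Arguments hact {n} F {X Y} f _ _.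

(* [F] is (the relational presentation of) a functor HCohI^n -> HCohI
   preserving filtered colimits and pullbacks *)
Definition variable_hypercoherence n (F : rawfun n) :=
  exists (G : forall X Y : power (idx n) HCohI, hom X Y ->
            @hom HCohI (robj F X) (robj F Y))
         (G1 : forall X, G X X (idm X) = idm _)
         (GM : forall X Y Z (g : hom Y Z) (f : hom X Y),
            G X Z (cmp g f) = cmp (G Y Z g) (G X Y f)),
    normal_functor (@Functor (power (idx n) HCohI) HCohI (robj F) G G1 GM) /\
    forall (X Y : hcohs n) (f : embs X Y) x y,
      hact F f x y <-> emb_fun (G X Y f) x = y.

(* Hypercoherences over the webs [idx k]; every finite one is isomorphic to one
   of those.  Since functors preserving filtered colimits only have normal
   forms over finite hypercoherences, restricting the representatives of normal
   forms to [finhc] loses no isomorphism class, and it makes the classes live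
   in the universe of webs, as required for the web of the trace. *)
Definition finhc := {k : nat & hcoh_on (idx k)}.
Definition hc_of (Z : finhc) : hcoh := Hcoh (projT2 Z).

Section NormalForms.
Variables (n : nat) (F : rawfun n).

Definition normal_point (X : hcohs n) (x : robj F X) :=
  forall (Y : hcohs n) (f : embs Y X),
    (exists y, hact F f y x) -> forall i, bijective (f i).

Definition rep := {Z : idx n -> finhc & rweb F (fun i => hc_of (Z i))}.
Definition rep_base (r : rep) : hcohs n := fun i => hc_of (projT1 r i).
Definition rep_point (r : rep) : robj F (rep_base r) := projT2 r.

Definition rep_iso (r s : rep) := exists f : embs (rep_base r) (rep_base s),
  (forall i, bijective (f i)) /\ hact F f (rep_point r) (rep_point s).

Definition NF : set (rep -> Prop) :=
  [set N | exists2 r, normal_point (rep_point r) & N = rep_iso r].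

Definition nf_of (Y : hcohs n) (x : robj F Y) (N : rep -> Prop) :=
  NF N /\ exists2 r, N r & exists f : embs (rep_base r) Y, hact F f (rep_point r) x.

Definition nf_set (Y : hcohs n) (S : robj F Y -> Prop) : set (rep -> Prop) :=
  [set N | exists2 x, S x & nf_of x N].

Definition weakly_finite := finite_set NF.

Definition uniform_clique_family (c : forall X : hcohs n, robj F X -> Prop) :=
  (forall X, clique (c X)) /\
  forall (X Y : hcohs n) (f : embs X Y) x y, hact F f x y -> (c X x <-> c Y y).

End NormalForms.

Arguments NF {n} F N.
Arguments weakly_finite {n} F.
Arguments uniform_clique_family {n} F c.
Arguments nf_of {n} F {Y} x N.
Arguments nf_set {n} F {Y} S.

Section Trace.
Variable F : rawfun 1.

Definition coherent_nf (N : (rep F -> Prop) -> Prop) :=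
  [/\ fin_ne N, N `<=` NF F
    & forall (X : hcohs 1) (S : robj F X -> Prop),
        fin_ne S -> nf_set F S = N -> Gamma S].

Definition trace_web := {N : rep F -> Prop | NF F N /\ coherent_nf [set N]}.

Definition trace_coh (S : trace_web -> Prop) :=
  fin_ne S /\ coherent_nf (sval @` S).

Lemma trace_fin_ne S : trace_coh S -> fin_ne S. Proof. by case. Qed.

Lemma trace_set1 x : trace_coh [set x].
Proof.
by split; [exact: fin_ne1 | rewrite image_set1; case: (proj2_sig x)].
Qed.

Definition htrace : hcoh_on trace_web := HcohOn trace_fin_ne trace_set1.

End Trace.

Section RawOps.
Variable n : nat.
Implicit Types F G : rawfun n.

Definition proj_f (i : idx n) : rawfun n :=
  @RawFun n (fun X => web (X i)) (fun X => str (X i)) (fun X Y R => R i).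

Definition const_f (T : Type) (A : hcoh_on T) : rawfun n :=
  @RawFun n (fun _ => T) (fun _ => A) (fun _ _ _ x y => x = y).

Definition perp_f F : rawfun n :=
  @RawFun n (rweb F) (fun X => hperp (rstr F X)) (@ract n F).

Definition tensor_f F G : rawfun n :=
  @RawFun n (fun X => (rweb F X * rweb G X)%type)
    (fun X => htensor (rstr F X) (rstr G X))
    (fun X Y R x y => ract R x.1 y.1 /\ ract R x.2 y.2).

Definition plus_f F G : rawfun n :=
  @RawFun n (fun X => (rweb F X + rweb G X)%type)
    (fun X => hplus (rstr F X) (rstr G X))
    (fun X Y R x y => match x, y with
       | inl a, inl b => ract R a b
       | inr a, inr b => ract R a b
       | _, _ => False
       end).

Definition bang_f F : rawfun n :=
  @RawFun n (fun X => bang_web (rstr F X)) (fun X => hbang (rstr F X))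
    (fun X Y R c d => sval d = [set y | exists2 x, sval c x & ract R x y]).

Definition partial_f (G : rawfun n.+1) (X : hcohs n) : rawfun 1 :=
  @RawFun 1 (fun Z => rweb G (ext X (Z None))) (fun Z => rstr G (ext X (Z None)))
    (fun Z W R => ract (ext_rel (fun i x y => x = y) (R None))).

(* The class of (Z, x) is sent to the class of (Z, G(f, id)(x)); the latter is
   the direct image of the former, because isomorphisms in the last parameter
   commute with G(f, id). *)
Definition all_f (G : rawfun n.+1) : rawfun n :=
  @RawFun n (fun X => trace_web (partial_f G X)) (fun X => htrace (partial_f G X))
    (fun X Y R N M => sval M = [set s : rep (partial_f G Y) |
       exists2 x : rweb (partial_f G X) (rep_base s),
         sval N (existT _ (projT1 s) x)
       & @ract _ G _ _ (ext_rel R (fun a b : rep_base s None => a = b))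
           x (rep_point s)]).

End RawOps.

Definition par_f n (F G : rawfun n) := perp_f (tensor_f (perp_f F) (perp_f G)).
Definition with_f n (F G : rawfun n) := perp_f (plus_f (perp_f F) (perp_f G)).
Definition whynot_f n (F : rawfun n) := perp_f (bang_f (perp_f F)).
Definition ex_f n (G : rawfun n.+1) := perp_f (all_f (perp_f G)).

(* [formula n]: formulas whose free variables are among [idx n]; a quantifier
   binds the variable [None]. *)
Inductive formula : nat -> Type :=
| Var n : idx n -> formula n
| NVar n : idx n -> formula n
| One n : formula n
| Bot n : formula n
| Zero n : formula n
| Top n : formula n
| Tensor n : formula n -> formula n -> formula n
| Par n : formula n -> formula n -> formula n
| Plus n : formula n -> formula n -> formula n
| With n : formula n -> formula n -> formula n
| Bang n : formula n -> formula n
| WhyNot n : formula n -> formula n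
| All n : formula n.+1 -> formula n
| Ex n : formula n.+1 -> formula n.

Arguments One {n}.
Arguments Bot {n}.
Arguments Zero {n}.
Arguments Top {n}.

Fixpoint dual n (A : formula n) : formula n :=
  match A with
  | Var _ i => NVar i
  | NVar _ i => Var i
  | One _ => Bot
  | Bot _ => One
  | Zero _ => Top
  | Top _ => Zero
  | Tensor _ A B => Par (dual A) (dual B)
  | Par _ A B => Tensor (dual A) (dual B)
  | Plus _ A B => With (dual A) (dual B)
  | With _ A B => Plus (dual A) (dual B)
  | Bang _ A => WhyNot (dual A)
  | WhyNot _ A => Bang (dual A)
  | All _ A => Ex (dual A)
  | Ex _ A => All (dual A)
  end.

Fixpoint rename n (A : formula n) : forall m, (idx n -> idx m) -> formula m :=
  match A in formula n return forall m, (idx n -> idx m) -> formula m with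
  | Var _ i => fun m s => Var (s i)
  | NVar _ i => fun m s => NVar (s i)
  | One _ => fun m s => One
  | Bot _ => fun m s => Bot
  | Zero _ => fun m s => Zero
  | Top _ => fun m s => Top
  | Tensor _ A B => fun m s => Tensor (rename A s) (rename B s)
  | Par _ A B => fun m s => Par (rename A s) (rename B s)
  | Plus _ A B => fun m s => Plus (rename A s) (rename B s)
  | With _ A B => fun m s => With (rename A s) (rename B s)
  | Bang _ A => fun m s => Bang (rename A s)
  | WhyNot _ A => fun m s => WhyNot (rename A s)
  | All _ A => fun m s => All (rename A (m := m.+1) (omap s))
  | Ex _ A => fun m s => Ex (rename A (m := m.+1) (omap s))
  end.

Definition wk n (A : formula n) : formula n.+1 := rename A (m := n.+1) Some.

Definition up n m (s : idx n -> formula m) : idx n.+1 -> formula m.+1 :=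
  fun o => if o is Some i then wk (s i) else @Var m.+1 None.

Fixpoint subst n (A : formula n) : forall m, (idx n -> formula m) -> formula m :=
  match A in formula n return forall m, (idx n -> formula m) -> formula m with
  | Var _ i => fun m s => s i
  | NVar _ i => fun m s => dual (s i)
  | One _ => fun m s => One
  | Bot _ => fun m s => Bot
  | Zero _ => fun m s => Zero
  | Top _ => fun m s => Top
  | Tensor _ A B => fun m s => Tensor (subst A s) (subst B s)
  | Par _ A B => fun m s => Par (subst A s) (subst B s)
  | Plus _ A B => fun m s => Plus (subst A s) (subst B s)
  | With _ A B => fun m s => With (subst A s) (subst B s)
  | Bang _ A => fun m s => Bang (subst A s)
  | WhyNot _ A => fun m s => WhyNot (subst A s)
  | All _ A => fun m s => All (subst A (up s))
  | Ex _ A => fun m s => Ex (subst A (up s))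
  end.

Definition inst1 n (B : formula n) : idx n.+1 -> formula n :=
  fun o => if o is Some i then Var i else B.

(* A[B/X], where X is the variable bound by the outermost quantifier *)
Definition inst n (A : formula n.+1) (B : formula n) : formula n :=
  subst A (inst1 B).

Fixpoint mall n (A : formula n) : bool :=
  match A with
  | Tensor _ A B | Par _ A B | Plus _ A B | With _ A B => mall A && mall B
  | Bang _ _ | WhyNot _ _ => false
  | All _ A | Ex _ A => mall A
  | _ => true
  end.

Fixpoint interp n (A : formula n) : rawfun n :=
  match A in formula n return rawfun n with
  | Var _ i => proj_f i
  | NVar _ i => perp_f (proj_f i)
  | One n => const_f n hone
  | Bot n => perp_f (const_f n hone)
  | Zero n => const_f n hzero
  | Top n => perp_f (const_f n hzero)
  | Tensor _ A B => tensor_f (interp A) (interp B)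
  | Par _ A B => par_f (interp A) (interp B)
  | Plus _ A B => plus_f (interp A) (interp B)
  | With _ A B => with_f (interp A) (interp B)
  | Bang _ A => bang_f (interp A)
  | WhyNot _ A => whynot_f (interp A)
  | All _ A => all_f (interp A)
  | Ex _ A => ex_f (interp A)
  end.

Lemma hcoh_on_eq T (X Y : hcoh_on T) : (forall S, coh X S <-> coh Y S) -> X = Y.
Proof.
case: X Y => [X X1 X2] [Y Y1 Y2] /= XY.
have eXY : X = Y by apply: funext => S; exact: propext.
case: _ / eXY Y1 Y2 {XY} => Y1 Y2.
by rewrite (Prop_irrelevance Y1 X1) (Prop_irrelevance Y2 X2).
Qed.

Lemma hperpK T (X : hcoh_on T) : hperp (hperp X) = X.
Proof.
apply: hcoh_on_eq => S; split=> [[fS nS]|XS].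
  case: (pselect (exists x, S = [set x])) => [[x ->]|nS1]; first exact: coh_set1.
  case: (pselect (coh X S)) => // nXS; case: nS; split=> //.
  by split=> // -[].
split; first exact: coh_fin_ne XS.
by case=> -[_ nS] nS1; exact: nS.
Qed.

Lemma perp_fK n (F : rawfun n) : perp_f (perp_f F) = F.
Proof.
case: F => w s a; rewrite /perp_f /=.
by congr (RawFun _ _); apply: functional_extensionality_dep => X; rewrite hperpK.
Qed.

Lemma interp_dual n (A : formula n) : interp (dual A) = perp_f (interp A).
Proof.
by elim: A => {n} //=;
  rewrite /par_f /with_f /whynot_f /ex_f => *;
  repeat match goal with H : interp (dual _) = _ |- _ => rewrite {}H end;
  rewrite ?perp_fK.
Qed.

Definition comp_f n m (F : rawfun n) (G : idx n -> rawfun m) : rawfun m :=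
  @RawFun m (fun X => rweb F (fun i => robj (G i) X))
    (fun X => rstr F (fun i => robj (G i) X))
    (fun X Y R => @ract n F (fun i => robj (G i) X) (fun i => robj (G i) Y)
                    (fun i => @ract m (G i) X Y R)).

Definition wk_f n (F : rawfun n) : rawfun n.+1 :=
  @comp_f n n.+1 F (fun i => @proj_f n.+1 (Some i)).

Definition up_f n m (G : idx n -> rawfun m) : idx n.+1 -> rawfun m.+1 :=
  fun o => if o is Some i then wk_f (G i) else @proj_f m.+1 None.

Definition act_id n (F : rawfun n) :=
  forall X : hcohs n, @ract n F X X (fun i x y => x = y) = (fun x y => x = y).

Lemma all_comp n m (F : rawfun n.+1) (G : idx n -> rawfun m) :
  (forall i, act_id (G i)) ->
  all_f (comp_f F (up_f G)) = comp_f (all_f F) G.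
Proof.
move=> idG; pose G' : idx n.+1 -> rawfun m.+1 := fun o => @RawFun m.+1
  (fun X => web (ext (fun i => robj (G i) (fun j => X (Some j))) (X None) o))
  (fun X => str (ext (fun i => robj (G i) (fun j => X (Some j))) (X None) o))
  (fun X Y R => @ext_rel n (fun i => robj (G i) (fun j => X (Some j)))
     (fun i => robj (G i) (fun j => Y (Some j))) (X None) (Y None)
     (fun i => @ract m (G i) (fun j => X (Some j)) (fun j => Y (Some j))
        (fun j => R (Some j))) (R None) o).
have -> : up_f G = G' by apply: funext => -[i|].
pose w (X : hcohs m) (Z : hcohs 1) := rweb F (ext (fun i => robj (G i) X) (Z None)).
pose st (X : hcohs m) (Z : hcohs 1) : hcoh_on (w X Z) := rstr F _.
pose Act := forall (X : hcohs m) (Z W : hcohs 1), rels Z W -> w X Z -> w X W -> Prop.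
pose P (a : Act) (X : hcohs m) := RawFun (st X) (a X).
pose H (a : Act) := @RawFun m (fun X => trace_web (P a X)) (fun X => htrace (P a X))
    (fun X Y R N M => sval M = [set s : rep (P a Y) |
       exists2 x : rweb (P a X) (rep_base s),
         sval N (existT _ (projT1 s) x)
       & @ract _ F _ _ (@ext_rel n (fun i => robj (G i) X) (fun i => robj (G i) Y)
            _ _ (fun i => @ract m (G i) X Y R)
            (fun a b : rep_base s None => a = b)) x (rep_point s)]).
pose a1 : Act := fun X Z W R => ract
  (@ext_rel n (fun i => robj (G i) X) (fun i => robj (G i) X) _ _
     (fun i => @ract m (G i) X X (fun i x y => x = y)) (R None)).
pose a2 : Act := fun X Z W R => ract
  (@ext_rel n (fun i => robj (G i) X) (fun i => robj (G i) X) _ _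
     (fun i x y => x = y) (R None)).
suff a12 : a1 = a2 by change (H a1 = H a2); rewrite a12.
apply: functional_extensionality_dep => X.
apply: functional_extensionality_dep => Z.
apply: functional_extensionality_dep => W.
apply: functional_extensionality_dep => R.
rewrite /a1 /a2; congr (ract (ext_rel _ _)).
by apply: functional_extensionality_dep => i; exact: idG.
Qed.
Lemma perp_comp n m (F : rawfun n) (G : idx n -> rawfun m) :
  perp_f (comp_f F G) = comp_f (perp_f F) G.
Proof. by []. Qed.

Lemma interp_id n (A : formula n) : act_id (interp A).
Proof.
have sigE T (Q : T -> Prop) (u v : {x | Q x}) : (sval v = sval u) = (u = v).
  apply: propext; split=> [|->//]; case: u v => [u Qu] [v Qv] /= vu.
  by case: _ / vu Qu => Qu; rewrite (Prop_irrelevance Qu Qv).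
have imE T (c : T -> Prop) : [set y | exists2 x, c x & x = y] = c.
  by apply/seteqP; split=> y /= => [[x cx <-]//|cy]; exists y.
have extE k (X : hcohs k) (Z : hcoh) :
    ext_rel (fun i (x y : X i) => x = y) (fun x y : Z => x = y) =
    (fun o (x y : ext X Z o) => x = y).
  by apply: functional_extensionality_dep => -[i|].
have pairE T U (x y : T * U) : (x.1 = y.1 /\ x.2 = y.2) = (x = y).
  by apply: propext; case: x y => [a b] [c d] /=; split=> [[-> ->]|[-> ->]].
have sumE T U (x y : T + U) : match x, y with inl a, inl b => a = b
    | inr a, inr b => a = b | _, _ => False end = (x = y).
  apply: propext; by case: x y => x [] y; split=> //; do [by move->|by case].
have allE k (F : rawfun k.+1) : act_id F -> act_id (all_f F).
  move=> idF X; apply: funext => N; apply: funext => M /=; rewrite -sigE.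
  congr (_ = _); apply/seteqP; split=> -[Z y].
    by case=> x Nx; rewrite extE idF /rep_point /= => xy; case: _ / xy.
  by move=> Ny; exists y; rewrite ?extE ?idF.
have bangE k (F : rawfun k) : act_id F -> act_id (bang_f F).
  move=> idF X; apply: funext => c; apply: funext => d /=.
  by rewrite idF imE sigE.
elim: A => {n} //= [n A IHA B IHB|n A IHA B IHB|n A IHA B IHB|n A IHA B IHB
    |n A IHA|n A IHA|n A IHA|n A IHA].
- by move=> X; apply: funext => x; apply: funext => y /=; rewrite IHA IHB pairE.
- by move=> X; apply: funext => x; apply: funext => y /=; rewrite IHA IHB pairE.
- by move=> X; apply: funext => x; apply: funext => y /=; rewrite IHA IHB sumE.
- by move=> X; apply: funext => x; apply: funext => y /=; rewrite IHA IHB sumE.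
- exact: bangE.
- exact: (bangE _ (perp_f _)).
- exact: allE.
- exact: (allE _ (perp_f _)).
Qed.

Lemma interp_rename n (A : formula n) m (s : idx n -> idx m) :
  interp (rename A s) = comp_f (interp A) (fun i => proj_f (s i)).
Proof.
have up_proj k l (t : idx k -> idx l) :
    (fun o => @proj_f l.+1 (omap t o)) = up_f (fun i => proj_f (t i)).
  by apply: funext => -[i|].
elim: A m s => {n} //=.
- by move=> n A IHA B IHB m s; rewrite IHA IHB.
- by move=> n A IHA B IHB m s; rewrite IHA IHB.
- by move=> n A IHA B IHB m s; rewrite IHA IHB.
- by move=> n A IHA B IHB m s; rewrite IHA IHB.
- by move=> n A IHA m s; rewrite IHA.
- by move=> n A IHA m s; rewrite IHA.
- by move=> n A IHA m s; rewrite IHA up_proj all_comp.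
- by move=> n A IHA m s; rewrite IHA up_proj /ex_f perp_comp all_comp.
Qed.

Lemma interp_wk n (A : formula n) : interp (wk A) = wk_f (interp A).
Proof. exact: interp_rename. Qed.

Lemma interp_subst n (A : formula n) m (s : idx n -> formula m) :
  interp (subst A s) = comp_f (interp A) (fun i => interp (s i)).
Proof.
have up_interp k l (t : idx k -> formula l) :
    (fun o => interp (up t o)) = up_f (fun i => interp (t i)).
  by apply: funext => -[i|] //=; rewrite interp_wk.
elim: A m s => {n} //=.
- by move=> n i m s; rewrite interp_dual.
- by move=> n A IHA B IHB m s; rewrite IHA IHB.
- by move=> n A IHA B IHB m s; rewrite IHA IHB.
- by move=> n A IHA B IHB m s; rewrite IHA IHB.
- by move=> n A IHA B IHB m s; rewrite IHA IHB.
- by move=> n A IHA m s; rewrite IHA.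
- by move=> n A IHA m s; rewrite IHA.
- by move=> n A IHA m s; rewrite IHA up_interp all_comp // => i; exact: interp_id.
- by move=> n A IHA m s; rewrite IHA up_interp /ex_f perp_comp all_comp // => i;
  exact: interp_id.
Qed.

Definition inst_f n (F : rawfun n.+1) (G : rawfun n) : rawfun n :=
  @RawFun n (fun X => rweb F (ext X (robj G X)))
    (fun X => rstr F (ext X (robj G X)))
    (fun X Y R => ract
       (@ext_rel n X Y (robj G X) (robj G Y) R (@ract n G X Y R))).

Lemma interp_inst n (A : formula n.+1) (B : formula n) :
  interp (inst A B) = inst_f (interp A) (interp B).
Proof.
rewrite interp_subst.
pose G : idx n.+1 -> rawfun n := fun o => @RawFun n
  (fun X => web (ext X (robj (interp B) X) o))
  (fun X => str (ext X (robj (interp B) X) o))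
  (fun X Y R => @ext_rel n X Y (robj (interp B) X) (robj (interp B) Y) R
     (@ract n (interp B) X Y R) o).
have -> : (fun o => interp (inst1 B o)) = G by apply: funext => -[i|].
reflexivity.
Qed.

(* Sequents are finite partial maps from names to formulas: names stand for the
   occurrences of formulas in a one-sided sequent, so that exchange is implicit.
   The same partial maps, with points of webs instead of formulas, are used for
   the elements of the denotations. *)
Definition pmap (T : Type) := nat -> option T.

Section PartialMaps.
Variable T : Type.
Implicit Types (f g : pmap T) (x : nat) (a : T).

Definition pempty : pmap T := fun _ => None.
Definition pset f x a : pmap T := fun z => if z == x then Some a else f z.
Definition pdisjoint f g := forall z, f z = None \/ g z = None.
Definition pjoin f g : pmap T := fun z => if f z is Some a then Some a else g z.
Definition plist (L : seq (nat * T)) : pmap T :=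
  foldr (fun p f => pset f p.1 p.2) pempty L.
End PartialMaps.

Arguments pempty {T}.

Definition context n := pmap (formula n).
Definition ctx_wk n (C : context n) : context n.+1 := fun z => omap (@wk n) (C z).
(* the context z : ?B for (z, B) in L *)
Definition whynots n (L : seq (nat * formula n)) : context n :=
  plist [seq (p.1, WhyNot p.2) | p <- L].

(* Proof terms of the one-sided sequent calculus.  Unless indicated otherwise, a
   rule gives to its principal formula the name of the active one(s). *)
Inductive term : nat -> Type :=
(* |- x : A, y : A^  *)
| Link n : nat -> nat -> formula n -> term n
(* cut of x : A in the first premise against x : A^ in the second one *)
| Cut n : nat -> formula n -> term n -> term n -> term n
| TOne n : nat -> term n
| TBot n : nat -> term n -> term n
| TTensor n : nat -> formula n -> formula n -> term n -> term n -> term n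
(* from x : A, y : B to x : A `par` B *)
| TPar n : nat -> nat -> formula n -> formula n -> term n -> term n
| TPlus1 n : nat -> formula n -> formula n -> term n -> term n
| TPlus2 n : nat -> formula n -> formula n -> term n -> term n
| TWith n : nat -> formula n -> formula n -> term n -> term n -> term n
(* the list is the rest of the sequent *)
| TTop n : nat -> seq (nat * formula n) -> term n
(* promotion; (z, B) in the list stands for z : ?B in the sequent *)
| TBang n : nat -> formula n -> seq (nat * formula n) -> term n -> term n
| TDer n : nat -> formula n -> term n -> term n
| TWeak n : nat -> formula n -> term n -> term n
(* from x : ?A, y : ?A to x : ?A *)
| TContr n : nat -> nat -> formula n -> term n -> term n
| TAll n : nat -> formula n.+1 -> term n.+1 -> term n
(* from x : A[B/X] to x : exists X. A *)
| TEx n : nat -> formula n.+1 -> formula n -> term n -> term n.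

Inductive derives : forall n, context n -> term n -> Prop :=
| d_link n x y (A : formula n) : x <> y ->
    derives (pset (pset pempty y (dual A)) x A) (Link x y A)
| d_cut n C D x (A : formula n) P Q :
    C x = None -> D x = None -> pdisjoint C D ->
    derives (pset C x A) P -> derives (pset D x (dual A)) Q ->
    derives (pjoin C D) (Cut x A P Q)
| d_one n x : derives (pset pempty x One) (TOne n x)
| d_bot n (C : context n) x P : C x = None ->
    derives C P -> derives (pset C x Bot) (TBot x P)
| d_tensor n C D x (A B : formula n) P Q :
    C x = None -> D x = None -> pdisjoint C D ->
    derives (pset C x A) P -> derives (pset D x B) Q ->
    derives (pset (pjoin C D) x (Tensor A B)) (TTensor x A B P Q)
| d_par n C x y (A B : formula n) P :
    C x = None -> C y = None -> x <> y ->
    derives (pset (pset C y B) x A) P ->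
    derives (pset C x (Par A B)) (TPar x y A B P)
| d_plus1 n C x (A B : formula n) P : C x = None ->
    derives (pset C x A) P -> derives (pset C x (Plus A B)) (TPlus1 x A B P)
| d_plus2 n C x (A B : formula n) P : C x = None ->
    derives (pset C x B) P -> derives (pset C x (Plus A B)) (TPlus2 x A B P)
| d_with n C x (A B : formula n) P Q : C x = None ->
    derives (pset C x A) P -> derives (pset C x B) Q ->
    derives (pset C x (With A B)) (TWith x A B P Q)
| d_top n x (L : seq (nat * formula n)) :
    plist L x = None -> uniq (map fst L) ->
    derives (pset (plist L) x Top) (TTop x L)
| d_bang n x (A : formula n) L P :
    whynots L x = None -> uniq (map fst L) ->
    derives (pset (whynots L) x A) P ->
    derives (pset (whynots L) x (Bang A)) (TBang x A L P)
| d_der n C x (A : formula n) P : C x = None ->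
    derives (pset C x A) P -> derives (pset C x (WhyNot A)) (TDer x A P)
| d_weak n C x (A : formula n) P : C x = None ->
    derives C P -> derives (pset C x (WhyNot A)) (TWeak x A P)
| d_contr n C x y (A : formula n) P :
    C x = None -> C y = None -> x <> y ->
    derives (pset (pset C y (WhyNot A)) x (WhyNot A)) P ->
    derives (pset C x (WhyNot A)) (TContr x y A P)
| d_all n (C : context n) x A P : C x = None ->
    derives (pset (ctx_wk C) x A) P -> derives (pset C x (All A)) (TAll x A P)
| d_ex n C x A (B : formula n) P : C x = None ->
    derives (pset C x (inst A B)) P -> derives (pset C x (Ex A)) (TEx x A B P).

Fixpoint mall_term n (P : term n) : bool :=
  match P with
  | Link _ _ _ A => mall A
  | Cut _ _ A P Q => [&& mall A, mall_term P & mall_term Q]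
  | TOne _ _ => true
  | TBot _ _ P => mall_term P
  | TTensor _ _ A B P Q | TWith _ _ A B P Q =>
      [&& mall A, mall B, mall_term P & mall_term Q]
  | TPar _ _ _ A B P | TPlus1 _ _ A B P | TPlus2 _ _ A B P =>
      [&& mall A, mall B & mall_term P]
  | TTop _ _ L => all (fun p => mall p.2) L
  | TBang _ _ _ _ _ | TDer _ _ _ _ | TWeak _ _ _ _ | TContr _ _ _ _ _ => false
  | TAll _ _ A P => mall A && mall_term P
  | TEx _ _ A B P => [&& mall A, mall B & mall_term P]
  end.

Definition point n (X : hcohs n) := {A : formula n & rweb (interp A) X}.
Definition Pt n (X : hcohs n) (A : formula n) (a : rweb (interp A) X) : point X :=
  existT _ A a.
Definition env n (X : hcohs n) := pmap (point X).

Definition cast n (F G : rawfun n) (e : F = G) (X : hcohs n) (a : rweb F X) :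
    rweb G X :=
  eq_rect F (fun H => rweb H X) a G e.

(* A and its dual have the same web. *)
Definition dual_pt n (X : hcohs n) (A : formula n) (a : rweb (interp A) X) :
    rweb (interp (dual A)) X :=
  cast (F := perp_f (interp A)) (esym (interp_dual A)) a.

Definition wk_pt n (X : hcohs n) (Z : hcoh) (p : point X) : point (ext X Z) :=
  @Pt n.+1 (ext X Z) (wk (tag p))
    (cast (F := wk_f (interp (tag p))) (esym (interp_wk (tag p)))
       (X := ext X Z) (tagged p)).

(* A point of A[B/X] as a point of A at (X, B(X)) *)
Definition inst_pt n (X : hcohs n) (A : formula n.+1) (B : formula n)
    (a : rweb (interp (inst A B)) X) :
    robj (partial_f (interp A) X) (fun _ => robj (interp B) X) :=
  cast (interp_inst A B) a.

Fixpoint denot n (P : term n) : forall X : hcohs n, env X -> Prop :=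
  match P in term n return forall X : hcohs n, env X -> Prop with
  | Link _ x y A => fun X r => exists a : rweb (interp A) X,
      r = pset (pset pempty y (Pt (dual_pt a))) x (Pt a)
  | Cut _ x A P Q => fun X r => exists (a : rweb (interp A) X) (s t : env X),
      [/\ s x = None, t x = None, pdisjoint s t & r = pjoin s t] /\
      denot P (pset s x (Pt a)) /\ denot Q (pset t x (Pt (dual_pt a)))
  | TOne _ x => fun X r => r = pset pempty x (@Pt _ X One tt)
  | TBot _ x P => fun X r => exists s : env X,
      [/\ s x = None, r = pset s x (@Pt _ X Bot tt) & denot P s]
  | TTensor _ x A B P Q => fun X r =>
      exists (a : rweb (interp A) X) (b : rweb (interp B) X) (s t : env X),
      [/\ s x = None, t x = None, pdisjoint s t
        & r = pset (pjoin s t) x (@Pt _ X (Tensor A B) (a, b))] /\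
      denot P (pset s x (Pt a)) /\ denot Q (pset t x (Pt b))
  | TPar _ x y A B P => fun X r =>
      exists (a : rweb (interp A) X) (b : rweb (interp B) X) (s : env X),
      [/\ s x = None, s y = None, r = pset s x (@Pt _ X (Par A B) (a, b))
        & denot P (pset (pset s y (Pt b)) x (Pt a))]
  | TPlus1 _ x A B P => fun X r => exists (a : rweb (interp A) X) (s : env X),
      [/\ s x = None, r = pset s x (@Pt _ X (Plus A B) (inl a))
        & denot P (pset s x (Pt a))]
  | TPlus2 _ x A B P => fun X r => exists (b : rweb (interp B) X) (s : env X),
      [/\ s x = None, r = pset s x (@Pt _ X (Plus A B) (inr b))
        & denot P (pset s x (Pt b))]
  | TWith _ x A B P Q => fun X r =>
      (exists (a : rweb (interp A) X) (s : env X),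
      [/\ s x = None, r = pset s x (@Pt _ X (With A B) (inl a))
        & denot P (pset s x (Pt a))]) \/
      (exists (b : rweb (interp B) X) (s : env X),
      [/\ s x = None, r = pset s x (@Pt _ X (With A B) (inr b))
        & denot Q (pset s x (Pt b))])
  | TTop _ _ _ => fun _ _ => False
  (* a point is obtained from a finite set T of points of the premise, by
     collecting those of A in a clique and taking unions on the context *)
  | TBang _ x A L P => fun X r =>
      exists T : env X -> Prop, [/\ finite_set T, T `<=` @denot _ P X,
        exists2 c : rweb (interp (Bang A)) X, r x = Some (Pt c)
          & sval c = [set a | exists2 t, T t & t x = Some (Pt a)]
      & forall z, z <> x ->
          match plist L z with
          | Some B => exists2 c : rweb (interp (WhyNot B)) X, r z = Some (Pt c)
              & sval c = [set b | exists2 t, T t &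
                  exists2 d : rweb (interp (WhyNot B)) X,
                    t z = Some (Pt d) & sval d b]
          | None => r z = None
          end]
  | TDer _ x A P => fun X r => exists (a : rweb (interp A) X)
      (c : rweb (interp (WhyNot A)) X) (s : env X),
      [/\ s x = None, r = pset s x (Pt c), sval c = [set a]
        & denot P (pset s x (Pt a))]
  | TWeak _ x A P => fun X r => exists (c : rweb (interp (WhyNot A)) X) (s : env X),
      [/\ s x = None, r = pset s x (Pt c), sval c = set0 & denot P s]
  | TContr _ x y A P => fun X r =>
      exists (c d e : rweb (interp (WhyNot A)) X) (s : env X),
      [/\ s x = None, s y = None, r = pset s x (Pt e) &
         sval e = sval c `|` sval d] /\
      denot P (pset (pset s y (Pt d)) x (Pt c))
  | TAll _ x A P => fun X r =>
      exists (c : rweb (interp (All A)) X) (s : env X)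
             (u : rep (partial_f (interp A) X)),
      [/\ s x = None, r = pset s x (Pt c), sval c u
        & @denot _ P (ext X (rep_base u None))
            (pset (fun z => omap (wk_pt (rep_base u None)) (s z)) x
               (@Pt _ (ext X (rep_base u None)) A (rep_point u)))]
  | TEx _ x A B P => fun X r =>
      exists (a : rweb (interp (inst A B)) X) (c : rweb (interp (Ex A)) X) (s : env X),
      [/\ s x = None, r = pset s x (Pt c),
          nf_of (partial_f (interp A) X) (inst_pt a) (sval c)
        & denot P (pset s x (Pt a))]
  end.

(* Here sequents are listed, so that the iterated par is a formula. *)
Definition sequent n := seq (nat * formula n).

Definition proves n (L : sequent n) (P : term n) :=
  uniq (map fst L) /\ derives (plist L) P.

Fixpoint par_list n (A : formula n) (L : sequent n) : formula n :=
  if L is p :: L' then Par A (par_list p.2 L') else A.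

Fixpoint env_list n (X : hcohs n) (x : nat) (A : formula n) (L : sequent n) :
    rweb (interp (par_list A L)) X -> env X :=
  match L return rweb (interp (par_list A L)) X -> env X with
  | [::] => fun a => pset pempty x (Pt a)
  | p :: L' => fun a => pset (env_list p.1 a.2) x (Pt a.1)
  end.

(* the denotation of a proof of the sequent (x, A) :: L, as a family of subsets
   of its interpretation; in particular, for L = [::], of the formula A *)
Definition denotation n (x : nat) (A : formula n) (L : sequent n) (P : term n) :
    forall X : hcohs n, robj (interp (par_list A L)) X -> Prop :=
  fun X => [set a | denot P (env_list x a)].

Arguments denotation {n} x A L P X.

Definition transp (x y z : nat) : nat :=
  if z == x then y else if z == y then x else z.

Definition transp_list n (x y : nat) (L : sequent n) : sequent n :=
  [seq (transp x y p.1, p.2) | p <- L].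

(* exchanges two names everywhere; when y is fresh, this renames x to y *)
Fixpoint swap n (u v : nat) (P : term n) : term n :=
  let t := transp u v in
  match P with
  | Link _ x y A => Link (t x) (t y) A
  | Cut _ x A P Q => Cut (t x) A (swap u v P) (swap u v Q)
  | TOne n x => TOne n (t x)
  | TBot _ x P => TBot (t x) (swap u v P)
  | TTensor _ x A B P Q => TTensor (t x) A B (swap u v P) (swap u v Q)
  | TPar _ x y A B P => TPar (t x) (t y) A B (swap u v P)
  | TPlus1 _ x A B P => TPlus1 (t x) A B (swap u v P)
  | TPlus2 _ x A B P => TPlus2 (t x) A B (swap u v P)
  | TWith _ x A B P Q => TWith (t x) A B (swap u v P) (swap u v Q)
  | TTop _ x L => TTop (t x) (transp_list u v L)
  | TBang _ x A L P => TBang (t x) A (transp_list u v L) (swap u v P)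
  | TDer _ x A P => TDer (t x) A (swap u v P)
  | TWeak _ x A P => TWeak (t x) A (swap u v P)
  | TContr _ x y A P => TContr (t x) (t y) A (swap u v P)
  | TAll _ x A P => TAll (t x) A (swap u v P)
  | TEx _ x A B P => TEx (t x) A B (swap u v P)
  end.

Fixpoint tsubst n (P : term n) : forall m, (idx n -> formula m) -> term m :=
  let sl n (L : sequent n) m (s : idx n -> formula m) : sequent m :=
    [seq (p.1, subst p.2 s) | p <- L] in
  match P in term n return forall m, (idx n -> formula m) -> term m with
  | Link _ x y A => fun m s => Link x y (subst A s)
  | Cut _ x A P Q => fun m s => Cut x (subst A s) (tsubst P s) (tsubst Q s)
  | TOne _ x => fun m s => TOne m x
  | TBot _ x P => fun m s => TBot x (tsubst P s)
  | TTensor _ x A B P Q => fun m s =>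
      TTensor x (subst A s) (subst B s) (tsubst P s) (tsubst Q s)
  | TPar _ x y A B P => fun m s => TPar x y (subst A s) (subst B s) (tsubst P s)
  | TPlus1 _ x A B P => fun m s => TPlus1 x (subst A s) (subst B s) (tsubst P s)
  | TPlus2 _ x A B P => fun m s => TPlus2 x (subst A s) (subst B s) (tsubst P s)
  | TWith _ x A B P Q => fun m s =>
      TWith x (subst A s) (subst B s) (tsubst P s) (tsubst Q s)
  | TTop _ x L => fun m s => TTop x (sl _ L m s)
  | TBang _ x A L P => fun m s => TBang x (subst A s) (sl _ L m s) (tsubst P s)
  | TDer _ x A P => fun m s => TDer x (subst A s) (tsubst P s)
  | TWeak _ x A P => fun m s => TWeak x (subst A s) (tsubst P s)
  | TContr _ x y A P => fun m s => TContr x y (subst A s) (tsubst P s)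
  | TAll _ x A P => fun m s => TAll x (subst A (up s)) (tsubst P (up s))
  | TEx _ x A B P => fun m s =>
      TEx x (subst A (up s)) (subst B s) (tsubst P s)
  end.

Definition twk n (P : term n) : term n.+1 :=
  tsubst P (fun i => @Var n.+1 (Some i)).

Definition weaken_list n (L : sequent n) (P : term n) : term n :=
  foldr (fun p Q => TWeak p.1 p.2 Q) P L.

(* contracts, for each name z of L, the formulas named z and z', where z' is the
   corresponding name in l *)
Definition contract_list n (L : sequent n) (l : seq nat) (P : term n) : term n :=
  foldr (fun q Q => TContr q.1.1 q.2 q.1.2 Q) P (zip L l).

Definition relabel n (L : sequent n) (l : seq nat) : sequent n :=
  zip l (map snd L).

Definition swap_list n (L : sequent n) (l : seq nat) (P : term n) : term n :=
  foldr (fun q Q => swap q.1.1 q.2 Q) P (zip L l).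

(* Elementary steps: renaming of bound names, symmetry of the cut, key cases,
   and commutation of a cut with the last rule of its first premise.  They are
   only used between proofs of the same sequent (see [red]), which takes care
   of all the freshness and matching conditions. *)
Inductive step n : term n -> term n -> Prop :=
| s_ren_cut x y A P Q : step (Cut x A P Q) (Cut y A (swap x y P) (swap x y Q))
| s_ren_par x y z A B P : step (TPar x y A B P) (TPar x z A B (swap y z P))
| s_ren_contr x y z A P : step (TContr x y A P) (TContr x z A (swap y z P))
| s_sym x A P Q : step (Cut x A P Q) (Cut x (dual A) Q P)
| s_link1 x y A B Q : step (Cut x A (Link x y B) Q) (swap x y Q)
| s_link2 x y A B Q : step (Cut x A (Link y x B) Q) (swap x y Q)
| s_unit x A P : step (Cut x A (TOne n x) (TBot x P)) P
| s_mult x y C A B A' B' P Q R :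
    step (Cut x C (TTensor x A B P Q) (TPar x y A' B' R))
         (Cut y B (swap x y Q) (Cut x A P R))
| s_add1 x C A B A' B' P Q R :
    step (Cut x C (TPlus1 x A B P) (TWith x A' B' Q R)) (Cut x A P Q)
| s_add2 x C A B A' B' P Q R :
    step (Cut x C (TPlus2 x A B P) (TWith x A' B' Q R)) (Cut x B P R)
| s_der x C A A' L P Q :
    step (Cut x C (TBang x A L P) (TDer x A' Q)) (Cut x A P Q)
| s_weak x C A A' L P Q :
    step (Cut x C (TBang x A L P) (TWeak x A' Q)) (weaken_list L Q)
| s_contr x y C A A' L l P Q : size l = size L ->
    step (Cut x C (TBang x A L P) (TContr x y A' Q))
         (contract_list L l
            (Cut x (Bang A) (TBang x A L P)
               (Cut y (Bang A)
                  (TBang y A (relabel L l) (swap x y (swap_list L l P))) Q)))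
| s_quant x C A A' B P Q :
    step (Cut x C (TAll x A P) (TEx x A' B Q))
         (Cut x (inst A B) (tsubst P (inst1 B)) Q)
| s_c_cut1 z C x A P P' Q :
    step (Cut z C (Cut x A P P') Q) (Cut x A (Cut z C P Q) P')
| s_c_cut2 z C x A P P' Q :
    step (Cut z C (Cut x A P P') Q) (Cut x A P (Cut z C P' Q))
| s_c_bot z C x P Q : step (Cut z C (TBot x P) Q) (TBot x (Cut z C P Q))
| s_c_tensor1 z C x A B P P' Q :
    step (Cut z C (TTensor x A B P P') Q) (TTensor x A B (Cut z C P Q) P')
| s_c_tensor2 z C x A B P P' Q :
    step (Cut z C (TTensor x A B P P') Q) (TTensor x A B P (Cut z C P' Q))
| s_c_par z C x y A B P Q :
    step (Cut z C (TPar x y A B P) Q) (TPar x y A B (Cut z C P Q))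
| s_c_plus1 z C x A B P Q :
    step (Cut z C (TPlus1 x A B P) Q) (TPlus1 x A B (Cut z C P Q))
| s_c_plus2 z C x A B P Q :
    step (Cut z C (TPlus2 x A B P) Q) (TPlus2 x A B (Cut z C P Q))
| s_c_with z C x A B P P' Q :
    step (Cut z C (TWith x A B P P') Q) (TWith x A B (Cut z C P Q) (Cut z C P' Q))
| s_c_top z C x L L' Q : step (Cut z C (TTop x L) Q) (TTop x L')
| s_c_bang z C D x A L L' M P Q :
    step (Cut z C (TBang x A L P) (TBang z D M Q))
         (TBang x A L' (Cut z C P (TBang z D M Q)))
| s_c_der z C x A P Q : step (Cut z C (TDer x A P) Q) (TDer x A (Cut z C P Q))
| s_c_weak z C x A P Q : step (Cut z C (TWeak x A P) Q) (TWeak x A (Cut z C P Q))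
| s_c_contr z C x y A P Q :
    step (Cut z C (TContr x y A P) Q) (TContr x y A (Cut z C P Q))
| s_c_all z C x A P Q :
    step (Cut z C (TAll x A P) Q) (TAll x A (Cut z (wk C) P (twk Q)))
| s_c_ex z C x A B P Q :
    step (Cut z C (TEx x A B P) Q) (TEx x A B (Cut z C P Q)).

Inductive red : forall n, term n -> term n -> Prop :=
| r_step n (C : context n) P Q :
    derives C P -> derives C Q -> step P Q -> red P Q
| r_cut1 n x (A : formula n) P P' Q : red P P' -> red (Cut x A P Q) (Cut x A P' Q)
| r_cut2 n x (A : formula n) P Q Q' : red Q Q' -> red (Cut x A P Q) (Cut x A P Q')
| r_bot n x (P P' : term n) : red P P' -> red (TBot x P) (TBot x P')
| r_tensor1 n x (A B : formula n) P P' Q :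
    red P P' -> red (TTensor x A B P Q) (TTensor x A B P' Q)
| r_tensor2 n x (A B : formula n) P Q Q' :
    red Q Q' -> red (TTensor x A B P Q) (TTensor x A B P Q')
| r_par n x y (A B : formula n) P P' :
    red P P' -> red (TPar x y A B P) (TPar x y A B P')
| r_plus1 n x (A B : formula n) P P' :
    red P P' -> red (TPlus1 x A B P) (TPlus1 x A B P')
| r_plus2 n x (A B : formula n) P P' :
    red P P' -> red (TPlus2 x A B P) (TPlus2 x A B P')
| r_with1 n x (A B : formula n) P P' Q :
    red P P' -> red (TWith x A B P Q) (TWith x A B P' Q)
| r_with2 n x (A B : formula n) P Q Q' :
    red Q Q' -> red (TWith x A B P Q) (TWith x A B P Q')
| r_bang n x (A : formula n) L P P' :
    red P P' -> red (TBang x A L P) (TBang x A L P')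
| r_der n x (A : formula n) P P' : red P P' -> red (TDer x A P) (TDer x A P')
| r_weak n x (A : formula n) P P' : red P P' -> red (TWeak x A P) (TWeak x A P')
| r_contr n x y (A : formula n) P P' :
    red P P' -> red (TContr x y A P) (TContr x y A P')
| r_all n x (A : formula n.+1) P P' : red P P' -> red (TAll x A P) (TAll x A P')
| r_ex n x A (B : formula n) P P' : red P P' -> red (TEx x A B P) (TEx x A B P').

(* Main.v *)
(** A functor on embeddings preserves filtered colimits and pullbacks exactly when
    every [x] in [F X] is supported by a finite set of elements of the webs of
    [X], and supports are closed under intersection; the normal form of [x] is its
    restriction to the least support.  The connectives, including the trace,
    preserve this property.  For MALL formulas the size of the supports is bounded
    and finite arguments have finite values, so that there are finitely many
    normal forms, and a uniform family of cliques is determined by those it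
    contains.

    The denotation of a proof consists of points indexed by the whole sequent.  It
    is a clique because any finite non-empty set of such points is a singleton or
    has a strictly coherent projection on some formula: in a cut, a projection
    cannot be strictly coherent both at [A] and at its dual.  For the same reason
    the cut point [a] witnessing a point over [Y] that comes from [X] also comes
    from [X]: its two images in the amalgam of two copies of [Y] over [X] are
    equal.

    Cut elimination is checked pointwise, using that denotations commute with
    renaming of names and with substitution of formulas.  A point of a promotion
    is a finite set of points of the premise whose context parts stay within finite
    cliques, so that such sets can be cut into pieces and glued together. *)

From Stdlib Require List.
Require Import Defs.
From mathcomp Require Import all_boot.
From mathcomp Require Import boolp classical_sets functions cardinality.

Set Implicit Arguments.
Unset Strict Implicit.
Unset Printing Implicit Defensive.

Local Open Scope classical_set_scope.

(** * Supports and normal functors *)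

(** Cliques and uniformity have to be established in one induction on proofs: the clique for the
    universal rule uses that its premise is uniform, to pass from one representative of a normal
    form to all of its points, while uniformity of the cut and of the existential rule uses that
    their premises are cliques. Working with projections of sets of environments has a purpose: a
    par is strictly coherent as soon as one of its components is, so no order on the sequent has to
    be fixed and a rule can be checked on its active formulas alone. The other obstacle is typing.
    The interpretations of [dual A], [wk A] and [subst A s] are equal to the expected functors
    without being convertible to them. Points are therefore carried by casts, which are compared
    through heterogeneous equality, or generalised until the equality can be destructed. Finally,
    [denot] splits environments existentially and [step] carries almost no freshness conditions.
    Typing resolves both: a proof determines its context, and the context determines how an
    environment splits. *)

Definition lin (T : Type) (s : seq T) : T -> Prop := fun x => List.In x s.

Lemma lin_cat (T : Type) (s t : seq T) x : lin (s ++ t) x <-> lin s x \/ lin t x.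
Proof. by rewrite /lin; split=> /List.in_app_iff. Qed.

Lemma lin_map (T U : Type) (f : T -> U) s y :
  lin (map f s) y <-> exists2 x, lin s x & f x = y.
Proof.
rewrite /lin; split=> [/List.in_map_iff[x [fx sx]]|[x sx fx]]; first by exists x.
by apply/List.in_map_iff; exists x.
Qed.

Lemma finite_lin (T : Type) (s : seq T) : finite_set (lin s).
Proof.
elim: s => [|a s IH]; first by rewrite (_ : lin [::] = set0) //; apply/seteqP; split.
rewrite (_ : lin (a :: s) = [set a] `|` lin s) ?finite_setU; first by split=> //; exact: finite_set1.
by apply/seteqP; split=> x /=; rewrite /lin /= => -[->|sx]; by [left|right].
Qed.

Lemma finite_linP (T : Type) (S : T -> Prop) :
  finite_set S <-> exists s, forall x, S x <-> lin s x.
Proof.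
split=> [|[s Ss]]; last by rewrite (_ : S = lin s); [exact: finite_lin | apply/seteqP; split=> x /Ss].
(* Webs have no decidable equality: [{classic T}] lends one to [finite_seqP], and boolean membership
   is then turned into [List.In]. *)
move=> /(@finite_seqP {classic T})[s Ss]; exists s => x; rewrite Ss /=.
rewrite /lin; elim: s {Ss} => [|a s IH] //=; rewrite inE -IH.
by split=> [/orP[/eqP->|?]|[->|?]]; rewrite ?eqxx //; [left|right|apply/orP; right].
Qed.

Lemma finite_sub_lin (T : Type) (S : T -> Prop) :
  finite_set S <-> exists s, forall x, S x -> lin s x.
Proof.
split=> [/finite_linP[s Ss]|[s Ss]]; first by exists s => x /Ss.
by apply: sub_finite_set (finite_lin s) => x /Ss.
Qed.

Lemma image_fin_ne (T U : Type) (f : T -> U) (S : T -> Prop) :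
  fin_ne S -> fin_ne (f @` S).
Proof. by case=> fS [x Sx]; split; [exact: finite_image | exists (f x); exists x]. Qed.

Lemma image_inj_fin_ne (T U : Type) (f : T -> U) (S : T -> Prop) :
  injective f -> fin_ne (f @` S) <-> fin_ne S.
Proof.
move=> fI; split; last exact: image_fin_ne.
case=> fS [_ [x Sx _]]; split; last by exists x.
by have /eq_finite_set <- := inj_card_eq (A := S) (in2W fI).
Qed.

Lemma image_inj_eq (T U : Type) (f : T -> U) (S S' : T -> Prop) :
  injective f -> f @` S = f @` S' -> S = S'.
Proof.
move=> fI e; apply/seteqP; split=> x Sx.
  have [y S'y /fI <- //] : (f @` S') (f x) by rewrite -e; exists x.
have [y Sy /fI <- //] : (f @` S) (f x) by rewrite e; exists x.
Qed.

(** Used to pick the points of the premises from which the points of a conclusion come: a choice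
    function makes them the image of a finite set, hence a finite set. *)
Lemma choose_on (T U : Type) (u0 : U) (S : T -> Prop) (R : T -> U -> Prop) :
  (forall x, S x -> exists y, R x y) ->
  exists f : T -> U, forall x, S x -> R x (f x).
Proof.
move=> H; have /choice[f Hf] : forall x, exists y, S x -> R x y.
  by move=> x; case: (pselect (S x)) => [/H[y Ry]|nS]; [exists y | exists u0].
by exists f.
Qed.

(** Proof irrelevance for equalities of indices is axiom K, which makes the second component
    injective for every index type. *)
Lemma existT_inj (I : Type) (P : I -> Type) i (x y : P i) :
  existT P i x = existT P i y -> x = y.
Proof.
have h (p q : {i & P i}) (pq : p = q) (d : projT1 p = projT1 q) :
    eq_rect _ P (projT2 p) _ d = projT2 q.
  by case: _ / pq d => d; rewrite (Prop_irrelevance d erefl).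
by move=> e; exact: (h _ _ e erefl).
Qed.

Section StrictCoh.
Variables (T : Type) (H : hcoh_on T).
Implicit Types S : T -> Prop.

Lemma fin_ne_set1 (U : Type) (S : U -> Prop) : S !=set0 ->
  (exists x, S = [set x]) <-> (forall x y, S x -> S y -> x = y).
Proof.
case=> x Sx; split=> [[y ->] a b -> -> //|SS].
by exists x; apply/seteqP; split=> y /= => [Sy|-> //]; exact: SS.
Qed.

Lemma strict_cohP S :
  strict_coh H S <-> coh H S /\ ~ (forall x y, S x -> S y -> x = y).
Proof.
by split=> -[HS nS]; split=> // h; apply: nS; have /coh_fin_ne[_ Sn0] := HS;
  apply/fin_ne_set1.
Qed.

Lemma cohE S : coh H S <-> fin_ne S /\ ((exists x, S = [set x]) \/ strict_coh H S).
Proof.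
split=> [HS|[fS [[x ->]|[]//]]]; last exact: coh_set1.
split; first exact: coh_fin_ne HS.
by case: (pselect (exists x, S = [set x])) => [|nS]; [left | right; split].
Qed.

(** Among finite non-empty sets, strict coherence in the dual is the exact complement of coherence.
    In particular no set is strictly coherent on both sides, which is what settles cuts. *)
Lemma strict_perp S : strict_coh (hperp H) S <-> fin_ne S /\ ~ coh H S.
Proof.
split=> [[[fS nS] n1]|[fS nS]].
  by split=> // HS; apply: nS; split.
split; first by split=> // -[].
by case=> x e; apply: nS; rewrite e; exact: coh_set1.
Qed.

End StrictCoh.

Lemma sval_inj (T : Type) (D : T -> Prop) : injective (@sval T D).
Proof. by move=> [x Dx] [y Dy] /= e; case: _ / e Dy => Dy; rewrite (Prop_irrelevance Dx Dy). Qed.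

(** Made transparent because coherence in the substructure has to unfold to coherence of the image
    for the inclusion to be an embedding by computation. *)
Definition subh (H : hcoh) (D : H -> Prop) : hcoh.
Proof.
refine (@Hcoh {x : H | D x} (@HcohOn _ (fun S => Gamma (sval @` S)) _ _)).
- by move=> S /coh_fin_ne /image_inj_fin_ne; apply; exact: sval_inj.
- by move=> x; rewrite image_set1; exact: coh_set1.
Defined.

Lemma subh_incl_coh (H : hcoh) (D : H -> Prop) (S : subh D -> Prop) :
  Gamma S <-> Gamma (sval @` S).
Proof. by []. Qed.

Definition subh_incl (H : hcoh) (D : H -> Prop) : emb (subh D) H :=
  @Emb (subh D) H sval (@sval_inj _ D) (@subh_incl_coh H D).

(** Injectivity of [f] forces the lift, and its compatibility with coherence comes for free since
    embeddings reflect coherence as well as preserve it. *)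
Lemma emb_lift (H K L : hcoh) (f : emb K H) (g : emb L H) :
  (forall w, exists z, f z = g w) -> exists h : emb L K, emb_cmp f h = g.
Proof.
move=> /choice[h fh].
have hI : injective h by move=> u v e; apply: (@emb_inj _ _ g); rewrite -!fh e.
have hC (S : L -> Prop) : Gamma S <-> Gamma (h @` S).
  rewrite (emb_coh f) image_comp (_ : (f \o h) = g); first exact: emb_coh.
  by apply: funext.
by exists (Emb hI hC); apply: emb_eq; apply: funext.
Qed.

Lemma emb_surj_bij (H K : hcoh) (f : emb H K) :
  (forall y, exists x, f x = y) -> bijective f.
Proof.
move=> /choice[g fg]; exists g => // x.
by apply: (@emb_inj _ _ f); rewrite fg.
Qed.

Lemma bij_surj (T U : Type) (f : T -> U) : bijective f -> forall y, exists x, f x = y.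
Proof. by case=> g _ gf y; exists (g y). Qed.

Section Embs.
Variable n : nat.
Implicit Types X Y Z W : hcohs n.

(** The webs of all parameters are pooled, so that a support is one set, and a finite support one
    list with one length, instead of a family. *)
Definition tot X := {i : idx n & X i}.
Definition eid X : embs X X := fun i => emb_id (X i).
Definition ecmp X Y Z (g : embs Y Z) (f : embs X Y) : embs X Z :=
  fun i => emb_cmp (g i) (f i).
Definition rng X Y (f : embs X Y) : tot Y -> Prop :=
  fun p => exists x, f (tag p) x = tagged p.
Definition bij X Y (f : embs X Y) := forall i, bijective (f i).
Definition restr X (E : tot X -> Prop) : hcohs n :=
  fun i => subh (fun x => E (existT _ i x)).
Definition rincl X (E : tot X -> Prop) : embs (restr E) X :=
  fun i => subh_incl (fun x => E (existT _ i x)).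

Lemma rng_incl X (E : tot X -> Prop) p : rng (rincl E) p <-> E p.
Proof.
case: p => i x; split=> [[[y Ey] /= <-]//|Ex].
by exists (exist (fun x => E (existT _ i x)) x Ex).
Qed.

Lemma rng_bij X Y (f : embs X Y) : (forall p, rng f p) <-> bij f.
Proof.
split=> [h i|h [i y]]; last exact: (bij_surj (h i)).
by apply: emb_surj_bij => y; exact: (h (existT _ i y)).
Qed.

Lemma embs_lift X Y Z (f : embs Y X) (g : embs Z X) :
  (forall p, rng g p -> rng f p) -> exists h : embs Z Y, ecmp f h = g.
Proof.
move=> gf; have H i : exists h : emb (Z i) (Y i), emb_cmp (f i) h = g i.
  by apply: emb_lift => w; apply: (gf (existT _ i (g i w))); exists w.
exists (fun i => projT1 (cid (H i))); apply: functional_extensionality_dep => i.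
exact: (projT2 (cid (H i))).
Qed.

Lemma bij_inv X Y (f : embs X Y) : bij f ->
  exists g : embs Y X, [/\ ecmp f g = eid Y, ecmp g f = eid X & bij g].
Proof.
move=> fb; have [|g fg] := @embs_lift _ _ _ f (eid Y).
  by move=> p _; exact: (proj2 (rng_bij f) fb).
have gf : ecmp g f = eid X.
  apply: functional_extensionality_dep => i; apply: emb_eq; apply: funext => x /=.
  by apply: (@emb_inj _ _ (f i)); rewrite -[f i (g i _)]/(ecmp f g i (f i x)) fg.
exists g; split=> // i; exists (f i) => x.
- by rewrite -[f i (g i _)]/(ecmp f g i x) fg.
- by rewrite -[g i (f i _)]/(ecmp g f i x) gf.
Qed.

Lemma bij_cmp X Y Z (g : embs Y Z) (f : embs X Y) : bij g -> bij f -> bij (ecmp g f).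
Proof. by move=> gb fb i; exact: bij_comp. Qed.

Lemma bij_id X : bij (eid X).
Proof. by move=> i; exists id. Qed.

(** Only one inclusion of the composition law is part of the record; totality and functionality of
    the action yield the other one, see [hact_cmp]. *)
Record functorial (F : rawfun n) : Prop := Functorial {
  fn_id : act_id F;
  fn_emb : forall X Y (f : embs X Y), exists e : emb (robj F X) (robj F Y),
    forall x y, hact F f x y <-> e x = y;
  fn_cmp : forall X Y Z (g : embs Y Z) (f : embs X Y) x y z,
    hact F f x y -> hact F g y z -> hact F (ecmp g f) x z }.

(** Any embedding with range inside [E] may witness a support, which makes supports easy to produce;
    by [supp_restr] the inclusion of [restr E] is then a witness too. *)
Definition supp (F : rawfun n) X (E : tot X -> Prop) (x : rweb F X) :=
  exists W (g : embs W X) w, hact F g w x /\ forall p, rng g p -> E p.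

Definition finite_supp (F : rawfun n) := forall X (x : rweb F X),
  exists s : seq (tot X), supp (lin s) x.

Definition supp_capped (F : rawfun n) := forall X (E E' : tot X -> Prop) (x : rweb F X),
  supp E x -> supp E' x -> supp (E `&` E') x.

Record normal (F : rawfun n) : Prop := Normal {
  nrm_fn : functorial F;
  nrm_fin : finite_supp F;
  nrm_cap : supp_capped F }.

Section Functorial.
Variables (F : rawfun n) (fF : functorial F).

Lemma hact_id X x y : hact F (eid X) x y <-> x = y.
Proof.
rewrite /hact (_ : graphs (eid X) = (fun i x y => x = y)); first by rewrite (fn_id fF).
by apply: functional_extensionality_dep.
Qed.

Lemma hact_total X Y (f : embs X Y) x : exists y, hact F f x y.
Proof. by have [e E] := fn_emb fF f; exists (e x); apply/E. Qed.

Lemma hact_fun X Y (f : embs X Y) x y y' : hact F f x y -> hact F f x y' -> y = y'.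
Proof. by have [e E] := fn_emb fF f => /E <- /E <-. Qed.

Lemma hact_inj X Y (f : embs X Y) x x' y : hact F f x y -> hact F f x' y -> x = x'.
Proof. by have [e E] := fn_emb fF f => /E <- /E /emb_inj. Qed.

Lemma hact_coh X Y (f : embs X Y) (S : robj F X -> Prop) :
  Gamma S <-> Gamma (X := robj F Y) [set y | exists2 x, S x & hact F f x y].
Proof.
have [e E] := fn_emb fF f; rewrite (emb_coh e).
rewrite (_ : e @` S = [set y | exists2 x, S x & hact F f x y]) //.
by apply/seteqP; split=> y [x Sx /E xy]; exists x => //; apply/E.
Qed.

Lemma hact_cmp X Y Z (g : embs Y Z) (f : embs X Y) x z :
  hact F (ecmp g f) x z <-> exists2 y, hact F f x y & hact F g y z.
Proof.
split=> [xz|[y xy yz]]; last exact (fn_cmp fF xy yz).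
have [y xy] := hact_total f x; have [z' yz'] := hact_total g y.
by exists y => //; rewrite (hact_fun xz (fn_cmp fF xy yz')).
Qed.

Lemma hact_cancel X Y Z (g : embs Y Z) (f : embs X Y) x y z :
  hact F (ecmp g f) x z -> hact F g y z -> hact F f x y.
Proof. by move=> /hact_cmp[y' xy' y'z] yz; rewrite (hact_inj yz y'z). Qed.

Lemma hact_lift X Y Z (f : embs Y X) (g : embs Z X) w x : hact F g w x ->
  (forall p, rng g p -> rng f p) ->
  exists (h : embs Z Y) y, [/\ ecmp f h = g, hact F h w y & hact F f y x].
Proof.
move=> gx /embs_lift[h fh]; move: gx; rewrite -fh => /hact_cmp[y wy yx].
by exists h, y.
Qed.

Lemma hact_bij X Y (f : embs X Y) y : bij f -> exists x, hact F f x y.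
Proof.
move=> /bij_inv[g [fg _ _]]; have [x yx] := hact_total g y.
have /hact_cmp[x' yx' x'y] : hact F (ecmp f g) y y by rewrite fg; apply/hact_id.
by exists x'.
Qed.

Lemma supp_restr X (E : tot X -> Prop) (x : rweb F X) :
  supp E x <-> exists x0, hact F (rincl E) x0 x.
Proof.
split=> [[W [g [w [gx gE]]]]|[x0 x0x]].
  have [|h [y [_ _ yx]]] := @hact_lift _ _ _ (rincl E) g w x gx; last by exists y.
  by move=> p /gE /rng_incl.
by exists (restr E), (rincl E), x0; split=> // p /rng_incl.
Qed.

Lemma supp_rng X Y (f : embs X Y) (y : rweb F Y) :
  supp (rng f) y <-> exists x, hact F f x y.
Proof.
split=> [[W [g [w [gx gE]]]]|[x xy]]; last by exists X, f, x.
by have [h [x [_ _ xy]]] := hact_lift gx gE; exists x.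
Qed.

End Functorial.

Lemma supp_mono (F : rawfun n) X (E E' : tot X -> Prop) (x : rweb F X) :
  (forall p, E p -> E' p) -> supp E x -> supp E' x.
Proof. by move=> EE' [W [g [w [gx gE]]]]; exists W, g, w; split=> // p /gE/EE'. Qed.

End Embs.

Arguments supp {n} F {X} E x.

(** * Normality and variable hypercoherences *)

Section HCohIColimits.
Variables (J : category) (filJ : filtered J).

Lemma filtered_fun (I : J -> J -> Prop) (T : Type) (R : T -> J -> Prop) (s : seq T) :
  (forall i j, inhabited (hom i j) -> I i j) ->
  (forall x i j, I i j -> R x i -> R x j) ->
  (forall x, lin s x -> exists j, R x j) -> exists j, forall x, lin s x -> R x j.
Proof.
move=> homI mono; elim: s => [_|a s IH Rs].
  by have [[j _] _ _] := filJ; exists j.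
have [|j Rj] := IH; first by move=> x sx; apply: Rs; right.
have [|j' Rj'] := Rs a; first by left.
have [_ /(_ j j')[k [/homI jk /homI j'k]] _] := filJ; exists k => x [<-|sx].
  exact: mono Rj'.
by apply: mono (Rj _ sx).
Qed.

Variables (D : functor J HCohI) (c : hcoh) (k : forall j, emb (D j) c).
Hypothesis kD : @is_cocone J HCohI D c k.
Hypothesis ksurj : forall x, exists j y, k j y = x.

(** Joint surjectivity suffices for universality. Two elements of [c] meet at a common stage, so
    that [u] is well defined and injective; a finite subset of [c] lies in the image of a single
    stage, where its coherence is the same as in [d]. *)
Lemma cocone_emb (d : hcoh) (l : forall j, emb (D j) d) :
  @is_cocone J HCohI D d l -> exists! u : emb c d, forall j, emb_cmp u (k j) = l j.
Proof.
move=> lD.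
have kE i j (f : hom i j) x : k j ((fmap D f : emb _ _) x) = k i x by rewrite -(kD f).
have lE i j (f : hom i j) x : l j ((fmap D f : emb _ _) x) = l i x by rewrite -(lD _ _ f).
have wd i j x y : k i x = k j y <-> l i x = l j y.
  have [_ /(_ i j)[m [[f] [g]]] _] := filJ.
  by rewrite -(kE _ _ f) -(kE _ _ g) -(lE _ _ f) -(lE _ _ g); split=> /emb_inj ->.
have /choice[u uE] : forall x, exists y, forall j z, k j z = x -> y = l j z.
  by move=> x; have [j [y <-]] := ksurj x; exists (l j y) => i z /wd.
have ul j z : u (k j z) = l j z by exact: uE.
have uI : injective u.
  move=> x y; have [i [a <-]] := ksurj x; have [j [b <-]] := ksurj y.
  by rewrite !ul => /wd.
have uC (S : c -> Prop) : Gamma S <-> Gamma (u @` S).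
  (* Coherent sets are finite and [u] is injective, so that both sides are false for an infinite
     [S]. *)
  suff fin : finite_set S -> Gamma S <-> Gamma (u @` S).
    split=> GS; have [fS _] := coh_fin_ne GS; apply/fin => //.
    by have [] : fin_ne S by apply/(image_inj_fin_ne S uI); exact: coh_fin_ne GS.
  move=> /finite_linP[s Ss].
  have [||x _|j Sj] := @filtered_fun (fun i j => inhabited (hom i j)) _
     (fun x j => exists y, k j y = x) s => //.
    by move=> x i j [f] [y <-]; exists ((fmap D f : emb _ _) y); rewrite kE.
  pose S' := [set y | S (k j y)].
  have -> : S = k j @` S'.
    apply/seteqP; split=> [x Sx|_ [y Sy <-]] //.
    by have [|y yx] := Sj x; [exact/Ss | exists y; rewrite /S' /= ?yx].
  rewrite -emb_coh image_comp (_ : u \o k j = l j) -?emb_coh //.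
  by apply: funext => y /=.
exists (Emb uI uC); split=> [j|v vl]; apply: emb_eq; apply: funext => x //=.
by have [j [y <-]] := ksurj x; rewrite ul -(vl j).
Qed.

Lemma cocone_colimit : @is_colimit J HCohI D c k.
Proof. by split=> // d l lD; exact: cocone_emb. Qed.

End HCohIColimits.

Lemma dep_choice (I : Type) (B : I -> Type) (R : forall i, B i -> Prop) :
  (forall i, exists b, R i b) -> exists f : forall i, B i, forall i, R i (f i).
Proof. by move=> H; exists (fun i => projT1 (cid (H i))) => i; case: cid. Qed.

(** The cocone factors through its joint range [E]. The universal map into [subh E] followed by the
    inclusion agrees with the identity on the cocone, hence is the identity, and [E] is
    everything. *)
Lemma colimit_surj (J : category) (D : functor J HCohI) (c : hcoh)
    (k : forall j, emb (D j) c) :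
  @is_colimit J HCohI D c k -> forall x, exists j y, k j y = x.
Proof.
case=> kD ku; pose E := fun x => exists j y, k j y = x.
have /dep_choice[l lk] : forall j, exists l : emb (D j) (subh E),
    emb_cmp (subh_incl E) l = k j.
  move=> j; apply: emb_lift => w.
  by exists (exist E (k j w) (ex_intro _ j (ex_intro _ w erefl))).
have lD : @is_cocone J HCohI D (subh E) l.
  move=> i j f; apply: emb_eq; apply: funext => x; apply: (@emb_inj _ _ (subh_incl E)).
  rewrite -[subh_incl E (l i x)]/(emb_cmp (subh_incl E) (l i) x) lk -(kD _ _ f).
  by rewrite -[RHS]/((k j) ((fmap D f : emb _ _) x)) -lk.
have [u [ul0 _]] := ku _ l lD.
have ul j : emb_cmp u (k j) = l j := ul0 j.
have [v [_ vu]] := ku _ k kD.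
have e : emb_cmp (subh_incl E) u = emb_id c.
  rewrite -(vu (emb_cmp (subh_incl E) u)); last first.
    by move=> j; rewrite -[LHS]/(emb_cmp (emb_cmp (subh_incl E) u) (k j)) -emb_A ul lk.
  by apply: vu => j; exact: emb_1m.
move=> x; have := svalP ((u : emb _ _) x).
by rewrite -[sval _]/(emb_cmp (subh_incl E) u x) e.
Qed.

Section PowerColimits.
Variables (n : nat) (J : category) (D : functor J (power (idx n) HCohI)).
Variables (c : hcohs n) (k : forall j, embs (D j) c).

Lemma power_colimit : filtered J -> @is_cocone J (power (idx n) HCohI) D c k ->
  (forall i x, exists j y, k j i y = x) ->
  @is_colimit J (power (idx n) HCohI) D c k.
Proof.
move=> filJ kD ksurj; split=> // d l lD.
pose Di i := @Functor J HCohI (fun j => D j i) (fun x y f => fmap D f i)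
  (fun x => congr1 (fun h => h i) (fmap1 D x))
  (fun x y z g f => congr1 (fun h => h i) (fmapM D g f)).
have H i : exists! u : emb (c i) (d i), forall j, emb_cmp u (k j i) = l j i.
  apply: (@cocone_emb J filJ (Di i) _ (fun j => k j i) _ (ksurj i) (d i) (fun j => l j i)).
    by move=> a b f; exact (congr1 (fun h : embs (D a) c => h i) (kD a b f)).
  by move=> a b f; exact (congr1 (fun h : embs (D a) d => h i) (lD a b f)).
have /dep_choice[u uP] := H.
exists u; split=> [j|v vl]; apply: functional_extensionality_dep => i.
  exact: (proj1 (uP i)).
by apply: (proj2 (uP i)) => j; exact (congr1 (fun h : embs (D j) d => h i) (vl j)).
Qed.

End PowerColimits.

(** The argument of [colimit_surj] is repeated on tuples, since a component of a colimit in the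
    power is not known in advance to be a colimit. *)
Lemma power_colimit_surj (n : nat) (J : category) (D : functor J (power (idx n) HCohI))
    (c : hcohs n) (k : forall j, embs (D j) c) :
  @is_colimit J (power (idx n) HCohI) D c k -> forall i x, exists j y, k j i y = x.
Proof.
case=> kD ku; pose E : tot c -> Prop := fun p => exists j, rng (k j) p.
have /dep_choice[l lk] : forall j, exists l : embs (D j) (restr E), ecmp (rincl E) l = k j.
  by move=> j; apply: embs_lift => p kp; apply/rng_incl; exists j.
have lD : @is_cocone J (power (idx n) HCohI) D (restr E) l.
  move=> i j f; apply: functional_extensionality_dep => m.
  apply: emb_eq; apply: funext => x; apply: (@emb_inj _ _ (rincl E m)).
  rewrite -[rincl E m (l i m x)]/(ecmp (rincl E) (l i) m x) lk -(kD _ _ f).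
  by rewrite -[RHS]/((k j m) ((fmap D f : embs _ _) m x)) -lk.
have [u [ul0 _]] := ku _ l lD.
have ul j : ecmp u (k j) = l j := ul0 j.
have [v [_ vu]] := ku _ k kD.
have e : ecmp (rincl E) u = eid c.
  rewrite -[LHS](vu (ecmp (rincl E) u)); last first.
    by move=> j; rewrite -[RHS]lk -[in RHS]ul; apply: functional_extensionality_dep => m; exact: emb_eq.
  by apply: vu => j; exact: (@cmp1m (power (idx n) HCohI)).
move=> i x; have [j [y /= jy]] := svalP (u i x); exists j, y; rewrite jy.
by rewrite -[sval _]/(ecmp (rincl E) u i x) e.
Qed.

(** The universal property is tested on the subobject of [X] made of the elements which [f] sends
    into the range of [g]: its inclusion factors through [P]. *)
Lemma power_pullback (n : nat) (X Y Z P : hcohs n) (f : embs X Z) (g : embs Y Z)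
    (a : embs P X) (b : embs P Y) :
  @is_pullback (power (idx n) HCohI) X Y Z P f g a b ->
  forall p, rng f p -> rng g p -> rng (ecmp f a) p.
Proof.
case=> fg Pu.
pose E : tot X -> Prop := fun p => exists y, f (tag p) (tagged p) = g (tag p) y.
have [|h gh] := @embs_lift _ _ _ _ g (ecmp f (rincl E)).
  by move=> [i z] [[x [y /= e]] /= <-]; exists y.
have [u [[au _] _]] := Pu (restr E) (rincl E) h (esym gh).
move=> [i z] [x /= <-] [y /= e].
pose t : restr E i := exist (fun x => E (existT _ i x)) x (ex_intro _ y (esym e)).
exists ((u : embs _ _) i t).
by rewrite /= -[X in _ = f i X]/(rincl E i t) -[in RHS]au.
Qed.

Lemma hcoh_pullback (H K L M : hcoh) (f : emb H L) (g : emb K L) (a : emb M H) (b : emb M K) :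
  emb_cmp f a = emb_cmp g b ->
  (forall x y, f x = g y -> exists t, a t = x) ->
  @is_pullback HCohI H K L M f g a b.
Proof.
move=> fg ab; split=> // q a' b' e.
have [|u au] := @emb_lift _ _ _ a a'.
  by move=> w; apply: (ab _ (b' w)); exact (congr1 (fun h : emb q L => h w) e).
exists u; split=> [|v [av _]]; last first.
  by apply: emb_eq; apply: funext => w; apply: (@emb_inj _ _ a);
    exact (congr1 (fun h : emb q H => h w) (etrans au (esym av))).
split=> //; apply: emb_eq; apply: funext => w; apply: (@emb_inj _ _ g).
have e' : emb_cmp f a' = emb_cmp g b' := e.
rewrite -[RHS]/(emb_cmp g b' w) -e' -au.
exact (congr1 (fun h : emb M L => h (u w)) (esym fg)).
Qed.

(** A finite support lies in the range of one stage of a filtered diagram, so that the image of a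
    colimit cocone is jointly surjective. The range of a pullback is the intersection of two ranges,
    so that closure of supports under intersection is exactly what preservation of pullbacks
    asks. *)
Lemma normal_variable n (F : rawfun n) : normal F -> variable_hypercoherence F.
Proof.
move=> [fF sF cF].
pose G (X Y : hcohs n) (f : embs X Y) : emb (robj F X) (robj F Y) :=
  projT1 (cid (fn_emb fF f)).
have GE X Y (f : embs X Y) x y : hact F f x y <-> G X Y f x = y.
  by rewrite /G; case: cid.
have G1 X : G X X (eid X) = emb_id _.
  by apply: emb_eq; apply: funext => x; apply/GE/hact_id.
have GM X Y Z (g : embs Y Z) (f : embs X Y) :
    G X Z (ecmp g f) = emb_cmp (G Y Z g) (G X Y f).
  apply: emb_eq; apply: funext => x; apply/GE.
  by apply/(hact_cmp fF); exists (G X Y f x); apply/GE.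
exists G, G1, GM; split=> //.
pose FF := @Functor (power (idx n) HCohI) HCohI (robj F) G G1 GM; rewrite -/FF; split=> [J D c k filJ kD|X Y Z P f g a b pb].
  apply: (@cocone_colimit J filJ (fcomp FF D) (robj F c) (fun j => G _ _ (k j))).
    move=> i j f; rewrite /= -[LHS]GM.
    by congr (G _ _ _); exact: (proj1 kD).
  move=> x; have [s [W [h [w [wx hs]]]]] := sF c x.
  have ks := power_colimit_surj kD.
  have [|||j sj] := @filtered_fun J filJ (fun i j => inhabited (hom i j)) _
      (fun p j => rng (k j) p) s => //.
  - move=> [m z] i j [f] [y /= <-]; exists ((fmap D f : embs _ _) m y).
    exact (congr1 (fun h : embs (D i) c => h m y) (proj1 kD i j f)).
  - by move=> [i y] _; have [j [t <-]] := ks i y; exists j, t.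
  exists j; have [|_ [y [_ _ yx]]] := hact_lift fF (f := k j) wx.
    by move=> p /hs /sj.
  by exists y; apply/GE.
have fg : ecmp f a = ecmp g b by case: pb.
apply: hcoh_pullback; first by rewrite -[LHS]GM -[RHS]GM -/(ecmp f a) -/(ecmp g b) fg.
move=> x y e; have xz : hact F f x (G _ _ f x) by apply/GE.
have yz : hact F g y (G _ _ f x) by apply/GE; rewrite e.
have s1 : supp F (rng f) (G _ _ f x) by apply/(supp_rng fF); exists x.
have s2 : supp F (rng g) (G _ _ f x) by apply/(supp_rng fF); exists y.
have := cF _ _ _ _ s1 s2 => /(supp_mono (E' := rng (ecmp f a))).
have := power_pullback pb.
move=> rg /(_ (fun p h => rg p (proj1 h) (proj2 h))) /(supp_rng fF)[t /(hact_cmp fF)[x' tx' x'z]].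
by exists t; apply/GE; rewrite (hact_inj fF xz x'z).
Qed.

(** * A tuple as the filtered colimit of its finite restrictions *)

Section FiniteSubobjects.
Variables (n : nat) (X : hcohs n).

Let homE (s t : seq (tot X)) : Type := forall p, lin s p -> lin t p.
Let idE (s : seq (tot X)) : homE s s := fun p h => h.
Let cmpE (s t u : seq (tot X)) (g : homE t u) (f : homE s t) : homE s u :=
  fun p h => g p (f p h).

(** The diagram to which preservation of filtered colimits is applied in order to obtain finite
    supports. An arrow is a proof of inclusion, so that parallel arrows are equal by proof
    irrelevance. *)
Definition finite_subsets : category :=
  @Category (seq (tot X)) homE idE cmpE
   (fun _ _ _ => erefl) (fun _ _ _ => erefl) (fun _ _ _ _ _ _ _ => erefl).

Lemma finite_subsets_filtered : filtered finite_subsets.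
Proof.
split=> [|s t|s t f g]; first by exists [::].
  exists (s ++ t); split; constructor => p sp; apply/lin_cat; by [left|right].
by exists t, (@idE t); have -> : f = g by exact (@Prop_irrelevance (forall p, lin s p -> lin t p) f g).
Qed.

Let subfun_map (s t : finite_subsets) (f : hom s t) : embs (restr (lin s)) (restr (lin t)) :=
  projT1 (cid (@embs_lift _ _ _ _ (rincl (lin t)) (rincl (lin s))
    (fun p h => proj2 (rng_incl (lin t) p) (f p (proj1 (rng_incl (lin s) p) h))))).

Let subfun_mapE (s t : finite_subsets) (f : hom s t) :
  ecmp (rincl (lin t)) (subfun_map f) = rincl (lin s).
Proof. by rewrite /subfun_map; case: cid. Qed.

Let incl_mono (s : finite_subsets) Z (f g : embs Z (restr (lin s))) :
  ecmp (rincl (lin s)) f = ecmp (rincl (lin s)) g -> f = g.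
Proof.
move=> e; apply: functional_extensionality_dep => i; apply: emb_eq; apply: funext => x.
apply: (@emb_inj _ _ (rincl (lin s) i)).
exact (congr1 (fun h : embs Z X => h i x) e).
Qed.

Let subfun1 s : subfun_map (idm s) = eid _.
Proof.
apply: incl_mono; rewrite subfun_mapE.
by apply: functional_extensionality_dep => i; exact: emb_eq.
Qed.

Let subfunM s t u (g : hom t u) (f : hom s t) :
  subfun_map (cmp g f) = ecmp (subfun_map g) (subfun_map f).
Proof.
apply: incl_mono; rewrite subfun_mapE -(subfun_mapE f) -(subfun_mapE g).
by apply: functional_extensionality_dep => i; exact: emb_eq.
Qed.

Definition finite_subobjects : functor finite_subsets (power (idx n) HCohI) :=
  @Functor finite_subsets (power (idx n) HCohI) (fun s => restr (lin s))
    subfun_map subfun1 subfunM.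

Lemma finite_subobjects_colimit :
  @is_colimit finite_subsets (power (idx n) HCohI) finite_subobjects X
    (fun s => rincl (lin s)).
Proof.
apply: power_colimit; first exact: finite_subsets_filtered.
  by move=> s t f; exact: subfun_mapE.
move=> i x; pose p : tot X := existT _ i x; exists [:: p].
have ix : lin [:: p] p by left.
by exists (exist (fun x' => lin [:: p] (existT _ i x')) x ix).
Qed.

End FiniteSubobjects.

(** Since [F] preserves the colimit of the finite restrictions of [X], an element of [F X] comes
    from one of them, and this restriction is a finite support. *)
Lemma variable_functorial n (F : rawfun n) : variable_hypercoherence F ->
  functorial F /\ finite_supp F.
Proof.
case=> G [G1 [GM [[colim _] GE]]].
have fF : functorial F.
  split=> [X|X Y f|X Y Z g f x y z /GE <- /GE <-]; last by apply/GE; rewrite GM.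
    apply: funext => x; apply: funext => y; apply: propext.
    by rewrite -[ract _ x y]/(hact F (eid X) x y) GE G1.
  by exists (G X Y f) => x y; exact: GE.
split=> // X x.
have := colim _ _ _ _ (finite_subsets_filtered X) (finite_subobjects_colimit X).
move=> cF; 
have [s [y yx]] := @colimit_surj _ (fcomp (@Functor (power (idx n) HCohI) HCohI
  (robj F) G G1 GM) (finite_subobjects X)) (robj F X)
  (fun s => G _ _ (rincl (lin s))) cF x.
 exists s; apply/(supp_restr fF).
by exists y; apply/GE.
Qed.

(** * Normal forms *)

Lemma lin_idx (T : Type) (s : seq T) :
  exists k (g : idx k -> T), injective g /\ forall x, lin s x <-> exists i, g i = x.
Proof.
elim: s => [|a s [k [g [gI gs]]]].
  by exists 0, (fun i : void => match i with end); split=> [[]|x]; split=> // -[[]].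
case: (pselect (lin s a)) => sa.
  exists k, g; split=> // x; rewrite -gs; split=> [[<-|]|] //; by right.
exists k.+1, (fun o : idx k.+1 => if o is Some i then g i else a); split.
  move=> [i|] [j|] //= => [/gI -> //|e|e]; case: sa; apply/gs; last by exists j.
  by exists i.
move=> x; split=> [[<-|/gs[i <-]]|[[i|] <-]]; first by exists None.
- by exists (Some i).
- by right; apply/gs; exists i.
- by left.
Qed.

(** Coherence is transported along an injective enumeration of the web; this is how normal forms
    reach their representatives over [finhc]. *)
Lemma finhc_iso (H : hcoh) : finite_set [set: H] ->
  exists (Z : finhc) (f : emb (hc_of Z) H), bijective f.
Proof.
move=> /finite_linP[s Hs]; have [k [g [gI gs]]] := lin_idx s.
have h1 (S : idx k -> Prop) : Gamma (g @` S) -> fin_ne S.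
  by move=> /coh_fin_ne; exact: (proj1 (image_inj_fin_ne S gI)).
have h2 (x : idx k) : Gamma (g @` [set x]) by rewrite image_set1; exact: coh_set1.
pose f : emb (hc_of (existT _ k (HcohOn h1 h2))) H :=
  @Emb (hc_of (existT _ k (HcohOn h1 h2))) H g gI (fun S => conj id id).
exists (existT _ k (HcohOn h1 h2)), f; apply: emb_surj_bij => y.
by have /gs : lin s y by exact/Hs.
Qed.

Lemma size_filter_lt (T : Type) (a : pred T) s x :
  lin s x -> ~~ a x -> size (filter a s) < size s.
Proof.
move=> sx ax; rewrite size_filter -(count_predC a s) -{1}[count a s]addn0 ltn_add2l.
by elim: s sx => //= y s IH [->|/IH h]; [rewrite ax | exact: ltn_addl].
Qed.

Section NormalForms.
Variables (n : nat) (F : rawfun n) (fF : functorial F).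

Lemma normal_point_hact X Y (f : embs X Y) x y :
  bij f -> hact F f x y -> normal_point (X := X) x -> normal_point (X := Y) y.
Proof.
move=> fb xy nx Z g [z zy]; have [f' [ff' f'f f'b]] := bij_inv fb.
have h : bij (ecmp f' g).
  apply: nx; exists z; apply/(hact_cmp fF); exists y => //.
  have [x' yx'] := hact_total fF f' y.
  suff -> : x = x' by [].
  have /(hact_id fF) // : hact F (eid X) x x'.
  by rewrite -f'f; apply/(hact_cmp fF); exists y.
have -> : g = ecmp f (ecmp f' g).
  have -> : ecmp f (ecmp f' g) = ecmp (ecmp f f') g.
    by apply: functional_extensionality_dep => i; exact: emb_eq.
  by rewrite ff'; apply: functional_extensionality_dep => i; exact: emb_eq.
exact: (bij_cmp fb h).
Qed.

Lemma rep_iso_refl r : rep_iso (F := F) r r.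
Proof. by exists (eid _); split; [exact: bij_id | apply/hact_id]. Qed.

Lemma rep_iso_trans r s t : rep_iso (F := F) r s -> rep_iso s t -> rep_iso r t.
Proof.
move=> [f [fb rs]] [g [gb st]]; exists (ecmp g f); split; first exact: bij_cmp.
by apply/(hact_cmp fF); exists (rep_point s).
Qed.

Lemma rep_iso_sym r s : rep_iso (F := F) r s -> rep_iso s r.
Proof.
move=> [f [fb rs]]; have [g [fg gf gb]] := bij_inv fb; exists g; split=> //.
apply: (@hact_cancel _ _ fF _ _ _ f _ _ _ (rep_point s)) => //.
by rewrite fg; apply/hact_id.
Qed.

Lemma rep_iso_eq r s : rep_iso (F := F) r s -> rep_iso r = rep_iso s.
Proof.
move=> rs; apply: funext => t; apply: propext; split.
  by apply: rep_iso_trans; exact: rep_iso_sym.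
exact: rep_iso_trans.
Qed.

Lemma NF_normal N r : NF F N -> N r -> normal_point (rep_point r) /\ N = rep_iso r.
Proof.
case=> s ns -> sr; split; last exact: rep_iso_eq.
by case: sr => f [fb /normal_point_hact]; apply.
Qed.

Lemma NF_rep r : normal_point (rep_point r) -> NF F (rep_iso r).
Proof. by exists r. Qed.

Lemma rep_of X (x : robj F X) : (forall i, finite_set [set: X i]) ->
  exists (r : rep F) (f : embs (rep_base r) X), bij f /\ hact F f (rep_point r) x.
Proof.
move=> Xfin; have H i := finhc_iso (Xfin i).
have /dep_choice[f fb] i :
    exists f : emb (hc_of (projT1 (cid (H i)))) (X i), bijective f.
  by case: (cid (H i)).
pose Z i := projT1 (cid (H i)).
have [y yx] := @hact_bij _ _ fF (fun i => hc_of (Z i)) X f x fb.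
by exists (existT _ Z y), f.
Qed.

Lemma restr_lin_finite X (s : seq (tot X)) i : finite_set [set: @restr n X (lin s) i].
Proof.
pose g (u : @restr n X (lin s) i) : tot X := existT _ i (sval u).
have gI : injective g.
  by move=> u v e; apply: sval_inj; exact: (existT_inj e).
have /eq_finite_set <- := inj_card_eq (A := setT) (in2W gI).
by apply/finite_sub_lin; exists s => _ [u _ <-]; exact: svalP u.
Qed.

(** The restriction to a supporting list of minimal length is normal: if an embedding carrying the
    point missed some [u], filtering [u] out of the list would leave a shorter support. *)
Lemma nf_of_exists_rep (sF : finite_supp F) X (x : robj F X) :
  exists (r : rep F) (f : embs (rep_base r) X),
    normal_point (rep_point r) /\ hact F f (rep_point r) x.
Proof.
pose a m := `[< exists2 s : seq (tot X), size s = m & supp F (lin s) x >].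
have [|m /asboolP[s sm sx] mmin] := @ex_minnP a.
  by have [s sx] := sF X x; exists (size s); apply/asboolP; exists s.
have /(supp_restr fF)[x0 x0x] := sx.
have nx0 : normal_point (X := restr (lin s)) x0.
  move=> Y f [y yx0]; apply/rng_bij => -[i [u su]]; apply: contrapT => nf.
  pose b (q : tot X) := ~~ `[< q = existT _ i u >].
  have : size (filter b s) < size s.
    by apply: (size_filter_lt su); rewrite /b negbK; apply/asboolP.
  rewrite ltnNge sm => /negP; apply; apply: mmin; apply/asboolP.
  exists (filter b s) => //; exists Y, (ecmp (rincl (lin s)) f), y.
  split; first by apply/(hact_cmp fF); exists x0.
  move=> q [v vq]; apply/List.filter_In; split.
    by case: q v vq => j w v /= <-; exact: svalP (f j v).
  apply/asboolP => e; case: _ / (esym e) v vq => v /= vu.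
  by apply: nf; exists v; exact: sval_inj.
have [r [f [fb rx]]] := rep_of x0 (restr_lin_finite s).
exists r, (ecmp (rincl (lin s)) f); split; last by apply/(hact_cmp fF); exists x0.
have [g [fg gf gb]] := bij_inv fb.
apply: (normal_point_hact gb _ nx0).
by apply: (@hact_cancel _ _ fF _ _ _ f _ _ _ x0) => //; rewrite fg; apply/hact_id.
Qed.

Lemma nf_exists (sF : finite_supp F) X (x : robj F X) : exists N, nf_of F x N.
Proof.
have [r [f [nr rx]]] := nf_of_exists_rep sF x; exists (rep_iso r).
by split; [exact: NF_rep | exists r; [exact: rep_iso_refl | exists f]].
Qed.

Lemma nf_of_hact X Y (f : embs X Y) x y N : hact F f x y -> nf_of F x N -> nf_of F y N.
Proof.
move=> xy [NN [r Nr [g rx]]]; split=> //; exists r => //.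
by exists (ecmp f g); apply/(hact_cmp fF); exists x.
Qed.

Lemma nf_of_rep N r : NF F N -> N r -> nf_of F (rep_point r) N.
Proof. by move=> NN Nr; split=> //; exists r => //; exists (eid _); apply/hact_id. Qed.

Lemma nf_of_all X (x : robj F X) N r : nf_of F x N -> N r ->
  exists f : embs (rep_base r) X, hact F f (rep_point r) x.
Proof.
move=> [NN [s Ns [g sx]]] Nr; have [_ Nis] := NF_normal NN Nr.
move: Ns; rewrite Nis => -[f [fb rs]]; exists (ecmp g f).
by apply/(hact_cmp fF); exists (rep_point s).
Qed.

End NormalForms.

Section NormalFormsOfNormal.
Variables (n : nat) (F : rawfun n) (nF : normal F).
Let fF := nrm_fn nF.

(** The ranges of [f] and [g] both support [x], hence so does their intersection. The witness [W] of
    the latter embeds into both bases, and normality makes these two embeddings bijective; their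
    composite is the isomorphism sought. *)
Lemma nf_unique X (x : robj F X) N M : nf_of F x N -> nf_of F x M -> N = M.
Proof.
move=> [NN [r Nr [f rx]]] [MM [s Ms [g sx]]].
have [nr ->] := NF_normal fF NN Nr; have [ns ->] := NF_normal fF MM Ms.
apply: (rep_iso_eq fF).
have s1 : supp F (rng f) x by apply/(supp_rng fF); exists (rep_point r).
have s2 : supp F (rng g) x by apply/(supp_rng fF); exists (rep_point s).
have [W [h [w [wx hfg]]]] := nrm_cap nF s1 s2.
have [|p [a [fp wa ax]]] := hact_lift fF (f := f) wx; first by move=> p /hfg[].
have [|q [b [gq wb bx]]] := hact_lift fF (f := g) wx; first by move=> q /hfg[].
have pb : bij p.
  by apply: nr; exists w; rewrite (hact_inj fF rx ax).
have qb : bij q.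
  by apply: ns; exists w; rewrite (hact_inj fF sx bx).
have [p' [pp' p'p p'b]] := bij_inv pb.
exists (ecmp q p'); split; first exact: bij_cmp.
apply/(hact_cmp fF); exists w; last by rewrite (hact_inj fF sx bx).
apply: (@hact_cancel _ _ fF _ _ _ p _ _ _ a) => //.
by rewrite pp'; apply/(hact_id fF); exact (hact_inj fF rx ax).
Qed.

End NormalFormsOfNormal.

Lemma finite_powerset (T : Type) (A : T -> Prop) :
  finite_set A -> finite_set [set B : T -> Prop | forall x, B x -> A x].
Proof.
move=> /finite_linP[s As].
have [L HL] : exists L : seq (T -> Prop), forall B, (forall x, B x -> lin s x) -> lin L B.
  elim: s {As} => [|a s [L HL]].
    exists [:: fun _ => False] => B B0; left; apply: funext => x.
    by apply: propext; split=> // /B0.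
  exists (L ++ [seq (fun x => x = a \/ B x) | B <- L]) => B Bs.
  apply/lin_cat; case: (pselect (B a)) => Ba; last first.
    by left; apply: HL => x Bx; case: (Bs x Bx) => // ax; case: Ba; rewrite ax.
  right; apply/lin_map; exists (fun x => B x /\ x <> a).
    by apply: HL => x [Bx xa]; case: (Bs x Bx) => // ax; case: xa.
  apply: funext => x; apply: propext; split=> [[->|[]]//|Bx].
  by case: (pselect (x = a)); [left|right].
by apply/finite_sub_lin; exists L => B BA; apply: HL => x /BA/As.
Qed.

Lemma finite_inj_on (T U : Type) (A : T -> Prop) (B : U -> Prop) (f : T -> U) :
  finite_set B -> (forall x, A x -> B (f x)) ->
  (forall x y, A x -> A y -> f x = f y -> x = y) -> finite_set A.
Proof.
move=> fB AB fI; have /eq_finite_set <- : (f @` A #= A)%card.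
  by apply: inj_card_eq => x y; rewrite !inE; exact: fI.
by apply: sub_finite_set fB => _ [x Ax <-]; exact: AB.
Qed.

Lemma finite_uniform_families n (F : rawfun n) :
  variable_hypercoherence F -> weakly_finite F ->
  finite_set [set c | uniform_clique_family F c].
Proof.
move=> /variable_functorial[fF sF] wF.
pose h (c : forall X, robj F X -> Prop) := fun N : rep F -> Prop =>
  NF F N /\ exists2 r, N r & c (rep_base r) (rep_point r).
apply: (finite_inj_on (finite_powerset wF) (f := h)); first by move=> c _ N [].
have sub c d : uniform_clique_family F c -> uniform_clique_family F d ->
    h c = h d -> forall X x, c X x -> d X x.
  move=> [_ uc] [_ ud] hh X x cx.
  have [r [f [nr rx]]] := nf_of_exists_rep fF sF x.
  have : h c (rep_iso r).
    split; first exact: NF_rep.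
    by exists r; [exact: rep_iso_refl | apply/(uc _ _ _ _ _ rx)].
  rewrite hh => -[_ [s [g [gb rs]] ds]].
  by apply/(ud _ _ _ _ _ rx)/(ud _ _ _ _ _ rs).
move=> c d uc ud hh; apply: functional_extensionality_dep => X; apply: funext => x.
by apply: propext; split; exact: sub.
Qed.

(** * Propositional connectives *)

Lemma image_id_set1 (T U : Type) (f : T -> U) (S : T -> Prop) : injective f ->
  (exists x, f @` S = [set x]) <-> (exists x, S = [set x]).
Proof.
move=> fI; split=> [[y e]|[x ->]]; last by exists (f x); rewrite image_set1.
have [x Sx xy] : (f @` S) y by rewrite e.
by exists x; apply: (image_inj_eq fI); rewrite image_set1 e xy.
Qed.

Lemma strict_coh_image (T U : Type) (H : hcoh_on T) (K : hcoh_on U) (f : T -> U)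
    (S : T -> Prop) : injective f ->
  (coh H S <-> coh K (f @` S)) -> strict_coh H S <-> strict_coh K (f @` S).
Proof.
move=> fI e.
by split=> -[/e HS n1]; split=> // /(image_id_set1 S fI).
Qed.

Lemma perp_coh_image (T U : Type) (H : hcoh_on T) (K : hcoh_on U) (f : T -> U)
    (S : T -> Prop) : injective f ->
  (coh H S <-> coh K (f @` S)) -> coh (hperp H) S <-> coh (hperp K) (f @` S).
Proof.
move=> fI e; have sE := strict_coh_image fI e.
by split=> -[fS nS]; (split; [exact/(image_inj_fin_ne S fI) | move=> /sE]).
Qed.

Section Connectives.
Variable n : nat.
Implicit Types F G : rawfun n.

Lemma normal_proj (i : idx n) : normal (proj_f i).
Proof.
have fF : functorial (proj_f i).
  split=> [X|X Y f|X Y Z g f x y z /= <- <- //]; first by apply: funext.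
  by exists (f i) => x y.
split=> // [X x|X E E' x].
  pose s : seq (tot X) := [:: existT _ i x]; exists s; apply/(supp_restr fF).
  by have sx : lin s (existT _ i x) by [left]; exists (exist (fun y => lin s (existT _ i y)) x sx).
move=> /(supp_restr fF)[[y Ey] /= xy] /(supp_restr fF)[[z Ez] /= xz].
apply/(supp_restr fF); rewrite /= in x xy xz *.
have EE : (E `&` E') (existT _ i x) by split; [rewrite -xy | rewrite -xz].
by exists (exist (fun y => (E `&` E') (existT _ i y)) x EE).
Qed.

Lemma normal_const (T : Type) (H : hcoh_on T) : normal (@const_f n T H).
Proof.
have fF : functorial (@const_f n T H).
  split=> [X|X Y f|X Y Z g f x y z /= -> -> //]; first by apply: funext.
  by exists (emb_id (Hcoh H)) => x y.
split=> // [X x|X E E' x _ _]; first exists [::];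
  by apply/(supp_restr fF); exists x.
Qed.

Lemma functorial_perp F : functorial F -> functorial (perp_f F).
Proof.
move=> fF; split; [exact: fn_id fF| |exact: (fn_cmp fF)] => X Y f.
have [e eE] := fn_emb fF f.
have eC (S : robj (perp_f F) X -> Prop) : Gamma S <-> Gamma (X := robj (perp_f F) Y) (e @` S).
  by apply: perp_coh_image; [exact (@emb_inj _ _ e) | exact (emb_coh e S)].
by exists (@Emb (robj (perp_f F) X) (robj (perp_f F) Y) e (@emb_inj _ _ e) eC).
Qed.

Lemma normal_perp F : normal F -> normal (perp_f F).
Proof. by case=> fF sF cF; split; [exact: functorial_perp | exact: sF | exact: cF]. Qed.

Lemma functorial_tensor F G : act_id (tensor_f F G) ->
  functorial F -> functorial G -> functorial (tensor_f F G).
Proof.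
move=> aI fF fG; split=> // [X Y f|X Y Z g f x y z [xy xy'] [yz yz']]; last first.
  by split; [exact (fn_cmp fF xy yz) | exact (fn_cmp fG xy' yz')].
have [e eE] := fn_emb fF f; have [d dE] := fn_emb fG f.
pose h (p : robj (tensor_f F G) X) : robj (tensor_f F G) Y := (e p.1, d p.2).
have hI : injective h.
  by move=> [a b] [a' b'] [/(@emb_inj _ _ e) -> /(@emb_inj _ _ d) ->].
have hC (S : robj (tensor_f F G) X -> Prop) : Gamma S <-> Gamma (h @` S).
  have e1 : fst @` (h @` S) = e @` (fst @` S) by rewrite !image_comp.
  have e2 : snd @` (h @` S) = d @` (snd @` S) by rewrite !image_comp.
  rewrite /Gamma /= /tensor_coh e1 e2.
  split=> -[f1 f2 f3]; (split; [exact/(image_inj_fin_ne S hI)| |]).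
  - by apply/(emb_coh e).
  - by apply/(emb_coh d).
  - by apply/(emb_coh e).
  - by apply/(emb_coh d).
exists (Emb hI hC) => -[a b] [a' b']; split=> [[/eE /= <- /dE /= <-] //|[<- <-]].
by split; [apply/eE | apply/dE].
Qed.

Lemma supp_tensor F G : functorial F -> functorial G ->
  forall X (E : tot X -> Prop) (x : rweb (tensor_f F G) X),
  supp (tensor_f F G) E x <-> supp F E x.1 /\ supp G E x.2.
Proof.
move=> fF fG X E [a b]; split=> [[W [g [[u v] [[/= ua vb] gE]]]]|].
  by split; [exists W, g, u | exists W, g, v].
move=> [/(supp_restr fF)[u ua] /(supp_restr fG)[v vb]].
by exists (restr E), (rincl E), (u, v); split=> // p /rng_incl.
Qed.

Lemma normal_tensor F G : act_id (tensor_f F G) ->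
  normal F -> normal G -> normal (tensor_f F G).
Proof.
move=> aI [fF sF cF] [fG sG cG]; have sE := supp_tensor fF fG.
split; first exact: functorial_tensor.
  move=> X [a b]; have [s sa] := sF X a; have [t tb] := sG X b; exists (s ++ t).
  by apply/sE; split; [apply: supp_mono sa | apply: supp_mono tb] => p sp;
    apply/lin_cat; [left|right].
by move=> X E E' x /sE[xE yE] /sE[xE' yE']; apply/sE; split; [exact: cF | exact: cG].
Qed.

Lemma plus_coh_image (T U T' U' : Type) (H : hcoh_on T) (K : hcoh_on U)
    (H' : hcoh_on T') (K' : hcoh_on U') (e : emb (Hcoh H) (Hcoh H'))
    (d : emb (Hcoh K) (Hcoh K')) (h : T + U -> T' + U') :
  (forall a, h (inl a) = inl (e a)) -> (forall b, h (inr b) = inr (d b)) ->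
  forall S, coh (hplus H K) S <-> coh (hplus H' K') (h @` S).
Proof.
move=> hl hr S; split=> [[[S' HS ->]|[S' KS ->]]|].
- left; exists (e @` S'); first exact/(emb_coh e).
  by rewrite !image_comp; congr (_ @` _); apply: funext => a /=.
- right; exists (d @` S'); first exact/(emb_coh d).
  by rewrite !image_comp; congr (_ @` _); apply: funext => a /=.
case=> -[S' HS hS].
- left; have SE : S = inl @` [set a | S (inl a)].
    apply/seteqP; split=> [[a|b] Sx|_ [a Sa <-] //]; first by exists a.
    by have [] : (inl @` S') (h (inr b)); [rewrite -hS; exists (inr b) | rewrite hr].
  exists [set a | S (inl a)] => //; apply/(emb_coh e).
  suff -> : e @` [set a | S (inl a)] = S' by [].
  apply: (@image_inj_eq _ _ (@inl T' U')); first by move=> x y [].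
  rewrite -hS [in RHS]SE !image_comp.
  by congr (_ @` _); apply: funext => a /=.
- right; have SE : S = inr @` [set a | S (inr a)].
    apply/seteqP; split=> [[b|a] Sx|_ [a Sa <-] //]; last by exists a.
    by have [] : (inr @` S') (h (inl b)); [rewrite -hS; exists (inl b) | rewrite hl].
  exists [set a | S (inr a)] => //; apply/(emb_coh d).
  suff -> : d @` [set a | S (inr a)] = S' by [].
  apply: (@image_inj_eq _ _ (@inr T' U')); first by move=> x y [].
  rewrite -hS [in RHS]SE !image_comp.
  by congr (_ @` _); apply: funext => a /=.
Qed.

Lemma functorial_plus F G : act_id (plus_f F G) ->
  functorial F -> functorial G -> functorial (plus_f F G).
Proof.
move=> aI fF fG; split=> // [X Y f|X Y Z g f]; last first.
  by case=> [x|x] [y|y] [z|z] //= xy yz;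
    [exact (fn_cmp fF xy yz) | exact (fn_cmp fG xy yz)].
have [e eE] := fn_emb fF f; have [d dE] := fn_emb fG f.
pose h (p : robj (plus_f F G) X) : robj (plus_f F G) Y :=
  match p with inl a => inl (e a) | inr b => inr (d b) end.
have hI : injective h.
  by move=> [a|a] [b|b] // [] => [/(@emb_inj _ _ e) ->|/(@emb_inj _ _ d) ->].
have hC (S : robj (plus_f F G) X -> Prop) : Gamma S <-> Gamma (h @` S).
  exact: (plus_coh_image (e := e) (d := d)).
exists (Emb hI hC) => -[a|a] [b|b] //=.
- by split=> [/eE -> //|[<-]]; apply/eE.
- by split=> [/dE -> //|[<-]]; apply/dE.
Qed.

Lemma supp_plus F G X (E : tot X -> Prop) (x : rweb (plus_f F G) X) :
  supp (plus_f F G) E x <->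
  match x with inl a => supp F E a | inr b => supp G E b end.
Proof.
case: x => a; split=> [[W [g [[u|u] [//= ua gE]]]]|[W [g [u [ua gE]]]]].
- by exists W, g, u.
- by exists W, g, (inl u).
- by exists W, g, u.
- by exists W, g, (inr u).
Qed.

Lemma normal_plus F G : act_id (plus_f F G) ->
  normal F -> normal G -> normal (plus_f F G).
Proof.
move=> aI [fF sF cF] [fG sG cG]; split; first exact: functorial_plus.
  by move=> X [a|a]; [have [s sa] := sF X a | have [s sa] := sG X a];
    exists s; apply/supp_plus.
by move=> X E E' [a|a] /supp_plus xE /supp_plus xE'; apply/supp_plus;
  [exact: cF | exact: cG].
Qed.

Lemma clique_image (H K : hcoh) (e : emb H K) (c : H -> Prop) :
  clique c <-> clique (e @` c).
Proof.
split=> [cc S fS Sc|cc S fS Sc].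
  have SE : S = e @` [set x | S (e x)].
    apply/seteqP; split=> [y Sy|_ [x Sx <-] //].
    by have [x _ xy] := Sc y Sy; exists x => //=; rewrite xy.
  rewrite SE -emb_coh; apply: cc.
    by apply/(image_inj_fin_ne _ (@emb_inj _ _ e)); rewrite -SE.
  by move=> x Sx; have [y cy /emb_inj <-] := Sc _ Sx.
rewrite (emb_coh e); apply: cc; first exact: image_fin_ne.
by move=> _ [x Sx <-]; exists x => //; exact: Sc.
Qed.

(** Every element of a multisection belongs to one of the cliques, so that a multisection of images
    lies in the range of [e] and can be pulled back. *)
Lemma multisection_image (H K : hcoh) (e : emb H K) (h : bang_web (str H) -> bang_web (str K))
    (A : bang_web (str H) -> Prop) (S : K -> Prop) :
  (forall c, sval (h c) = e @` sval c) ->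
  multisection S (h @` A) <-> exists2 S0, S = e @` S0 & multisection S0 A.
Proof.
move=> hE; split=> [[S1 S2]|[S0 -> [S1 S2]]]; last first.
  split=> [_ [c Ac <-]|_ [x Sx <-]].
    by have [x Sx cx] := S1 c Ac; exists (e x); [exists x | rewrite hE; exists x].
  by have [c Ac cx] := S2 x Sx; exists (h c); [exists c | rewrite hE; exists x].
exists [set x | S (e x)].
  apply/seteqP; split=> [y Sy|_ [x Sx <-] //].
  have [_ [c Ac <-]] := S2 y Sy; rewrite hE => -[x cx xy].
  by exists x => //=; rewrite xy.
split=> [c Ac|x Sx].
  have [|y Sy] := S1 (h c); first by exists c.
  by rewrite hE => -[x cx xy]; exists x => //=; rewrite xy.
have [_ [c Ac <-]] := S2 _ Sx; rewrite hE => -[y cy /emb_inj yx].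
by exists c => //; rewrite -yx.
Qed.

Lemma bang_coh_image (H K : hcoh) (e : emb H K) (h : bang_web (str H) -> bang_web (str K))
    (A : bang_web (str H) -> Prop) :
  (forall c, sval (h c) = e @` sval c) -> injective h ->
  coh (hbang (str H)) A <-> coh (hbang (str K)) (h @` A).
Proof.
move=> hE hI; split=> -[fA mA]; (split; first exact/(image_inj_fin_ne A hI)).
  move=> S fS /(multisection_image _ _ hE)[S0 SE mS]; rewrite SE.
  apply/(emb_coh e); apply: mA => //.
  by apply/(image_inj_fin_ne _ (@emb_inj _ _ e)); rewrite -SE.
move=> S fS mS; apply/(emb_coh e); apply: mA; first exact: image_fin_ne.
by apply/(multisection_image _ _ hE); exists S.
Qed.

Lemma functorial_bang F : act_id (bang_f F) -> functorial F -> functorial (bang_f F).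
Proof.
move=> aI fF; split=> // [X Y f|X Y Z g f x y z]; last first.
  rewrite /hact /= => xy yz; rewrite yz xy; apply/seteqP; split=> [c [b [a xa ab] bc]|c [a xa]].
    by exists a => //; exact (fn_cmp fF ab bc).
  by move=> /(hact_cmp fF)[b ab bc]; exists b => //; exists a.
have [e eE] := fn_emb fF f.
have hP (c : robj (bang_f F) X) : finite_set (e @` sval c) /\ clique (X := robj F Y) (e @` sval c).
  case: c => c [fc cc]; split; first exact: finite_image.
  exact: (proj1 (clique_image e c)).
pose h (c : robj (bang_f F) X) : robj (bang_f F) Y := exist _ _ (hP c).
have hI : injective h.
  move=> c d /(congr1 sval) /= e'; apply: sval_inj.
  exact: (image_inj_eq (@emb_inj _ _ e)).
have hC (S : robj (bang_f F) X -> Prop) : Gamma S <-> Gamma (h @` S).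
  exact: (@bang_coh_image (robj F X) (robj F Y) e).
exists (Emb hI hC) => c d /=.
have -> : [set y | exists2 x, sval c x & ract (graphs f) x y] = e @` sval c.
  by apply/seteqP; split=> y [x cx /eE xy]; exists x => //; apply/eE.
by split=> [dE|<- //]; apply: sval_inj; rewrite dE.
Qed.

(** Elements are pulled back one at a time; together they form again a finite clique because
    embeddings reflect both finiteness and cliques. *)
Lemma supp_bang F X (E : tot X -> Prop) (c : rweb (bang_f F) X) : functorial F ->
  supp (bang_f F) E c <-> forall x, sval c x -> supp F E x.
Proof.
move=> fF; split=> [[W [g [d [dc gE]]]] y|cE].
  by rewrite dc => -[x dx xy]; exists W, g, x.
pose d := [set x0 | exists2 x, sval c x & hact F (rincl E) x0 x].
have [e eE] := fn_emb fF (rincl E).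
have cd : sval c = e @` d.
  apply/seteqP; split=> [x cx|_ [y [x cx /eE yx] <-]]; last by rewrite yx.
  by have /(supp_restr fF)[x0 x0x] := cE _ cx; exists x0; [exists x | apply/eE].
have dP : finite_set d /\ clique (X := robj F (restr E)) d.
  have [fc cc] := svalP c; rewrite cd in fc cc.
  split; last exact (proj2 (clique_image e d) cc).
  by have /eq_finite_set <- := inj_card_eq (A := d) (in2W (@emb_inj _ _ e)).
exists (restr E), (rincl E), (exist _ d dP); split; last by move=> p /rng_incl.
rewrite /hact /= cd; apply/seteqP; split=> [_ [y dy <-]|x [y dy yx]].
  by exists y => //; apply/eE.
by exists y => //; apply/eE.
Qed.

Lemma normal_bang F : act_id (bang_f F) -> normal F -> normal (bang_f F).
Proof.
move=> aI [fF sF cF]; split; first exact: functorial_bang.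
  move=> X c; have [/finite_linP[s cs] _] := svalP c.
  have [t ht] : exists t : seq (tot X), forall x, lin s x -> supp F (lin t) x.
    elim: s {cs} => [|a s [t ht]]; first by exists [::].
    have [u ua] := sF X a; exists (u ++ t) => x [<-|/ht tx].
      by apply: supp_mono ua => p up; apply/lin_cat; left.
    by apply: supp_mono tx => p up; apply/lin_cat; right.
  by exists t; apply/supp_bang => // x /cs/ht.
move=> X E E' c /(supp_bang _ _ fF) cE /(supp_bang _ _ fF) cE'.
by apply/supp_bang => // x cx; apply: cF; [exact: cE | exact: cE'].
Qed.

End Connectives.

(** * Universal quantification *)

Definition exte n (X Y : hcohs n) (Z W : hcoh) (f : embs X Y) (g : emb Z W) :
    embs (ext X Z) (ext Y W) :=
  fun o => match o return emb (ext X Z o) (ext Y W o) with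
           | Some i => f i
           | None => g
           end.

(** The set given by [E] on the old parameters and by [D] on the new one. The match is dependent
    because [ext X Z o] only reduces once [o] is a constructor. *)
Definition pairE n (X : hcohs n) (Z : hcoh) (E : tot X -> Prop) (D : Z -> Prop) :
    tot (ext X Z) -> Prop :=
  fun p => match p with existT o x =>
    match o return ext X Z o -> Prop with
    | Some i => fun x => E (existT _ i x)
    | None => fun z => D z
    end x end.

Definition tot_some n (X : hcohs n) (Z : hcoh) (p : tot (ext X Z)) : option (tot X) :=
  match p with existT o x =>
    match o return ext X Z o -> option (tot X) with
    | Some i => fun x => Some (existT _ i x)
    | None => fun _ => None
    end x end.

Definition tot_none n (X : hcohs n) (Z : hcoh) (p : tot (ext X Z)) : option Z :=
  match p with existT o x =>
    match o return ext X Z o -> option Z with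
    | Some i => fun _ => None
    | None => fun z => Some z
    end x end.

Lemma lin_pmap (T U : Type) (f : T -> option U) s x y :
  lin s x -> f x = Some y -> lin (seq.pmap f s) y.
Proof.
move=> + fx; elim: s => //= a s IH [->|/IH h]; first by rewrite fx; left.
by case: (f a) => //= b; right.
Qed.

Lemma size_pmap_le (T U : Type) (f : T -> option U) s : size (seq.pmap f s) <= size s.
Proof. by elim: s => //= a s IH; case: (f a) => [b|] /=; [exact: IH | exact: leqW]. Qed.

Lemma lin_pairE n (X : hcohs n) (Z : hcoh) (s : seq (tot (ext X Z))) p :
  lin s p -> pairE (lin (seq.pmap (@tot_some n X Z) s)) (lin (seq.pmap (@tot_none n X Z) s)) p.
Proof. by case: p => -[i|] x sx; exact: (lin_pmap sx). Qed.

Section Exte.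
Variable n : nat.
Implicit Types X Y : hcohs n.
Implicit Types Z W : hcoh.

Lemma graphs_exte X Y Z W (f : embs X Y) (g : emb Z W) :
  graphs (exte f g) = ext_rel (graphs f) (fun a b => g a = b).
Proof. by apply: functional_extensionality_dep => -[i|]. Qed.

Lemma ecmp_exte X Y X' Z W Z' (f' : embs Y X') (g' : emb W Z') (f : embs X Y) (g : emb Z W) :
  ecmp (exte f' g') (exte f g) = exte (ecmp f' f) (emb_cmp g' g).
Proof. by apply: functional_extensionality_dep => -[i|]. Qed.

Lemma ecmp_1m X Y (f : embs X Y) : ecmp (eid Y) f = f.
Proof. by apply: functional_extensionality_dep => i; exact: emb_eq. Qed.

Lemma ecmp_m1 X Y (f : embs X Y) : ecmp f (eid X) = f.
Proof. by apply: functional_extensionality_dep => i; exact: emb_eq. Qed.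

Lemma rng_exte X Y Z W (f : embs X Y) (g : emb Z W) p :
  rng (exte f g) p <-> pairE (rng f) (fun z => exists y, g y = z) p.
Proof. by case: p => -[i|] z. Qed.

Variables (G : rawfun n.+1) (nG : normal G).
Let fG := nrm_fn nG.

(** Actions on disjoint parameters commute, both composites being the action of [exte f h]. This is
    what makes the action of the trace independent of the representative of a class. *)
Lemma hact_square X Y Z W (f : embs X Y) (h : emb Z W) a a' b b' :
  hact G (exte f (emb_id Z)) a b -> hact G (exte (eid X) h) a a' ->
  hact G (exte f (emb_id W)) a' b' <-> hact G (exte (eid Y) h) b b'.
Proof.
move=> ab aa'.
have e : ecmp (exte f (emb_id W)) (exte (eid X) h) = ecmp (exte (eid Y) h) (exte f (emb_id Z)).
  by rewrite !ecmp_exte ecmp_1m ecmp_m1 emb_1m emb_m1.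
split=> h1.
  have : hact G (ecmp (exte f (emb_id W)) (exte (eid X) h)) a b'.
    by apply/(hact_cmp fG); exists a'.
  by rewrite e => /(hact_cmp fG)[b1 ab1 b1b']; rewrite (hact_fun fG ab ab1).
have : hact G (ecmp (exte (eid Y) h) (exte f (emb_id Z))) a b'.
  by apply/(hact_cmp fG); exists b.
by rewrite -e => /(hact_cmp fG)[a1 aa1 a1b']; rewrite (hact_fun fG aa' aa1).
Qed.

Lemma partial_hact X (U V : hcohs 1) (g : embs U V) :
  hact (partial_f G X) g = hact G (exte (eid X) (g None)).
Proof. by rewrite /hact graphs_exte. Qed.

Lemma functorial_partial X : functorial (partial_f G X).
Proof.
split=> [U|U V g|U V W g f x y z].
- have := fn_id fG (ext X (U None)) => <-; rewrite /=; congr (ract _).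
  by apply: functional_extensionality_dep => -[i|].
- have [e eE] := fn_emb fG (exte (eid X) (g None)).
  by exists e => x y; rewrite partial_hact; exact: eE.
- rewrite !partial_hact => xy yz.
  have := fn_cmp fG xy yz; rewrite ecmp_exte.
  by rewrite (ecmp_1m (eid X)).
Qed.

Lemma supp_partial X (U : hcohs 1) (E : tot U -> Prop) (x : rweb G (ext X (U None))) :
  supp (partial_f G X) E x <->
  supp G (pairE (fun _ => True) (fun u => E (existT _ None u))) x.
Proof.
split=> [[W [g [w [wx gE]]]]|].
  exists (ext X (W None)), (exte (eid X) (g None)), w; split.
    by move: wx; rewrite partial_hact.
  move=> p /rng_exte; case: p => -[i|] // z [y /= yz].
  by apply: gE; exists y.
pose D u := E (existT _ None u) => -[W [g [w [wx gE]]]].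
have [|h [x0 [_ _ x0x]]] := hact_lift fG (f := exte (eid X) (subh_incl D)) wx.
  move=> p /gE /=; case: p => -[i|] z pE; apply/rng_exte; first by exists z.
  by exists (exist D z pE).
exists (fun _ => subh D).
exists (fun o => match o return emb (subh D) (U o) with
  | None => subh_incl D | Some v => match v with end end), x0.
rewrite partial_hact; split=> // -[[[]|] z] [y /= <-].
exact: svalP y.
Qed.

Lemma normal_partial X : normal (partial_f G X).
Proof.
split; first exact: functorial_partial.
  move=> U x; have [s sx] := nrm_fin nG x.
  pose t := [seq (existT _ None u : tot U) | u <- seq.pmap (@tot_none n X (U None)) s].
  exists t; apply/supp_partial; apply: supp_mono sx => p /lin_pairE.
  by case: p => -[i|] z //= h; apply/lin_map; exists z.
move=> U E E' x /supp_partial xE /supp_partial xE'; apply/supp_partial.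
by have := nrm_cap nG xE xE'; apply: supp_mono => -[[i|] z] [].
Qed.

(** If [y] comes from [V] along [g] in the last parameter, intersecting this support with the range
    of [f] shows that [x] does too, and normality of [x] makes [g] bijective. *)
Lemma normal_point_exte X Y (U : hcohs 1) (f : embs X Y) x y :
  hact G (exte f (emb_id (U None))) x y ->
  normal_point (F := partial_f G X) (X := U) x ->
  normal_point (F := partial_f G Y) (X := U) y.
Proof.
move=> xy nx V g [z]; rewrite partial_hact => zy.
have s1 : supp G (rng (exte f (emb_id (U None)))) y by apply/(supp_rng fG); exists x.
have s2 : supp G (rng (exte (eid Y) (g None))) y by apply/(supp_rng fG); exists z.
have s3 : supp G (rng (ecmp (exte f (emb_id (U None))) (exte (eid X) (g None)))) y.
  rewrite ecmp_exte ecmp_m1 emb_1m; apply: supp_mono (nrm_cap nG s1 s2).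
  move=> p [/rng_exte h1 /rng_exte h2]; apply/rng_exte.
  by case: p h1 h2 => -[i|] w.
have [t /(hact_cmp fG)[x' tx' x'y]] := proj1 (supp_rng fG _ _) s3.
by apply: nx; exists t; rewrite partial_hact (hact_inj fG xy x'y).
Qed.

(* The action of [all_f G] along [f], on classes of normal forms. *)
Definition nfim X Y (f : embs X Y) (N : rep (partial_f G X) -> Prop) :
    rep (partial_f G Y) -> Prop :=
  fun s => exists2 x : rweb (partial_f G X) (rep_base s),
    N (existT _ (projT1 s) x) & hact G (exte f (emb_id (rep_base s None))) x (rep_point s).

Section Image.
Variables (X Y : hcohs n) (f : embs X Y).

(** By [hact_square] an isomorphism of the bound parameter can be moved across [f], so that acting
    on one representative determines the whole image class. *)
Lemma nfim_rep (r : rep (partial_f G X)) y : hact G (exte f (emb_id (rep_base r None))) (rep_point r) y ->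
  normal_point (rep_point r) ->
  nfim f (rep_iso r) = rep_iso (existT _ (projT1 r) y : rep (partial_f G Y)).
Proof.
move=> ry nr; apply: funext => s; apply: propext; split.
  move=> [x [h [hb rx]] xs]; exists h; split=> //; rewrite partial_hact.
  by rewrite partial_hact in rx; apply: (proj1 (hact_square _ ry rx)).
move=> [h [hb ys]]; rewrite partial_hact in ys.
have [x rx] := hact_total fG (exte (eid X) (h None)) (rep_point r).
exists x; last exact: (proj2 (hact_square _ ry rx)).
by exists h; split=> //; rewrite partial_hact.
Qed.

Lemma nfim_nf (U : hcohs 1) x y N : hact G (exte f (emb_id (U None))) x y ->
  nf_of (partial_f G X) (Y := U) x N -> nf_of (partial_f G Y) (Y := U) y (nfim f N).
Proof.
move=> xy [NN [r Nr [g rx]]].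
have [nr ->] := NF_normal (functorial_partial X) NN Nr.
have [z rz] := hact_total fG (exte f (emb_id (rep_base r None))) (rep_point r).
rewrite (nfim_rep rz nr); split.
  by apply: NF_rep; exact: (normal_point_exte rz nr).
exists (existT _ (projT1 r) z); first exact: (rep_iso_refl (functorial_partial Y)).
exists g; rewrite partial_hact; rewrite partial_hact in rx.
exact: (proj1 (hact_square _ rz rx)).
Qed.

Lemma NF_nfim N : NF (partial_f G X) N -> NF (partial_f G Y) (nfim f N).
Proof.
move=> NN; have [r nr Nr] := NN.
have [z rz] := hact_total fG (exte f (emb_id (rep_base r None))) (rep_point r).
suff [] : nf_of (partial_f G Y) (Y := rep_base r) z (nfim f N) by [].
apply: (nfim_nf rz); rewrite Nr; apply: (nf_of_rep (functorial_partial X)).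
  exact: NF_rep.
exact: (rep_iso_refl (functorial_partial X)).
Qed.

Lemma nfim_inj N M : NF (partial_f G X) N -> NF (partial_f G X) M ->
  nfim f N = nfim f M -> N = M.
Proof.
move=> NN MM NM; have [[Z x] nr Nr] := NN.
have [z rz] := hact_total fG (exte f (emb_id (hc_of (Z None)))) x.
have : nfim f N (existT _ Z z).
  by exists x => //; rewrite Nr; exact: (rep_iso_refl (functorial_partial X)).
rewrite NM => -[x' Mx' x'z].
have e : x' = x by exact: (hact_inj fG x'z rz).
rewrite e in Mx'; have [_ ->] := NF_normal (functorial_partial X) MM Mx'.
by rewrite Nr.
Qed.

(** The lifting that turns a set over [Y], all of whose normal forms come from [X], into a set over
    [X]: a point with normal form [nfim f N] is obtained from a representative of [N] by an
    embedding of the bound parameter only. *)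
Lemma nf_of_nfim (U : hcohs 1) y N : NF (partial_f G X) N ->
  nf_of (partial_f G Y) (Y := U) y (nfim f N) ->
  exists2 x, hact G (exte f (emb_id (U None))) x y & nf_of (partial_f G X) (Y := U) x N.
Proof.
move=> NN yN; have [r nr Nr] := NN.
have [z rz] := hact_total fG (exte f (emb_id (rep_base r None))) (rep_point r).
have [|g] := nf_of_all (functorial_partial Y) (r := existT _ (projT1 r) z) yN.
  rewrite Nr (nfim_rep rz nr); exact: (rep_iso_refl (functorial_partial Y)).
rewrite partial_hact => zy.
have [x rx] := hact_total fG (exte (eid X) (g None)) (rep_point r).
exists x; first exact: (proj2 (hact_square _ rz rx)).
rewrite Nr; split; first exact: NF_rep.
exists r; first exact: (rep_iso_refl (functorial_partial X)).
by exists g; rewrite partial_hact.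
Qed.

(** Coherence of a set of normal forms is a condition on all sets having these normal forms. Test
    sets over [Y] are pulled back to [X] by [nf_of_nfim], test sets over [X] are pushed forward, and
    [hact_coh] compares their coherence. *)
Lemma coherent_nf_nfim (NS : (rep (partial_f G X) -> Prop) -> Prop) :
  (forall N, NS N -> NF (partial_f G X) N) ->
  coherent_nf NS <-> coherent_nf (nfim f @` NS).
Proof.
move=> NSN; split=> -[[fN NS0] _ H].
  split; first by apply: image_fin_ne; split.
    by move=> _ [N /NSN NN <-]; exact: NF_nfim.
  move=> U S fS SE; pose h := exte f (emb_id (U None)).
  pose S0 : robj (partial_f G X) U -> Prop := [set x | exists2 y, S y & hact G h x y].
  have nfS y : S y -> exists x N, [/\ hact G h x y, NS N & nf_of (partial_f G X) (Y := U) x N].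
    move=> Sy; have [M yM] := nf_exists (functorial_partial Y)
      (nrm_fin (normal_partial Y)) (X := U) y.
    have [N NSn NM] : (nfim f @` NS) M by rewrite -SE; exists y.
    rewrite -NM in yM; have [x xy xN] := nf_of_nfim (NSN _ NSn) yM.
    by exists x, N.
  have SE0 : S = [set y | exists2 x, S0 x & hact G h x y].
    apply/seteqP; split=> [y Sy|y [x [y' Sy' xy'] xy]].
      by have [x [N [xy _ _]]] := nfS y Sy; exists x => //; exists y.
    by rewrite (hact_fun fG xy xy').
  have -> : Gamma S <-> Gamma S0 by rewrite [in X in X <-> _]SE0; symmetry; exact: (hact_coh fG h).
  apply: H.
    have [e eE] := fn_emb fG h.
    apply/(image_inj_fin_ne S0 (@emb_inj _ _ e)); rewrite (_ : e @` S0 = S) //.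
    rewrite SE0; apply/seteqP; split=> y [x Sx /eE xy]; exists x => //; exact/eE.
  apply/seteqP; split=> [N [x [y Sy xy] xN]|N NSn].
    have : nf_set (partial_f G Y) S (nfim f N).
      by exists y => //; exact: nfim_nf xy xN.
    rewrite SE => -[M NSM /nfim_inj <- //]; first exact: NSN.
    by case: xN.
  have : nf_set (partial_f G Y) S (nfim f N) by rewrite SE; exists N.
  move=> [y Sy yN]; have [x xy xN] := nf_of_nfim (NSN _ NSn) yN.
  by exists x => //; exists y.
split=> //.
  split; last by case: NS0 => _ [N NSn _]; exists N.
  apply: (finite_inj_on fN (f := nfim f)); first by move=> N NSn; exists N.
  by move=> N M /NSN NN /NSN MM; exact: nfim_inj.
move=> U S fS SE; pose h := exte f (emb_id (U None)).
apply/(hact_coh fG h); apply: H.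
  have [e eE] := fn_emb fG h.
  rewrite (_ : [set y | _] = e @` S); first exact: image_fin_ne.
  by apply/seteqP; split=> y [x Sx /eE xy]; exists x => //; exact/eE.
rewrite -SE; apply/seteqP; split=> [M [y [x Sx xy] yM]|_ [N [x Sx xN] <-]].
  have [N xN] := nf_exists (functorial_partial X) (nrm_fin (normal_partial X)) (X := U) x.
  exists N; first by exists x.
  exact: (nf_unique (normal_partial Y) (nfim_nf xy xN) yM).
have [y xy] := hact_total fG h x.
by exists y; [exists x | exact: nfim_nf xy xN].
Qed.

Lemma coherent_nfim1 N : NF (partial_f G X) N ->
  coherent_nf [set N] <-> coherent_nf [set nfim f N].
Proof.
by move=> NN; rewrite -(image_set1 (nfim f)); apply: coherent_nf_nfim => _ ->.
Qed.

Lemma hact_all (N : rweb (all_f G) X) (M : rweb (all_f G) Y) :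
  hact (all_f G) f N M <-> sval M = nfim f (sval N).
Proof.
rewrite /hact /= (_ : [set s | _] = nfim f (sval N)) //.
apply: funext => s; apply: propext.
by split=> -[x Nx xs]; exists x => //; move: xs; rewrite /hact graphs_exte.
Qed.

End Image.

Lemma nfim_cmp X Y Y' (g : embs Y Y') (f : embs X Y) N :
  nfim (ecmp g f) N = nfim g (nfim f N).
Proof.
apply: funext => s; apply: propext; set Z := rep_base s None.
have e : exte (ecmp g f) (emb_id Z) = ecmp (exte g (emb_id Z)) (exte f (emb_id Z)).
  by rewrite ecmp_exte emb_1m.
split=> [[x Nx]|[y [x Nx xy] ys]].
  by rewrite e => /(hact_cmp fG)[y xy ys]; exists y => //; exists x.
by exists x => //; rewrite e; apply/(hact_cmp fG); exists y.
Qed.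

Lemma functorial_all : act_id (all_f G) -> functorial (all_f G).
Proof.
move=> aI; split=> // [X Y f|X Y Z g f N M K]; last first.
  by move=> /hact_all NM /hact_all MK; apply/hact_all; rewrite MK NM -nfim_cmp.
have eP (N : rweb (all_f G) X) : NF (partial_f G Y) (nfim f (sval N)) /\
    coherent_nf [set nfim f (sval N)].
  by case: N => N [NN cN]; split; [exact: NF_nfim | exact/(coherent_nfim1 f NN)].
pose e (N : robj (all_f G) X) : robj (all_f G) Y := exist _ _ (eP N).
have eI : injective e.
  move=> [N [NN cN]] [M [MM cM]] /(congr1 sval) /= /nfim_inj NM; apply: sval_inj.
  exact: NM.
have eC (S : robj (all_f G) X -> Prop) : Gamma S <-> Gamma (e @` S).
  have e1 : sval @` (e @` S) = nfim f @` (sval @` S) by rewrite !image_comp.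
  have e2 : coherent_nf (sval @` S) <-> coherent_nf (nfim f @` (sval @` S)).
    by apply: coherent_nf_nfim => _ [[N [NN cN]] _ <-].
  rewrite /Gamma /= /trace_coh e1.
  by split=> -[fS cS]; (split; [exact/(image_inj_fin_ne S eI) | exact/e2]).
exists (Emb eI eC) => N M; split=> [/hact_all MN|<-]; last exact/hact_all.
exact: sval_inj.
Qed.

(** The base of a representative is bound in its class, hence all of it may be used: only the
    elements of the free parameters [X] count in a support of [N]. *)
Lemma supp_all X (E : tot X -> Prop) (N : rweb (all_f G) X) r : sval N r ->
  supp (all_f G) E N <-> supp G (pairE E (fun _ => True)) (rep_point r).
Proof.
move=> Nr; split=> [[W [g [M [/hact_all MN gE]]]]|sr].
  move: Nr; rewrite MN => -[x Mx xr].
  exists (ext W (rep_base r None)), (exte g (emb_id _)), x; split=> // p /rng_exte.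
  by case: p => -[i|] z //= h; apply: gE.
have [W [g [w [wr gE]]]] := sr.
have [|h [x [_ _ xr]]] := hact_lift fG (f := exte (rincl E) (emb_id (rep_base r None))) wr.
  move=> p /gE; case: p => -[i|] z /= h; apply/rng_exte; last by exists z.
  exact: (proj2 (rng_incl E (existT _ i z)) h).
have [N0 xN0] := nf_exists (functorial_partial _) (nrm_fin (normal_partial _))
  (X := rep_base r) x.
(* The point restricted to [E] has a normal form [N0]; its image along the inclusion is a normal
   form of the representative, so it equals [N] by uniqueness. *)
case: N Nr => N [NN cN] /= Nr; have NE : N = nfim (rincl E) N0.
  apply: (nf_unique (normal_partial X) (X := rep_base r) (x := rep_point r)).
    exact: (nf_of_rep (functorial_partial X)).
  exact: nfim_nf xr xN0.
have [NN0 _] := xN0.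
have P0 : NF (partial_f G (restr E)) N0 /\ coherent_nf [set N0].
  by split=> //; apply/(coherent_nfim1 (rincl E) NN0); rewrite -NE.
exists (restr E), (rincl E), (exist _ N0 P0); split; last by move=> p /rng_incl.
exact/hact_all.
Qed.

Lemma supp_all_list X (N : rweb (all_f G) X) (r : rep (partial_f G X)) (s : seq (tot (ext X (rep_base r None)))) :
  sval N r -> supp G (lin s) (rep_point r) ->
  supp (all_f G) (lin (seq.pmap (@tot_some n X (rep_base r None)) s)) N.
Proof.
move=> Nr sr; apply/(supp_all _ Nr); apply: supp_mono sr => p /lin_pairE.
by case: p => -[i|].
Qed.

Lemma trace_rep X (N : rweb (all_f G) X) : exists2 r, sval N r & normal_point (rep_point r).
Proof.
have [[r nr Nr] _] := svalP N; exists r => //; rewrite Nr; exact: (rep_iso_refl (functorial_partial X)).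
Qed.

Lemma normal_all : act_id (all_f G) -> normal (all_f G).
Proof.
move=> aI; split; first exact: functorial_all.
  move=> X N; have [r Nr _] := trace_rep N; have [s sr] := nrm_fin nG (rep_point r).
  by exists (seq.pmap (@tot_some n X (rep_base r None)) s); exact: supp_all_list.
move=> X E E' N; have [r Nr _] := trace_rep N.
move=> /(supp_all _ Nr) sE /(supp_all _ Nr) sE'; apply/(supp_all _ Nr).
by apply: supp_mono (nrm_cap nG sE sE') => p; case: p => -[i|] z [].
Qed.

End Exte.

(** * Weak finiteness *)

Lemma normal_interp n (A : formula n) : normal (interp A).
Proof.
elim: A => {n} [n i|n i|n|n|n|n|n A IHA B IHB|n A IHA B IHB|n A IHA B IHB|n A IHA B IHB
    |n A IHA|n A IHA|n A IHA|n A IHA].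
- exact: normal_proj.
- exact/normal_perp/normal_proj.
- exact: normal_const.
- exact/normal_perp/normal_const.
- exact: normal_const.
- exact/normal_perp/normal_const.
- exact: (normal_tensor (@interp_id _ (Tensor A B))).
- apply: normal_perp; apply: (normal_tensor (@interp_id _ (Par A B)));
  exact: normal_perp.
- exact: (normal_plus (@interp_id _ (Plus A B))).
- apply: normal_perp; apply: (normal_plus (@interp_id _ (With A B)));
  exact: normal_perp.
- exact: (normal_bang (@interp_id _ (Bang A))).
- apply: normal_perp; apply: (normal_bang (@interp_id _ (WhyNot A)));
  exact: normal_perp.
- exact: (normal_all IHA (@interp_id _ (All A))).
- apply: normal_perp; apply: (normal_all (normal_perp IHA)).
  exact: (@interp_id _ (Ex A)).
Qed.

(** Pigeonhole principle: remove one occurrence of [f None]; the remaining values differ from it,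
    hence stay in the list. *)
Lemma inj_size_lin (k : nat) (T : Type) (s : seq T) (f : idx k -> T) :
  injective f -> (forall i, lin s (f i)) -> k <= size s.
Proof.
elim: k s f => // k IH s f fI fs.
have [s1 [s2 se]] := List.in_split _ _ (fs None).
have : k <= size (s1 ++ s2).
  apply: (IH _ (fun i => f (Some i))); first by move=> i j /fI [].
  move=> i; have := fs (Some i); rewrite se => /lin_cat[|[/fI//|]] h; apply/lin_cat;
  by [left|right].
by rewrite se !size_cat /= addnS.
Qed.

Lemma finite_hcoh_on (T : Type) : finite_set [set: T] -> finite_set [set: hcoh_on T].
Proof.
move=> fT; have f1 := finite_powerset fT; have f2 := finite_powerset f1.
apply: (finite_inj_on f2 (f := @coh T)) => // H K _ _ HK.
by apply: hcoh_on_eq => S; rewrite HK.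
Qed.

Lemma finite_idx k : finite_set [set: idx k].
Proof.
elim: k => [|k IH]; first by rewrite (_ : [set: _] = set0) //; apply/seteqP; split=> -[].
rewrite (_ : [set: idx k.+1] = [set None] `|` (Some @` [set: idx k])).
  by rewrite finite_setU; split; [exact: finite_set1 | exact: finite_image].
by apply/seteqP; split=> // -[i|] _; [right; exists i | left].
Qed.

Lemma finite_finhc B : finite_set [set Z : finhc | projT1 Z <= B].
Proof.
elim: B => [|B IH].
  apply: (@sub_finite_set _ _ ((fun H => existT _ 0 H : finhc) @` setT)).
    by move=> [[|k] H] //= _; exists H.
  exact/finite_image/finite_hcoh_on/finite_idx.
apply: (@sub_finite_set _ _ ([set Z : finhc | projT1 Z <= B] `|`
    ((fun H => existT _ B.+1 H : finhc) @` setT))).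
  move=> [k H] /=; rewrite leq_eqVlt => /orP[/eqP e|?]; last by left.
  by right; case: _ / (esym e) H => H; exists H.
by rewrite finite_setU; split=> //; exact/finite_image/finite_hcoh_on/finite_idx.
Qed.

Lemma finite_idx_fun (n : nat) (T : Type) (A : T -> Prop) : finite_set A ->
  finite_set [set g : idx n -> T | forall i, A (g i)].
Proof.
move=> fA; elim: n => [|n IH].
  apply: (finite_inj_on (finite_set1 tt) (f := fun _ => tt)) => // g h _ _ _.
  by apply: funext => -[].
apply: (finite_inj_on (finite_setX IH fA)
  (f := fun g : idx n.+1 -> T => ((fun i => g (Some i)), g None))).
  by move=> g Ag; split => /= [i|]; exact: Ag.
move=> g h _ _ [gh1 gh2]; apply: funext => -[i|] //.
exact: (congr1 (fun k => k i) gh1).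
Qed.

Lemma finite_sigma (I : Type) (T : I -> Type) (A : I -> Prop) : finite_set A ->
  (forall i, A i -> finite_set [set: T i]) -> finite_set [set p : {i & T i} | A (projT1 p)].
Proof.
move=> /finite_linP[s As] fT.
have {}fT i : lin s i -> finite_set [set: T i] by move=> /As/fT.
suff : finite_set [set p : {i & T i} | lin s (projT1 p)].
  by apply: sub_finite_set => p /As.
elim: s {A As} fT => [|a s IH] fT; first by apply: sub_finite_set (finite_set0 _) => p [].
apply: (@sub_finite_set _ _ ((existT _ a @` [set: T a]) `|` [set p | lin s (projT1 p)])).
  by move=> [i x] /= [e|h]; [left; case: _ / e x => x; exists x | right].
rewrite finite_setU; split; first by apply/finite_image/fT; left.
by apply: IH => i si; apply: fT; right.
Qed.

(** Finiteness on finite arguments accompanies the bound on supports because the two meet at the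
    quantifier: the web of the trace is finite when the partial functor is weakly finite, which
    takes both. The exponential of a variable keeps the second clause and loses the first, its
    points being cliques of any finite size. *)
Definition bounded n (F : rawfun n) := 
  (exists B, forall X (x : rweb F X), exists2 s, size s <= B & supp F (lin s) x) /\
  forall X : hcohs n, (forall i, finite_set [set: X i]) -> finite_set [set: rweb F X].

(** A support of a normal point exhausts its base, so that [B] bounds the size of every component of
    the base. There are finitely many hypercoherences of such sizes, and finitely many points over
    each tuple of them. *)
Lemma bounded_weakly_finite n (F : rawfun n) : functorial F -> bounded F -> weakly_finite F.
Proof.
move=> fF [[B sB] fw].
apply: (@sub_finite_set _ _ (@rep_iso n F @` [set r | forall i, projT1 (projT1 r i) <= B])).
  move=> _ [r nr ->]; exists r => // i.
  have [s sl [W [g [w [wr gs]]]]] := sB _ (rep_point r).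
  have gb : bij g by apply: nr; exists w.
  apply: leq_trans sl; pose f (x : rep_base r i) : tot (rep_base r) := existT _ i x.
  apply: (@inj_size_lin _ _ s f); first by move=> x y; exact: existT_inj.
  by move=> x; apply: gs; exact: (proj2 (rng_bij g) gb).
apply: finite_image.
apply: (@finite_sigma _ _ (fun Z : idx n -> finhc => forall i, projT1 (Z i) <= B)).
  exact: finite_idx_fun (finite_finhc B).
by move=> Z _; apply: fw => i; exact: finite_idx.
Qed.

Section Bounded.
Variable n : nat.
Implicit Types F G : rawfun n.

Lemma bounded_proj i : bounded (@proj_f n i).
Proof.
split=> [|X fX]; last exact: fX.
exists 1 => X x; pose s : seq (tot X) := [:: existT _ i x]; exists s => //.
apply/(supp_restr (nrm_fn (normal_proj i))).
have sx : lin s (existT _ i x) by left.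
by exists (exist (fun y => lin s (existT _ i y)) x sx).
Qed.

Lemma bounded_const (T : Type) (H : hcoh_on T) : finite_set [set: T] -> bounded (@const_f n T H).
Proof.
move=> fT; split=> // ; exists 0 => X x; exists [::] => //.
by apply/(supp_restr (nrm_fn (normal_const _ H))); exists x.
Qed.

Lemma bounded_perp F : bounded F -> bounded (perp_f F).
Proof. by []. Qed.

Lemma bounded_tensor F G : functorial F -> functorial G ->
  bounded F -> bounded G -> bounded (tensor_f F G).
Proof.
move=> fF fG [[B sB] fwF] [[C sC] fwG]; split=> [|X fX]; last first.
  rewrite (_ : [set: _] = [set: rweb F X] `*` [set: rweb G X]); last first.
    by apply/seteqP; split.
  by apply: finite_setX; [exact: fwF | exact: fwG].
exists (B + C) => X [a b]; have [s sB' sa] := sB X a; have [t tC tb] := sC X b.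
exists (s ++ t); first by rewrite size_cat leq_add.
apply/(supp_tensor fF fG); split; [apply: supp_mono sa | apply: supp_mono tb] => p sp;
  apply/lin_cat; by [left|right].
Qed.

Lemma bounded_plus F G : bounded F -> bounded G -> bounded (plus_f F G).
Proof.
move=> [[B sB] fwF] [[C sC] fwG]; split=> [|X fX]; last first.
  apply: (@sub_finite_set _ _ ((inl @` [set: rweb F X]) `|` (inr @` [set: rweb G X]))).
    by move=> [a|b] _; [left; exists a | right; exists b].
  by rewrite finite_setU; split; apply: finite_image; [exact: fwF | exact: fwG].
exists (B + C) => X [a|a]; [have [s sl sa] := sB X a | have [s sl sa] := sC X a];
  exists s; by [apply: leq_trans sl _; rewrite ?leq_addr ?leq_addl | apply/supp_plus].
Qed.

Lemma bounded_partial (G : rawfun n.+1) (X : hcohs n) : normal G ->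
  (forall i, finite_set [set: X i]) -> bounded G -> bounded (partial_f G X).
Proof.
move=> nG fX [[B sB] fw]; split=> [|U fU]; last first.
  by apply: fw => -[i|]; [exact: fX | exact: fU].
exists B => U x; have [s sl sx] := sB _ x.
exists [seq (existT _ None u : tot U) | u <- seq.pmap (@tot_none n X (U None)) s].
  by rewrite size_map (leq_trans (size_pmap_le _ _)).
apply/(supp_partial nG); apply: supp_mono sx => p /lin_pairE.
by case: p => -[i|] z //= h; apply/lin_map; exists z.
Qed.

(** For finite [X] the web of the trace injects into the normal forms of the partial functor, which
    is itself bounded; supports of the trace are obtained from those of representatives by dropping
    the bound part. *)
Lemma bounded_all (G : rawfun n.+1) : normal G -> bounded G -> bounded (all_f G).
Proof.
move=> nG bG; split=> [|X fX]; last first.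
  have wf := bounded_weakly_finite (functorial_partial nG X) (bounded_partial nG fX bG).
  apply: (finite_inj_on wf (f := sval)); first by move=> [N []].
  by move=> N M _ _; exact: sval_inj.
have [[B sB] _] := bG; exists B => X N; have [r Nr _] := trace_rep nG N.
have [s sl sr] := sB _ (rep_point r).
exists (seq.pmap (@tot_some n X (rep_base r None)) s); last exact: supp_all_list.
exact: leq_trans (size_pmap_le _ _) sl.
Qed.

End Bounded.

Lemma bounded_interp n (A : formula n) : mall A -> bounded (interp A).
Proof.
have f1 : finite_set [set: unit].
  by apply: sub_finite_set (finite_set1 tt) => -[].
have f0 : finite_set [set: void].
  by apply: sub_finite_set (finite_set0 _) => -[].
elim: A => {n} // [n i|n i|n|n|n|n|n A IHA B IHB|n A IHA B IHB|n A IHA B IHB|n A IHA B IHB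
    |n A IHA|n A IHA] /=.
- by move=> _; exact: bounded_proj.
- by move=> _; exact: (bounded_perp (bounded_proj i)).
- by move=> _; exact: bounded_const.
- by move=> _; exact: (bounded_perp (bounded_const n hone f1)).
- by move=> _; exact: bounded_const.
- by move=> _; exact: (bounded_perp (bounded_const n hzero f0)).
- move=> /andP[/IHA bA /IHB bB].
  exact: (bounded_tensor (nrm_fn (normal_interp A)) (nrm_fn (normal_interp B)) bA bB).
- move=> /andP[/IHA bA /IHB bB]; apply/bounded_perp.
  exact: (bounded_tensor (nrm_fn (normal_perp (normal_interp A)))
    (nrm_fn (normal_perp (normal_interp B))) (bounded_perp bA) (bounded_perp bB)).
- by move=> /andP[/IHA bA /IHB bB]; exact: bounded_plus.
- move=> /andP[/IHA bA /IHB bB]; apply/bounded_perp.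
  exact: (bounded_plus (bounded_perp bA) (bounded_perp bB)).
- by move=> /IHA bA; exact: (bounded_all (normal_interp A)).
- move=> /IHA bA; apply/bounded_perp.
  exact: (bounded_all (normal_perp (normal_interp A)) (bounded_perp bA)).
Qed.

Lemma weakly_finite_interp n (A : formula n) : mall A -> weakly_finite (interp A).
Proof.
by move=> /bounded_interp; apply: bounded_weakly_finite; exact: nrm_fn (normal_interp A).
Qed.

(** * Formulas and derivations *)

Local Notation pmap := Defs.pmap.
Local Notation point := Defs.point.

Lemma dualK n (A : formula n) : dual (dual A) = A.
Proof. by elim: A => {n} //= n; do ?[move=> A -> B -> | move=> A ->]. Qed.

Lemma dual_rename n (A : formula n) m (r : idx n -> idx m) :
  dual (rename A r) = rename (dual A) r.
Proof.
by elim: A m r => {n} //= n; do ?[move=> A IHA B IHB m r; rewrite IHA IHB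
  | move=> A IHA m r; rewrite IHA].
Qed.

Lemma rename_rename n (A : formula n) m k (r : idx n -> idx m) (q : idx m -> idx k) :
  rename (rename A r) q = rename A (q \o r).
Proof.
have upE i j l (u : idx i -> idx j) (v : idx j -> idx l) :
    (omap v : idx j.+1 -> idx l.+1) \o (omap u : idx i.+1 -> idx j.+1) = omap (v \o u).
  by apply: funext => -[].
by elim: A m k r q => {n} //= n; do ?[move=> A IHA B IHB m k r q; rewrite IHA IHB
  | move=> A IHA m k r q; rewrite IHA ?upE].
Qed.

Lemma subst_rename n (A : formula n) m k (r : idx n -> idx m) (s : idx m -> formula k) :
  subst (rename A r) s = subst A (s \o r).
Proof.
have upE i j l (u : idx i -> idx j) (v : idx j -> formula l) :
    up v \o (omap u : idx i.+1 -> idx j.+1) = up (v \o u).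
  by apply: funext => -[].
by elim: A m k r s => {n} //= n; do ?[move=> A IHA B IHB m k r s; rewrite IHA IHB
  | move=> A IHA m k r s; rewrite IHA ?upE].
Qed.

Lemma rename_subst n (A : formula n) m k (s : idx n -> formula m) (r : idx m -> idx k) :
  rename (subst A s) r = subst A (fun i => rename (s i) r).
Proof.
have upE i l j (t : idx i -> formula l) (q : idx l -> idx j) :
    (fun o => rename (up t o) (omap q : idx l.+1 -> idx j.+1)) = up (fun i => rename (t i) q).
  by apply: funext => -[a|] //=; rewrite /wk !rename_rename.
elim: A m k s r => {n} //= n.
- by move=> i m k s r; rewrite dual_rename.
- by move=> A IHA B IHB m k s r; rewrite IHA IHB.
- by move=> A IHA B IHB m k s r; rewrite IHA IHB.
- by move=> A IHA B IHB m k s r; rewrite IHA IHB.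
- by move=> A IHA B IHB m k s r; rewrite IHA IHB.
- by move=> A IHA m k s r; rewrite IHA.
- by move=> A IHA m k s r; rewrite IHA.
- by move=> A IHA m k s r; rewrite IHA upE.
- by move=> A IHA m k s r; rewrite IHA upE.
Qed.

Lemma dual_subst n (A : formula n) m (s : idx n -> formula m) :
  dual (subst A s) = subst (dual A) s.
Proof.
by elim: A m s => {n} //= n; do ?[move=> A IHA B IHB m s; rewrite IHA IHB
  | move=> A IHA m s; rewrite IHA | move=> i m s; rewrite dualK].
Qed.

Lemma subst_wk_up n (A : formula n) m (s : idx n -> formula m) :
  subst (wk A) (up s) = wk (subst A s).
Proof. by rewrite /wk subst_rename rename_subst. Qed.

Lemma subst_subst n (A : formula n) m k (s : idx n -> formula m) (t : idx m -> formula k) :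
  subst (subst A s) t = subst A (fun i => subst (s i) t).
Proof.
have upE i l j (u : idx i -> formula l) (v : idx l -> formula j) :
    (fun o => subst (up u o) (up v)) = up (fun i => subst (u i) v).
  by apply: funext => -[a|] //=; rewrite subst_wk_up.
elim: A m k s t => {n} //= n.
- by move=> i m k s t; rewrite dual_subst.
- by move=> A IHA B IHB m k s t; rewrite IHA IHB.
- by move=> A IHA B IHB m k s t; rewrite IHA IHB.
- by move=> A IHA B IHB m k s t; rewrite IHA IHB.
- by move=> A IHA B IHB m k s t; rewrite IHA IHB.
- by move=> A IHA m k s t; rewrite IHA.
- by move=> A IHA m k s t; rewrite IHA.
- by move=> A IHA m k s t; rewrite IHA upE.
- by move=> A IHA m k s t; rewrite IHA upE.
Qed.

Lemma rename_var n (A : formula n) m (r : idx n -> idx m) :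
  rename A r = subst A (fun i => Var (r i)).
Proof.
have upE i l (q : idx i -> idx l) :
    (fun o => @Var l.+1 (omap q o)) = up (fun i => Var (q i)).
  by apply: funext => -[].
by elim: A m r => {n} //= n; do ?[move=> A IHA B IHB m r; rewrite IHA IHB
  | move=> A IHA m r; rewrite IHA ?upE].
Qed.

Lemma subst_var n (A : formula n) : subst A (@Var n) = A.
Proof.
have upE l : up (@Var l) = @Var l.+1 by apply: funext => -[].
by elim: A => {n} //= n; do ?[move=> A IHA B IHB; rewrite IHA IHB
  | move=> A IHA; rewrite ?upE IHA].
Qed.

(** Instantiating the new variable undoes weakening; [One] is an arbitrary choice. *)
Lemma wk_inj n : injective (@wk n).
Proof.
move=> A B e; have h (D : formula n) : subst (wk D) (inst1 One) = D.
  by rewrite /wk subst_rename subst_var.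
by rewrite -(h A) e h.
Qed.

Lemma subst_inst n (A : formula n.+1) (B : formula n) m (s : idx n -> formula m) :
  subst (inst A B) s = inst (subst A (up s)) (subst B s).
Proof.
rewrite /inst !subst_subst; congr (subst A _); apply: funext => -[i|] //=.
by rewrite /wk subst_rename subst_var.
Qed.

(* [derives] by recursion on the proof, so that inversion is mere computation. *)
Fixpoint der n (P : term n) : context n -> Prop :=
  match P in term n return context n -> Prop with
  | Link _ x y A => fun E => x <> y /\ E = pset (pset pempty y (dual A)) x A
  | Cut _ x A P Q => fun E => exists C D,
      [/\ C x = None, D x = None, pdisjoint C D & E = pjoin C D] /\
      der P (pset C x A) /\ der Q (pset D x (dual A))
  | TOne _ x => fun E => E = pset pempty x One
  | TBot _ x P => fun E => exists C, [/\ C x = None, E = pset C x Bot & der P C]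
  | TTensor _ x A B P Q => fun E => exists C D,
      [/\ C x = None, D x = None, pdisjoint C D & E = pset (pjoin C D) x (Tensor A B)] /\
      der P (pset C x A) /\ der Q (pset D x B)
  | TPar _ x y A B P => fun E => exists C,
      [/\ C x = None, C y = None, x <> y & E = pset C x (Par A B)] /\
      der P (pset (pset C y B) x A)
  | TPlus1 _ x A B P => fun E => exists C,
      [/\ C x = None, E = pset C x (Plus A B) & der P (pset C x A)]
  | TPlus2 _ x A B P => fun E => exists C,
      [/\ C x = None, E = pset C x (Plus A B) & der P (pset C x B)]
  | TWith _ x A B P Q => fun E => exists C,
      [/\ C x = None, E = pset C x (With A B), der P (pset C x A) & der Q (pset C x B)]
  | TTop _ x L => fun E =>
      [/\ plist L x = None, uniq (map fst L) & E = pset (plist L) x Top]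
  | TBang _ x A L P => fun E =>
      [/\ whynots L x = None, uniq (map fst L), E = pset (whynots L) x (Bang A)
        & der P (pset (whynots L) x A)]
  | TDer _ x A P => fun E => exists C,
      [/\ C x = None, E = pset C x (WhyNot A) & der P (pset C x A)]
  | TWeak _ x A P => fun E => exists C,
      [/\ C x = None, E = pset C x (WhyNot A) & der P C]
  | TContr _ x y A P => fun E => exists C,
      [/\ C x = None, C y = None, x <> y & E = pset C x (WhyNot A)] /\
      der P (pset (pset C y (WhyNot A)) x (WhyNot A))
  | TAll _ x A P => fun E => exists C,
      [/\ C x = None, E = pset C x (All A) & der P (pset (ctx_wk C) x A)]
  | TEx _ x A B P => fun E => exists C,
      [/\ C x = None, E = pset C x (Ex A) & der P (pset C x (inst A B))]
  end.

Lemma derives_der n (C : context n) P : derives C P -> der P C.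
Proof.
elim=> {n C P} /=.
- by [].
- by move=> n C D x A P Q Cx Dx CD _ dP _ dQ; exists C, D.
- by [].
- by move=> n C x P Cx _ dP; exists C.
- by move=> n C D x A B P Q Cx Dx CD _ dP _ dQ; exists C, D.
- by move=> n C x y A B P Cx Cy xy _ dP; exists C.
- by move=> n C x A B P Cx _ dP; exists C.
- by move=> n C x A B P Cx _ dP; exists C.
- by move=> n C x A B P Q Cx _ dP _ dQ; exists C.
- by [].
- by [].
- by move=> n C x A P Cx _ dP; exists C.
- by move=> n C x A P Cx _ dP; exists C.
- by move=> n C x y A P Cx Cy xy _ dP; exists C.
- by move=> n C x A P Cx _ dP; exists C.
- by move=> n C x A B P Cx _ dP; exists C.
Qed.

Lemma psetE T (f : pmap T) x a : pset f x a x = Some a.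
Proof. by rewrite /pset eqxx. Qed.

Definition etyped n (C : context n) (X : hcohs n) (r : env X) :=
  forall z, omap tag (r z) = C z.

Lemma whynotsE n (L : sequent n) z : whynots L z = omap (@WhyNot n) (plist L z).
Proof.
rewrite /whynots; elim: L => //= -[y B] L IH.
by rewrite /pset /= IH; case: eqP.
Qed.

(** * Points of the interpretation *)

Section Casts.
Variable n : nat.
Implicit Types F G : rawfun n.

(** A cast of points depends on the equality of webs only. Since [perp_f] leaves webs untouched,
    that equality is often [erefl] even though the functors are not convertible, and the cast then
    disappears. *)
Lemma cast_web F G (e : F = G) (w : rweb F = rweb G) (X : hcohs n) (a : rweb F X) :
  cast e a = eq_rect (rweb F) (fun W => W X) a (rweb G) w.
Proof. by case: _ / e w => w; rewrite (Prop_irrelevance w erefl). Qed.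

Lemma cast_id F (e : F = F) (X : hcohs n) (a : rweb F X) : cast e a = a.
Proof. by rewrite (Prop_irrelevance e erefl). Qed.

Lemma cast_inj F G (e : F = G) (X : hcohs n) : injective (@cast n F G e X).
Proof. by case: _ / e. Qed.

Lemma cast_surj F G (e : F = G) (X : hcohs n) b : exists a, cast e (X := X) a = b.
Proof. by case: _ / e b => b; exists b. Qed.

Lemma ract_cast F G (e : F = G) (X Y : hcohs n) (R : rels X Y) x y :
  ract R (cast e x) (cast e y) <-> ract R x y.
Proof. by case: _ / e. Qed.

Lemma strict_coh_cast F G (e : F = G) (X : hcohs n) (S : rweb F X -> Prop) :
  strict_coh (rstr G X) (cast e (X := X) @` S) <-> strict_coh (rstr F X) S.
Proof. by case: _ / e => /=; rewrite image_id. Qed.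

Lemma cast_pair F G F' G' (e : perp_f (tensor_f F G) = par_f F' G')
    (eF : perp_f F = F') (eG : perp_f G = G') (X : hcohs n) a b :
  cast e (X := X) (a, b) = (cast eF a, cast eG b).
Proof. by case: _ / eF e => e; case: _ / eG e => e; rewrite (cast_web e erefl). Qed.

Lemma cast_inl F G F' G' (e : perp_f (plus_f F G) = with_f F' G')
    (eF : perp_f F = F') (eG : perp_f G = G') (X : hcohs n) a :
  cast e (X := X) (inl a) = inl (cast eF a).
Proof. by case: _ / eF e => e; case: _ / eG e => e; rewrite (cast_web e erefl). Qed.

Lemma cast_inr F G F' G' (e : perp_f (plus_f F G) = with_f F' G')
    (eF : perp_f F = F') (eG : perp_f G = G') (X : hcohs n) b :
  cast e (X := X) (inr b) = inr (cast eG b).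
Proof. by case: _ / eF e => e; case: _ / eG e => e; rewrite (cast_web e erefl). Qed.

Lemma cast_bang F F' (e : perp_f (bang_f F) = perp_f (bang_f F')) (k : F = F')
    (X : hcohs n) (c : rweb (bang_f F) X) a :
  sval (cast e (X := X) c : rweb (bang_f F') X) (cast k a) <-> sval c a.
Proof. by case: _ / k e => e; rewrite (cast_web e erefl). Qed.

End Casts.

Section Points.
Variable n : nat.

(* Points of different formulas are compared through heterogeneous equality,
   which makes the casts of [dual_pt], [wk_pt] and [inst_pt] invisible. *)
Definition jv (m : nat) (X : hcohs m) (p : point X) : {T : Type & T} :=
  existT id (rweb (interp (tag p)) X) (tagged p).

Lemma jv_cast (F G : rawfun n) (e : F = G) (X : hcohs n) (a : rweb F X) :
  existT id (rweb G X) (cast e a) = existT id (rweb F X) a.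
Proof. by case: _ / e. Qed.

Lemma point_ext (X : hcohs n) (p q : point X) : tag p = tag q -> jv p = jv q -> p = q.
Proof.
case: p q => [A a] [B b] /= AB; case: _ / AB b => b.
by move=> e; rewrite (existT_inj e : a = b).
Qed.

Lemma Pt_inj (X : hcohs n) A : injective (@Pt n X A).
Proof. by move=> a b; exact: existT_inj. Qed.

Lemma Pt_tag (X : hcohs n) (p : point X) A : tag p = A -> exists a, p = Pt (A := A) a.
Proof. by case: p => B b /= <-; exists b. Qed.

Lemma jv_dual (X : hcohs n) A (a : rweb (interp A) X) : jv (Pt (dual_pt a)) = jv (Pt a).
Proof. exact: (@jv_cast (perp_f (interp A))). Qed.

Lemma dual_ptK (X : hcohs n) A (a : rweb (interp A) X) : Pt (dual_pt (dual_pt a)) = Pt a.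
Proof. by apply: point_ext; [exact: dualK | rewrite !jv_dual]. Qed.

Lemma dual_pt_inj (X : hcohs n) A : injective (@dual_pt n X A).
Proof. exact (@cast_inj n (perp_f (interp A)) _ (esym (interp_dual A)) X). Qed.

Lemma dual_pt_surj (X : hcohs n) A b : exists a, @dual_pt n X A a = b.
Proof. exact (@cast_surj n (perp_f (interp A)) _ (esym (interp_dual A)) X b). Qed.

Lemma strict_dual (X : hcohs n) A (S : rweb (interp A) X -> Prop) :
  strict_coh (rstr (interp (dual A)) X) (@dual_pt n X A @` S) <->
  strict_coh (hperp (rstr (interp A) X)) S.
Proof. exact (@strict_coh_cast n (perp_f (interp A)) _ (esym (interp_dual A)) X S). Qed.

Lemma dual_tensor (X : hcohs n) A B (a : rweb (interp A) X) (b : rweb (interp B) X) :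
  @dual_pt n X (Tensor A B) (a, b) = (dual_pt a, dual_pt b).
Proof. exact: (@cast_pair n (interp A) (interp B)). Qed.

Lemma dual_plus1 (X : hcohs n) A B (a : rweb (interp A) X) :
  @dual_pt n X (Plus A B) (inl a) = inl (dual_pt a).
Proof. exact: (@cast_inl n (interp A) (interp B) _ _ _ _ (esym (interp_dual B))). Qed.

Lemma dual_plus2 (X : hcohs n) A B (b : rweb (interp B) X) :
  @dual_pt n X (Plus A B) (inr b) = inr (dual_pt b).
Proof. exact: (@cast_inr n (interp A) (interp B) _ _ _ (esym (interp_dual A))). Qed.

Lemma interp_perp_dual (A : formula n) : interp A = perp_f (interp (dual A)).
Proof. by rewrite interp_dual perp_fK. Qed.

(** [dual_pt] casts from [perp_f (interp A)]; here the same map is a cast from [interp A] itself,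
    the form under which it passes through the exponential in [cast_bang]. *)
Lemma dual_pt_cast (X : hcohs n) A (a : rweb (interp A) X) :
  dual_pt a = cast (interp_perp_dual A) a.
Proof.
pose w : rweb (interp A) = rweb (interp (dual A)) := congr1 (@rweb n) (interp_perp_dual A).
exact (etrans (cast_web (F := perp_f (interp A)) (esym (interp_dual A)) w a)
  (esym (cast_web (interp_perp_dual A) w a))).
Qed.

Lemma dual_bang (X : hcohs n) A (c : rweb (interp (Bang A)) X) a :
  sval (@dual_pt n X (Bang A) c : rweb (interp (WhyNot (dual A))) X) (dual_pt a) <-> sval c a.
Proof. by rewrite (dual_pt_cast a); exact (@cast_bang n (interp A) (perp_f (interp (dual A)))
  (esym (interp_dual (Bang A))) (interp_perp_dual A) X c a). Qed.

End Points.

(** * The action of embeddings on points of formulas *)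

Section Actions.
Variable n : nat.
Implicit Types X Y : hcohs n.

Lemma fn_interp (A : formula n) : functorial (interp A).
Proof. exact: nrm_fn (normal_interp A). Qed.

Definition act (A : formula n) X Y (f : embs X Y) :
    emb (robj (interp A) X) (robj (interp A) Y) :=
  projT1 (cid (fn_emb (fn_interp A) f)).

Lemma actE (A : formula n) X Y (f : embs X Y) x y :
  hact (interp A) f x y <-> act A f x = y.
Proof. by rewrite /act; case: cid. Qed.

Lemma hact_act (A : formula n) X Y (f : embs X Y) x : hact (interp A) f x (act A f x).
Proof. exact/actE. Qed.

Lemma act_id_emb (A : formula n) X x : act A (eid X) x = x.
Proof. by apply/actE/(hact_id (fn_interp A)). Qed.

Lemma act_cmp (A : formula n) X Y Z (g : embs Y Z) (f : embs X Y) x :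
  act A (ecmp g f) x = act A g (act A f x).
Proof.
by apply/actE/(hact_cmp (fn_interp A)); exists (act A f x); exact: hact_act.
Qed.

Lemma act_inj (A : formula n) X Y (f : embs X Y) : injective (act A f).
Proof. exact: emb_inj. Qed.

Lemma act_dual (A : formula n) X Y (f : embs X Y) a :
  act (dual A) f (dual_pt a) = dual_pt (act A f a).
Proof.
apply/actE; rewrite /hact /dual_pt; apply/ract_cast.
exact: (hact_act (A := A)).
Qed.

Lemma act_one X Y (f : embs X Y) : act One f tt = tt.
Proof. by case: (act _ _ _). Qed.

Lemma act_bot X Y (f : embs X Y) : act Bot f tt = tt.
Proof. by case: (act _ _ _). Qed.

Lemma act_tensor A B X Y (f : embs X Y) a b :
  act (Tensor A B) f (a, b) = (act A f a, act B f b).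
Proof. by apply/actE; split; exact: hact_act. Qed.

Lemma act_par A B X Y (f : embs X Y) a b :
  act (Par A B) f (a, b) = (act A f a, act B f b).
Proof. by apply/actE; split; exact: hact_act. Qed.

Lemma act_plus1 A B X Y (f : embs X Y) a : act (Plus A B) f (inl a) = inl (act A f a).
Proof. by apply/actE; exact: hact_act. Qed.

Lemma act_plus2 A B X Y (f : embs X Y) a : act (Plus A B) f (inr a) = inr (act B f a).
Proof. by apply/actE; exact: hact_act. Qed.

Lemma act_with1 A B X Y (f : embs X Y) a : act (With A B) f (inl a) = inl (act A f a).
Proof. by apply/actE; exact: hact_act. Qed.

Lemma act_with2 A B X Y (f : embs X Y) a : act (With A B) f (inr a) = inr (act B f a).
Proof. by apply/actE; exact: hact_act. Qed.

Lemma hact_bangE A X Y (f : embs X Y) (c : rweb (interp (Bang A)) X)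
    (d : rweb (interp (Bang A)) Y) :
  hact (interp (Bang A)) f c d <-> sval d = act A f @` sval c.
Proof.
rewrite /hact /= (_ : [set y | _] = act A f @` sval c) //.
by apply/seteqP; split=> y [x cx /actE xy]; exists x => //; exact/actE.
Qed.

Lemma act_bang A X Y (f : embs X Y) c : sval (act (Bang A) f c) = act A f @` sval c.
Proof. exact/hact_bangE/hact_act. Qed.

Lemma hact_whynotE A X Y (f : embs X Y) (c : rweb (interp (WhyNot A)) X)
    (d : rweb (interp (WhyNot A)) Y) :
  hact (interp (WhyNot A)) f c d <-> sval d = act A f @` sval c.
Proof.
rewrite /hact /= (_ : [set y | _] = act A f @` sval c) //.
by apply/seteqP; split=> y [x cx /actE xy]; exists x => //; exact/actE.
Qed.

Lemma act_whynot A X Y (f : embs X Y) c : sval (act (WhyNot A) f c) = act A f @` sval c.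
Proof. exact/hact_whynotE/hact_act. Qed.

Lemma act_all A X Y (f : embs X Y) c : sval (act (All A) f c) = nfim (G := interp A) f (sval c).
Proof. by have /hact_all := hact_act (A := All A) f c. Qed.

Lemma act_ex A X Y (f : embs X Y) c :
  sval (act (Ex A) f c) = nfim (G := perp_f (interp A)) f (sval c).
Proof.
exact (proj1 (@hact_all n (perp_f (interp A)) X Y f c (act (Ex A) f c))
  (hact_act (A := Ex A) f c)).
Qed.

Lemma act_inst (A : formula n.+1) B X Y (f : embs X Y) (a : rweb (interp (inst A B)) X) :
  hact (interp A) (exte f (act B f)) (inst_pt a) (inst_pt (act (inst A B) f a)).
Proof.
have := hact_act (A := inst A B) f a; rewrite /hact -(ract_cast (interp_inst A B)) /=.
rewrite -/(inst_pt a) -/(inst_pt (act (inst A B) f a)) graphs_exte.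
suff -> : ract (r := interp B) (graphs f) = (fun a b => act B f a = b) by [].
by apply: funext => x; apply: funext => y; apply: propext; exact: actE.
Qed.

End Actions.

(* Two copies of [K] glued along [H]; a coherent set lies within one copy. *)
Lemma hcoh_amalgam (H K : hcoh) (f : emb H K) : exists L (i j : emb K L),
  (forall x, i (f x) = j (f x)) /\
  forall y y', i y = j y' -> y = y' /\ exists x, f x = y.
Proof.
(* The second copy, tagged [true], keeps only the elements outside the range of [f]; on the range
   [j0] falls back to the first copy, which is the gluing. *)
pose W := {p : K * bool | p.2 = false \/ ~ exists x, f x = p.1}.
pose i0 y : W := exist _ (y, false) (or_introl erefl).
have /choice[j0 jE] : forall y, exists w : W,
    sval w = (y, ~~ `[< exists x, f x = y >]).
  move=> y; case: (pselect (exists x, f x = y)) => h.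
    by exists (i0 y) => /=; rewrite asboolT.
  by exists (exist _ (y, true) (or_intror h)); rewrite /= asboolF.
have ij y y' : i0 y = j0 y' -> y = y' /\ exists x, f x = y.
  move=> /(congr1 sval); rewrite jE /= => -[<- h]; split=> //.
  by apply: contrapT => nh; move: h; rewrite asboolF.
have ijf x : i0 (f x) = j0 (f x).
  by apply: sval_inj; rewrite jE /= asboolT //; exists x.
have i0I : injective i0 by move=> y y' /(congr1 sval) [].
have j0I : injective j0 by move=> y y' /(congr1 sval); rewrite !jE => -[].
pose G (S : W -> Prop) := exists2 S' : K -> Prop, Gamma S' & S = i0 @` S' \/ S = j0 @` S'.
have Gfin S : G S -> fin_ne S by case=> S' /coh_fin_ne fS [->|->]; exact: image_fin_ne.
have G1 w : G [set w].
  case: w => -[y b] h; exists [set y]; first exact: coh_set1.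
  rewrite !image_set1; case: b h => h; [right|left]; congr [set _]; apply: sval_inj => //.
  by rewrite jE asboolF //=; case: h.
pose L := Hcoh (HcohOn Gfin G1).
have ijS (S S' : K -> Prop) : i0 @` S = j0 @` S' -> S = S'.
  move=> e; apply/seteqP; split=> y Sy.
    by have [y' S'y' /esym/ij[-> _]] : (j0 @` S') (i0 y) by rewrite -e; exists y.
  by have [y' S'y' /ij[<- _]] : (i0 @` S) (j0 y) by rewrite e; exists y.
have iC (S : K -> Prop) : Gamma S <-> Gamma (X := L) (i0 @` S).
  split=> [GS|[S' GS' [/(image_inj_eq i0I) ->|/ijS ->]] //].
  by exists S => //; left.
have jC (S : K -> Prop) : Gamma S <-> Gamma (X := L) (j0 @` S).
  split=> [GS|[S' GS' [/esym/ijS <-|/(image_inj_eq j0I) ->]] //].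
  by exists S => //; right.
by exists L, (@Emb K L i0 i0I iC), (@Emb K L j0 j0I jC).
Qed.

Lemma amalgam n (X Y : hcohs n) (f : embs X Y) : exists Z (i j : embs Y Z),
  ecmp i f = ecmp j f /\ forall p, rng i p -> rng j p -> rng (ecmp i f) p.
Proof.
have /dep_choice[Z /dep_choice[i /dep_choice[j ij]]] := fun m => hcoh_amalgam (f m).
exists Z, i, j; split.
  by apply: functional_extensionality_dep => m; apply: emb_eq; apply: funext; exact: (ij m).1.
move=> [m z] [y /= yz] [y' /= y'z].
have [_ [x xy]] := (ij m).2 y y' (etrans yz (esym y'z)).
by exists x; rewrite /= xy.
Qed.

(** The common image is supported by the ranges of both [i] and [j], hence by their intersection,
    which is the range of [ecmp i f]; injectivity of [i] then brings [a] back to [X]. *)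
Lemma act_amalgam n (A : formula n) (X Y Z : hcohs n) (f : embs X Y) (i j : embs Y Z) a :
  (forall p, rng i p -> rng j p -> rng (ecmp i f) p) ->
  act A i a = act A j a -> exists x, act A f x = a.
Proof.
move=> ijf e; have fA := fn_interp A.
have s1 : supp (interp A) (rng i) (act A i a).
  by apply/(supp_rng fA); exists a; exact: hact_act.
have s2 : supp (interp A) (rng j) (act A i a).
  by apply/(supp_rng fA); exists a; rewrite e; exact: hact_act.
have : supp (interp A) (rng (ecmp i f)) (act A i a).
  by apply: supp_mono (nrm_cap (normal_interp A) s1 s2) => p [h1 h2]; exact: ijf.
move=> /(supp_rng fA)[x /actE]; rewrite act_cmp => /act_inj xa.
by exists x.
Qed.

(** * The action of embeddings on environments *)

Section EnvActions.
Variable n : nat.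
Implicit Types X Y : hcohs n.

Definition pact X Y (f : embs X Y) (p : point X) : point Y :=
  Pt (act (tag p) f (tagged p)).

Definition eact X Y (f : embs X Y) (r : env X) : env Y := fun z => omap (pact f) (r z).

Lemma eact_pset X Y (f : embs X Y) r x A (a : rweb (interp A) X) :
  eact f (pset r x (Pt a)) = pset (eact f r) x (Pt (act A f a)).
Proof. by apply: funext => z; rewrite /eact /pset; case: eqP. Qed.

Lemma eact_pjoin X Y (f : embs X Y) r s : eact f (pjoin r s) = pjoin (eact f r) (eact f s).
Proof. by apply: funext => z; rewrite /eact /pjoin; case: (r z). Qed.

Lemma pact_inj X Y (f : embs X Y) : injective (pact f).
Proof.
move=> [A a] [B b] e; have /= AB : A = B := congr1 tag e.
case: _ / AB b e => b e; congr existT; apply: (@act_inj _ A X Y f).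
exact (Pt_inj e).
Qed.

Lemma eact_inj X Y (f : embs X Y) : injective (eact f).
Proof.
move=> r s e; apply: funext => z; have := congr1 (fun h : pmap _ => h z) e.
by rewrite /eact; case: (r z) (s z) => [p|] [q|] //= /Some_inj /pact_inj ->.
Qed.

Lemma eact_None X Y (f : embs X Y) r z : (eact f r z = None) <-> (r z = None).
Proof. by rewrite /eact; case: (r z). Qed.

Lemma eact_cmp X Y Z (g : embs Y Z) (f : embs X Y) r : eact (ecmp g f) r = eact g (eact f r).
Proof.
by apply: funext => z; rewrite /eact; case: (r z) => //= p; rewrite /pact /= act_cmp.
Qed.

End EnvActions.

Section WeakenedEnvs.
Variable n : nat.
Implicit Types X Y : hcohs n.

Definition wk_env X (Z : hcoh) (r : env X) : env (ext X Z) :=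
  fun z => omap (wk_pt Z) (r z).

Lemma jv_wk X Z (p : point X) : jv (wk_pt Z p) = jv p.
Proof. exact: (@jv_cast n.+1 (wk_f (interp (tag p)))). Qed.

Lemma wk_pt_inj X Z : injective (@wk_pt n X Z).
Proof.
move=> p q e; apply: point_ext; first exact/wk_inj/(congr1 tag e).
by rewrite -(jv_wk Z p) e jv_wk.
Qed.

Lemma pact_wk X Y Z W (f : embs X Y) (g : emb Z W) p :
  pact (exte f g) (wk_pt Z p) = wk_pt W (pact f p).
Proof.
case: p => A a; rewrite /pact /wk_pt /=; congr Pt; apply/actE.
rewrite /hact (ract_cast (F := wk_f (interp A))).
exact: (hact_act (A := A) f a).
Qed.

Lemma eact_wk X Y Z W (f : embs X Y) (g : emb Z W) r :
  eact (exte f g) (wk_env Z r) = wk_env W (eact f r).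
Proof.
by apply: funext => z; rewrite /eact /wk_env; case: (r z) => //= p; rewrite pact_wk.
Qed.

Definition eproj X (z : nat) (A : formula n) (S : env X -> Prop) : rweb (interp A) X -> Prop :=
  [set a | exists2 r, S r & r z = Some (Pt a)].

Arguments eproj {X} z A S _.

(** Sufficient for coherence in the iterated par of the sequent, whichever order its formulas are
    listed in: the set has at most one element, or one of its projections is strictly coherent. *)
Definition ecoh (C : context n) X (S : env X -> Prop) :=
  (forall r r', S r -> S r' -> r = r') \/
  exists z A, C z = Some A /\ strict_coh (rstr (interp A) X) (eproj z A S).

End WeakenedEnvs.

Arguments eproj {n X} z A S _.

(* Equations between partial maps are decided pointwise: instantiate all
   hypotheses at a name [w], then split on equality of names. *)
Ltac pm_at w := repeat match goal with
 | H : pdisjoint _ _ |- _ => move: {H} (H w)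
 | H : etyped _ _ |- _ => move: {H} (H w)
 | H : @eq ?T ?f ?g |- _ => lazymatch eval hnf in T with
     | nat -> option _ => move: {H} (congr1 (fun h : T => h w) H) end
 end.

Ltac pm_unfold := rewrite /pset /pjoin /pempty /ctx_wk /=.

Ltac pm_split := repeat match goal with
 | |- context [?a == ?b] => case: (a =P b) => [?|?]; [try (exfalso; congruence); try subst|]
 end.

Ltac pm_close := intros; try congruence;
  repeat match goal with
  | |- context [match ?o with Some _ => _ | None => _ end] => destruct o eqn:?
  | |- context [omap _ ?o] => destruct o eqn:?; simpl in *
  | H : context [omap _ ?o] |- _ => destruct o eqn:?; simpl in *
  | H : context [match ?o with Some _ => _ | None => _ end] |- _ => destruct o eqn:?
  | H : _ \/ _ |- _ => destruct H
  end; simpl in *; try congruence.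

Ltac pm w := pm_at w; pm_unfold; pm_split; simpl; pm_close.

Lemma plist_whynots n (L : sequent n) z A : plist L z = Some A -> whynots L z = Some (WhyNot A).
Proof. by rewrite whynotsE => ->. Qed.

Lemma denot_typed n (P : term n) C (X : hcohs n) (r : env X) :
  der P C -> denot P r -> etyped C r.
Proof.
elim: P C X r => {n} /=.
- move=> n x y A E X r [xy ->] [a ->] w; rewrite /pset /pempty.
  by case: eqP => // _; case: eqP.
- move=> n x A P IHP Q IHQ E X r [C [D [[Cx Dx CD ->] [dP dQ]]]].
  move=> [a [s [t [[sx tx st ->] [/(IHP _ _ _ dP) hP /(IHQ _ _ _ dQ) hQ]]]]] w.
  pm w.
- move=> n x E X r -> -> w; by pm w.
- move=> n x P IHP E X r [C [Cx -> dP]] [s [sx -> /(IHP _ _ _ dP) hP]] w.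
  by pm w.
- move=> n x A B P IHP Q IHQ E X r [C [D [[Cx Dx CD ->] [dP dQ]]]].
  move=> [a [b [s [t [[sx tx st ->] [/(IHP _ _ _ dP) hP /(IHQ _ _ _ dQ) hQ]]]]]] w.
  by pm w.
- move=> n x y A B P IHP E X r [C [[Cx Cy xy ->] dP]].
  move=> [a [b [s [sx sy -> /(IHP _ _ _ dP) hP]]]] w.
  by pm w.
- move=> n x A B P IHP E X r [C [Cx -> dP]] [a [s [sx -> /(IHP _ _ _ dP) hP]]] w.
  by pm w.
- move=> n x A B P IHP E X r [C [Cx -> dP]] [a [s [sx -> /(IHP _ _ _ dP) hP]]] w.
  by pm w.
- move=> n x A B P IHP Q IHQ E X r [C [Cx -> dP dQ]].
  move=> [] [a [s [sx -> hP]]] w; [move: hP => /(IHP _ _ _ dP) hP | move: hP => /(IHQ _ _ _ dQ) hP].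
    by pm w.
  by pm w.
- by [].
- move=> n x A L P IHP E X r [Lx _ -> dP] [T [_ _ [c rx _] rz]] z.
  rewrite /pset; case: eqP => [->|zx]; first by rewrite rx.
  by move: (rz z zx); rewrite whynotsE; case: plist => [B [d -> _]|->].
- move=> n x A P IHP E X r [C [Cx -> dP]] [a [c [s [sx -> _ /(IHP _ _ _ dP) hP]]]] w.
  by pm w.
- move=> n x A P IHP E X r [C [Cx -> dP]] [c [s [sx -> _ /(IHP _ _ _ dP) hP]]] w.
  by pm w.
- move=> n x y A P IHP E X r [C [[Cx Cy xy ->] dP]].
  move=> [c [d [e [s [[sx sy -> _] /(IHP _ _ _ dP) hP]]]]] w.
  by pm w.
- move=> n x A P IHP E X r [C [Cx -> dP]].
  move=> [c [s [u [sx -> _ /(IHP _ _ _ dP) hP]]]] w.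
  move: (hP w); rewrite /pset /ctx_wk; case: eqP => // _.
  case: (s w) (C w) => [p|] [B|] //= [] /wk_inj -> //.
- move=> n x A B P IHP E X r [C [Cx -> dP]].
  move=> [a [c [s [sx -> _ /(IHP _ _ _ dP) hP]]]] w.
  by pm w.
Qed.

(** * Cliques *)

Section StrictCoherence.
Variables (T U : Type) (H : hcoh_on T) (K : hcoh_on U).

Lemma strict_fin_ne S : strict_coh H S -> fin_ne S.
Proof. by case=> /coh_fin_ne. Qed.

Lemma strict_sub_false S : strict_coh H S -> (forall x y, S x -> S y -> x = y) -> False.
Proof. by move=> /strict_cohP[_]. Qed.

Lemma coh_subsingleton S : fin_ne S -> (forall x y, S x -> S y -> x = y) -> coh H S.
Proof. by move=> fS SS; apply/cohE; split=> //; left; apply/fin_ne_set1 => //; case: fS. Qed.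

Lemma strict_tensor (S : T * U -> Prop) : fin_ne S ->
  ~ (forall x y, S x -> S y -> x = y) ->
  coh H (fst @` S) -> coh K (snd @` S) -> strict_coh (htensor H K) S.
Proof. by move=> fS nS c1 c2; apply/strict_cohP. Qed.

Lemma strict_par (S : T * U -> Prop) : fin_ne S ->
  strict_coh H (fst @` S) \/ strict_coh K (snd @` S) ->
  strict_coh (hperp (htensor (hperp H) (hperp K))) S.
Proof. by move=> fS h; apply/strict_perp; split=> // -[_ [_ n1] [_ n2]]; case: h. Qed.

Lemma strict_plus1 (S : T -> Prop) : strict_coh H S -> strict_coh (hplus H K) (inl @` S).
Proof.
move=> /strict_cohP[cS nS]; apply/strict_cohP; split; first by left; exists S.
move=> h; apply: nS => x y Sx Sy.
have [//] : inl x = inl y :> T + U by apply: h; [exists x | exists y].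
Qed.

Lemma strict_plus2 (S : U -> Prop) : strict_coh K S -> strict_coh (hplus H K) (inr @` S).
Proof.
move=> /strict_cohP[cS nS]; apply/strict_cohP; split; first by right; exists S.
move=> h; apply: nS => x y Sx Sy.
have [//] : inr x = inr y :> T + U by apply: h; [exists x | exists y].
Qed.

Lemma strict_with1 (S : T + U -> Prop) : (forall b, ~ S (inr b)) ->
  strict_coh H [set a | S (inl a)] ->
  strict_coh (hperp (hplus (hperp H) (hperp K))) S.
Proof.
move=> S0 sS; have SE : S = inl @` [set a | S (inl a)].
  by apply/seteqP; split=> [[a|b] Sx|_ [a Sa <-] //]; [exists a | case: (S0 b)].
apply/strict_perp; split; first by rewrite SE; exact/image_fin_ne/strict_fin_ne.
case=> -[S' cS' e]; last first.
  have [a Sa] := (strict_fin_ne sS).2.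
  by have [? _ //] : (inr @` S') (inl a : T + U) by rewrite -e.
suff e' : [set a | S (inl a)] = S' by case: cS' => _; rewrite -e'.
apply/seteqP; split=> a /= Sa; last by rewrite e; exists a.
by have [a' S'a' [<-]] : (inl @` S') (inl a : T + U) by rewrite -e.
Qed.

Lemma strict_with2 (S : T + U -> Prop) : (forall b, ~ S (inl b)) ->
  strict_coh K [set a | S (inr a)] ->
  strict_coh (hperp (hplus (hperp H) (hperp K))) S.
Proof.
move=> S0 sS; have SE : S = inr @` [set a | S (inr a)].
  by apply/seteqP; split=> [[b|a] Sx|_ [a Sa <-] //]; [case: (S0 b) | exists a].
have [a0 Sa0] : exists a, S (inr a).
  by case: sS => /coh_fin_ne [].
apply/strict_perp; split.
  by rewrite SE; apply: image_fin_ne; case: sS => /coh_fin_ne.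
case=> -[S' cS' e].
  by have [? _ //] : (inl @` S') (inr a0 : T + U) by rewrite -e.
suff e' : [set a | S (inr a)] = S' by case: cS' => _; rewrite -e'.
apply/seteqP; split=> a /= Sa; last by rewrite e; exists a.
by have [a' S'a' [<-]] : (inr @` S') (inr a : T + U) by rewrite -e.
Qed.

Lemma strict_with_mixed (S : T + U -> Prop) a b : fin_ne S -> S (inl a) -> S (inr b) ->
  strict_coh (hperp (hplus (hperp H) (hperp K))) S.
Proof.
move=> fS Sa Sb; apply/strict_perp; split=> // -[[S' _ e]|[S' _ e]].
  by move: Sb; rewrite e => -[].
by move: Sa; rewrite e => -[].
Qed.

(** Unfolding the double dual: incoherence of [S] among cliques of the dual means that some
    multisection is not coherent in the dual, that is, strictly coherent in [H]. *)
Lemma strict_whynot (S : bang_web (hperp H) -> Prop) :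
  strict_coh (hperp (hbang (hperp H))) S <->
  fin_ne S /\ exists M : T -> Prop, [/\ fin_ne M, multisection M S & strict_coh H M].
Proof.
split=> [/strict_perp[fS nS]|[fS [M [fM mM sM]]]]; last first.
  by apply/strict_perp; split=> // -[_ /(_ M fM mM)] -[_ /(_ sM)].
split=> //; apply: contrapT => nM; apply: nS; split=> // M fM mM.
by split=> // sM; apply: nM; exists M.
Qed.

End StrictCoherence.

Definition clique_family n (P : term n) (C : context n) := forall (X : hcohs n) (S : env X -> Prop),
  fin_ne S -> (forall r, S r -> denot P r) -> ecoh C S.

Definition uniform_denot n (P : term n) := forall (X Y : hcohs n) (f : embs X Y) (r : env X),
  denot P r <-> denot P (eact f r).

(** * Coherence of sets of environments *)

Section EnvCoherence.
Variables (n : nat) (X : hcohs n).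

Lemma eproj_fin_ne (C : context n) (S : env X -> Prop) z A : fin_ne S ->
  (forall r, S r -> etyped C r) -> C z = Some A -> fin_ne (eproj z A S).
Proof.
move=> [fS [r Sr]] St Cz; have pt q : S q -> exists a, q z = Some (Pt (A := A) a).
  move=> Sq; have := St q Sq z; rewrite Cz.
  by case: (q z) => //= p [/Pt_tag[a ->]]; exists a.
split; last by have [a ra] := pt r Sr; exists a, r.
have h : finite_set ((fun r : env X => r z) @` S) := finite_image _ fS.
apply: (finite_inj_on h (f := fun a => Some (Pt (A := A) a))).
  by move=> a [q Sq qa]; exists q.
by move=> a b _ _ /Some_inj /Pt_inj.
Qed.

Lemma eproj_image (w : env X -> env X) (S : env X -> Prop) z A :
  (forall r, S r -> w r z = r z) -> eproj z A (w @` S) = eproj z A S.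
Proof.
move=> h; apply/seteqP; split=> [a [_ [r Sr <-]]|a [r Sr ra]].
  by rewrite h // => ra; exists r.
by exists (w r); [exists r | rewrite h].
Qed.

(* The clique condition of a premise, seen from the conclusion: [special] are
   the names of the active formulas. *)
Lemma ecoh_premise (C C' : context n) (special : nat -> Prop) (S : env X -> Prop)
    (w : env X -> env X) :
  (forall z A, C' z = Some A -> special z \/
     C z = Some A /\ forall r, S r -> w r z = r z) ->
  ecoh C' (w @` S) ->
  [\/ ecoh C S, forall r r', S r -> S r' -> w r = w r' |
      exists z A, [/\ special z, C' z = Some A
        & strict_coh (rstr (interp A) X) (eproj z A (w @` S))]].
Proof.
move=> h [sub|[z [A [Cz sz]]]].
  by constructor 2 => r r' Sr Sr'; apply: sub; [exists r | exists r'].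
case: (h z A Cz) => [spz|[CzA wz]]; first by constructor 3; exists z, A.
by constructor 1; right; exists z, A; split=> //; rewrite -(eproj_image _ wz).
Qed.

(** The two points share their context [s], whose projections are at most singletons and cannot be
    strictly coherent; only the active formula is left. *)
Lemma eq_or_strict (P : term n) (C : context n) (s : env X) x A a b :
  clique_family P C -> C x = Some A ->
  denot P (pset s x (Pt (A := A) a)) -> denot P (pset s x (Pt (A := A) b)) ->
  a = b \/ strict_coh (rstr (interp A) X) [set a; b].
Proof.
move=> cP Cx Pa Pb; pose S := [set pset s x (Pt a); pset s x (Pt b)].
have fS : fin_ne S by split; [exact: finite_set2 | exists (pset s x (Pt a)); left].
have [|sub|[z [B [Cz sz]]]] := cP X S fS; first by move=> r [->|->].
  have := sub _ _ (or_introl erefl) (or_intror erefl) => /(congr1 (fun h : pmap _ => h x)).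
  by rewrite !psetE => /Some_inj /Pt_inj; left.
case: (z =P x) => [zx|zx].
  move: Cz sz; rewrite zx Cx => -[<-]; right.
  rewrite (_ : [set a; b] = eproj x A S) //; apply/seteqP; split=> c.
    by move=> [->|->]; [exists (pset s x (Pt a)); first by left
      | exists (pset s x (Pt b)); first by right]; rewrite psetE.
  by move=> [r [->|->]]; rewrite psetE => /Some_inj /Pt_inj ->; [left|right].
exfalso; apply: (strict_sub_false sz) => c d [r [->|->]] rc [r' [->|->]] r'd;
move: rc r'd; rewrite /pset; case: eqP => // _ -> /Some_inj /Pt_inj //.
Qed.

End EnvCoherence.

(** * Cliques for links and cuts *)

Section CliqueRules.
Variable n : nat.
Implicit Types (C D E : context n) (A B : formula n) (P Q : term n).

Lemma ecoh_premise1 (X : hcohs n) C C0 x A (S : env X -> Prop) (w : env X -> env X) :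
  ecoh (pset C0 x A) (w @` S) ->
  (forall z B, z <> x -> C0 z = Some B -> C z = Some B /\ forall r, S r -> w r z = r z) ->
  [\/ ecoh C S, forall r r', S r -> S r' -> w r = w r' |
      strict_coh (rstr (interp A) X) (eproj x A (w @` S))].
Proof.
move=> eS h; have [|//|//|[z [B [-> ]]]] := ecoh_premise (C := C) (special := eq^~ x) _ eS.
- move=> z B; case: (z =P x) => [|zx]; [by left|right].
  by apply: h => //; move: H; rewrite /pset; case: eqP.
- by constructor 1.
- by constructor 2.
- by rewrite psetE => -[BE]; case: _ / BE; constructor 3.
Qed.

(** The two projections are the same set up to duality: either it is coherent in [A], and strictly
    so unless it is a singleton, or it is strictly coherent in the dual. *)
Lemma clique_link x y A : x <> y ->
  clique_family (Link x y A) (pset (pset pempty y (dual A)) x A).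
Proof.
move=> xy X S fS Sd; case: (pselect (forall r r', S r -> S r' -> r = r')); first by left.
move=> nS; right.
have px : fin_ne (eproj x A S).
  by apply: (eproj_fin_ne fS (C := pset (pset pempty y (dual A)) x A)); [
    move=> r /Sd; exact: (denot_typed (P := Link x y A)) | rewrite psetE].
have dE : eproj y (dual A) S = @dual_pt n X A @` eproj x A S.
  apply/seteqP; split=> [b [r Sr]|_ [a [r Sr ra] <-]].
    have [a re] := Sd r Sr; rewrite re /pset eqxx; case: eqP => [/esym//|_].
    by move=> /Some_inj/Pt_inj <-; exists a => //; exists r => //; rewrite re psetE.
  exists r => //; have [a' re] := Sd r Sr; move: ra; rewrite re psetE => /Some_inj/Pt_inj <-.
  by rewrite /pset eqxx; case: eqP => [/esym//|].
case: (pselect (coh (rstr (interp A) X) (eproj x A S))) => cx.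
  exists x, A; rewrite psetE; split=> //; apply/strict_cohP; split=> // h.
  apply: nS => r r' Sr Sr'; have [a re] := Sd r Sr; have [a' re'] := Sd r' Sr'.
  rewrite re re' (h a a') //; first by exists r => //; rewrite re psetE.
  by exists r' => //; rewrite re' psetE.
exists y, (dual A); split; first by rewrite /pset eqxx; case: eqP => [/esym//|].
rewrite dE; apply/strict_dual; exact/strict_perp.
Qed.

(** If one premise is constant on the set, so is the cut point, and the other premise cannot be
    strictly coherent at it. If both premises are strictly coherent at the cut formula,
    [strict_perp] is contradicted. *)
Lemma clique_cut x A P Q C D : C x = None -> D x = None -> pdisjoint C D ->
  der P (pset C x A) -> der Q (pset D x (dual A)) ->
  clique_family P (pset C x A) -> clique_family Q (pset D x (dual A)) ->
  clique_family (Cut x A P Q) (pjoin C D).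
Proof.
move=> Cx Dx CD dP dQ cP cQ X S fS Sd.
have [|w wE] := @choose_on _ _ (pempty, pempty) S (fun r (w : env X * env X) =>
    exists a s t, [/\ s x = None, t x = None, pdisjoint s t & r = pjoin s t] /\
      [/\ w = (pset s x (Pt (A := A) a), pset t x (Pt (dual_pt a))),
       denot P w.1 & denot Q w.2]).
  move=> r /Sd[a [s [t [h1 [h2 h3]]]]].
  by exists (pset s x (Pt a), pset t x (Pt (dual_pt a))); exists a, s, t.
pose w1 r := (w r).1; pose w2 r := (w r).2.
have P1 : ecoh (pset C x A) (w1 @` S).
  by apply: cP; [exact: image_fin_ne | move=> _ [r /wE[a [s [t [_ [_ h _]]]]] <-]].
have Q1 : ecoh (pset D x (dual A)) (w2 @` S).
  by apply: cQ; [exact: image_fin_ne | move=> _ [r /wE[a [s [t [_ [_ _ h]]]]] <-]].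
have [|//|P2|Ps] := ecoh_premise1 (C := pjoin C D) P1.
- move=> z B zx Cz; split; first by pm z.
  move=> r /wE[a [s [t [[sx tx st ->] [we hP hQ]]]]].
  have := denot_typed dP hP; rewrite /w1 we => /= ts.
  by clear - zx Cz sx tx st ts; pm z.
- have [|//|Q2|Qs] := ecoh_premise1 (C := pjoin C D) Q1.
  + move=> z B zx Dz; split; first by clear - zx Dz CD; pm z.
    move=> r /wE[a [s [t [[sx tx st ->] [we hP hQ]]]]].
    have := denot_typed dQ hQ; rewrite /w2 we => /= ts.
    by clear - zx Dz sx tx st ts; pm z.
  + left=> r r' Sr Sr'; have [a [s [t [[sx tx st re] [we _ _]]]]] := wE r Sr.
    have [a' [s' [t' [[sx' tx' st' re'] [we' _ _]]]]] := wE r' Sr'.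
    have := P2 r r' Sr Sr'; have := Q2 r r' Sr Sr'; rewrite /w1 /w2 we we' re re' /= => e1 e2.
    by apply: funext => z; clear - sx tx sx' tx' e1 e2; pm z.
  exfalso; apply: (strict_sub_false Qs) => b b' [_ [r Sr <-] rb] [_ [r' Sr' <-] rb'].
  have [a [s [t [_ [we _ _]]]]] := wE r Sr; have [a' [s' [t' [_ [we' _ _]]]]] := wE r' Sr'.
  move: rb rb'; rewrite /w2 we we' /= !psetE => /Some_inj/Pt_inj <- /Some_inj/Pt_inj <-.
  have := P2 r r' Sr Sr'; rewrite /w1 we we' /= => /(congr1 (fun h : pmap _ => h x)).
  by rewrite !psetE => /Some_inj/Pt_inj ->.
have [|//|Q2|Qs] := ecoh_premise1 (C := pjoin C D) Q1.
- move=> z B zx Dz; split; first by clear - zx Dz CD; pm z.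
  move=> r /wE[a [s [t [[sx tx st ->] [we hP hQ]]]]].
  have := denot_typed dQ hQ; rewrite /w2 we => /= ts.
  by clear - zx Dz sx tx st ts; pm z.
- exfalso; apply: (strict_sub_false Ps) => b b' [_ [r Sr <-] rb] [_ [r' Sr' <-] rb'].
  have [a [s [t [_ [we _ _]]]]] := wE r Sr; have [a' [s' [t' [_ [we' _ _]]]]] := wE r' Sr'.
  move: rb rb'; rewrite /w1 we we' /= !psetE => /Some_inj/Pt_inj <- /Some_inj/Pt_inj <-.
  have := Q2 r r' Sr Sr'; rewrite /w2 we we' /= => /(congr1 (fun h : pmap _ => h x)).
  by rewrite !psetE => /Some_inj/Pt_inj/dual_pt_inj ->.
exfalso; move: Qs.
rewrite (_ : eproj x (dual A) _ = @dual_pt n X A @` eproj x A (w1 @` S)).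
  by move=> /strict_dual/strict_perp[_]; apply; case: Ps.
apply/seteqP; split=> [b [_ [r Sr <-] rb]|_ [b [_ [r Sr <-] rb] <-]].
  have [a [s [t [_ [we _ _]]]]] := wE r Sr; move: rb.
  rewrite /w2 we /= psetE => /Some_inj/Pt_inj <-; exists a => //.
  by exists (w1 r); [exists r | rewrite /w1 we /= psetE].
have [a [s [t [_ [we _ _]]]]] := wE r Sr; move: rb.
rewrite /w1 we /= psetE => /Some_inj/Pt_inj <-.
by exists (w2 r); [exists r | rewrite /w2 we /= psetE].
Qed.
End CliqueRules.

(** * Cliques for units and tensors *)

Section CliqueRules.
Variable n : nat.
Implicit Types (C D E : context n) (A B : formula n) (P Q : term n).

Lemma ecoh_premise0 (X : hcohs n) C C0 (S : env X -> Prop) (w : env X -> env X) :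
  ecoh C0 (w @` S) ->
  (forall z B, C0 z = Some B -> C z = Some B /\ forall r, S r -> w r z = r z) ->
  ecoh C S \/ forall r r', S r -> S r' -> w r = w r'.
Proof.
move=> eS h; have [|//|//|[z [B [//]]]] := ecoh_premise (C := C) (special := fun _ => False) _ eS.
- by move=> z B /h; right.
- by left.
- by right.
Qed.

Lemma pset_inj (T : Type) (s t : pmap T) x a b : s x = None -> t x = None ->
  pset s x a = pset t x b -> s = t /\ a = b.
Proof.
move=> sx tx e; split.
  by apply: funext => z; pm z.
by have := congr1 (fun h : pmap _ => h x) e; rewrite !psetE => -[].
Qed.

Lemma clique_one x : clique_family (TOne n x) (pset pempty x One).
Proof. by move=> X S fS Sd; left=> r r' /Sd -> /Sd ->. Qed.

Lemma clique_bot x P C : C x = None -> der P C -> clique_family P C ->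
  clique_family (TBot x P) (pset C x Bot).
Proof.
move=> Cx dP cP X S fS Sd.
have [|w wE] := @choose_on _ _ pempty S (fun r s =>
    [/\ s x = None, r = pset s x (@Pt _ X Bot tt) & denot P s]).
  by move=> r /Sd.
have P1 : ecoh C (w @` S).
  by apply: cP; [exact: image_fin_ne | move=> _ [r /wE[_ _ h] <-]].
have [|//|h] := ecoh_premise0 (C := pset C x Bot) P1.
  move=> z B Cz; split; first by pm z.
  by move=> r /wE[sx e _]; rewrite [in RHS]e /pset; case: eqP => // zx; move: Cz; rewrite zx Cx.
left=> r r' Sr Sr'; have [_ -> _] := wE r Sr; have [_ -> _] := wE r' Sr'.
by rewrite (h r r').
Qed.

(** When the context decides nothing, each active projection is a singleton or strictly coherent.
    Two singletons leave a single point; otherwise both projections are coherent and the tensor has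
    at least two points, hence is strictly coherent. *)
Lemma clique_tensor x A B P Q C D : C x = None -> D x = None -> pdisjoint C D ->
  der P (pset C x A) -> der Q (pset D x B) ->
  clique_family P (pset C x A) -> clique_family Q (pset D x B) ->
  clique_family (TTensor x A B P Q) (pset (pjoin C D) x (Tensor A B)).
Proof.
move=> Cx Dx CD dP dQ cP cQ X S fS Sd.
have [|w wE] := @choose_on _ _ (pempty, pempty) S (fun r (w : env X * env X) =>
    exists a b s t, [/\ s x = None, t x = None, pdisjoint s t &
      r = pset (pjoin s t) x (@Pt _ X (Tensor A B) (a, b))] /\
      [/\ w = (pset s x (Pt (A := A) a), pset t x (Pt b)), denot P w.1 & denot Q w.2]).
  move=> r /Sd[a [b [s [t [h1 [h2 h3]]]]]].
  by exists (pset s x (Pt a), pset t x (Pt b)); exists a, b, s, t.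
pose w1 r := (w r).1; pose w2 r := (w r).2.
have P1 : ecoh (pset C x A) (w1 @` S).
  by apply: cP; [exact: image_fin_ne | move=> _ [r /wE[a [b [s [t [_ [_ h _]]]]]] <-]].
have Q1 : ecoh (pset D x B) (w2 @` S).
  by apply: cQ; [exact: image_fin_ne | move=> _ [r /wE[a [b [s [t [_ [_ _ h]]]]]] <-]].
have {}P1 := ecoh_premise1 (C := pset (pjoin C D) x (Tensor A B)) P1.
have {P1}[|//|P2|Ps] := P1.
- move=> z K zx Cz; split; first by pm z.
  move=> r /wE[a [b [s [t [[sx tx st ->] [we hP hQ]]]]]].
  have := denot_typed dP hP; rewrite /w1 we => /= ts.
  by clear - zx Cz sx tx st ts; pm z.
all: have {}Q1 := ecoh_premise1 (C := pset (pjoin C D) x (Tensor A B)) Q1.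
all: have {Q1}[|//|Q2|Qs] := Q1.
all: try (move=> z K zx Dz; split; [by clear - zx Dz CD; pm z|];
  move=> r /wE[a [b [s [t [[sx tx st ->] [we hP hQ]]]]]];
  have := denot_typed dQ hQ; rewrite /w2 we => /= ts;
  by clear - zx Dz sx tx st ts; pm z).
- left=> r r' Sr Sr'; have [a [b [s [t [[sx tx st re] [we _ _]]]]]] := wE r Sr.
  have [a' [b' [s' [t' [[sx' tx' st' re'] [we' _ _]]]]]] := wE r' Sr'.
  have := P2 r r' Sr Sr'; have := Q2 r r' Sr Sr'; rewrite /w1 /w2 we we' re re' /=.
  move=> eQ eP; have [-> /Pt_inj ->] := pset_inj sx sx' eP.
  by have [-> /Pt_inj ->] := pset_inj tx tx' eQ.
all: right; exists x, (Tensor A B); rewrite psetE; split=> //.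
all: have fx : fin_ne (eproj x (Tensor A B) S) by
  apply: (eproj_fin_ne fS (C := pset (pjoin C D) x (Tensor A B))); [
    move=> r /Sd; apply: (denot_typed (P := TTensor x A B P Q)); exists C, D | rewrite psetE].
all: have e1 : fst @` eproj x (Tensor A B) S = eproj x A (w1 @` S).
1,3,5: apply/seteqP; split=> [_ [ab [r Sr rx] <-]|a0 [_ [r Sr <-] rx]];
  have [a [b [s [t [[sx tx st re] [we _ _]]]]]] := wE r Sr; move: rx;
  [rewrite re psetE => /Some_inj/Pt_inj <-; exists (w1 r); [by exists r | by rewrite /w1 we /= psetE]
  | rewrite /w1 we /= psetE => /Some_inj/Pt_inj <-; exists (a, b) => //;
    exists r => //; by rewrite re psetE].
all: have e2 : snd @` eproj x (Tensor A B) S = eproj x B (w2 @` S).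
1,3,5: apply/seteqP; split=> [_ [ab [r Sr rx] <-]|a0 [_ [r Sr <-] rx]];
  have [a [b [s [t [[sx tx st re] [we _ _]]]]]] := wE r Sr; move: rx;
  [rewrite re psetE => /Some_inj/Pt_inj <-; exists (w2 r); [by exists r | by rewrite /w2 we /= psetE]
  | rewrite /w2 we /= psetE => /Some_inj/Pt_inj <-; exists (a, b) => //;
    exists r => //; by rewrite re psetE].
all: apply: strict_tensor => //; rewrite ?e1 ?e2; try by case: Ps; try by case: Qs.
all: try (by case: Ps); try (by case: Qs).
all: try (move=> h; (apply: (strict_sub_false Ps) || apply: (strict_sub_false Qs)) => u v;
  rewrite -?e1 -?e2 => -[p px <-] [q qx <-]; by rewrite (h p q)).
- apply: coh_subsingleton; first by rewrite -e1; exact: image_fin_ne.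
  move=> u v [_ [r Sr <-] ru] [_ [r' Sr' <-] rv]; move: ru; rewrite (P2 r r' Sr Sr') rv.
  by move=> /Some_inj/Pt_inj.
- apply: coh_subsingleton; first by rewrite -e2; exact: image_fin_ne.
  move=> u v [_ [r Sr <-] ru] [_ [r' Sr' <-] rv]; move: ru; rewrite (Q2 r r' Sr Sr') rv.
  by move=> /Some_inj/Pt_inj.
Qed.
End CliqueRules.

(** * Cliques for the remaining rules without boxes or eigenvariables *)

Section CliqueRules.
Variable n : nat.
Implicit Types (C D E : context n) (A B : formula n) (P Q : term n).

Lemma denot_fin_ne P C (X : hcohs n) (S : env X -> Prop) z A : fin_ne S -> der P C ->
  (forall r, S r -> denot P r) -> C z = Some A -> fin_ne (eproj z A S).
Proof.
by move=> fS dP Sd Cz; apply: (eproj_fin_ne fS (C := C)) => // r /Sd; exact: denot_typed.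
Qed.

Lemma pset_None (T : Type) (s : pmap T) x y b : x <> y -> s x = None -> pset s y b x = None.
Proof. by move=> xy sx; rewrite /pset; case: eqP. Qed.

(** Common form of the plus, dereliction and existential rules: one active formula, turned into the
    principal one by a relation [R] that is functional and carries strict coherence forward. *)
Lemma clique_unary x A B P Q C (R : forall X, rweb (interp A) X -> rweb (interp B) X -> Prop) :
  C x = None -> der P (pset C x A) -> der Q (pset C x B) ->
  (forall X r, denot Q (X := X) r -> exists a b s,
     [/\ s x = None, r = pset s x (Pt b), R X a b & denot P (pset s x (Pt a))]) ->
  (forall X a b b', R X a b -> R X a b' -> b = b') ->
  (forall X (S : rweb (interp A) X -> Prop) (S' : rweb (interp B) X -> Prop),
     fin_ne S' -> (forall b, S' b -> exists2 a, S a & R X a b) ->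
     (forall a, S a -> exists2 b, S' b & R X a b) ->
     strict_coh (rstr (interp A) X) S -> strict_coh (rstr (interp B) X) S') ->
  clique_family P (pset C x A) -> clique_family Q (pset C x B).
Proof.
move=> Cx dP dQ QE Rfun Rstrict cP X S fS Sd.
have [|w wE] := @choose_on _ _ pempty S (fun r (u : env X) =>
    exists a b s, [/\ s x = None, r = pset s x (Pt (A := B) b), R X a b,
      u = pset s x (Pt (A := A) a) & denot P u]).
  by move=> r /Sd/QE[a [b [s [sx re Rab h]]]]; exists (pset s x (Pt a)), a, b, s.
have P1 : ecoh (pset C x A) (w @` S).
  by apply: cP; [exact: image_fin_ne | move=> _ [r /wE[a [b [s [_ _ _ _ h]]]] <-]].
have [|//|P2|Ps] := ecoh_premise1 (C := pset C x B) P1.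
- move=> z K zx Cz; split; first by pm z.
  move=> r /wE[a [b [s [sx -> _ -> _]]]].
  by rewrite /pset; case: eqP.
- left=> r r' Sr Sr'; have [a [b [s [sx re Rab we _]]]] := wE r Sr.
  have [a' [b' [s' [sx' re' Rab' we' _]]]] := wE r' Sr'.
  have := P2 r r' Sr Sr'; rewrite we we' re re' => e.
  have [-> /Pt_inj aa'] := pset_inj sx sx' e; rewrite -aa' in Rab'.
  by rewrite (Rfun _ _ _ _ Rab Rab').
right; exists x, B; rewrite psetE; split=> //; apply: Rstrict Ps.
- by apply: (denot_fin_ne fS dQ Sd); rewrite psetE.
- move=> b [r Sr rb]; have [a [b' [s [sx re Rab we _]]]] := wE r Sr.
  move: rb; rewrite re psetE => /Some_inj/Pt_inj <-; exists a => //.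
  by exists (w r); [exists r | rewrite we psetE].
- move=> a [_ [r Sr <-] ra]; have [a' [b [s [sx re Rab we _]]]] := wE r Sr.
  move: ra; rewrite we psetE => /Some_inj/Pt_inj <-; exists b => //.
  by exists r => //; rewrite re psetE.
Qed.

Lemma clique_plus1 x A B P C : C x = None -> der P (pset C x A) ->
  clique_family P (pset C x A) -> clique_family (TPlus1 x A B P) (pset C x (Plus A B)).
Proof.
move=> Cx dP; apply: (@clique_unary x A (Plus A B) P (TPlus1 x A B P) C
  (fun X a b => b = inl a)) => //.
- by exists C.
- by move=> X r [a [s [sx re h]]]; exists a, (inl a), s.
- by move=> X a b b' -> ->.
move=> X S S' fS h1 h2 sS.
rewrite (_ : S' = inl @` S); first exact: strict_plus1.
apply/seteqP; split=> [b S'b|_ [a Sa <-]].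
  by have [a Sa ->] := h1 b S'b; exists a.
by have [b S'b <-] := h2 a Sa.
Qed.

Lemma clique_plus2 x A B P C : C x = None -> der P (pset C x B) ->
  clique_family P (pset C x B) -> clique_family (TPlus2 x A B P) (pset C x (Plus A B)).
Proof.
move=> Cx dP; apply: (@clique_unary x B (Plus A B) P (TPlus2 x A B P) C
  (fun X a b => b = inr a)) => //.
- by exists C.
- by move=> X r [a [s [sx re h]]]; exists a, (inr a), s.
- by move=> X a b b' -> ->.
move=> X S S' fS h1 h2 sS.
rewrite (_ : S' = inr @` S); first exact: strict_plus2.
apply/seteqP; split=> [b S'b|_ [a Sa <-]].
  by have [a Sa ->] := h1 b S'b; exists a.
by have [b S'b <-] := h2 a Sa.
Qed.

Lemma clique_der x A P C : C x = None -> der P (pset C x A) ->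
  clique_family P (pset C x A) -> clique_family (TDer x A P) (pset C x (WhyNot A)).
Proof.
move=> Cx dP; apply: (@clique_unary x A (WhyNot A) P (TDer x A P) C
  (fun X a (c : rweb (interp (WhyNot A)) X) => sval c = [set a])) => //.
- by exists C.
- by move=> X a b b' ba ba'; apply: sval_inj; rewrite ba ba'.
move=> X S S' fS h1 h2 sS; apply/strict_whynot; split=> //.
exists S; split=> //; first by case: sS => /coh_fin_ne.
split=> [c /h1[a Sa ->]|a /h2[c S'c ca]]; first by exists a.
by exists c => //; rewrite ca.
Qed.

(** If the normal forms were coherent for the dual of [A], every set with these normal forms would
    be coherent there, in particular the instances at [interp B], which are strictly coherent in
    [A]. *)
Lemma clique_ex x (A : formula n.+1) B P C : C x = None -> der P (pset C x (inst A B)) ->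
  clique_family P (pset C x (inst A B)) -> clique_family (TEx x A B P) (pset C x (Ex A)).
Proof.
move=> Cx dP; apply: (@clique_unary x (inst A B) (Ex A) P (TEx x A B P) C
  (fun X a (c : rweb (interp (Ex A)) X) =>
     nf_of (partial_f (interp A) X) (inst_pt a) (sval c))) => //.
- by exists C.
- move=> X a b b' ba ba'; apply: sval_inj.
  exact: (nf_unique (normal_partial (normal_interp A) X) ba ba').
move=> X S S' fS h1 h2 sS; apply/strict_perp; split=> // -[_ [_ _ H]].
pose U : hcohs 1 := fun _ => robj (interp B) X.
have := H U (@inst_pt n X A B @` S); case.
- by apply: image_fin_ne; case: sS => /coh_fin_ne.
- apply/seteqP; split=> [N [_ [a Sa <-] aN]|_ [c S'c <-]].
    have [c S'c ac] := h2 a Sa; exists c => //.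
    exact: (nf_unique (normal_partial (normal_interp A) X) ac aN).
  by have [a Sa ac] := h1 c S'c; exists (inst_pt a) => //; exists a.
move=> _; apply; exact: (proj2 (strict_coh_cast (interp_inst A B) S) sS).
Qed.

Lemma clique_weak x A P C : C x = None -> der P C -> clique_family P C ->
  clique_family (TWeak x A P) (pset C x (WhyNot A)).
Proof.
move=> Cx dP cP X S fS Sd.
have [|w wE] := @choose_on _ _ pempty S (fun r s =>
    exists c : rweb (interp (WhyNot A)) X,
    [/\ s x = None, r = pset s x (Pt c), sval c = set0 & denot P s]).
  by move=> r /Sd[c [s h]]; exists s, c.
have P1 : ecoh C (w @` S).
  by apply: cP; [exact: image_fin_ne | move=> _ [r /wE[c [_ _ _ h]] <-]].
have [|//|h] := ecoh_premise0 (C := pset C x (WhyNot A)) P1.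
  move=> z B Cz; split; first by pm z.
  by move=> r /wE[c [sx e _ _]]; rewrite [in RHS]e /pset; case: eqP => // zx; move: Cz; rewrite zx Cx.
left=> r r' Sr Sr'; have [c [_ -> c0 _]] := wE r Sr; have [c' [_ -> c0' _]] := wE r' Sr'.
rewrite (h r r') //; congr (pset _ _ (Pt _)); apply: sval_inj; by rewrite c0 c0'.
Qed.

Lemma clique_par x y A B P C : C x = None -> C y = None -> x <> y ->
  der P (pset (pset C y B) x A) -> clique_family P (pset (pset C y B) x A) ->
  clique_family (TPar x y A B P) (pset C x (Par A B)).
Proof.
move=> Cx Cy xy dP cP X S fS Sd.
have [|w wE] := @choose_on _ _ pempty S (fun r (u : env X) =>
    exists a b s, [/\ s x = None, s y = None, r = pset s x (@Pt _ X (Par A B) (a, b)),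
      u = pset (pset s y (Pt b)) x (Pt (A := A) a) & denot P u]).
  by move=> r /Sd[a [b [s [sx sy re h]]]]; exists (pset (pset s y (Pt b)) x (Pt a)), a, b, s.
have P1 : ecoh (pset (pset C y B) x A) (w @` S).
  by apply: cP; [exact: image_fin_ne | move=> _ [r /wE[a [b [s [_ _ _ _ h]]]] <-]].
have [|//|P2|[z [K [zxy Cz Ps]]]] := ecoh_premise (C := pset C x (Par A B))
    (special := fun z => z = x \/ z = y) _ P1.
- move=> z K Cz; case: (z =P x) => [zx|zx]; first by left; left.
  case: (z =P y) => [zy|zy]; first by left; right.
  right; split; first by move: Cz; clear - zx zy; pm z.
  by move=> r /wE[a [b [s [sx sy -> -> _]]]]; clear - zx zy; pm z.
- left=> r r' Sr Sr'; have [a [b [s [sx sy re we _]]]] := wE r Sr.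
  have [a' [b' [s' [sx' sy' re' we' _]]]] := wE r' Sr'.
  have := P2 r r' Sr Sr'; rewrite we we' re re' => e.
  have [e' /Pt_inj ->] := pset_inj (pset_None (Pt b) xy sx) (pset_None (Pt b') xy sx') e.
  by have [-> /Pt_inj ->] := pset_inj sy sy' e'.
have fx : fin_ne (eproj x (Par A B) S).
  apply: (denot_fin_ne (P := TPar x y A B P) (C := pset C x (Par A B)) fS) => //.
    by exists C.
  by rewrite psetE.
right; exists x, (Par A B); rewrite psetE; split=> //; apply: strict_par => //.
case: zxy => zE; move: Cz Ps; rewrite zE; [left|right].
  move: Cz; rewrite psetE => -[KE]; case: _ / KE Ps => Ps.
  rewrite (_ : fst @` _ = eproj x A (w @` S)) //.
  apply/seteqP; split=> [_ [ab [r Sr rx] <-]|a0 [_ [r Sr <-] rx]];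
    have [a [b [s [sx sy re we _]]]] := wE r Sr; move: rx.
    rewrite re psetE => /Some_inj/Pt_inj <-; exists (w r); first by exists r.
    by rewrite we psetE.
  rewrite we psetE => /Some_inj/Pt_inj <-; exists (a, b) => //.
  by exists r => //; rewrite re psetE.
move: Cz; rewrite /pset eqxx; case: eqP => [/esym//|_] -[KE]; case: _ / KE Ps => Ps.
rewrite (_ : snd @` _ = eproj y B (w @` S)) //.
apply/seteqP; split=> [_ [ab [r Sr rx] <-]|a0 [_ [r Sr <-] rx]];
  have [a [b [s [sx sy re we _]]]] := wE r Sr; move: rx.
  rewrite re psetE => /Some_inj/Pt_inj <-; exists (w r); first by exists r.
  by rewrite we /pset eqxx; case: eqP => [/esym//|].
rewrite we /pset eqxx; case: eqP => [/esym//|_] => /Some_inj/Pt_inj <-.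
exists (a, b) => //.
by exists r => //; rewrite re psetE.
Qed.

(** A multisection of the projection of the premise at [x] or at [y] is also one for the unions, so
    that a strictly coherent one serves for the conclusion. *)
Lemma clique_contr x y A P C : C x = None -> C y = None -> x <> y ->
  der P (pset (pset C y (WhyNot A)) x (WhyNot A)) ->
  clique_family P (pset (pset C y (WhyNot A)) x (WhyNot A)) ->
  clique_family (TContr x y A P) (pset C x (WhyNot A)).
Proof.
move=> Cx Cy xy dP cP X S fS Sd.
have [|w wE] := @choose_on _ _ pempty S (fun r (u : env X) =>
    exists (c d e : rweb (interp (WhyNot A)) X) s,
      [/\ s x = None, s y = None, r = pset s x (Pt e) & sval e = sval c `|` sval d] /\
      (u = pset (pset s y (Pt d)) x (Pt c) /\ denot P u)).
  move=> r /Sd[c [d [e [s [h1 h2]]]]].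
  by exists (pset (pset s y (Pt d)) x (Pt c)), c, d, e, s.
have P1 : ecoh (pset (pset C y (WhyNot A)) x (WhyNot A)) (w @` S).
  by apply: cP; [exact: image_fin_ne | move=> _ [r /wE[c [d [e [s [_ [_ h]]]]]] <-]].
have [|//|P2|[z [K [zxy Cz Ps]]]] := ecoh_premise (C := pset C x (WhyNot A))
    (special := fun z => z = x \/ z = y) _ P1.
- move=> z K Cz; case: (z =P x) => [zx|zx]; first by left; left.
  case: (z =P y) => [zy|zy]; first by left; right.
  right; split; first by move: Cz; clear - zx zy; pm z.
  by move=> r /wE[c [d [e [s [[sx sy -> _] [-> _]]]]]]; clear - zx zy; pm z.
- left=> r r' Sr Sr'; have [c [d [e [s [[sx sy re ce] [we _]]]]]] := wE r Sr.
  have [c' [d' [e' [s' [[sx' sy' re' ce'] [we' _]]]]]] := wE r' Sr'.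
  have := P2 r r' Sr Sr'; rewrite we we' re re' => h.
  have [h' /Pt_inj cc'] := pset_inj (pset_None (Pt d) xy sx) (pset_None (Pt d') xy sx') h.
  have [-> /Pt_inj dd'] := pset_inj sy sy' h'.
  by congr (pset _ _ (Pt _)); apply: sval_inj; rewrite ce ce' cc' dd'.
have fx : fin_ne (eproj x (WhyNot A) S).
  apply: (denot_fin_ne (P := TContr x y A P) (C := pset C x (WhyNot A)) fS) => //.
    by exists C.
  by rewrite psetE.
right; exists x, (WhyNot A); rewrite psetE; split=> //; apply/strict_whynot; split=> //.
have KE : K = WhyNot A.
  by case: zxy Cz => -> ; rewrite /pset eqxx; [move=> [->] | case: eqP => [_ [->]|_ [->]]].
case: _ / (esym KE) Ps {Cz} => /strict_whynot[_ [M [fM [M1 M2] sM]]].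
exists M; split=> //; split=> [e [r Sr rx]|a Ma].
  have [c [d [e' [s [[sx sy re ce] [we _]]]]]] := wE r Sr.
  move: rx; rewrite re psetE => /Some_inj/Pt_inj <-; rewrite ce.
  case: zxy => zE; rewrite zE in M1.
    have [|a Ma ca] := M1 c; last by exists a => //; left.
    by exists (w r); [exists r | rewrite we psetE].
  have [|a Ma ca] := M1 d; last by exists a => //; right.
  by exists (w r); [exists r | rewrite we /pset eqxx; case: eqP => [/esym//|]].
have [c0 [_ [r Sr <-] rc] ca] := M2 a Ma.
have [c [d [e [s [[sx sy re ce] [we _]]]]]] := wE r Sr.
exists e; first by exists r => //; rewrite re psetE.
rewrite ce; move: rc; rewrite we; case: zxy => ->.
  by rewrite psetE => /Some_inj/Pt_inj ->; left.
by rewrite /pset eqxx; case: eqP => [/esym//|_] /Some_inj/Pt_inj ->; right.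
Qed.

Lemma clique_with x A B P Q C : C x = None ->
  der P (pset C x A) -> der Q (pset C x B) ->
  clique_family P (pset C x A) -> clique_family Q (pset C x B) ->
  clique_family (TWith x A B P Q) (pset C x (With A B)).
Proof.
move=> Cx dP dQ cP cQ X S fS Sd.
have dW : der (TWith x A B P Q) (pset C x (With A B)) by exists C.
have fx : fin_ne (eproj x (With A B) S).
  by apply: (denot_fin_ne fS dW Sd); rewrite psetE.
case: (pselect (exists a, eproj x (With A B) S (inl a))) => [[a Sa]|nA].
  case: (pselect (exists b, eproj x (With A B) S (inr b))) => [[b Sb]|nB].
    right; exists x, (With A B); rewrite psetE; split=> //.
    exact: strict_with_mixed Sa Sb.
  have {}Sd r : S r -> exists a s, [/\ s x = None, r = pset s x (@Pt _ X (With A B) (inl a))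
      & denot P (pset s x (Pt a))].
    move=> Sr; case: (Sd r Sr) => // -[b [s [sx re h]]]; case: nB; exists b, r => //.
    by rewrite re psetE.
  have [|w wE] := @choose_on _ _ pempty S (fun r (u : env X) =>
      exists a s, [/\ s x = None, r = pset s x (@Pt _ X (With A B) (inl a)),
        u = pset s x (Pt a) & denot P u]).
    by move=> r /Sd[a' [s [sx re h]]]; exists (pset s x (Pt a')), a', s.
  have P1 : ecoh (pset C x A) (w @` S).
    by apply: cP; [exact: image_fin_ne | move=> _ [r /wE[a' [s [_ _ _ h]]] <-]].
  have [|//|P2|Ps] := ecoh_premise1 (C := pset C x (With A B)) P1.
  - move=> z K zx Cz; split; first by pm z.
    by move=> r /wE[a' [s [sx -> -> _]]]; rewrite /pset; case: eqP.
  - left=> r r' Sr Sr'; have [u [s [sx re we _]]] := wE r Sr.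
    have [u' [s' [sx' re' we' _]]] := wE r' Sr'.
    have := P2 r r' Sr Sr'; rewrite we we' re re' => e.
    by have [-> /Pt_inj ->] := pset_inj sx sx' e.
  right; exists x, (With A B); rewrite psetE; split=> //; apply: strict_with1.
    by move=> b Sb; apply: nB; exists b.
  rewrite (_ : [set a | _] = eproj x A (w @` S)) //.
  apply/seteqP; split=> [u [r Sr ru]|u [_ [r Sr <-] ru]];
    have [u' [s [sx re we _]]] := wE r Sr; move: ru.
    rewrite re psetE => /Some_inj/Pt_inj [<-]; exists (w r); first by exists r.
    by rewrite we psetE.
  rewrite we psetE => /Some_inj/Pt_inj <-; exists r => //; by rewrite re psetE.
have {}Sd r : S r -> exists a s, [/\ s x = None, r = pset s x (@Pt _ X (With A B) (inr a))
    & denot Q (pset s x (Pt a))].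
  move=> Sr; case: (Sd r Sr) => // -[b [s [sx re h]]]; case: nA; exists b, r => //.
  by rewrite re psetE.
have [|w wE] := @choose_on _ _ pempty S (fun r (u : env X) =>
    exists a s, [/\ s x = None, r = pset s x (@Pt _ X (With A B) (inr a)),
      u = pset s x (Pt a) & denot Q u]).
  by move=> r /Sd[a' [s [sx re h]]]; exists (pset s x (Pt a')), a', s.
have P1 : ecoh (pset C x B) (w @` S).
  by apply: cQ; [exact: image_fin_ne | move=> _ [r /wE[a' [s [_ _ _ h]]] <-]].
have [|//|P2|Ps] := ecoh_premise1 (C := pset C x (With A B)) P1.
- move=> z K zx Cz; split; first by pm z.
  by move=> r /wE[a' [s [sx -> -> _]]]; rewrite /pset; case: eqP.
- left=> r r' Sr Sr'; have [u [s [sx re we _]]] := wE r Sr.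
  have [u' [s' [sx' re' we' _]]] := wE r' Sr'.
  have := P2 r r' Sr Sr'; rewrite we we' re re' => e.
  by have [-> /Pt_inj ->] := pset_inj sx sx' e.
right; exists x, (With A B); rewrite psetE; split=> //; apply: strict_with2.
  by move=> b Sb; apply: nA; exists b.
rewrite (_ : [set a | _] = eproj x B (w @` S)) //.
apply/seteqP; split=> [u [r Sr ru]|u [_ [r Sr <-] ru]];
  have [u' [s [sx re we _]]] := wE r Sr; move: ru.
  rewrite re psetE => /Some_inj/Pt_inj [<-]; exists (w r); first by exists r.
  by rewrite we psetE.
rewrite we psetE => /Some_inj/Pt_inj <-; exists r => //; by rewrite re psetE.
Qed.

End CliqueRules.

Lemma etyped_pt n (C : context n) (X : hcohs n) (r : env X) z A :
  etyped C r -> C z = Some A -> exists a, r z = Some (Pt (A := A) a).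
Proof.
by move=> /(_ z) + Cz; rewrite Cz; case: (r z) => //= p [/Pt_tag[a ->]]; exists a.
Qed.

Lemma plist_whynot_None n (L : sequent n) x : whynots L x = None -> plist L x = None.
Proof. by rewrite whynotsE; case: plist. Qed.

(** * Cliques for promotion *)

Section BangRule.
Variables (n : nat) (x : nat) (A : formula n) (L : sequent n) (P : term n).
Hypotheses (Lx : whynots L x = None) (dP : der P (pset (whynots L) x A)).

(** The clause of [denot] for promotion, named so that a witness [T] can be chosen for each point of
    a set. *)
Definition promotes (X : hcohs n) (T : env X -> Prop) (r : env X) :=
  [/\ finite_set T, T `<=` @denot _ P X,
        exists2 c : rweb (interp (Bang A)) X, r x = Some (Pt c)
          & sval c = [set a | exists2 t, T t & t x = Some (Pt a)]
      & forall z, z <> x ->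
          match plist L z with
          | Some B => exists2 c : rweb (interp (WhyNot B)) X, r z = Some (Pt c)
              & sval c = [set b | exists2 t, T t &
                  exists2 d : rweb (interp (WhyNot B)) X,
                    t z = Some (Pt d) & sval d b]
          | None => r z = None
          end].

Lemma premise_pt (X : hcohs n) (t : env X) : denot P t -> exists a, t x = Some (Pt (A := A) a).
Proof. by move=> /(denot_typed dP)/etyped_pt; apply; rewrite psetE. Qed.

Lemma premise_whynot (X : hcohs n) (t : env X) z B : denot P t -> plist L z = Some B ->
  exists d, t z = Some (Pt (A := WhyNot B) d).
Proof.
move=> /(denot_typed dP)/etyped_pt h Lz; apply: h; rewrite /pset.
by case: eqP => [zx|_]; [move: (plist_whynot_None Lx); rewrite -zx Lz | exact: plist_whynots].
Qed.

Lemma plist_neq z B : plist L z = Some B -> z <> x.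
Proof. by move=> Lz zx; move: (plist_whynot_None Lx); rewrite -zx Lz. Qed.

Lemma promotes_whynot (X : hcohs n) T (r : env X) z B : promotes T r -> plist L z = Some B ->
  exists2 c : rweb (interp (WhyNot B)) X, r z = Some (Pt c)
              & sval c = [set b | exists2 t, T t &
                  exists2 d : rweb (interp (WhyNot B)) X,
                    t z = Some (Pt d) & sval d b].
Proof. by case=> _ _ _ h Lz; have := h z (plist_neq Lz); rewrite Lz. Qed.

Hypothesis cP : clique_family P (pset (whynots L) x A).

Lemma promotion_coherence (X : hcohs n) (U : env X -> Prop) : fin_ne U ->
  (forall t, U t -> denot P t) ->
  (forall z B, plist L z = Some B ->
     ~ strict_coh (rstr (interp (WhyNot B)) X) (eproj z (WhyNot B) U)) ->
  (forall t t', U t -> U t' -> t = t') \/ strict_coh (rstr (interp A) X) (eproj x A U).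
Proof.
move=> fU Ud nU; have [?|[z [B [Cz sz]]]] := cP fU Ud; first by left.
move: Cz sz; rewrite /pset; case: eqP => [->|zx] Cz sz; first by right; case: Cz sz => ->.
move: Cz; rewrite whynotsE; case Lz: (plist L z) => [K|] //= [KE].
by case: (nU z K Lz); rewrite KE.
Qed.

(** Strict coherence at a context formula of the conclusion is enough, so it is assumed to fail.
    Then coherence at the promoted formula holds, and if all points have the same promoted clique
    they are shown to have the same context. *)
Lemma clique_bang : uniq (map fst L) ->
  clique_family (TBang x A L P) (pset (whynots L) x (Bang A)).
Proof.
move=> uL X S fS Sd.
have dB : der (TBang x A L P) (pset (whynots L) x (Bang A)) by [].
case: (pselect (exists z B, plist L z = Some B /\
    strict_coh (rstr (interp (WhyNot B)) X) (eproj z (WhyNot B) S))) => [[z [B [Lz sz]]]|nS].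
  right; exists z, (WhyNot B); split=> //; rewrite /pset; case: eqP => [zx|_].
    by case: (plist_neq Lz).
  exact: plist_whynots.
have [|T TE] := @choose_on _ _ (fun _ => False) S (fun r (T : env X -> Prop) => promotes T r).
  by move=> r /Sd.
(* [U] selects points of the premise that meet every [T r]. A multisection of its projection at a
   context name is also one of the projection of [S], contexts being collected by union; hence [U]
   is not strictly coherent on the context. *)
have key (U : env X -> Prop) : U !=set0 ->
    (forall t, U t -> exists2 r, S r & T r t) ->
    (forall r, S r -> exists2 t, U t & T r t) ->
    (forall t t', U t -> U t' -> t = t') \/ strict_coh (rstr (interp A) X) (eproj x A U).
  move=> U0 U1 U2.
  have Ud t : U t -> denot P t by move=> /U1[r Sr Tt]; have [_ h _ _] := TE r Sr; exact: h.
  apply: promotion_coherence => //.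
    split=> //; apply: (@sub_finite_set _ _ (\bigcup_(r in S) T r)).
      by move=> t /U1[r Sr Tt]; exists r.
    by apply: bigcup_finite; [case: fS | move=> r Sr; have [] := TE r Sr].
  move=> z B Lz /strict_whynot[_ [M [fM [M1 M2] sM]]]; apply: nS; exists z, B; split=> //.
  have fz : fin_ne (eproj z (WhyNot B) S).
    apply: (denot_fin_ne fS dB Sd); rewrite /pset; case: eqP => [zx|_].
      by case: (plist_neq Lz).
    exact: plist_whynots.
  apply/strict_whynot; split=> //; exists M; split=> //; split=> [c [r Sr rc]|b Mb].
    have [c' rc' ce] := promotes_whynot (TE r Sr) Lz.
    move: rc'; rewrite rc => /Some_inj/Pt_inj cc'; rewrite -cc' in ce.
    have [t Ut Tt] := U2 r Sr; have [d td] := premise_whynot (Ud t Ut) Lz.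
    have [|b Mb db] := M1 d; first by exists t.
    by exists b => //; rewrite ce; exists t => //; exists d.
  have [d [t Ut td] db] := M2 b Mb; have [r Sr Tt] := U1 t Ut.
  have [c rc ce] := promotes_whynot (TE r Sr) Lz.
  by exists c; [exists r | rewrite ce; exists t => //; exists d].
have fx : fin_ne (eproj x (Bang A) S) by apply: (denot_fin_ne fS dB Sd); rewrite psetE.
have rx r : S r -> exists2 c, r x = Some (Pt (A := Bang A) c) &
    sval c = [set a | exists2 t, T r t & t x = Some (Pt a)].
  by move=> Sr; have [] := TE r Sr.
(* A multisection [M] of the promoted cliques is the projection of the premise points lying over it,
   and [key] applies to these. *)
have cx : coh (rstr (interp (Bang A)) X) (eproj x (Bang A) S).
  split=> // M fM [M1 M2].
  pose U t := exists r a, [/\ S r, T r t, t x = Some (Pt (A := A) a) & M a].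
  have UM : eproj x A U = M.
    apply/seteqP; split=> [a [t [r [a' [Sr Tt ta Ma]]]]|a Ma].
      by rewrite ta => /Some_inj/Pt_inj <-.
    have [c [r Sr rc] ca] := M2 a Ma; have [c' rc' ce] := rx r Sr.
    move: rc'; rewrite rc => /Some_inj/Pt_inj cc'; move: ca; rewrite cc' ce => -[t Tt ta].
    by exists t => //; exists r, a.
  have M1' r : S r -> exists2 t, U t & T r t.
    move=> Sr; have [c rc ce] := rx r Sr; have [|a Ma] := M1 c; first by exists r.
    by rewrite ce => -[t Tt ta]; exists t => //; exists r, a.
  have [] := key U.
  - by case: fS => _ [r /M1'[t Ut _]]; exists t.
  - by move=> t [r [a [Sr Tt _ _]]]; exists r.
  - exact: M1'.
  - move=> h; apply: coh_subsingleton => // a b; rewrite -UM => -[t Ut ta] [t' Ut'].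
    by rewrite -(h t t') // ta => /Some_inj/Pt_inj.
  - by rewrite UM; case.
case: (pselect (forall c c', eproj x (Bang A) S c -> eproj x (Bang A) S c' -> c = c')) => sx;
  last by right; exists x, (Bang A); rewrite psetE; split=> //; apply/strict_cohP.
(* All promoted cliques being equal, each [T r0] has points over a fixed [a]. By [key] they all
   coincide, since their projection at [x] is a singleton; the one which contributes [b] to [r]
   therefore contributes it to [r']. *)
have sub z B (c c' : rweb (interp (WhyNot B)) X) r r' (b : rweb (interp B) X) : plist L z = Some B -> S r -> S r' ->
    r z = Some (Pt (A := WhyNot B) c) -> r' z = Some (Pt c') -> sval c b -> sval c' b.
  move=> Lz Sr Sr' rc rc' cb.
  have [c1 rc1 ce] := promotes_whynot (TE r Sr) Lz.
  have [c1' rc1' ce'] := promotes_whynot (TE r' Sr') Lz.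
  move: rc1; rewrite rc => /Some_inj/Pt_inj e; rewrite -e in ce.
  move: rc1'; rewrite rc' => /Some_inj/Pt_inj e'; rewrite -e' in ce'.
  move: cb; rewrite ce => -[t Tt [d td db]].
  have dPt t0 r0 : S r0 -> T r0 t0 -> denot P t0.
    by move=> Sr0 Tt0; have [_ h _ _] := TE r0 Sr0; exact: h.
  have [a ta] := premise_pt (dPt t r Sr Tt).
  pose U t0 := exists r0, [/\ S r0, T r0 t0 & t0 x = Some (Pt a)].
  have U2 r0 : S r0 -> exists2 t0, U t0 & T r0 t0.
    move=> Sr0; have [k rk ke] := rx r Sr; have [k0 rk0 ke0] := rx r0 Sr0.
    have kk : k = k0 by apply: sx; [exists r | exists r0].
    have : sval k0 a by rewrite -kk ke; exists t.
    by rewrite ke0 => -[t0 Tt0 ta0]; exists t0 => //; exists r0.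
  have [] := key U.
  - by exists t; exists r.
  - by move=> t0 [r0 [Sr0 Tt0 _]]; exists r0.
  - exact: U2.
  - move=> h; have [t' Ut' Tt'] := U2 r' Sr'.
    rewrite ce'; exists t' => //; exists d => //.
    by rewrite -(h t t') //; exists r.
  - move=> /strict_sub_false[] u v [t0 [r0 [_ _ tu]]]; rewrite tu => /Some_inj/Pt_inj <-.
    by move=> [t1 [r1 [_ _ tv]]]; rewrite tv => /Some_inj/Pt_inj <-.
left=> r r' Sr Sr'; apply: funext => z; case: (z =P x) => [->|zx].
  have [c rc _] := rx r Sr; have [c' rc' _] := rx r' Sr'; rewrite rc rc'.
  by rewrite (sx c c') //; [exists r | exists r'].
have [_ _ _ /(_ z zx)] := TE r Sr; have [_ _ _ /(_ z zx)] := TE r' Sr'.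
case Lz: (plist L z) => [B|]; last by move=> -> ->.
move=> [c' rc' _] [c rc _]; rewrite rc rc'; congr (Some (Pt _)); apply: sval_inj.
by apply/seteqP; split=> b; [exact: (sub z B c c' r r') | exact: (sub z B c' c r' r)].
Qed.

End BangRule.

(** * Cliques for the universal quantifier *)

Section AllRule.
Variables (n x : nat) (A : formula n.+1) (P : term n.+1) (C : context n).
Hypotheses (Cx : C x = None) (dP : der P (pset (ctx_wk C) x A)).
Hypothesis uP : uniform_denot P.

Lemma eact_eid m (X : hcohs m) (r : env X) : eact (eid X) r = r.
Proof.
by apply: funext => z; rewrite /eact; case: (r z) => //= -[B b]; rewrite /pact /= act_id_emb.
Qed.

(** [denot] asks for one representative of the class; uniformity of the premise spreads this to
    every point with that normal form, over any value of the bound parameter. Coherence in the trace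
    can only be tested in this second form. *)
Lemma denot_allE (X : hcohs n) (r : env X) : denot (TAll x A P) r <->
  exists (c : rweb (interp (All A)) X) (s : env X), [/\ s x = None, r = pset s x (Pt c) &
    forall (V : hcohs 1) (a : rweb (interp A) (ext X (V None))),
      nf_of (partial_f (interp A) X) (Y := V) a (sval c) ->
      denot P (pset (wk_env (V None) s) x (@Pt _ (ext X (V None)) A a))].
Proof.
split=> [[c [s [u [sx re cu h]]]]|[c [s [sx re h]]]].
  exists c, s; split=> // V a ac.
  have [g] := nf_of_all (functorial_partial (normal_interp A) X) ac cu.
  rewrite partial_hact => /actE <-.
  move: h => /(proj1 (uP (exte (eid X) (g None)) _)); rewrite eact_pset.
  by rewrite -/(wk_env (rep_base u None) s) eact_wk eact_eid.
have [u cu nu] := trace_rep (normal_interp A) c.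
exists c, s, u; split=> //; apply: (h (rep_base u)).
apply: (nf_of_rep (functorial_partial (normal_interp A) X)) => //.
by have [] := svalP c.
Qed.

Lemma wk_None (X : hcohs n) (Z : hcoh) (s : env X) z : s z = None -> wk_env Z s z = None.
Proof. by rewrite /wk_env => ->. Qed.

Hypothesis cP : clique_family P (pset (ctx_wk C) x A).

Lemma clique_all : clique_family (TAll x A P) (pset C x (All A)).
Proof.
move=> X S fS Sd.
have dA : der (TAll x A P) (pset C x (All A)) by exists C.
case: (pselect (exists z B, [/\ z <> x, C z = Some B &
    strict_coh (rstr (interp B) X) (eproj z B S)])) => [[z [B [zx Cz sz]]]|nS].
  by right; exists z, B; split=> //; rewrite /pset; case: eqP.
have [|f fE] := @choose_on _ _ pempty S (fun r (s : env X) =>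
   exists c : rweb (interp (All A)) X, [/\ s x = None, r = pset s x (Pt c) &
    forall (V : hcohs 1) (a : rweb (interp A) (ext X (V None))),
      nf_of (partial_f (interp A) X) (Y := V) a (sval c) ->
      denot P (pset (wk_env (V None) s) x (@Pt _ (ext X (V None)) A a))]).
  by move=> r /Sd/denot_allE[c [s hs]]; exists s, c.
have nfU := nf_unique (normal_partial (normal_interp A) X).
(* [D] is a test set over [V] meeting the class of every point of [S]. Three outcomes: [D] is a
   singleton and the contexts agree, [D] is strictly coherent, or some element of [D] has a normal
   form foreign to [S]. The last one is impossible when [D] has exactly the normal forms of [S]. *)
have key (V : hcohs 1) (D : rweb (interp A) (ext X (V None)) -> Prop) : fin_ne D ->
    (forall r c, S r -> r x = Some (Pt (A := All A) c) ->
       exists2 a, D a & nf_of (partial_f (interp A) X) (Y := V) a (sval c)) ->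
    ((forall a a', D a -> D a' -> a = a') /\
     (forall r c r' c' a a', S r -> r x = Some (Pt (A := All A) c) ->
        S r' -> r' x = Some (Pt (A := All A) c') ->
        D a -> nf_of (partial_f (interp A) X) (Y := V) a (sval c) ->
        D a' -> nf_of (partial_f (interp A) X) (Y := V) a' (sval c') -> f r = f r')) \/
    strict_coh (rstr (interp A) (ext X (V None))) D \/
    exists2 a, D a & forall r c, S r -> r x = Some (Pt (A := All A) c) ->
      ~ nf_of (partial_f (interp A) X) (Y := V) a (sval c).
  move=> fD SD.
  case: (pselect (exists2 a, D a & forall r c, S r -> r x = Some (Pt (A := All A) c) ->
      ~ nf_of (partial_f (interp A) X) (Y := V) a (sval c))) => [?|/forall2NP DS].
    by right; right.
  have {}DS a : D a -> exists r c, [/\ S r, r x = Some (Pt (A := All A) c)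
      & nf_of (partial_f (interp A) X) (Y := V) a (sval c)].
    move=> Da; have [//|/existsNP[r /existsNP[c /not_implyP[Sr /not_implyP[rc /contrapT ac]]]]] := DS a.
    by exists r, c.
  pose pt r a := pset (wk_env (V None) (f r)) x (@Pt _ (ext X (V None)) A a).
  pose U (t : env (ext X (V None))) := exists r c a, [/\ S r, r x = Some (Pt (A := All A) c), D a,
    nf_of (partial_f (interp A) X) (Y := V) a (sval c) & t = pt r a].
  have Ud t : U t -> denot P t.
    move=> [r [c [a [Sr rc Da ac ->]]]]; have [c' [fx re]] := fE r Sr; apply.
    have rc' : r x = Some (Pt c'). by rewrite [in LHS]re psetE.
    by move: rc; rewrite rc' => /Some_inj/Pt_inj ->.
  have fU : fin_ne U.
    split; last first.
      have [_ [a Da]] := fD; have [r [c [Sr rc ac]]] := DS a Da.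
      by exists (pt r a), r, c, a.
    apply: (@sub_finite_set _ _ ((fun p => pt p.1 p.2) @` (S `*` D))).
      by move=> t [r [c [a [Sr rc Da ac ->]]]]; exists (r, a).
    by apply/finite_image/finite_setX; [case: fS | case: fD].
  have Dx : eproj x A U = D.
    apply/seteqP; split=> [a [_ [r [c [b [Sr rc Db bc ->]]]]]|a Da].
      by rewrite /pt psetE => /Some_inj/Pt_inj <-.
    have [r [c [Sr rc ac]]] := DS a Da; exists (pt r a); last by rewrite /pt psetE.
    by exists r, c, a.
  have [h|[z [B [Bz sz]]]] := cP fU Ud.
    left; split.
      move=> a a' Da Da'; have [r [c [Sr rc ac]]] := DS a Da.
      have [r' [c' [Sr' rc' ac']]] := DS a' Da'.
      have : pt r a = pt r' a' by apply: h; [exists r, c, a | exists r', c', a'].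
      by move=> /(congr1 (fun g : pmap _ => g x)); rewrite /pt !psetE => /Some_inj/Pt_inj.
    move=> r c r' c' a a' Sr rc Sr' rc' Da ac Da' ac'.
    have e : pt r a = pt r' a' by apply: h; [exists r, c, a | exists r', c', a'].
    have [d [fx _ _]] := fE r Sr; have [d' [fx' _ _]] := fE r' Sr'.
    have [wf _] := pset_inj (wk_None _ fx) (wk_None _ fx') e.
    apply: funext => z; have := congr1 (fun g : pmap _ => g z) wf; rewrite /wk_env.
    by case: (f r z) (f r' z) => [p|] [p'|] //= /Some_inj/wk_pt_inj ->.
  case: (z =P x) => [zx|zx].
    by right; left; move: Bz sz; rewrite zx psetE => -[<-]; rewrite Dx.
  case: nS; move: Bz; rewrite /pset; case: eqP => // _.
  rewrite /ctx_wk; case Cz: (C z) => [K|] //= [KB].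
  exists z, K; split=> //; case: _ / KB sz => sz.
  pose ck (b : rweb (interp K) X) : rweb (interp (wk K)) (ext X (V None)) :=
    cast (F := wk_f (interp K)) (esym (interp_wk K)) (X := ext X (V None)) b.
  have wkP r a b : S r -> (pt r a z = Some (Pt (A := wk K) b)) <->
      exists2 b0, r z = Some (Pt b0) & b = ck b0.
    move=> Sr; have [d [_ re _]] := fE r Sr.
    have rz : r z = f r z by rewrite [in LHS]re /pset; case: eqP.
    have ez : pt r a z = wk_env (V None) (f r) z by rewrite /pt /pset; case: eqP.
    have [b1 rb] : exists b1, r z = Some (Pt (A := K) b1).
      apply: (etyped_pt (C := pset C x (All A))); first exact: (denot_typed dA (Sd r Sr)).
      by rewrite /pset; case: eqP.
    rewrite ez /wk_env -rz rb /=; split.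
      by move=> /Some_inj h; exists b1 => //; rewrite -(Pt_inj h).
    by move=> [b0 /Some_inj/Pt_inj -> ->].
  have e : eproj z (wk K) U = ck @` eproj z K S.
    apply/seteqP; split=> [b [_ [r [c [a [Sr rc Da ac ->]]]]]|_ [b0 [r Sr rb] <-]].
      by move=> /(wkP _ _ _ Sr)[b0 rb ->]; exists b0 => //; exists r.
    have [c [_ re _]] := fE r Sr; have rc : r x = Some (Pt c) by rewrite [in LHS]re psetE.
    have [a Da ac] := SD r c Sr rc.
    by exists (pt r a); [exists r, c, a | apply/(wkP _ _ _ Sr); exists b0].
  move: sz; rewrite e.
  exact: (proj1 (strict_coh_cast (F := wk_f (interp K)) (esym (interp_wk K)) _)).
have fx : fin_ne (eproj x (All A) S) by apply: (denot_fin_ne fS dA Sd); rewrite psetE.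
have cx : coh (rstr (interp (All A)) X) (eproj x (All A) S).
  split=> //; split.
  - exact: image_fin_ne.
  - by move=> _ [c _ <-]; have [] := svalP c.
  move=> V D fD DE.
  have [||[h _]|[sD|[a Da na]]] := key V D.
  - exact: fD.
  - move=> r c Sr rc.
    have : nf_set (partial_f (interp A) X) (Y := V) D (sval c).
      by rewrite DE; exists c => //; exists r.
    by case=> a Da ac; exists a.
  - exact: coh_subsingleton.
  - by case: sD.
  exfalso; have [N aN] := nf_exists (functorial_partial (normal_interp A) X)
    (nrm_fin (normal_partial (normal_interp A) X)) (X := V) a.
  have : nf_set (partial_f (interp A) X) (Y := V) D N by exists a.
  by rewrite DE => -[c [r Sr rc] cN]; apply: (na r c Sr rc); rewrite cN.
case: (pselect (forall c c', eproj x (All A) S c -> eproj x (All A) S c' -> c = c')) => sx;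
  last by right; exists x, (All A); rewrite psetE; split=> //; apply/strict_cohP.
left=> r r' Sr Sr'.
have [c [fx' re _]] := fE r Sr; have [c' [fx'' re' _]] := fE r' Sr'.
have rc : r x = Some (Pt c) by rewrite [in LHS]re psetE.
have rc' : r' x = Some (Pt c') by rewrite [in LHS]re' psetE.
have cc : c = c' by apply: sx; [exists r | exists r'].
(* All points now have the same class [c]. Testing with the singleton of one representative excludes
   the last two outcomes of [key], and the first one equates the contexts. *)
have [u cu nu] := trace_rep (normal_interp A) c.
pose D := [set rep_point u].
have uc : nf_of (partial_f (interp A) X) (Y := rep_base u) (rep_point u) (sval c).
  apply: (nf_of_rep (functorial_partial (normal_interp A) X)) => //.
  by have [] := svalP c.
have [||[_ h]|[sD|[a Da na]]] := key (rep_base u) D.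
- exact: fin_ne1.
- move=> r0 c0 Sr0 rc0; exists (rep_point u) => //.
  by rewrite (sx c0 c) //; [exists r0 | exists r].
- rewrite re re' cc; congr (pset _ _ _); apply: (h r c r' c') => //.
  by rewrite -cc.
- by exfalso; apply: (strict_sub_false sD) => a b -> ->.
by exfalso; apply: (na r c) => //; rewrite Da.
Qed.
End AllRule.

(** * Uniformity *)

Section Uniformity.
Variable n : nat.
Implicit Types (X Y : hcohs n) (P Q : term n) (A B : formula n) (C D : context n).

Lemma eact_at X Y (f : embs X Y) (r : env X) z A b :
  eact f r z = Some (Pt (A := A) b) <-> exists2 a, r z = Some (Pt a) & act A f a = b.
Proof.
split=> [|[a ra <-]]; last by rewrite /eact ra.
rewrite /eact; case: (r z) => [[K k]|] //= /Some_inj e.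
have KA : K = A := congr1 tag e; move: b e; case: _ / KA => b e.
by exists k => //; exact: (Pt_inj e).
Qed.

Lemma eact_pset_inv X Y (f : embs X Y) (r : env X) (s : env Y) x A a :
  eact f r = pset s x (Pt (A := A) a) -> s x = None ->
  exists s' a', [/\ s' x = None, r = pset s' x (Pt a'), s = eact f s' & a = act A f a'].
Proof.
move=> e sx; have /eact_at[a' ra' aa'] : eact f r x = Some (Pt a) by rewrite e psetE.
exists (fun z => if z == x then None else r z), a'; split=> //.
- by rewrite eqxx.
- by apply: funext => z; rewrite /pset; case: eqP => [->|].
apply: funext => z; have := congr1 (fun h : pmap _ => h z) e.
by rewrite /eact /pset; case: eqP => [->|_ ->].
Qed.

Lemma eact_pjoin_inv X Y (f : embs X Y) (r : env X) (s t : env Y) :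
  eact f r = pjoin s t -> pdisjoint s t ->
  exists s' t', [/\ pdisjoint s' t', r = pjoin s' t', s = eact f s' & t = eact f t'].
Proof.
move=> e st; exists (fun z => if s z is Some _ then r z else None),
  (fun z => if s z is Some _ then None else r z).
split=> [z|||]; first by case: (s z); [right|left].
- by apply: funext => z; rewrite /pjoin; case: (s z); case: (r z).
- apply: funext => z; have := congr1 (fun h : pmap _ => h z) e.
  by rewrite /eact /pjoin; case: (s z).
apply: funext => z; have := congr1 (fun h : pmap _ => h z) e; have := st z.
by rewrite /eact /pjoin; case: (s z) => [p|]; case: (t z) => [q|] //= [].
Qed.

Lemma eact_pempty_inv X Y (f : embs X Y) s : pempty = eact f s -> s = pempty.
Proof.
move=> e; apply: funext => z; have := congr1 (fun h : pmap _ => h z) e.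
by rewrite /eact /pempty; case: (s z).
Qed.

Lemma eact_pdisjoint X Y (f : embs X Y) s t :
  pdisjoint (eact f s) (eact f t) <-> pdisjoint s t.
Proof. by split=> h z; have := h z; rewrite !eact_None. Qed.

Lemma uniform_link x y A : uniform_denot (Link x y A).
Proof.
move=> X Y f r; split=> [[a ->]|[b e]].
  by exists (act A f a); rewrite !eact_pset act_dual.
case: (x =P y) => [xy|xy].
  have e' : eact f r = pset pempty x (Pt b).
    by rewrite e xy; apply: funext => z; rewrite /pset; case: eqP.
  have [s [a [sx re se _]]] := eact_pset_inv e' erefl; exists a.
  by rewrite re xy (eact_pempty_inv se); apply: funext => z; rewrite /pset; case: eqP.
have [|s [a [sx re se ba]]] := eact_pset_inv e; first by rewrite /pset; case: eqP.
have [s' [a' [sy se' s'e aa']]] := eact_pset_inv (esym se) erefl.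
have s'0 := eact_pempty_inv s'e.
have a'a : a' = dual_pt a.
  by apply: (@act_inj _ _ _ _ f); rewrite -aa' act_dual ba.
by exists a; rewrite re se' s'0 a'a.
Qed.

Lemma uniform_one x : uniform_denot (TOne n x).
Proof.
move=> X Y f r; split=> [->|e]; first by rewrite /= eact_pset act_one.
have [s [[] [sx re se _]]] := eact_pset_inv e erefl; by rewrite /= re (eact_pempty_inv se).
Qed.

Lemma uniform_bot x P : uniform_denot P -> uniform_denot (TBot x P).
Proof.
move=> uP X Y f r; split=> [[s [sx -> h]]|[t [tx e h]]].
  exists (eact f s); split; [exact/eact_None | | exact: (proj1 (uP _ _ _ _))].
  by rewrite eact_pset act_bot.
have [s [[] [sx re se _]]] := eact_pset_inv e tx; exists s; split=> //.
by apply/(uP _ _ f); rewrite -se.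
Qed.

Lemma uniform_cut x A P Q C D : C x = None -> D x = None ->
  der P (pset C x A) -> der Q (pset D x (dual A)) ->
  clique_family P (pset C x A) -> clique_family Q (pset D x (dual A)) ->
  uniform_denot P -> uniform_denot Q -> uniform_denot (Cut x A P Q).
Proof.
move=> Cx Dx dP dQ cP cQ uP uQ X Y f r; split.
  move=> [a [s [t [[sx tx st ->] [hP hQ]]]]].
  exists (act A f a), (eact f s), (eact f t); split.
    by split; [exact/eact_None | exact/eact_None | exact/eact_pdisjoint | exact: eact_pjoin].
  by rewrite -act_dual -!eact_pset; split; [exact: (proj1 (uP _ _ _ _)) | exact: (proj1 (uQ _ _ _ _))].
move=> [a [s [t [[sx tx st e] [hP hQ]]]]].
have [s' [t' [st' re se te]]] := eact_pjoin_inv e st.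
have [Z [i [j [ij ijf]]]] := amalgam f.
(* [m] stands for [i] and for [j]. Both agree on what comes from [X], in particular on the contexts
   [s] and [t], so that the two images of the premises can differ at the cut point only. *)
have h m : (forall r, eact m (eact f r) = eact i (eact f r)) ->
    denot P (pset (eact i s) x (Pt (act A m a))) /\
    denot Q (pset (eact i t) x (Pt (dual_pt (act A m a)))).
  move=> mi; rewrite se te -!mi -se -te -act_dual -!eact_pset.
  by split; [exact: (proj1 (uP _ _ _ _)) | exact: (proj1 (uQ _ _ _ _))].
have [Pi Qi] := h i (fun _ => erefl).
have [Pj Qj] := h j (fun r => etrans (esym (eact_cmp j f r)) (etrans
  (congr1 (fun g => eact g r) (esym ij)) (eact_cmp i f r))).
have ia : act A i a = act A j a.
  have [//|sA] := eq_or_strict cP (psetE _ _ _) Pi Pj.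
  have [/dual_pt_inj//|sD] := eq_or_strict cQ (psetE _ _ _) Qi Qj.
  exfalso; move: sD; rewrite -[X in strict_coh _ X]/([set _; _]).
  rewrite (_ : [set _; _] = @dual_pt n Z A @` [set act A i a; act A j a]).
    by move=> /strict_dual/strict_perp[_]; apply; case: sA.
  by rewrite image_setU !image_set1.
have [a0 a0a] := act_amalgam ijf ia.
exists a0, s', t'; split.
  by split=> //; [move: sx; rewrite se => /eact_None | move: tx; rewrite te => /eact_None].
split; [apply/(uP _ _ f) | apply/(uQ _ _ f)]; rewrite eact_pset.
  by rewrite -se a0a.
by rewrite act_dual a0a -te.
Qed.

Lemma uniform_tensor x A B P Q : uniform_denot P -> uniform_denot Q ->
  uniform_denot (TTensor x A B P Q).
Proof.
move=> uP uQ X Y f r; split.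
  move=> [a [b [s [t [[sx tx st ->] [hP hQ]]]]]].
  exists (act A f a), (act B f b), (eact f s), (eact f t); split.
    split; [exact/eact_None | exact/eact_None | exact/eact_pdisjoint|].
    by rewrite eact_pset eact_pjoin act_tensor.
  by rewrite -!eact_pset; split; [exact: (proj1 (uP _ _ _ _)) | exact: (proj1 (uQ _ _ _ _))].
move=> [a [b [s [t [[sx tx st e] [hP hQ]]]]]].
have [|r' [[a' b'] [rx re se]]] := eact_pset_inv e; first by rewrite /pjoin sx.
rewrite act_tensor => -[ae be].
have [s' [t' [st' re' se' te']]] := eact_pjoin_inv (esym se) st.
exists a', b', s', t'; split.
  split=> //; [by move: sx; rewrite se' => /eact_None | by move: tx; rewrite te' => /eact_None|].
  by rewrite re re'.
split; [apply/(uP _ _ f) | apply/(uQ _ _ f)]; rewrite eact_pset.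
  by rewrite -se' -ae.
by rewrite -te' -be.
Qed.

Lemma uniform_par x y A B P : x <> y -> uniform_denot P -> uniform_denot (TPar x y A B P).
Proof.
move=> xy uP X Y f r; split.
  move=> [a [b [s [sx sy -> hP]]]].
  exists (act A f a), (act B f b), (eact f s).
  split; [exact/eact_None | exact/eact_None | by rewrite eact_pset act_par|].
  by rewrite -!eact_pset; exact: (proj1 (uP _ _ _ _)).
move=> [a [b [s [sx sy e hP]]]].
have [s' [[a' b'] [rx re se]]] := eact_pset_inv e sx; rewrite act_par => -[ae be].
exists a', b', s'; split=> //; first by move: sy; rewrite se => /eact_None.
by apply/(uP _ _ f); rewrite !eact_pset -se -ae -be.
Qed.

(** The third hypothesis carries the content: the active point of the premise must come from [X]
    when the conclusion does. It is read off the principal point for plus and dereliction, and takes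
    an amalgam for the existential. *)
Lemma uniform_unary x A B P Q (R : forall X, rweb (interp A) X -> rweb (interp B) X -> Prop) :
  (forall X r, denot Q (X := X) r <-> exists a b s,
     [/\ s x = None, r = pset s x (Pt b), R X a b & denot P (pset s x (Pt a))]) ->
  (forall X Y (f : embs X Y) a b, R X a b -> R Y (act A f a) (act B f b)) ->
  (forall X Y (f : embs X Y) s a b, R Y a (act B f b) ->
     denot P (pset (eact f s) x (Pt a)) -> exists2 a0, act A f a0 = a & R X a0 b) ->
  uniform_denot P -> uniform_denot Q.
Proof.
move=> QE R1 R2 uP X Y f r; rewrite !QE; split=> [[a [b [s [sx -> Rab h]]]]|].
  exists (act A f a), (act B f b), (eact f s); split; [exact/eact_None | exact: eact_pset | exact: R1 |].
  by rewrite -eact_pset; exact: (proj1 (uP _ _ _ _)).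
move=> [a [b [s [sx e Rab h]]]]; have [s' [b' [s'x re se be]]] := eact_pset_inv e sx.
rewrite be in Rab; rewrite se in h; have [a' aa' Rab'] := R2 _ _ _ _ _ _ Rab h.
exists a', b', s'; split=> //; apply/(uP _ _ f).
by rewrite eact_pset aa'.
Qed.

Lemma uniform_plus1 x A B P : uniform_denot P -> uniform_denot (TPlus1 x A B P).
Proof.
apply: (@uniform_unary x A (Plus A B) P _ (fun X a b => b = inl a)).
- move=> X r; split=> [[a [s [sx re h]]]|[a [b [s [sx -> -> h]]]]]; first by exists a, (inl a), s.
  by exists a, s.
- by move=> X Y f a b ->; rewrite act_plus1.
move=> X Y f s a [b|b]; rewrite ?act_plus1 ?act_plus2 // => -[<-] _.
by exists b.
Qed.

Lemma uniform_plus2 x A B P : uniform_denot P -> uniform_denot (TPlus2 x A B P).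
Proof.
apply: (@uniform_unary x B (Plus A B) P _ (fun X a b => b = inr a)).
- move=> X r; split=> [[a [s [sx re h]]]|[a [b [s [sx -> -> h]]]]]; first by exists a, (inr a), s.
  by exists a, s.
- by move=> X Y f a b ->; rewrite act_plus2.
move=> X Y f s a [b|b]; rewrite ?act_plus1 ?act_plus2 // => -[<-] _.
by exists b.
Qed.

Lemma uniform_with x A B P Q : uniform_denot P -> uniform_denot Q ->
  uniform_denot (TWith x A B P Q).
Proof.
move=> uP uQ X Y f r.
split=> -[] [a [s [sx e h]]].
- left; exists (act A f a), (eact f s); split; [exact/eact_None | by rewrite e eact_pset act_with1 |].
  by rewrite -eact_pset; exact: (proj1 (uP _ _ _ _)).
- right; exists (act B f a), (eact f s); split; [exact/eact_None | by rewrite e eact_pset act_with2 |].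
  by rewrite -eact_pset; exact: (proj1 (uQ _ _ _ _)).
- left; have [s' [[a'|a'] [s'x re se]]] := eact_pset_inv e sx;
    rewrite ?act_with1 ?act_with2 // => -[ae]; exists a', s'; split=> //.
  by apply/(uP _ _ f); rewrite eact_pset -se -ae.
- right; have [s' [[a'|a'] [s'x re se]]] := eact_pset_inv e sx;
    rewrite ?act_with1 ?act_with2 // => -[ae]; exists a', s'; split=> //.
  by apply/(uQ _ _ f); rewrite eact_pset -se -ae.
Qed.

Lemma uniform_der x A P : uniform_denot P -> uniform_denot (TDer x A P).
Proof.
apply: (@uniform_unary x A (WhyNot A) P _
  (fun X a (c : rweb (interp (WhyNot A)) X) => sval c = [set a])).
- by move=> X r.
- by move=> X Y f a b ba; rewrite act_whynot ba image_set1.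
move=> X Y f s a b; rewrite act_whynot => ba _.
have [a0 ba0 a0a] : (act A f @` sval b) a by rewrite ba.
exists a0 => //; apply: (image_inj_eq (@act_inj _ _ _ _ f)).
by rewrite ba image_set1 a0a.
Qed.

Lemma uniform_weak x A P : uniform_denot P -> uniform_denot (TWeak x A P).
Proof.
move=> uP X Y f r; split=> [[c [s [sx -> c0 h]]]|[c [s [sx e c0 h]]]].
  exists (act (WhyNot A) f c), (eact f s); split; [exact/eact_None | exact: eact_pset | |exact: (proj1 (uP _ _ _ _))].
  by rewrite act_whynot c0 image_set0.
have [s' [c' [s'x re se ce]]] := eact_pset_inv e sx; exists c', s'; split=> //.
  apply: (image_inj_eq (@act_inj _ A _ _ f)); rewrite image_set0 -act_whynot -ce; exact: c0.
by apply/(uP _ _ f); rewrite -se.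
Qed.

Lemma bang_web_lift (H K : hcoh) (e : emb H K) (d : bang_web (str K)) :
  (forall b, sval d b -> exists a, e a = b) ->
  exists c : bang_web (str H), sval d = e @` sval c.
Proof.
move=> de; pose c := [set a | sval d (e a)].
have dE : sval d = e @` c.
  by apply/seteqP; split=> [b db|_ [a ca <-] //]; have [a ab] := de b db; exists a; rewrite /c /= ?ab.
have cP : finite_set c /\ clique (X := Hcoh (str H)) c.
  have [fd cd] := svalP d; rewrite dE in fd cd; split; last exact: (proj2 (clique_image e c) cd).
  by have /eq_finite_set <- := inj_card_eq (A := c) (in2W (@emb_inj _ _ e)).
by exists (exist _ c cP).
Qed.

Lemma act_whynot_lift X Y (f : embs X Y) A (d : rweb (interp (WhyNot A)) Y) :
  (forall b, sval d b -> exists a, act A f a = b) ->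
  exists c, act (WhyNot A) f c = d.
Proof.
pose e : emb (Hcoh (hperp (rstr (interp A) X))) (Hcoh (hperp (rstr (interp A) Y))) :=
  @Emb (Hcoh (hperp (rstr (interp A) X))) (Hcoh (hperp (rstr (interp A) Y))) (act A f)
   (@act_inj _ _ _ _ f)
   (fun S => perp_coh_image (@act_inj _ _ _ _ f) (emb_coh (act A f) S)).
move=> /(@bang_web_lift _ _ e)[c dc]; exists c.
by apply: sval_inj; rewrite act_whynot dc.
Qed.

Lemma uniform_contr x y A P : x <> y -> uniform_denot P -> uniform_denot (TContr x y A P).
Proof.
move=> xy uP X Y f r; split.
  move=> [c [d [e [s [[sx sy -> ce] h]]]]].
  exists (act _ f c), (act _ f d), (act _ f e), (eact f s); split.
    split; [exact/eact_None | exact/eact_None | exact: eact_pset |].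
    by rewrite !act_whynot ce image_setU.
  by rewrite -!eact_pset; exact: (proj1 (uP _ _ _ _)).
move=> [c [d [e [s [[sx sy re ce] h]]]]].
have [s' [e' [s'x re' se ee]]] := eact_pset_inv re sx.
rewrite ee act_whynot in ce.
have [c' cc'] : exists c', act (WhyNot A) f c' = c.
  apply: act_whynot_lift => b cb; have [a _ <-] : (act A f @` sval e') b by rewrite ce; left.
  by exists a.
have [d' dd'] : exists d', act (WhyNot A) f d' = d.
  apply: act_whynot_lift => b cb; have [a _ <-] : (act A f @` sval e') b by rewrite ce; right.
  by exists a.
exists c', d', e', s'; split.
  split=> //; first by move: sy; rewrite se => /eact_None.
  apply: (image_inj_eq (@act_inj _ A _ _ f)).
  by rewrite image_setU -!act_whynot cc' dd' act_whynot.
by apply/(uP _ _ f); rewrite !eact_pset cc' dd' -se.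
Qed.

End Uniformity.

Lemma rep_eta n (F : rawfun n) (u : rep F) : existT _ (projT1 u) (rep_point u) = u.
Proof. by case: u. Qed.

Section Uniformity.
Variable n : nat.
Implicit Types (X Y : hcohs n) (P Q : term n) (B : formula n) (C D : context n).

(** Instances move both the free parameters and the value of the bound one. The action is factored
    as [f] on the former followed by [act B f] on the latter, and only the first factor changes the
    class. *)
Lemma nf_of_inst (A : formula n.+1) B X Y (f : embs X Y) (a : rweb (interp (inst A B)) X) N :
  nf_of (partial_f (interp A) X) (inst_pt a) N ->
  nf_of (partial_f (interp A) Y) (inst_pt (act (inst A B) f a)) (nfim (G := interp A) f N).
Proof.
have nA := normal_interp A; have fA := nrm_fn nA.
have h := act_inst f a.
have e : exte f (act B f) = ecmp (exte (eid Y) (act B f)) (exte f (emb_id (robj (interp B) X))).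
  by rewrite ecmp_exte ecmp_1m emb_m1.
move: h; rewrite e => /(hact_cmp fA)[b ab ba].
move=> /(nfim_nf nA ab) bN.
apply: (nf_of_hact (functorial_partial nA Y) (f := fun=> act B f) _ bN).
by rewrite partial_hact.
Qed.

(** As for cuts, the witness [a] is compared with itself in an amalgam. Its two images have the same
    normal form, a coherent singleton in the trace of the dual, so they cannot form a strictly
    coherent set and must be equal. Injectivity of [nfim] then returns the class over [X]. *)
Lemma uniform_ex x (A : formula n.+1) B P C : C x = None -> der P (pset C x (inst A B)) ->
  clique_family P (pset C x (inst A B)) -> uniform_denot P -> uniform_denot (TEx x A B P).
Proof.
move=> Cx dP cP uP.
have nA := normal_interp A.
apply: (@uniform_unary n x (inst A B) (Ex A) P _
  (fun X a (c : rweb (interp (Ex A)) X) =>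
     nf_of (partial_f (interp A) X) (inst_pt a) (sval c))) => //.
  by move=> X Y f a c ac; rewrite act_ex; exact: nf_of_inst.
move=> X Y f s a c; rewrite act_ex => ac hP.
have [Z [i [j [ij ijf]]]] := amalgam f.
have h m : (forall r, eact m (eact f r) = eact i (eact f r)) ->
    denot P (pset (eact i (eact f s)) x (Pt (act (inst A B) m a))).
  by move=> mi; rewrite -mi -eact_pset; exact: (proj1 (uP _ _ _ _)).
have Pi := h i (fun _ => erefl).
have Pj := h j (fun r => etrans (esym (eact_cmp j f r)) (etrans
  (congr1 (fun g => eact g r) (esym ij)) (eact_cmp i f r))).
have ia : act (inst A B) i a = act (inst A B) j a.
  have [//|sA] := eq_or_strict cP (psetE _ _ _) Pi Pj.
  pose N := nfim (G := interp A) (ecmp i f) (sval c).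
  have Ni : nf_of (partial_f (interp A) Z) (inst_pt (act (inst A B) i a)) N.
    by rewrite /N nfim_cmp //; exact: nf_of_inst.
  have Nj : nf_of (partial_f (interp A) Z) (inst_pt (act (inst A B) j a)) N.
    by rewrite /N ij nfim_cmp //; exact: nf_of_inst.
  have NE : N = sval (act (Ex A) (ecmp i f) c) by rewrite act_ex.
  have [_ [_ _ H]] := svalP (act (Ex A) (ecmp i f) c); rewrite -NE in H.
  pose S := @inst_pt n Z A B @` [set act (inst A B) i a; act (inst A B) j a].
  have [||_ []] := H (fun _ => robj (interp B) Z) S.
  - by apply: image_fin_ne; case: sA => /coh_fin_ne.
  - apply/seteqP; split=> [M [_ [b ab <-] bM]|_ ->].
      by case: ab bM => -> bM; [exact: (nf_unique (normal_partial nA Z) bM Ni)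
        | exact: (nf_unique (normal_partial nA Z) bM Nj)].
    by exists (inst_pt (act (inst A B) i a)) => //; exists (act (inst A B) i a) => //; left.
  exact: (proj2 (strict_coh_cast (interp_inst A B) _) sA).
have [a0 a0a] := act_amalgam ijf ia; exists a0 => //.
have [NN _] := svalP c.
have [M aM] := nf_exists (functorial_partial nA X) (nrm_fin (normal_partial nA X)) (inst_pt a0).
have fM := nf_of_inst f aM; rewrite a0a in fM.
have e := nf_unique (normal_partial nA Y) fM ac.
by rewrite -(nfim_inj nA _ NN e) //; case: aM.
Qed.

Lemma uniform_all x (A : formula n.+1) (P : term n.+1) :
  uniform_denot P -> uniform_denot (TAll x A P).
Proof.
move=> uP X Y f r; have nA := normal_interp A; split.
  move=> [c [s [u [sx -> cu h]]]].
  have [y uy] := hact_total (nrm_fn nA) (exte f (emb_id (rep_base u None))) (rep_point u).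
  exists (act (All A) f c), (eact f s), (existT _ (projT1 u) y); split.
  - exact/eact_None.
  - exact: eact_pset.
  - rewrite act_all; exists (rep_point u) => //.
    exact: (eq_ind_r (sval c) cu (rep_eta u)).
  have := proj1 (uP _ _ (exte f (emb_id (rep_base u None))) _) h.
  rewrite eact_pset -/(wk_env (rep_base u None) s) eact_wk.
  by move/actE: uy => ->.
move=> [c [s [u [sx e cu h]]]].
have [s' [c' [s'x re se ce]]] := eact_pset_inv e sx.
move: cu; rewrite ce act_all => -[z cz zu].
exists c', s', (existT _ (projT1 u) z); split=> //.
apply/(uP _ _ (exte f (emb_id (rep_base u None)))).
rewrite eact_pset -/(wk_env (rep_base u None) s') eact_wk -se.
by move/actE: zu => ->.
Qed.

(** * Uniformity of promotion *)

Section Bang.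
Variables (x : nat) (A : formula n) (L : sequent n) (P : term n).
Hypotheses (Lx : whynots L x = None) (dP : der P (pset (whynots L) x A)).
Hypothesis uP : uniform_denot P.

Lemma eact_collect X Y (f : embs X Y) (T : env X -> Prop) z B (a : rweb (interp B) Y) :
  (exists2 t, (eact f @` T) t & t z = Some (Pt a)) <->
  (act B f @` [set a0 | exists2 t, T t & t z = Some (Pt a0)]) a.
Proof.
split=> [[_ [t Tt <-] /eact_at[a0 ta <-]]|[a0 [t Tt ta] <-]]; first by exists a0 => //; exists t.
by exists (eact f t); [exists t | apply/eact_at; exists a0].
Qed.

Lemma eact_union X Y (f : embs X Y) (T : env X -> Prop) z B (b : rweb (interp B) Y) :
  (exists2 t, (eact f @` T) t & exists2 d : rweb (interp (WhyNot B)) Y,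
     t z = Some (Pt d) & sval d b) <->
  (act B f @` [set b0 | exists2 t, T t & exists2 d : rweb (interp (WhyNot B)) X,
     t z = Some (Pt d) & sval d b0]) b.
Proof.
split=> [[_ [t Tt <-] [d /eact_at[d0 td <-]]]|[b0 [t Tt [d td db]] <-]].
  by rewrite act_whynot => -[b0 db <-]; exists b0 => //; exists t => //; exists d0.
exists (eact f t); first by exists t.
exists (act (WhyNot B) f d); first by apply/eact_at; exists d.
by rewrite act_whynot; exists b0.
Qed.

Lemma promotes_eact X Y (f : embs X Y) (T : env X -> Prop) (r : env X) :
  promotes x A L P (eact f @` T) (eact f r) <-> promotes x A L P T r.
Proof.
split=> -[fT TP [c rc ce] h]; split.
- by have /eq_finite_set <- := inj_card_eq (A := T) (in2W (@eact_inj _ _ _ f)).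
- by move=> t Tt; apply/(uP f)/TP; exists t.
- move: rc => /eact_at[c0 rc cc]; exists c0 => //.
  apply: (image_inj_eq (@act_inj _ A _ _ f)); rewrite -act_bang cc ce.
  by apply/seteqP; split=> a /eact_collect.
- move=> z /h; case: (plist L z) => [B|/eact_None //] [d /eact_at[d0 rd dd] de].
  exists d0 => //; apply: (image_inj_eq (@act_inj _ B _ _ f)); rewrite -act_whynot dd de.
  by apply/seteqP; split=> a /eact_union.
- exact: finite_image.
- by move=> _ [t Tt <-]; exact (proj1 (uP f t) (TP t Tt)).
- exists (act (Bang A) f c); first by apply/eact_at; exists c.
  by rewrite act_bang ce; apply/seteqP; split=> a /eact_collect.
- move=> z /h; case: (plist L z) => [B|/eact_None //] [d rd de].
  exists (act (WhyNot B) f d); first by apply/eact_at; exists d.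
  by rewrite act_whynot de; apply/seteqP; split=> a /eact_union.
Qed.

(** Every point of [T] has its components inside the finite cliques of the conclusion. As these come
    from [X], so does each element, and [T] is the image of its inverse image. *)
Lemma uniform_bang : uniform_denot (TBang x A L P).
Proof.
move=> X Y f r; split=> [[T TE]|[T TE]]; first by exists (eact f @` T); exact/promotes_eact.
pose T0 t := T (eact f t).
suff TT : T = eact f @` T0 by exists T0; apply/(promotes_eact f); rewrite -TT.
apply/seteqP; split=> [t Tt|_ [t Tt <-] //].
suff [t0 t0t] : exists t0, eact f t0 = t by exists t0 => //; rewrite /T0 t0t.
have pt : denot P t by have [_ h _ _] := TE; exact: h.
have /choice[t0 t0E] : forall z, exists o, omap (pact f) o = t z.
  move=> z; case: (z =P x) => [->|zx].
    have [a ta] := premise_pt dP pt; have [_ _ [c rc ce] _] := TE.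
    move: rc => /eact_at[c0 rc cc].
    have : sval c a by rewrite ce; exists t.
    rewrite -cc act_bang => -[a0 _ a0a]; exists (Some (Pt a0)).
    by rewrite ta -a0a.
  case Lz: (plist L z) => [B|].
    have [d td] := premise_whynot Lx dP pt Lz.
    have [c rc ce] := promotes_whynot Lx TE Lz; move: rc => /eact_at[c0 rc cc].
    have [d0 d0d] : exists d0, act (WhyNot B) f d0 = d.
      apply: act_whynot_lift => b db.
      have : sval c b by rewrite ce; exists t => //; exists d.
      by rewrite -cc act_whynot => -[b0 _ b0b]; exists b0.
    by exists (Some (Pt d0)); rewrite td -d0d.
  exists None; have := denot_typed dP pt z; rewrite /pset; case: eqP => // _.
  by rewrite whynotsE Lz; case: (t z).
by exists t0; apply: funext.
Qed.

End Bang.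
End Uniformity.

(** Neither half can be proved alone: see [clique_all] for the use of uniformity, [uniform_cut] and
    [uniform_ex] for the use of cliques. *)
Theorem denot_sound n (P : term n) C : der P C -> uniform_denot P /\ clique_family P C.
Proof.
elim: P C => {n} /=.
- by move=> n x y A C [xy ->]; split; [exact: uniform_link | exact: clique_link].
- move=> n x A P IHP Q IHQ _ [C [D [[Cx Dx CD ->] [dP dQ]]]].
  have [uP cP] := IHP _ dP; have [uQ cQ] := IHQ _ dQ.
  by split; [exact: (uniform_cut Cx Dx dP dQ) | exact: clique_cut].
- by move=> n x _ ->; split; [exact: uniform_one | exact: clique_one].
- move=> n x P IHP _ [C [Cx -> dP]]; have [uP cP] := IHP _ dP.
  by split; [exact: uniform_bot | exact: clique_bot].
- move=> n x A B P IHP Q IHQ _ [C [D [[Cx Dx CD ->] [dP dQ]]]].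
  have [uP cP] := IHP _ dP; have [uQ cQ] := IHQ _ dQ.
  by split; [exact: uniform_tensor | exact: clique_tensor].
- move=> n x y A B P IHP _ [C [[Cx Cy xy ->] dP]]; have [uP cP] := IHP _ dP.
  by split; [exact: uniform_par | exact: clique_par].
- move=> n x A B P IHP _ [C [Cx -> dP]]; have [uP cP] := IHP _ dP.
  by split; [exact: uniform_plus1 | exact: clique_plus1].
- move=> n x A B P IHP _ [C [Cx -> dP]]; have [uP cP] := IHP _ dP.
  by split; [exact: uniform_plus2 | exact: clique_plus2].
- move=> n x A B P IHP Q IHQ _ [C [Cx -> dP dQ]].
  have [uP cP] := IHP _ dP; have [uQ cQ] := IHQ _ dQ.
  by split; [exact: uniform_with | exact: clique_with].
- move=> n x L C _; split; first by move=> X Y f r.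
  by move=> X S [_ [r Sr]] /(_ r Sr).
- move=> n x A L P IHP _ [Lx uL -> dP]; have [uP cP] := IHP _ dP.
  by split; [exact: uniform_bang | exact: clique_bang].
- move=> n x A P IHP _ [C [Cx -> dP]]; have [uP cP] := IHP _ dP.
  by split; [exact: uniform_der | exact: clique_der].
- move=> n x A P IHP _ [C [Cx -> dP]]; have [uP cP] := IHP _ dP.
  by split; [exact: uniform_weak | exact: clique_weak].
- move=> n x y A P IHP _ [C [[Cx Cy xy ->] dP]]; have [uP cP] := IHP _ dP.
  by split; [exact: uniform_contr | exact: clique_contr].
- move=> n x A P IHP _ [C [Cx -> dP]]; have [uP cP] := IHP _ dP.
  by split; [exact: uniform_all | exact: clique_all].
- move=> n x A B P IHP _ [C [Cx -> dP]]; have [uP cP] := IHP _ dP.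
  by split; [exact: (uniform_ex Cx dP) | exact: clique_ex].
Qed.

(** * From environments to points of the iterated par *)

Section Sequents.
Variable n : nat.
Implicit Types (L : sequent n) (A : formula n).

Lemma env_list_None (X : hcohs n) x A L (a : rweb (interp (par_list A L)) X) z :
  z \notin x :: map fst L -> env_list x a z = None.
Proof.
elim: L x A a => [|[y B] L IH] x A a /=; rewrite in_cons negb_or => /andP[zx zL].
  by rewrite /pset (negbTE zx).
by rewrite /pset (negbTE zx); exact: IH.
Qed.

Lemma env_list_inj (X : hcohs n) x A L : uniq (x :: map fst L) ->
  injective (@env_list n X x A L).
Proof.
elim: L x A => [|[y B] L IH] x A /=.
  by move=> _ a b /(pset_inj erefl erefl)[_ /Pt_inj].
move=> /andP[xL uL] [a b] [a' b'] /= e.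
have [e' /Pt_inj ->] := pset_inj (env_list_None b xL) (env_list_None b' xL) e.
by rewrite (IH _ _ uL _ _ e').
Qed.

(** By induction with [strict_par]: strict coherence of one component propagates through every par
    above it. *)
Lemma env_list_strict (X : hcohs n) x A L (S : rweb (interp (par_list A L)) X -> Prop) z B :
  fin_ne S -> pset (plist L) x A z = Some B ->
  strict_coh (rstr (interp B) X) (eproj z B (env_list x (L := L) (A := A) @` S)) ->
  strict_coh (rstr (interp (par_list A L)) X) S.
Proof.
elim: L x A S => [|[y K] L IH] x A S fS /=.
  rewrite {1}/pset {1}/pempty; case: eqP => // -> [AB]; case: _ / AB.
  rewrite (_ : eproj x A _ = S) //; apply/seteqP; split=> [a [_ [b Sb <-]]|a Sa].
    by rewrite /= psetE => /Some_inj/Pt_inj <-.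
  by exists (pset pempty x (Pt a)); [exists a | rewrite psetE].
case: (z =P x) => [-> |zx].
  rewrite psetE => -[AB]; case: _ / AB => sA; apply: strict_par => //; left.
  rewrite (_ : fst @` S = eproj x A (env_list x (L := (y, K) :: L) (A := A) @` S)) //.
  apply/seteqP; split=> [_ [[a b] Sab <-]|a [_ [[a' b] Sb <-]]].
    by exists (env_list x (L := (y, K) :: L) (A := A) (a, b)); [exists (a, b) | rewrite /= psetE].
  by rewrite /= psetE => /Some_inj/Pt_inj <-; exists (a', b).
rewrite {1}/pset; case: eqP => // _ Cz sB; apply: strict_par => //; right.
apply: (IH y K) => //; first exact: image_fin_ne.
rewrite (_ : eproj z B _ = eproj z B (env_list x (L := (y, K) :: L) (A := A) @` S)) //.
apply/seteqP; split=> [b [_ [_ [[a c] Sac <-] <-]] h|b [_ [[a c] Sac <-]] h].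
  exists (env_list x (L := (y, K) :: L) (A := A) (a, c)); first by exists (a, c).
  by rewrite /= /pset; case: eqP.
exists (env_list y c); first by exists c => //; exists (a, c).
by move: h; rewrite /= /pset; case: eqP.
Qed.

Lemma eact_env_list (X Y : hcohs n) (f : embs X Y) x A L (a : rweb (interp (par_list A L)) X) :
  eact f (env_list x a) = env_list x (act (par_list A L) f a).
Proof.
elim: L x A a => [|[y K] L IH] x A a /=; first exact: eact_pset.
by case: a => a b; rewrite /= eact_pset IH act_par.
Qed.

Lemma uniform_clique_denotation x A L (P : term n) : proves ((x, A) :: L) P ->
  uniform_clique_family (interp (par_list A L)) (denotation x A L P).
Proof.
move=> [/= uL /derives_der dP]; have [uP cP] := denot_sound dP.
split=> [X S fS Sd|X Y f a b /actE <-]; last first.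
  by rewrite /denotation /= -eact_env_list; exact: uP.
have [|h|[z [B [Bz sz]]]] := cP X (env_list x (A := A) (L := L) @` S) (image_fin_ne _ fS).
- by move=> _ [a Sa <-]; exact: Sd.
- apply: coh_subsingleton => // a b Sa Sb; apply: (env_list_inj uL).
  by apply: h; [exists a | exists b].
by have [] := env_list_strict fS Bz sz.
Qed.

End Sequents.

Lemma finite_denotations n x (A : formula n) : mall A ->
  finite_set [set d | exists P : term n,
    [/\ mall_term P, proves [:: (x, A)] P & d = denotation x A [::] P]].
Proof.
move=> mA; apply: sub_finite_set (finite_uniform_families
  (normal_variable (normal_interp A)) (weakly_finite_interp mA)).
by move=> _ [P [_ pP ->]]; exact: (uniform_clique_denotation pP).
Qed.

(** * Renaming *)

Lemma ctx_wk_inj n (C D : context n) : ctx_wk C = ctx_wk D -> C = D.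
Proof.
move=> e; apply: funext => z; have := congr1 (fun h : pmap _ => h z) e.
by rewrite /ctx_wk; case: (C z) (D z) => [A|] [B|] //= /Some_inj/wk_inj ->.
Qed.

Lemma ctx_wk_None n (C : context n) x : C x = None -> ctx_wk C x = None.
Proof. by rewrite /ctx_wk => ->. Qed.

(** Proof terms carry enough formulas to determine their sequent. It identifies the contexts
    obtained by inverting the two sides of a cut elimination step. *)
Lemma der_unique n (P : term n) C D : der P C -> der P D -> C = D.
Proof.
elim: P C D => {n} /=.
- by move=> n x y A C D [_ ->] [_ ->].
- move=> n x A P IHP Q IHQ _ _ [C [D [[Cx Dx _ ->] [dP dQ]]]] [C' [D' [[Cx' Dx' _ ->] [dP' dQ']]]].
  have [-> _] := pset_inj Cx Cx' (IHP _ _ dP dP').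
  by have [-> _] := pset_inj Dx Dx' (IHQ _ _ dQ dQ').
- by move=> n x _ _ -> ->.
- by move=> n x P IHP _ _ [C [Cx -> dP]] [C' [Cx' -> dP']]; rewrite (IHP _ _ dP dP').
- move=> n x A B P IHP Q IHQ _ _ [C [D [[Cx Dx _ ->] [dP dQ]]]] [C' [D' [[Cx' Dx' _ ->] [dP' dQ']]]].
  have [-> _] := pset_inj Cx Cx' (IHP _ _ dP dP').
  by have [-> _] := pset_inj Dx Dx' (IHQ _ _ dQ dQ').
- move=> n x y A B P IHP _ _ [C [[Cx Cy xy ->] dP]] [C' [[Cx' Cy' _ ->] dP']].
  have [e _] := pset_inj (pset_None B xy Cx) (pset_None B xy Cx') (IHP _ _ dP dP').
  by have [-> _] := pset_inj Cy Cy' e.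
- move=> n x A B P IHP _ _ [C [Cx -> dP]] [C' [Cx' -> dP']].
  by have [-> _] := pset_inj Cx Cx' (IHP _ _ dP dP').
- move=> n x A B P IHP _ _ [C [Cx -> dP]] [C' [Cx' -> dP']].
  by have [-> _] := pset_inj Cx Cx' (IHP _ _ dP dP').
- move=> n x A B P IHP Q IHQ _ _ [C [Cx -> dP _]] [C' [Cx' -> dP' _]].
  by have [-> _] := pset_inj Cx Cx' (IHP _ _ dP dP').
- by move=> n x L _ _ [_ _ ->] [_ _ ->].
- by move=> n x A L P IHP _ _ [_ _ -> _] [_ _ -> _].
- move=> n x A P IHP _ _ [C [Cx -> dP]] [C' [Cx' -> dP']].
  by have [-> _] := pset_inj Cx Cx' (IHP _ _ dP dP').
- by move=> n x A P IHP _ _ [C [Cx -> dP]] [C' [Cx' -> dP']]; rewrite (IHP _ _ dP dP').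
- move=> n x y A P IHP _ _ [C [[Cx Cy xy ->] dP]] [C' [[Cx' Cy' _ ->] dP']].
  have [e _] := pset_inj (pset_None (WhyNot A) xy Cx) (pset_None (WhyNot A) xy Cx') (IHP _ _ dP dP').
  by have [-> _] := pset_inj Cy Cy' e.
- move=> n x A P IHP _ _ [C [Cx -> dP]] [C' [Cx' -> dP']].
  by have [/ctx_wk_inj -> _] := pset_inj (ctx_wk_None Cx) (ctx_wk_None Cx') (IHP _ _ dP dP').
- move=> n x A B P IHP _ _ [C [Cx -> dP]] [C' [Cx' -> dP']].
  by have [-> _] := pset_inj Cx Cx' (IHP _ _ dP dP').
Qed.

(** * Exchange of two names *)

Section Swap.
Variables u v : nat.
Local Notation tr := (transp u v).

Lemma transpK : involutive tr.
Proof.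
move=> z; rewrite /transp; case: (z =P u) => [->|zu].
  by case: (v =P u) => [->|_]; rewrite ?eqxx.
case: (z =P v) => [->|zv]; first by rewrite eqxx.
by case: (z =P u) => //; case: (z =P v).
Qed.

Lemma transp_inj : injective tr.
Proof. exact: inv_inj transpK. Qed.

Lemma transp_neq x y : x <> y -> tr x <> tr y.
Proof. by move=> xy /transp_inj. Qed.

Definition via (T : Type) (f : pmap T) : pmap T := fun z => f (tr z).

Lemma viaK T (f : pmap T) : via (via f) = f.
Proof. by apply: funext => z; rewrite /via transpK. Qed.

Lemma via_pset T (f : pmap T) x a : via (pset f x a) = pset (via f) (tr x) a.
Proof.
apply: funext => z; rewrite /via /pset; case: (z =P tr x) => [->|h]; first by rewrite transpK eqxx.
by case: eqP => // e; case: h; rewrite -e transpK.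
Qed.

Lemma via_at T (f : pmap T) x : via f (tr x) = f x.
Proof. by rewrite /via transpK. Qed.

Lemma via_disjoint T (f g : pmap T) : pdisjoint f g -> pdisjoint (via f) (via g).
Proof. by move=> h z; exact: h. Qed.

Lemma via_plist (T : Type) (L : seq (nat * T)) :
  via (plist L) = plist [seq (tr p.1, p.2) | p <- L].
Proof. by elim: L => //= p L IH; rewrite via_pset IH. Qed.

Lemma via_whynots n (L : sequent n) : via (whynots L) = whynots (transp_list u v L).
Proof. by rewrite /whynots via_plist -!map_comp. Qed.

Lemma uniq_transp n (L : sequent n) :
  uniq (map fst (transp_list u v L)) = uniq (map fst L).
Proof.
rewrite -map_comp (@eq_map _ _ _ (tr \o fst)) // map_comp map_inj_uniq //.
exact: transp_inj.
Qed.

Lemma swapK n (P : term n) : swap u v (swap u v P) = P.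
Proof.
have tlK m (L : sequent m) : transp_list u v (transp_list u v L) = L.
  by rewrite /transp_list -map_comp -[RHS]map_id; apply: eq_map => -[a b] /=; rewrite transpK.
by elim: P => {n} //= n *; rewrite ?transpK ?tlK;
  repeat match goal with H : swap _ _ (swap _ _ _) = _ |- _ => rewrite {}H end.
Qed.

Lemma der_swap n (P : term n) C : der P C -> der (swap u v P) (via C).
Proof.
elim: P C => {n} /=.
- move=> n x y A _ [xy ->]; split; first exact: transp_neq.
  by rewrite !via_pset.
- move=> n x A P IHP Q IHQ _ [C [D [[Cx Dx CD ->] [/IHP dP /IHQ dQ]]]].
  exists (via C), (via D); rewrite !via_at -!via_pset; split=> //.
  by split=> //; exact: via_disjoint.
- by move=> n x _ ->; rewrite via_pset.
- move=> n x P IHP _ [C [Cx -> /IHP dP]]; exists (via C); rewrite via_at via_pset.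
  by split.
- move=> n x A B P IHP Q IHQ _ [C [D [[Cx Dx CD ->] [/IHP dP /IHQ dQ]]]].
  exists (via C), (via D); rewrite !via_at -!via_pset; split=> //.
  by split=> //; [exact: via_disjoint | rewrite via_pset].
- move=> n x y A B P IHP _ [C [[Cx Cy xy ->] /IHP dP]].
  exists (via C); rewrite !via_at -!via_pset; split=> //; split=> //; exact: transp_neq.
- move=> n x A B P IHP _ [C [Cx -> /IHP dP]]; exists (via C).
  by rewrite via_at -!via_pset.
- move=> n x A B P IHP _ [C [Cx -> /IHP dP]]; exists (via C).
  by rewrite via_at -!via_pset.
- move=> n x A B P IHP Q IHQ _ [C [Cx -> /IHP dP /IHQ dQ]]; exists (via C).
  by rewrite via_at -!via_pset.
- move=> n x L _ [Lx uL ->]; rewrite -via_plist via_at -via_pset; split=> //.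
  by rewrite uniq_transp.
- move=> n x A L P IHP _ [Lx uL -> /IHP dP]; rewrite -via_whynots via_at -!via_pset.
  by rewrite uniq_transp.
- move=> n x A P IHP _ [C [Cx -> /IHP dP]]; exists (via C).
  by rewrite via_at -!via_pset.
- move=> n x A P IHP _ [C [Cx -> /IHP dP]]; exists (via C).
  by rewrite via_at -!via_pset.
- move=> n x y A P IHP _ [C [[Cx Cy xy ->] /IHP dP]].
  exists (via C); rewrite !via_at -!via_pset; split=> //; split=> //; exact: transp_neq.
- move=> n x A P IHP _ [C [Cx -> /IHP dP]]; exists (via C).
  by rewrite via_at -!via_pset; split=> //; move: dP; rewrite via_pset.
- move=> n x A B P IHP _ [C [Cx -> /IHP dP]]; exists (via C).
  by rewrite via_at -!via_pset.
Qed.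

Lemma denot_swap1 n (P : term n) (X : hcohs n) (r : env X) :
  denot P r -> denot (swap u v P) (via r).
Proof.
elim: P X r => {n} /=.
- by move=> n x y A X r [a ->]; exists a; rewrite !via_pset.
- move=> n x A P IHP Q IHQ X r [a [s [t [[sx tx st ->] [/IHP hP /IHQ hQ]]]]].
  exists a, (via s), (via t); rewrite !via_at -!via_pset; split=> //.
  by split=> //; exact: via_disjoint.
- by move=> n x X r ->; rewrite via_pset.
- move=> n x P IHP X r [s [sx -> /IHP hP]]; exists (via s); rewrite via_at via_pset.
  by split.
- move=> n x A B P IHP Q IHQ X r [a [b [s [t [[sx tx st ->] [/IHP hP /IHQ hQ]]]]]].
  exists a, b, (via s), (via t); rewrite !via_at -!via_pset; split=> //.
  by split=> //; [exact: via_disjoint | rewrite via_pset].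
- move=> n x y A B P IHP X r [a [b [s [sx sy -> /IHP hP]]]].
  by exists a, b, (via s); rewrite !via_at -!via_pset.
- move=> n x A B P IHP X r [a [s [sx -> /IHP hP]]]; exists a, (via s).
  by rewrite !via_at -!via_pset.
- move=> n x A B P IHP X r [a [s [sx -> /IHP hP]]]; exists a, (via s).
  by rewrite !via_at -!via_pset.
- move=> n x A B P IHP Q IHQ X r [] [a [s [sx -> h]]]; [left|right]; exists a, (via s);
  rewrite !via_at -!via_pset; split=> //; by [exact: IHP | exact: IHQ].
- by [].
- move=> n x A L P IHP X r [T [fT TP [c rc ce] h]]; exists (@via (point X) @` T); split.
  + exact: finite_image.
  + by move=> _ [t Tt <-]; apply: IHP; exact: TP.
  + exists c; first by rewrite via_at.
    rewrite ce; apply/seteqP; split=> [a [t Tt ta]|a [_ [t Tt <-]]].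
      by exists (via t); [exists t | rewrite via_at].
    by rewrite via_at => ta; exists t.
  move=> z zx; have := h (tr z); rewrite -via_plist /via => /(_ _).
  have zx' : tr z <> x by move=> e; case: zx; rewrite -e transpK.
  move=> /(_ zx'); case: (plist L (tr z)) => // B [d rd de]; exists d => //.
  rewrite de; apply/seteqP; split=> [b [t Tt hb]|b [_ [t Tt <-] hb]].
    by exists (via t); [exists t | ].
  by exists t.
- move=> n x A P IHP X r [a [c [s [sx -> ca /IHP hP]]]]; exists a, c, (via s).
  by rewrite !via_at -!via_pset.
- move=> n x A P IHP X r [c [s [sx -> ca /IHP hP]]]; exists c, (via s).
  by rewrite !via_at -!via_pset.
- move=> n x y A P IHP X r [c [d [e [s [[sx sy -> ce] /IHP hP]]]]].
  by exists c, d, e, (via s); rewrite !via_at -!via_pset.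
- move=> n x A P IHP X r [c [s [w [sx -> cw /IHP hP]]]]; exists c, (via s), w.
  rewrite !via_at -!via_pset; split=> //.
  by move: hP; rewrite via_pset.
- move=> n x A B P IHP X r [a [c [s [sx -> ca /IHP hP]]]]; exists a, c, (via s).
  by rewrite !via_at -!via_pset.
Qed.

Lemma denot_swap n (P : term n) (X : hcohs n) (r : env X) :
  denot (swap u v P) r <-> denot P (via r).
Proof.
split=> [/denot_swap1|/denot_swap1]; first by rewrite swapK.
by rewrite viaK.
Qed.

End Swap.

(** * Denotations at typed environments *)

Lemma pjoin_None (T : Type) (s t : pmap T) z : s z = None -> t z = None ->
  pjoin s t z = None.
Proof. by rewrite /pjoin => ->. Qed.

Section TypedEnvs.
Variables (n : nat) (X : hcohs n).
Implicit Types (C D : context n) (r s t : env X) (A B : formula n).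

Lemma etyped_None C s z : etyped C s -> C z = None -> s z = None.
Proof. by move=> /(_ z) + Cz; rewrite Cz; case: (s z). Qed.

Lemma etyped_pset C s x A a : etyped C s -> etyped (pset C x A) (pset s x (Pt (A := A) a)).
Proof. by move=> ts z; rewrite /pset; case: eqP. Qed.

Lemma etyped_pset_inv C r x A : C x = None -> etyped (pset C x A) r ->
  exists s a, [/\ s x = None, etyped C s & r = pset s x (Pt (A := A) a)].
Proof.
move=> Cx tr; have [a ra] := etyped_pt tr (psetE _ _ _).
exists (fun z => if z == x then None else r z), a; split; first by rewrite eqxx.
  by move=> z; have := tr z; rewrite /pset; case: eqP => [->|].
by apply: funext => z; rewrite /pset; case: eqP => [->|].
Qed.

Lemma etyped_pjoin C D s t : pdisjoint C D -> etyped C s -> etyped D t ->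
  etyped (pjoin C D) (pjoin s t) /\ pdisjoint s t.
Proof.
move=> CD ts tt; split=> z; have := CD z; have := ts z; have := tt z; rewrite /pjoin.
  by case: (s z) (C z) => [p|] [A|] //=; case: (t z) (D z) => [q|] [B|] //= _ _ [].
by case: (s z) (C z) => [p|] [A|] //=; case: (t z) (D z) => [q|] [B|] //=; first [by left | by right | by move=> _ _ []].
Qed.

Lemma etyped_pjoin_inv C D r : pdisjoint C D -> etyped (pjoin C D) r ->
  exists s t, [/\ etyped C s, etyped D t, pdisjoint s t & r = pjoin s t].
Proof.
move=> CD tr; exists (fun z => if C z is Some _ then r z else None),
  (fun z => if D z is Some _ then r z else None); split.
- by move=> z; have := tr z; rewrite /pjoin; case: (C z).
- by move=> z; have := tr z; have := CD z; rewrite /pjoin; case: (C z) (D z) => [A|] [B|] // [].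
- by move=> z; have := CD z; case: (C z) (D z) => [A|] [B|] //; [case|right|left|left].
apply: funext => z; have := tr z; rewrite /pjoin; case: (C z) => [A|].
  by case: (r z).
by case: (D z) => [B|] //; case: (r z).
Qed.

Lemma pjoin_typed_inj C D s t s' t' : pdisjoint C D -> etyped C s -> etyped C s' ->
  etyped D t -> etyped D t' -> pjoin s t = pjoin s' t' -> s = s' /\ t = t'.
Proof.
move=> CD ts ts' tt tt' e; split; apply: funext => z; have := CD z;
have := ts z; have := ts' z; have := tt z; have := tt' z;
have := congr1 (fun h : pmap _ => h z) e; rewrite /pjoin;
by case: (s z) (s' z) (t z) (t' z) (C z) (D z) => [?|] [?|] [?|] [?|] [?|] [?|] //=; intuition congruence.
Qed.

End TypedEnvs.

Section Views.
Variables (n : nat) (X : hcohs n).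
Implicit Types (C D : context n) (r s t : env X) (A B : formula n) (P Q : term n).

(** [denot] leaves the splitting of the environment unspecified; since each part must fit the
    context of its premise, it can only be the given one. *)
Lemma denot_cut C D s t x A P Q : C x = None -> D x = None -> pdisjoint C D ->
  der P (pset C x A) -> der Q (pset D x (dual A)) -> etyped C s -> etyped D t ->
  denot (Cut x A P Q) (pjoin s t) <->
  exists a, denot P (pset s x (Pt (A := A) a)) /\ denot Q (pset t x (Pt (dual_pt a))).
Proof.
move=> Cx Dx CD dP dQ ts tt; split=> [|[a [hP hQ]]]; last first.
  exists a, s, t; split=> //; split=> //; [exact: etyped_None ts Cx | exact: etyped_None tt Dx|].
  by have [] := etyped_pjoin CD ts tt.
move=> [a [s' [t' [[sx tx _ e] [hP hQ]]]]]; exists a.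
have ts' : etyped C s'.
  move=> z; have := denot_typed dP hP z; rewrite /pset; case: eqP => // ->.
  by rewrite sx Cx.
have tt' : etyped D t'.
  move=> z; have := denot_typed dQ hQ z; rewrite /pset; case: eqP => // ->.
  by rewrite tx Dx.
by have [-> ->] := pjoin_typed_inj CD ts ts' tt tt' e.
Qed.

Lemma denot_tensor C D s t x A B (a : rweb (interp A) X) (b : rweb (interp B) X) P Q : C x = None -> D x = None -> pdisjoint C D ->
  der P (pset C x A) -> der Q (pset D x B) -> etyped C s -> etyped D t ->
  denot (TTensor x A B P Q) (pset (pjoin s t) x (@Pt _ X (Tensor A B) (a, b))) <->
  denot P (pset s x (Pt a)) /\ denot Q (pset t x (Pt b)).
Proof.
move=> Cx Dx CD dP dQ ts tt.
have sx := etyped_None ts Cx; have tx := etyped_None tt Dx.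
split=> [|[hP hQ]]; last first.
  exists a, b, s, t; split=> //; split=> //.
  by have [] := etyped_pjoin CD ts tt.
move=> [a' [b' [s' [t' [[sx' tx' _ e] [hP hQ]]]]]].
have [e' /Pt_inj[-> ->]] := pset_inj (pjoin_None sx tx) (pjoin_None sx' tx') e.
have ts' : etyped C s'.
  move=> z; have := denot_typed dP hP z; rewrite /pset; case: eqP => // ->.
  by rewrite sx' Cx.
have tt' : etyped D t'.
  move=> z; have := denot_typed dQ hQ z; rewrite /pset; case: eqP => // ->.
  by rewrite tx' Dx.
by have [-> ->] := pjoin_typed_inj CD ts ts' tt tt' e'.
Qed.

Lemma denot_bot s x P : s x = None ->
  denot (TBot x P) (pset s x (@Pt _ X Bot tt)) <-> denot P s.
Proof.
move=> sx; split=> [[s' [sx' e h]]|h]; last by exists s.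
by have [-> _] := pset_inj sx sx' e.
Qed.

Lemma denot_par s x y A B (a : rweb (interp A) X) (b : rweb (interp B) X) P : s x = None -> s y = None ->
  denot (TPar x y A B P) (pset s x (@Pt _ X (Par A B) (a, b))) <->
  denot P (pset (pset s y (Pt b)) x (Pt a)).
Proof.
move=> sx sy; split=> [[a' [b' [s' [sx' sy' e h]]]]|h]; last by exists a, b, s.
by have [-> /Pt_inj[-> ->]] := pset_inj sx sx' e.
Qed.

Lemma denot_plus1 s x A B c P : s x = None ->
  denot (TPlus1 x A B P) (pset s x (@Pt _ X (Plus A B) c)) <->
  exists2 a, c = inl a & denot P (pset s x (Pt a)).
Proof.
move=> sx; split=> [[a [s' [sx' e h]]]|[a -> h]]; last by exists a, s.
by have [-> /Pt_inj ->] := pset_inj sx sx' e; exists a.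
Qed.

Lemma denot_plus2 s x A B c P : s x = None ->
  denot (TPlus2 x A B P) (pset s x (@Pt _ X (Plus A B) c)) <->
  exists2 b, c = inr b & denot P (pset s x (Pt b)).
Proof.
move=> sx; split=> [[a [s' [sx' e h]]]|[a -> h]]; last by exists a, s.
by have [-> /Pt_inj ->] := pset_inj sx sx' e; exists a.
Qed.

Lemma denot_with s x A B c P Q : s x = None ->
  denot (TWith x A B P Q) (pset s x (@Pt _ X (With A B) c)) <->
  match c with
  | inl a => denot P (pset s x (Pt a))
  | inr b => denot Q (pset s x (Pt b))
  end.
Proof.
move=> sx; split=> [[] [a [s' [sx' e h]]]|].
- by have [-> /Pt_inj ->] := pset_inj sx sx' e.
- by have [-> /Pt_inj ->] := pset_inj sx sx' e.
by case: c => a h; [left | right]; exists a, s.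
Qed.

Lemma denot_der s x A c P : s x = None ->
  denot (TDer x A P) (pset s x (@Pt _ X (WhyNot A) c)) <->
  exists2 a, sval c = [set a] & denot P (pset s x (Pt a)).
Proof.
move=> sx; split=> [[a [c' [s' [sx' e ca h]]]]|[a ca h]]; last by exists a, c, s.
by have [-> /Pt_inj ->] := pset_inj sx sx' e; exists a.
Qed.

Lemma denot_weak s x A c P : s x = None ->
  denot (TWeak x A P) (pset s x (@Pt _ X (WhyNot A) c)) <-> sval c = set0 /\ denot P s.
Proof.
move=> sx; split=> [[c' [s' [sx' e ca h]]]|[ca h]]; last by exists c, s.
by have [-> /Pt_inj ->] := pset_inj sx sx' e.
Qed.

Lemma denot_contr s x y A e P : s x = None -> s y = None ->
  denot (TContr x y A P) (pset s x (@Pt _ X (WhyNot A) e)) <->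
  exists c d : rweb (interp (WhyNot A)) X,
    sval e = sval c `|` sval d /\ denot P (pset (pset s y (Pt d)) x (Pt c)).
Proof.
move=> sx sy; split=> [[c [d [e' [s' [[sx' sy' E ce] h]]]]]|[c [d [ce h]]]]; last first.
  by exists c, d, e, s.
by have [-> /Pt_inj ->] := pset_inj sx sx' E; exists c, d.
Qed.

Lemma denot_all s x (A : formula n.+1) c (P : term n.+1) : s x = None ->
  denot (TAll x A P) (pset s x (@Pt _ X (All A) c)) <->
  exists2 u : rep (partial_f (interp A) X), sval c u
        & @denot _ P (ext X (rep_base u None))
            (pset (wk_env (rep_base u None) s) x
               (@Pt _ (ext X (rep_base u None)) A (rep_point u))).
Proof.
move=> sx; split=> [[c' [s' [u [sx' E ce h]]]]|[u cu h]]; last by exists c, s, u.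
by have [-> /Pt_inj ->] := pset_inj sx sx' E; exists u.
Qed.

Lemma denot_ex s x (A : formula n.+1) B c (P : term n) : s x = None ->
  denot (TEx x A B P) (pset s x (@Pt _ X (Ex A) c)) <->
  exists2 a : rweb (interp (inst A B)) X,
    nf_of (partial_f (interp A) X) (inst_pt a) (sval c) & denot P (pset s x (Pt a)).
Proof.
move=> sx; split=> [[a [c' [s' [sx' E ca h]]]]|[a ca h]]; last by exists a, c, s.
by have [-> /Pt_inj ->] := pset_inj sx sx' E; exists a.
Qed.

(* [collects L x T s c] : the point of the conclusion of a promotion built from
   the set [T] of points of the premise is [pset s x c]. *)
Definition collects x A (L : sequent n) (T : env X -> Prop) s (c : rweb (interp (Bang A)) X) :=
  sval c = [set a | exists2 t, T t & t x = Some (Pt a)] /\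
  forall z B, plist L z = Some B -> exists2 d : rweb (interp (WhyNot B)) X,
    s z = Some (Pt d) &
    sval d = [set b | exists2 t, T t &
                  exists2 d : rweb (interp (WhyNot B)) X,
                    t z = Some (Pt d) & sval d b].

Lemma denot_bang s x A L c P : whynots L x = None -> etyped (whynots L) s ->
  denot (TBang x A L P) (pset s x (@Pt _ X (Bang A) c)) <->
  exists T, [/\ finite_set T, T `<=` @denot _ P X & collects x L T s c].
Proof.
move=> Lx ts; split=> [[T [fT TP [c' + ce] h]]|[T [fT TP [ce h]]]].
  rewrite psetE => /Some_inj/Pt_inj cc; exists T; split=> //; split; first by rewrite cc.
  move=> z B Lz; have zx : z <> x by move=> zx; move: Lx; rewrite whynotsE -zx Lz.
  by have := h z zx; rewrite Lz /pset; case: eqP.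
exists T; split=> //; first by exists c => //; rewrite psetE.
move=> z zx; case Lz: (plist L z) => [B|].
  by have [d sz de] := h z B Lz; exists d => //; rewrite /pset; case: eqP.
have := ts z; rewrite whynotsE Lz /pset; case: eqP => // _; by case: (s z).
Qed.

End Views.

(** * Substitution *)

Section SubstContexts.
Variables (n m : nat) (s : idx n -> formula m).

Definition csubst (C : context n) : context m := fun z => omap (fun A => subst A s) (C z).

Lemma csubst_pset C x A : csubst (pset C x A) = pset (csubst C) x (subst A s).
Proof. by apply: funext => z; rewrite /csubst /pset; case: eqP. Qed.

Lemma csubst_pjoin C D : csubst (pjoin C D) = pjoin (csubst C) (csubst D).
Proof. by apply: funext => z; rewrite /csubst /pjoin; case: (C z). Qed.

Lemma csubst_None C z : csubst C z = None <-> C z = None.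
Proof. by rewrite /csubst; case: (C z). Qed.

Lemma csubst_disjoint C D : pdisjoint C D -> pdisjoint (csubst C) (csubst D).
Proof. by move=> h z; have := h z; rewrite !csubst_None. Qed.

Lemma csubst_plist L : csubst (plist L) = plist [seq (p.1, subst p.2 s) | p <- L].
Proof. by elim: L => //= p L IH; rewrite csubst_pset IH. Qed.

Lemma csubst_whynots L : csubst (whynots L) = whynots [seq (p.1, subst p.2 s) | p <- L].
Proof. by rewrite /whynots csubst_plist -!map_comp. Qed.

End SubstContexts.

Lemma csubst_wk n m (s : idx n -> formula m) C : csubst (up s) (ctx_wk C) = ctx_wk (csubst s C).
Proof.
by apply: funext => z; rewrite /csubst /ctx_wk; case: (C z) => //= A; rewrite subst_wk_up.
Qed.

Lemma der_subst n (P : term n) C m (s : idx n -> formula m) :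
  der P C -> der (tsubst P s) (csubst s C).
Proof.
elim: P C m s => {n} /=.
- by move=> n x y A _ m s [xy ->]; rewrite !csubst_pset -dual_subst.
- move=> n x A P IHP Q IHQ _ m s [C [D [[Cx Dx CD ->] [dP dQ]]]].
  exists (csubst s C), (csubst s D); rewrite dual_subst -!csubst_pset csubst_pjoin.
  split; last by split; [exact: IHP | exact: IHQ].
  by split=> //; [exact/csubst_None | exact/csubst_None | exact: csubst_disjoint].
- by move=> n x _ m s ->; rewrite csubst_pset.
- move=> n x P IHP _ m s [C [Cx -> dP]]; exists (csubst s C); rewrite csubst_pset.
  by split=> //; [exact/csubst_None | exact: IHP].
- move=> n x A B P IHP Q IHQ _ m s [C [D [[Cx Dx CD ->] [dP dQ]]]].
  exists (csubst s C), (csubst s D); rewrite -csubst_pjoin -!csubst_pset.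
  split; last by split; [exact: IHP | exact: IHQ].
  by split; [exact/csubst_None | exact/csubst_None | exact: csubst_disjoint | rewrite csubst_pset].
- move=> n x y A B P IHP _ m s [C [[Cx Cy xy ->] dP]]; exists (csubst s C).
  rewrite -!csubst_pset; split; last exact: IHP.
  by split=> //; [exact/csubst_None | exact/csubst_None | rewrite csubst_pset].
- move=> n x A B P IHP _ m s [C [Cx -> dP]]; exists (csubst s C); rewrite -csubst_pset.
  by split=> //; [exact/csubst_None | rewrite csubst_pset | exact: IHP].
- move=> n x A B P IHP _ m s [C [Cx -> dP]]; exists (csubst s C); rewrite -csubst_pset.
  by split=> //; [exact/csubst_None | rewrite csubst_pset | exact: IHP].
- move=> n x A B P IHP Q IHQ _ m s [C [Cx -> dP dQ]]; exists (csubst s C); rewrite -!csubst_pset.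
  by split=> //; [exact/csubst_None | rewrite csubst_pset | exact: IHP | exact: IHQ].
- move=> n x L _ m s [Lx uL ->]; rewrite csubst_pset csubst_plist; split=> //.
    by rewrite -csubst_plist; apply/csubst_None.
  by rewrite -map_comp (@eq_map _ _ _ fst).
- move=> n x A L P IHP _ m s [Lx uL -> dP].
  rewrite -csubst_whynots -csubst_pset; split; [exact/csubst_None | | by rewrite csubst_pset | exact: IHP].
  by rewrite -map_comp (@eq_map _ _ _ fst).
- move=> n x A P IHP _ m s [C [Cx -> dP]]; exists (csubst s C); rewrite -csubst_pset.
  by split=> //; [exact/csubst_None | rewrite csubst_pset | exact: IHP].
- move=> n x A P IHP _ m s [C [Cx -> dP]]; exists (csubst s C).
  by split=> //; [exact/csubst_None | rewrite csubst_pset | exact: IHP].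
- move=> n x y A P IHP _ m s [C [[Cx Cy xy ->] dP]]; exists (csubst s C).
  rewrite -/(subst (WhyNot A) s) -!csubst_pset; split; last exact: IHP.
  by split=> //; [exact/csubst_None | exact/csubst_None].
- move=> n x A P IHP _ m s [C [Cx -> dP]]; exists (csubst s C).
  rewrite -csubst_wk -csubst_pset.
  by split=> //; [exact/csubst_None | rewrite csubst_pset | exact: IHP].
- move=> n x A B P IHP _ m s [C [Cx -> dP]]; exists (csubst s C).
  rewrite -subst_inst -csubst_pset.
  by split=> //; [exact/csubst_None | rewrite csubst_pset | exact: IHP].
Qed.

Section SubstPoints.
Variables (n m : nat) (s : idx n -> formula m) (X : hcohs m).

(** The values at [X] of the substituted formulas. A point of [A] over this tuple is, up to the cast
    [cs], a point of the substituted formula over [X]. *)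
Definition sobj : hcohs n := fun i => robj (interp (s i)) X.

Definition cs (A : formula n) (a : rweb (interp A) sobj) : rweb (interp (subst A s)) X :=
  cast (F := comp_f (interp A) (fun i => interp (s i))) (esym (interp_subst A s)) a.

Lemma cs_inj A : injective (@cs A).
Proof. exact (@cast_inj m (comp_f (interp A) (fun i => interp (s i))) _ (esym (interp_subst A s)) X). Qed.

Lemma cs_surj A b : exists a, @cs A a = b.
Proof. exact (@cast_surj m (comp_f (interp A) (fun i => interp (s i))) _ (esym (interp_subst A s)) X b). Qed.

Definition psub (p : point sobj) : point X := Pt (cs (tagged p)).

Definition esub (r : env sobj) : env X := fun z => omap psub (r z).

Lemma jv_psub p : jv (psub p) = jv p.
Proof. exact (@jv_cast m (comp_f (interp (tag p)) (fun i => interp (s i))) _ (esym (interp_subst (tag p) s)) X (tagged p)). Qed.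

Lemma esub_pset r x A (a : rweb (interp A) sobj) :
  esub (pset r x (Pt a)) = pset (esub r) x (Pt (cs a)).
Proof. by apply: funext => z; rewrite /esub /pset; case: eqP. Qed.

Lemma esub_pjoin r t : esub (pjoin r t) = pjoin (esub r) (esub t).
Proof. by apply: funext => z; rewrite /esub /pjoin; case: (r z). Qed.

Lemma esub_None r z : esub r z = None <-> r z = None.
Proof. by rewrite /esub; case: (r z). Qed.

Lemma etyped_esub C r : etyped C r -> etyped (csubst s C) (esub r).
Proof. by move=> tr z; rewrite /csubst -(tr z) /esub; case: (r z). Qed.

Lemma etyped_esub_inv C (r : env X) : etyped (csubst s C) r ->
  exists2 r0, etyped C r0 & esub r0 = r.
Proof.
move=> tr; have /choice[f fE] : forall z, exists o, omap tag o = C z /\ omap psub o = r z.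
  move=> z; have := tr z; rewrite /csubst; case: (C z) => [A|]; last first.
    by case: (r z) => // _; exists None.
  case: (r z) => //= p [/Pt_tag[a ->]]; have [b <-] := cs_surj a.
  by exists (Some (Pt b)).
by exists f; [move=> z; exact: (fE z).1 | apply: funext => z; exact: (fE z).2].
Qed.

Lemma esub_typed_inj C r r' : etyped C r -> etyped C r' -> esub r = esub r' -> r = r'.
Proof.
move=> tr tr' e; apply: funext => z; have := congr1 (fun h : pmap _ => h z) e.
have := tr z; have := tr' z; rewrite /esub.
case: (r z) (r' z) => [p|] [p'|] //=.
case: (C z) => // A [/Pt_tag[a' ->]] [/Pt_tag[a ->]] /Some_inj aa'.
by have -> : a = a' by exact: (cs_inj (Pt_inj aa')).
Qed.

(** The equality behind [cs] is generalised to one between tensors of arbitrary functors: only then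
    can the equalities of the components be destructed, leaving a cast along a reflexive equality.
    The next lemmas proceed alike. *)
Lemma cs_tensor A B a b : @cs (Tensor A B) (a, b) = (cs a, cs b).
Proof.
suff h (F G F' G' : rawfun m) (e : tensor_f F G = tensor_f F' G') (eF : F = F') (eG : G = G') c d :
    cast e (X := X) (c, d) = (cast eF c, cast eG d).
  exact: (h (comp_f (interp A) _) (comp_f (interp B) _)).
by case: _ / eF e => e; case: _ / eG e => e; rewrite cast_id.
Qed.

Lemma cs_par A B a b : @cs (Par A B) (a, b) = (cs a, cs b).
Proof.
suff h (F G F' G' : rawfun m) (e : par_f F G = par_f F' G') (eF : F = F') (eG : G = G') c d :
    cast e (X := X) (c, d) = (cast eF c, cast eG d).
  exact: (h (comp_f (interp A) _) (comp_f (interp B) _)).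
by case: _ / eF e => e; case: _ / eG e => e; rewrite cast_id.
Qed.

Lemma cs_plus A B c : @cs (Plus A B) c =
  match c with inl a => inl (cs a) | inr b => inr (cs b) end.
Proof.
suff h (F G F' G' : rawfun m) (e : plus_f F G = plus_f F' G') (eF : F = F') (eG : G = G')
    (d : rweb F X + rweb G X) : cast e (X := X) d =
    match d with inl a => inl (cast eF a) | inr b => inr (cast eG b) end.
  exact: (h (comp_f (interp A) _) (comp_f (interp B) _)).
by case: _ / eF e => e; case: _ / eG e => e; rewrite cast_id; case: d.
Qed.

Lemma cs_with A B c : @cs (With A B) c =
  match c with inl a => inl (cs a) | inr b => inr (cs b) end.
Proof.
suff h (F G F' G' : rawfun m) (e : with_f F G = with_f F' G') (eF : F = F') (eG : G = G')
    (d : rweb F X + rweb G X) : cast e (X := X) d =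
    match d with inl a => inl (cast eF a) | inr b => inr (cast eG b) end.
  exact: (h (comp_f (interp A) _) (comp_f (interp B) _)).
by case: _ / eF e => e; case: _ / eG e => e; rewrite cast_id; case: d.
Qed.

Lemma cs_bang A (c : rweb (interp (Bang A)) sobj) :
  sval (@cs (Bang A) c : rweb (interp (Bang (subst A s))) X) = @cs A @` sval c.
Proof.
suff h (F F' : rawfun m) (e : bang_f F = bang_f F') (k : F = F') (d : rweb (bang_f F) X) :
    sval (cast e (X := X) d : rweb (bang_f F') X) = (fun a => cast k a) @` sval d.
  exact: (h (comp_f (interp A) _)).
by case: _ / k e => e; rewrite cast_id /= image_id.
Qed.

Lemma cs_whynot A (c : rweb (interp (WhyNot A)) sobj) :
  sval (@cs (WhyNot A) c : rweb (interp (WhyNot (subst A s))) X) = @cs A @` sval c.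
Proof.
suff h (F F' : rawfun m) (e : whynot_f F = whynot_f F') (k : F = F') (d : rweb (whynot_f F) X) :
    sval (cast e (X := X) d : rweb (whynot_f F') X) = (fun a => cast k a) @` sval d.
  exact: (h (comp_f (interp A) _)).
by case: _ / k e => e; rewrite cast_id /= image_id.
Qed.

(** Stated between points because [subst (dual A) s] and [dual (subst A s)] are equal without being
    convertible. *)
Lemma cs_dual A (a : rweb (interp A) sobj) : Pt (cs (dual_pt a)) = Pt (dual_pt (cs a)).
Proof.
apply: point_ext; first by rewrite /= dual_subst.
rewrite jv_dual; have h1 := jv_psub (Pt (dual_pt a)); have h2 := jv_psub (Pt a).
by rewrite /psub /= in h1 h2; rewrite h1 h2 jv_dual.
Qed.

Lemma esub_at (r : env sobj) C z A b : etyped C r -> C z = Some A ->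
  esub r z = Some (Pt (A := subst A s) b) <-> exists2 a, r z = Some (Pt (A := A) a) & cs a = b.
Proof.
move=> tr Cz; split=> [|[a ra <-]]; last by rewrite /esub ra.
have [a ra] := etyped_pt tr Cz; rewrite /esub ra => /Some_inj ab.
by exists a => //; exact: (Pt_inj ab).
Qed.

End SubstPoints.

(** [G'] moves the case analysis of [up_f] inside [ext], which makes webs and coherences of the two
    sides convertible. Only the actions differ, by the action of identities on the free parameters,
    which [act_id] removes. *)
Lemma partial_comp n m (F : rawfun n.+1) (G : idx n -> rawfun m) (X : hcohs m) :
  (forall i, act_id (G i)) ->
  partial_f (comp_f F (up_f G)) X = partial_f F (fun i => robj (G i) X).
Proof.
move=> idG; pose G' : idx n.+1 -> rawfun m.+1 := fun o => @RawFun m.+1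
  (fun X => web (ext (fun i => robj (G i) (fun j => X (Some j))) (X None) o))
  (fun X => str (ext (fun i => robj (G i) (fun j => X (Some j))) (X None) o))
  (fun X Y R => @ext_rel n (fun i => robj (G i) (fun j => X (Some j)))
     (fun i => robj (G i) (fun j => Y (Some j))) (X None) (Y None)
     (fun i => @ract m (G i) (fun j => X (Some j)) (fun j => Y (Some j))
        (fun j => R (Some j))) (R None) o).
have -> : up_f G = G' by apply: funext => -[i|].
pose w (Z : hcohs 1) := rweb F (ext (fun i => robj (G i) X) (Z None)).
pose st (Z : hcohs 1) : hcoh_on (w Z) := rstr F _.
pose Act := forall (Z W : hcohs 1), rels Z W -> w Z -> w W -> Prop.
pose a1 : Act := fun Z W R => ract
  (@ext_rel n (fun i => robj (G i) X) (fun i => robj (G i) X) _ _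
     (fun i => @ract m (G i) X X (fun i x y => x = y)) (R None)).
pose a2 : Act := fun Z W R => ract
  (@ext_rel n (fun i => robj (G i) X) (fun i => robj (G i) X) _ _
     (fun i x y => x = y) (R None)).
suff a12 : a1 = a2 by change (RawFun st a1 = RawFun st a2); rewrite a12.
apply: functional_extensionality_dep => Z.
apply: functional_extensionality_dep => W.
apply: functional_extensionality_dep => R.
rewrite /a1 /a2; congr (ract (ext_rel _ _)).
by apply: functional_extensionality_dep => i; exact: idG.
Qed.

Lemma interp_up n m (s : idx n -> formula m) :
  (fun o => interp (up s o)) = up_f (fun i => interp (s i)).
Proof. by apply: funext => -[i|] //=; rewrite interp_wk. Qed.

Lemma partial_subst n m (A : formula n.+1) (s : idx n -> formula m) X :
  partial_f (interp (subst A (up s))) X = partial_f (interp A) (sobj s X).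
Proof.
by rewrite interp_subst interp_up partial_comp // => i; exact: interp_id.
Qed.

Lemma ext_sobj n m (s : idx n -> formula m) (X : hcohs m) (V : hcoh) :
  ext (sobj s X) V = sobj (up s) (ext X V).
Proof.
by apply: functional_extensionality_dep => -[i|] //; rewrite /sobj /= interp_wk.
Qed.

(** * Transport along equalities of tuples *)

Section Transport.
Variable n : nat.

(** Under a binder, [ext (sobj s X) V] and [sobj (up s) (ext X V)] are equal without being
    convertible; points and environments have to be carried from one to the other. *)
Definition trpt (X Y : hcohs n) (e : X = Y) (p : point X) : point Y :=
  eq_rect X (@Defs.point n) p Y e.

Definition trenv (X Y : hcohs n) (e : X = Y) (r : env X) : env Y :=
  fun z => omap (trpt e) (r z).

Lemma denot_trenv (P : term n) X Y (e : X = Y) (r : env X) :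
  denot P (trenv e r) <-> denot P r.
Proof.
case: _ / e; rewrite (_ : trenv _ r = r) //.
by apply: funext => z; rewrite /trenv; case: (r z).
Qed.

Lemma tag_trpt X Y (e : X = Y) (p : point X) : tag (trpt e p) = tag p.
Proof. by case: _ / e. Qed.

Lemma jv_trpt X Y (e : X = Y) (p : point X) : jv (trpt e p) = jv p.
Proof. by case: _ / e. Qed.

Lemma trenv_pset X Y (e : X = Y) (r : env X) x p :
  trenv e (pset r x p) = pset (trenv e r) x (trpt e p).
Proof. by apply: funext => z; rewrite /trenv /pset; case: eqP. Qed.

Lemma etyped_trenv C X Y (e : X = Y) (r : env X) : etyped C r -> etyped C (trenv e r).
Proof. by case: _ / e => tr z; rewrite -(tr z) /trenv; case: (r z). Qed.

End Transport.

Lemma trace_jv (F F' : rawfun 1) (e : F = F') (c : trace_web F) (c' : trace_web F')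
    (Z : idx 1 -> finhc) x x' :
  existT id (trace_web F) c = existT id (trace_web F') c' ->
  existT id (rweb F (fun i => hc_of (Z i))) x = existT id (rweb F' (fun i => hc_of (Z i))) x' ->
  sval c (existT _ Z x) <-> sval c' (existT _ Z x').
Proof.
case: _ / e c' x' => c' x' cc xx.
by rewrite (existT_inj cc : c = c') (existT_inj xx : x = x').
Qed.

Lemma nf_jv (F F' : rawfun 1) (e : F = F') (c : trace_web (perp_f F))
    (c' : trace_web (perp_f F')) (V V' : hcohs 1) (eV : V = V') x x' :
  existT id (trace_web (perp_f F)) c = existT id (trace_web (perp_f F')) c' ->
  existT id (rweb F V) x = existT id (rweb F' V') x' ->
  nf_of F (Y := V) x (sval c) <-> nf_of F' (Y := V') x' (sval c').
Proof.
case: _ / e c' x'; case: _ / eV => c' x' cc xx.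
by rewrite (existT_inj cc : c = c') (existT_inj xx : x = x').
Qed.

Lemma wk_env_typed n (C : context n) (X : hcohs n) (Z : hcoh) (r : env X) :
  etyped C r -> etyped (ctx_wk C) (wk_env Z r).
Proof. by move=> tr z; rewrite /ctx_wk -(tr z) /wk_env; case: (r z). Qed.

(** * Substitution under a binder *)

Section SubstBinder.
Variables (n m : nat) (s : idx n -> formula m) (X : hcohs m) (V : hcoh).

Lemma psub_wk (p : point (sobj s X)) :
  psub (trpt (ext_sobj s X V) (wk_pt V p)) = wk_pt V (psub p).
Proof.
apply: point_ext; last by rewrite jv_psub jv_trpt !jv_wk jv_psub.
by rewrite /= tag_trpt /= subst_wk_up.
Qed.

Lemma esub_wk (r : env (sobj s X)) :
  esub (trenv (ext_sobj s X V) (wk_env V r)) = wk_env V (esub r).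
Proof.
by apply: funext => z; rewrite /esub /trenv /wk_env; case: (r z) => //= p; rewrite psub_wk.
Qed.

Lemma psub_ext (A : formula n.+1) (a : rweb (interp A) (ext (sobj s X) V)) :
  exists2 b, psub (trpt (ext_sobj s X V) (Pt a)) = Pt (A := subst A (up s)) (X := ext X V) b &
    existT id _ b = existT id _ a.
Proof.
have tE := tag_trpt (ext_sobj s X V) (Pt a).
have [b bE] := Pt_tag (p := psub (trpt (ext_sobj s X V) (Pt a))) (A := subst A (up s))
  (congr1 (fun A => subst A (up s)) tE).
exists b => //; have := jv_psub (trpt (ext_sobj s X V) (Pt a)).
by rewrite bE jv_trpt.
Qed.

Lemma psub_ext_surj (A : formula n.+1) (b : rweb (interp (subst A (up s))) (ext X V)) :
  exists2 a : rweb (interp A) (ext (sobj s X) V),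
    psub (trpt (ext_sobj s X V) (Pt a)) = Pt b & existT id _ b = existT id _ a.
Proof.
have [a0 a0b] := cs_surj (s := up s) b.
have [a aE] : exists a : rweb (interp A) (ext (sobj s X) V),
    trpt (ext_sobj s X V) (Pt a) = Pt a0.
  rewrite /trpt; case: _ / (ext_sobj s X V) a0 {a0b} => a0; by exists a0.
exists a; first by rewrite aE /psub /= a0b.
have := jv_psub (trpt (ext_sobj s X V) (Pt a)).
by rewrite aE /psub /= a0b => h; have := jv_trpt (ext_sobj s X V) (Pt a); rewrite aE => h'; rewrite /jv /= in h h' *; rewrite h h'.
Qed.

End SubstBinder.

Definition subst_ok n (P : term n) C := forall m (s : idx n -> formula m) (X : hcohs m)
  (r : env (sobj s X)), etyped C r -> denot P r <-> denot (tsubst P s) (esub r).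

Lemma esub_psetp n m (s : idx n -> formula m) (X : hcohs m) (r : env (sobj s X)) x p :
  esub (pset r x p) = pset (esub r) x (psub p).
Proof. by apply: funext => z; rewrite /esub /pset; case: eqP. Qed.

(** * Substitution in a promotion *)

Section SubstBang.
Variables (n x : nat) (A : formula n) (L : sequent n) (P : term n).
Hypotheses (Lx : whynots L x = None) (uL : uniq (map fst L)).
Hypotheses (dP : der P (pset (whynots L) x A)) (sP : subst_ok P (pset (whynots L) x A)).
Variables (m : nat) (s : idx n -> formula m) (X : hcohs m).
Local Notation L' := [seq (p.1, subst p.2 s) | p <- L].

Lemma plist_subst z : plist L' z = omap (fun A => subst A s) (plist L z).
Proof. by rewrite -csubst_plist. Qed.

Lemma collects_esub T (r : env (sobj s X)) c :
  (forall t, T t -> etyped (pset (whynots L) x A) t) -> etyped (whynots L) r ->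
  collects x (A := subst A s) L' (@esub n m s X @` T) (esub r) (cs (A := Bang A) c) <->
  collects x L T r c.
Proof.
move=> tT tr.
have e1 : [set a | exists2 t, (@esub n m s X @` T) t & t x = Some (Pt (A := subst A s) a)]
    = @cs n m s X A @` [set a | exists2 t, T t & t x = Some (Pt a)].
  apply/seteqP; split=> [a [_ [t Tt <-]]|_ [a [t Tt ta] <-]].
    by move=> /(esub_at _ (tT t Tt) (psetE _ _ _))[a0 ta <-]; exists a0 => //; exists t.
  exists (esub t); first by exists t.
  by apply/(esub_at _ (tT t Tt) (psetE _ _ _)); exists a.
have e2 z B : plist L z = Some B ->
    [set b | exists2 t, (@esub n m s X @` T) t & exists2 d : rweb (interp (WhyNot (subst B s))) X,
       t z = Some (Pt d) & sval d b] =
    @cs n m s X B @` [set b | exists2 t, T t & exists2 d : rweb (interp (WhyNot B)) (sobj s X),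
       t z = Some (Pt d) & sval d b].
  move=> Lz; have Cz : pset (whynots L) x A z = Some (WhyNot B).
    rewrite /pset; case: eqP => [zx|_]; last exact: plist_whynots.
    by move: Lx; rewrite whynotsE -zx Lz.
  apply/seteqP; split=> [b [_ [t Tt <-]] [d + db]|_ [b [t Tt [d td db]] <-]].
    move=> /(esub_at (A := WhyNot B) _ (tT t Tt) Cz)[d0 td dd].
    by move: db; rewrite -dd cs_whynot => -[b0 db <-]; exists b0 => //; exists t => //; exists d0.
  exists (esub t); first by exists t.
  exists (cs (A := WhyNot B) d); first by apply/(esub_at (A := WhyNot B) _ (tT t Tt) Cz); exists d.
  by rewrite cs_whynot; exists b.
split=> -[h1 h2]; split.
- apply: (image_inj_eq (@cs_inj _ _ s X A)); rewrite -cs_bang -e1; exact: h1.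
- move=> z B Lz; have [|d + de] := h2 z (subst B s); first by rewrite plist_subst Lz.
  move=> /(esub_at (A := WhyNot B) _ tr (plist_whynots Lz))[d0 rd dd]; exists d0 => //.
  apply: (image_inj_eq (@cs_inj _ _ s X B)); rewrite -cs_whynot -(e2 z B Lz) -de.
  by rewrite -dd.
- by rewrite e1 -h1 -cs_bang.
move=> z B'; rewrite plist_subst; case Lz: (plist L z) => [B|] //= [<-].
have [d rd de] := h2 z B Lz; exists (cs (A := WhyNot B) d).
  by apply/(esub_at (A := WhyNot B) _ tr (plist_whynots Lz)); exists d.
by rewrite (e2 z B Lz) -de -cs_whynot.
Qed.

Lemma subst_bang (r : env (sobj s X)) : etyped (pset (whynots L) x (Bang A)) r ->
  denot (TBang x A L P) r <-> denot (tsubst (TBang x A L P) s) (esub r).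
Proof.
move=> /(etyped_pset_inv Lx)[r0 [c [rx tr ->]]].
have Lx' : whynots L' x = None by rewrite -csubst_whynots; apply/csubst_None.
have tr' : etyped (whynots L') (esub r0) by rewrite -csubst_whynots; exact: etyped_esub.
rewrite esub_pset (denot_bang _ _ Lx tr).
rewrite -/tsubst /= -/(denot (TBang x (subst A s) L' (tsubst P s)) _).
have v := denot_bang (cs (A := Bang A) c) (tsubst P s) Lx' tr'.
split=> [[T [fT TP ce]]|/v[T' [fT TP ce]]].
  apply/v; exists (@esub n m s X @` T); split; first exact: finite_image.
    by move=> _ [t Tt <-]; apply/sP; [exact: denot_typed dP (TP t Tt) | exact: TP].
  by apply/collects_esub => // t /TP; exact: denot_typed.
have dP' := der_subst s dP.
(* Typing belongs to [T] because distinct formulas may become equal after substitution: [esub] is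
   injective only on environments of a given context, and finiteness of [T] depends on it. *)
pose T (t : env (sobj s X)) := etyped (pset (whynots L) x A) t /\ T' (esub t).
have TT : T' = @esub n m s X @` T.
  apply/seteqP; split=> [t Tt|_ [t [_ Tt] <-] //].
  have [t0 t0t e] := etyped_esub_inv (denot_typed dP' (TP t Tt)).
  by exists t0 => //; split=> //; rewrite e.
exists T; split.
- apply: (finite_inj_on fT (f := @esub n m s X)); first by move=> t [].
  by move=> t t' [tt _] [tt' _]; exact: esub_typed_inj tt tt'.
- by move=> t [tt Tt]; apply/sP => //; exact: TP.
by apply/collects_esub => //; [move=> t [] | rewrite -TT].
Qed.

End SubstBang.

Theorem denot_subst n (P : term n) C : der P C -> subst_ok P C.
Proof.
elim: P C => {n}.
- move=> n x y A _ [xy ->] m s X r tr.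
  have e (a : rweb (interp A) (sobj s X)) :
      esub (pset (pset pempty y (Pt (dual_pt a))) x (Pt a)) =
      pset (pset pempty y (Pt (dual_pt (cs a)))) x (Pt (cs a)).
    by rewrite !esub_pset cs_dual.
  split=> [[a ->]|[a]]; first by exists (cs a); rewrite e.
  have [a0 <-] := cs_surj a; rewrite -e => re; exists a0.
  apply: (esub_typed_inj tr _ re).
  by apply: etyped_pset; apply: etyped_pset.
- move=> n x A P IHP Q IHQ _ [C [D [[Cx Dx CD ->] [dP dQ]]]] m s X r.
  move=> /(etyped_pjoin_inv CD)[u [v [tu tv _ ->]]].
  have dP' : der (tsubst P s) (pset (csubst s C) x (subst A s)).
    by rewrite -csubst_pset; exact: der_subst.
  have dQ' : der (tsubst Q s) (pset (csubst s D) x (dual (subst A s))).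
    by rewrite dual_subst -csubst_pset; exact: der_subst.
  have Cx' := proj2 (csubst_None s C x) Cx; have Dx' := proj2 (csubst_None s D x) Dx.
  rewrite esub_pjoin (denot_cut Cx Dx CD dP dQ tu tv).
  rewrite -[tsubst _ _]/(Cut x (subst A s) (tsubst P s) (tsubst Q s)).
  rewrite (denot_cut Cx' Dx' (csubst_disjoint s CD) dP' dQ' (etyped_esub tu) (etyped_esub tv)).
  split=> [[a [hP hQ]]|[a]].
    exists (cs a); rewrite -cs_dual -!esub_pset; split.
      by apply/(IHP _ dP) => //; exact: etyped_pset.
    by apply/(IHQ _ dQ) => //; exact: etyped_pset.
  have [a0 <-] := cs_surj a; rewrite -cs_dual -!esub_pset => -[hP hQ]; exists a0; split.
    by apply/(IHP _ dP) => //; exact: etyped_pset.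
  by apply/(IHQ _ dQ) => //; exact: etyped_pset.
- move=> n x _ -> m s X r tr.
  have [u [[] [ux tu re]]] := etyped_pset_inv erefl tr.
  have u0 : u = pempty by apply: funext => z; have := tu z; rewrite /pempty; case: (u z).
  rewrite re u0; split=> // _; rewrite /=.
  have c1 : @cs n m s X One tt = tt by case: (cs _).
  by rewrite esub_pset c1.
- move=> n x P IHP _ [C [Cx -> dP]] m s X r /(etyped_pset_inv Cx)[u [[] [ux tu ->]]].
  rewrite esub_pset -[tsubst _ _]/(TBot x (tsubst P s)).
  have -> : @cs n m s X Bot tt = tt by case: (cs _).
  rewrite (denot_bot _ ux) (denot_bot _ (proj2 (esub_None u x) ux)).
  exact (IHP _ dP _ s X u tu).
- move=> n x A B P IHP Q IHQ _ [C [D [[Cx Dx CD ->] [dP dQ]]]] m s X r.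
  move=> /(etyped_pset_inv (pjoin_None Cx Dx))[w [[a b] [wx tw ->]]].
  have [u [v [tu tv _ ->]]] := etyped_pjoin_inv CD tw.
  have dP' : der (tsubst P s) (pset (csubst s C) x (subst A s)).
    by rewrite -csubst_pset; exact: der_subst.
  have dQ' : der (tsubst Q s) (pset (csubst s D) x (subst B s)).
    by rewrite -csubst_pset; exact: der_subst.
  have Cx' := proj2 (csubst_None s C x) Cx; have Dx' := proj2 (csubst_None s D x) Dx.
  rewrite esub_pset cs_tensor esub_pjoin (denot_tensor _ _ Cx Dx CD dP dQ tu tv).
  rewrite -[tsubst _ _]/(TTensor x (subst A s) (subst B s) (tsubst P s) (tsubst Q s)).
  have -> := denot_tensor (cs a) (cs b) Cx' Dx' (csubst_disjoint s CD) dP' dQ'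
    (etyped_esub tu) (etyped_esub tv).
  rewrite -!esub_pset (IHP _ dP) ?(IHQ _ dQ) //; exact: etyped_pset.
- move=> n x y A B P IHP _ [C [[Cx Cy xy ->] dP]] m s X r.
  move=> /(etyped_pset_inv Cx)[u [[a b] [ux tu ->]]].
  have uy := etyped_None tu Cy.
  rewrite esub_pset cs_par (denot_par _ _ _ ux uy).
  rewrite -[tsubst _ _]/(TPar x y (subst A s) (subst B s) (tsubst P s)).
  have -> := denot_par (cs a) (cs b) (tsubst P s) (proj2 (esub_None u x) ux)
    (proj2 (esub_None u y) uy).
  by rewrite -!esub_pset; apply: (IHP _ dP); do 2!apply: etyped_pset.
- move=> n x A B P IHP _ [C [Cx -> dP]] m s X r.
  move=> /(etyped_pset_inv Cx)[u [c [ux tu ->]]].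
  rewrite esub_pset cs_plus (denot_plus1 _ _ ux).
  rewrite -[tsubst _ _]/(TPlus1 x (subst A s) (subst B s) (tsubst P s)).
  have -> := denot_plus1 (match c with inl a => inl (cs a) | inr b => inr (cs b) end)
    (tsubst P s) (proj2 (esub_None u x) ux).
  split=> [[a -> h]|[a]].
    exists (cs a) => //; rewrite -esub_pset; apply/(IHP _ dP) => //; exact: etyped_pset.
  case: c => // c [<-] h; exists c => //; apply/(IHP _ dP); first exact: etyped_pset.
  by rewrite esub_pset.
- move=> n x A B P IHP _ [C [Cx -> dP]] m s X r.
  move=> /(etyped_pset_inv Cx)[u [c [ux tu ->]]].
  rewrite esub_pset cs_plus (denot_plus2 _ _ ux).
  rewrite -[tsubst _ _]/(TPlus2 x (subst A s) (subst B s) (tsubst P s)).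
  have -> := denot_plus2 (match c with inl a => inl (cs a) | inr b => inr (cs b) end)
    (tsubst P s) (proj2 (esub_None u x) ux).
  split=> [[a -> h]|[a]].
    exists (cs a) => //; rewrite -esub_pset; apply/(IHP _ dP) => //; exact: etyped_pset.
  case: c => // c [<-] h; exists c => //; apply/(IHP _ dP); first exact: etyped_pset.
  by rewrite esub_pset.
- move=> n x A B P IHP Q IHQ _ [C [Cx -> dP dQ]] m s X r.
  move=> /(etyped_pset_inv Cx)[u [c [ux tu ->]]].
  rewrite esub_pset cs_with (denot_with _ _ _ ux).
  rewrite -[tsubst _ _]/(TWith x (subst A s) (subst B s) (tsubst P s) (tsubst Q s)).
  have -> := denot_with (match c with inl a => inl (cs a) | inr b => inr (cs b) end)
    (tsubst P s) (tsubst Q s) (proj2 (esub_None u x) ux).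
  by case: c => c; rewrite -esub_pset; [apply: (IHP _ dP) | apply: (IHQ _ dQ)]; exact: etyped_pset.
- by move=> n x L C _ m s X r _.
- move=> n x A L P IHP _ [Lx uL -> dP] m s X r tr.
  exact: (subst_bang Lx dP (IHP _ dP)).
- move=> n x A P IHP _ [C [Cx -> dP]] m s X r.
  move=> /(etyped_pset_inv Cx)[u [c [ux tu ->]]].
  rewrite esub_pset (denot_der _ _ ux).
  rewrite -[tsubst _ _]/(TDer x (subst A s) (tsubst P s)).
  have -> := denot_der (cs (A := WhyNot A) c) (tsubst P s) (proj2 (esub_None u x) ux).
  rewrite cs_whynot; split=> [[a ca h]|[a ca h]].
    exists (cs a); first by rewrite ca image_set1.
    by rewrite -esub_pset; apply/(IHP _ dP) => //; exact: etyped_pset.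
  have [a0 ca0 a0a] : (@cs _ _ s X A @` sval c) a by rewrite ca.
  exists a0.
    by apply: (image_inj_eq (@cs_inj _ _ s X A)); rewrite ca image_set1 a0a.
  by apply/(IHP _ dP); [exact: etyped_pset | rewrite esub_pset a0a].
- move=> n x A P IHP _ [C [Cx -> dP]] m s X r.
  move=> /(etyped_pset_inv Cx)[u [c [ux tu ->]]].
  rewrite esub_pset (denot_weak _ _ ux).
  rewrite -[tsubst _ _]/(TWeak x (subst A s) (tsubst P s)).
  have -> := denot_weak (cs (A := WhyNot A) c) (tsubst P s) (proj2 (esub_None u x) ux).
  rewrite cs_whynot (IHP _ dP) //; split=> -[c0 h]; split=> //; first by rewrite c0 image_set0.
  by apply: (image_inj_eq (@cs_inj _ _ s X A)); rewrite c0 image_set0.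
- move=> n x y A P IHP _ [C [[Cx Cy xy ->] dP]] m s X r.
  move=> /(etyped_pset_inv Cx)[u [e [ux tu ->]]].
  have uy := etyped_None tu Cy.
  rewrite esub_pset (denot_contr _ _ ux uy).
  rewrite -[tsubst _ _]/(TContr x y (subst A s) (tsubst P s)).
  have -> := denot_contr (cs (A := WhyNot A) e) (tsubst P s) (proj2 (esub_None u x) ux)
    (proj2 (esub_None u y) uy).
  split=> [[c [d [ce h]]]|[c [d []]]].
    exists (cs (A := WhyNot A) c), (cs (A := WhyNot A) d); rewrite !cs_whynot ce image_setU.
    split=> //; have := IHP _ dP _ s X (pset (pset u y (Pt d)) x (Pt c)).
    by rewrite !esub_pset => /(_ _)[|+ _]; [do 2!apply: etyped_pset | apply].
  have [c0 <-] := @cs_surj _ _ s X (WhyNot A) c; have [d0 <-] := @cs_surj _ _ s X (WhyNot A) d.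
  rewrite !cs_whynot -image_setU => /(image_inj_eq (@cs_inj _ _ s X A)) ce h.
  exists c0, d0; split=> //.
  by apply/(IHP _ dP); [do 2!apply: etyped_pset | rewrite !esub_pset].
- move=> n x A P IHP _ [C [Cx -> dP]] m s X r.
  move=> /(etyped_pset_inv Cx)[u [c [ux tu ->]]].
  rewrite esub_pset (denot_all _ _ ux).
  rewrite -[tsubst _ _]/(TAll x (subst A (up s)) (tsubst P (up s))).
  have -> := denot_all (A := subst A (up s)) (cs (A := All A) c) (tsubst P (up s))
    (proj2 (esub_None u x) ux).
  have cc := jv_psub (Pt (A := All A) c).
  have key V (a : rweb (interp A) (ext (sobj s X) V)) b :
     psub (trpt (ext_sobj s X V) (Pt a)) = Pt b ->
     denot P (pset (wk_env V u) x (Pt a)) <->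
     denot (tsubst P (up s)) (pset (wk_env V (esub u)) x (@Pt _ (ext X V) (subst A (up s)) b)).
    move=> ab; rewrite -(denot_trenv P (ext_sobj s X V)) (IHP _ dP _ (up s) (ext X V)).
      by rewrite trenv_pset esub_psetp ab esub_wk.
    by apply: etyped_trenv; apply: etyped_pset; exact: wk_env_typed.
  split=> [[[Z a] ca h]|[[Z b] cb h]].
    have [b ab ba] := psub_ext (s := s) (X := X) (V := hc_of (Z None)) (A := A) a.
    exists (existT _ Z b); last exact: (proj1 (key _ _ _ ab) h).
    exact: (proj1 (trace_jv (esym (partial_subst A s X)) (esym cc) (esym ba)) ca).
  have [a ab ba] := psub_ext_surj (s := s) (X := X) (V := hc_of (Z None)) (A := A) b.
  exists (existT _ Z a); last exact: (proj2 (key _ _ _ ab) h).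
  exact: (proj2 (trace_jv (esym (partial_subst A s X)) (esym cc) (esym ba)) cb).
- move=> n x A B P IHP _ [C [Cx -> dP]] m s X r.
  move=> /(etyped_pset_inv Cx)[u [c [ux tu ->]]].
  rewrite esub_pset (denot_ex _ _ _ ux).
  rewrite -[tsubst _ _]/(TEx x (subst A (up s)) (subst B s) (tsubst P s)).
  have -> := denot_ex (A := subst A (up s)) (subst B s) (cs (A := Ex A) c) (tsubst P s)
    (proj2 (esub_None u x) ux).
  have cc := jv_psub (Pt (A := Ex A) c).
  have eB : (fun=> robj (interp (subst B s)) X) =
      (fun=> robj (interp B) (sobj s X)) :> hcohs 1 by rewrite interp_subst.
  have key (a : rweb (interp (inst A B)) (sobj s X))
      (b : rweb (interp (inst (subst A (up s)) (subst B s))) X) :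
      Pt (cs a) = Pt b ->
      (nf_of (partial_f (interp A) (sobj s X)) (inst_pt a) (sval c) <->
       nf_of (partial_f (interp (subst A (up s))) X) (inst_pt b)
         (sval (cs (A := Ex A) c : rweb (interp (Ex (subst A (up s)))) X))) /\
      (denot P (pset u x (Pt a)) <-> denot (tsubst P s) (pset (esub u) x (Pt b))).
    move=> ab; split; last first.
      by rewrite -ab -esub_pset; apply: (IHP _ dP); exact: etyped_pset.
    symmetry; apply: (nf_jv (partial_subst A s X) eB cc).
    rewrite /inst_pt (jv_cast (interp_inst A B)).
    rewrite (jv_cast (interp_inst (subst A (up s)) (subst B s))).
    by rewrite -[LHS]/(jv (Pt b)) -ab -[RHS]/(jv (Pt a)); exact: (jv_psub (Pt a)).
  split=> [[a ac h]|[b bc h]].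
    have [b bE] := Pt_tag (p := Pt (cs a)) (subst_inst A B s).
    have [k1 k2] := key a b bE.
    by exists b; [exact: (proj1 k1) | exact: (proj1 k2)].
  have [b0 bE] := Pt_tag (p := Pt b) (esym (subst_inst A B s)).
  have [a ab] := cs_surj b0; rewrite -ab in bE.
  have [k1 k2] := key a b (esym bE).
  by exists a; [exact: (proj2 k1) | exact: (proj2 k2)].
Qed.

(** * Instantiation and promotion *)

Section FormulaInjectivity.
Variable n : nat.
Implicit Types A B : formula n.

Lemma Par_inj A B A' B' : Par A B = Par A' B' -> A = A' /\ B = B'.
Proof. by case=> h1 h2; split; [exact: (existT_inj h1) | exact: (existT_inj h2)]. Qed.

Lemma With_inj A B A' B' : With A B = With A' B' -> A = A' /\ B = B'.
Proof. by case=> h1 h2; split; [exact: (existT_inj h1) | exact: (existT_inj h2)]. Qed.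

Lemma WhyNot_inj A A' : WhyNot A = WhyNot A' -> A = A'.
Proof. by case=> h; exact: (existT_inj h). Qed.

Lemma Ex_inj (A A' : formula n.+1) : Ex A = Ex A' -> A = A'.
Proof. by case=> h; exact: (existT_inj h). Qed.

End FormulaInjectivity.

Lemma csubst_var n (C : context n) :
  csubst (fun i => @Var n.+1 (Some i)) C = ctx_wk C.
Proof.
by apply: funext => z; rewrite /csubst /ctx_wk; case: (C z) => //= A; rewrite /wk rename_var.
Qed.

Lemma der_twk n (P : term n) C : der P C -> der (twk P) (ctx_wk C).
Proof. by move=> /(der_subst (fun i => @Var n.+1 (Some i))); rewrite csubst_var. Qed.

(** Weakening of proofs is a substitution by variables, and on environments the two casts [wk_pt]
    and [psub] agree because both are invisible to heterogeneous equality. *)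
Lemma denot_twk n (P : term n) C (X : hcohs n) (Z : hcoh) (r : env X) :
  der P C -> etyped C r -> denot (twk P) (wk_env Z r) <-> denot P r.
Proof.
move=> dP tr; pose s i := @Var n.+1 (Some i).
have -> : wk_env Z r = @esub n n.+1 s (ext X Z) r.
  apply: funext => z; rewrite /esub /wk_env; case: (r z) => //= p; congr Some.
  apply: point_ext; first by rewrite /= /wk rename_var.
  by rewrite jv_wk (jv_psub (s := s) (X := ext X Z)).
have h := denot_subst dP; symmetry; exact (h n.+1 s (ext X Z) r tr).
Qed.

Lemma sobj_inst1 n (B : formula n) (X : hcohs n) :
  ext X (robj (interp B) X) = sobj (inst1 B) X.
Proof. by apply: functional_extensionality_dep => -[i|]. Qed.

Lemma denot_inst n (P : term n.+1) (C : context n) x (A : formula n.+1) (B : formula n)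
    (X : hcohs n) (r : env X) (a : rweb (interp (inst A B)) X) :
  C x = None -> der P (pset (ctx_wk C) x A) -> etyped C r ->
  denot (tsubst P (inst1 B)) (pset r x (Pt a)) <->
  denot P (pset (wk_env (robj (interp B) X) r) x
     (@Pt _ (ext X (robj (interp B) X)) A (inst_pt a))).
Proof.
move=> Cx dP tr; rewrite -(denot_trenv P (sobj_inst1 B X)).
have h := denot_subst dP; rewrite (h n (inst1 B) X); last first.
  by apply: etyped_trenv; apply: etyped_pset; exact: wk_env_typed.
rewrite trenv_pset esub_psetp.
suff [-> ->] : esub (trenv (sobj_inst1 B X) (wk_env (robj (interp B) X) r)) = r /\
    psub (trpt (sobj_inst1 B X) (@Pt _ (ext X (robj (interp B) X)) A (inst_pt a))) = Pt a by [].
split.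
  apply: funext => z; rewrite /esub /trenv /wk_env; case: (r z) => //= p; congr Some.
  apply: point_ext; last by rewrite jv_psub jv_trpt jv_wk.
  by rewrite /= tag_trpt /= /wk subst_rename subst_var.
apply: point_ext; first by rewrite /= tag_trpt.
rewrite jv_psub jv_trpt; exact: (jv_cast (interp_inst A B)).
Qed.

Section AllPoints.
Variables (n x : nat) (A : formula n.+1) (P : term n.+1) (C : context n).
Hypotheses (Cx : C x = None) (dP : der P (pset (ctx_wk C) x A)).

Lemma denot_all_nf (X : hcohs n) (s : env X) c : s x = None ->
  denot (TAll x A P) (pset s x (@Pt _ X (All A) c)) <->
  forall (V : hcohs 1) (a : rweb (interp A) (ext X (V None))),
      nf_of (partial_f (interp A) X) (Y := V) a (sval c) ->
      denot P (pset (wk_env (V None) s) x (@Pt _ (ext X (V None)) A a)).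
Proof.
have [uP cP] := denot_sound dP.
have AE := denot_allE x A uP.
move=> sx; split=> [/AE[c' [s' [sx' e h]]]|h].
  by have [-> /Pt_inj ->] := pset_inj sx sx' e.
by apply/AE; exists c, s.
Qed.

(* By uniformity, a single point of [P] yields all the points with the same
   normal form. *)
Lemma trace_point (X : hcohs n) (s : env X) (V : hcohs 1)
    (a : rweb (interp A) (ext X (V None))) : etyped C s ->
  denot P (pset (wk_env (V None) s) x (@Pt _ (ext X (V None)) A a)) ->
  exists2 c : rweb (interp (All A)) X,
    nf_of (partial_f (interp A) X) (Y := V) a (sval c)
    & denot (TAll x A P) (pset s x (Pt c)).
Proof.
move=> ts h; have [uP cP] := denot_sound dP.
have nA := normal_interp A; have fX := functorial_partial nA X.
have [N aN] := nf_exists fX (nrm_fin (normal_partial nA X)) (X := V) a.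
have all (W : hcohs 1) (b : rweb (interp A) (ext X (W None))) :
    nf_of (partial_f (interp A) X) (Y := W) b N ->
    denot P (pset (wk_env (W None) s) x (@Pt _ (ext X (W None)) A b)).
  have [NN [u Nu [g ua]]] := aN => bN.
  have [k ub] := nf_of_all fX bN Nu.
  rewrite partial_hact in ua; rewrite partial_hact in ub.
  have : denot P (pset (wk_env (rep_base u None) s) x
      (@Pt _ (ext X (rep_base u None)) A (rep_point u))).
    apply/(uP _ _ (exte (eid X) (g None))); rewrite eact_pset eact_wk eact_eid.
    by move/actE: ua => ->.
  move=> /(proj1 (uP _ _ (exte (eid X) (k None)) _)); rewrite eact_pset eact_wk eact_eid.
  by move/actE: ub => ->.
(* The class itself must be shown coherent. Over any [W] its points give points of [P] with a common
   context, so that a set of them, if not a singleton, is strictly coherent at [A]. *)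
have cN : NF (partial_f (interp A) X) N /\ coherent_nf [set N].
  split; first by case: aN.
  split; [exact: fin_ne1 | by move=> _ ->; case: aN |] => W S fS SN.
  have SNF b : S b -> nf_of (partial_f (interp A) X) (Y := W) b N.
    move=> Sb; have [M bM] := nf_exists fX (nrm_fin (normal_partial nA X)) (X := W) b.
    have : nf_set (partial_f (interp A) X) (Y := W) S M by exists b.
    by rewrite SN => <-.
  pose pt (b : rweb (interp A) (ext X (W None))) := pset (wk_env (W None) s) x (Pt b).
  have Sx : eproj x A (pt @` S) = S.
    apply/seteqP; split=> [b [_ [b' Sb' <-]]|b Sb].
      by rewrite /pt psetE => /Some_inj/Pt_inj <-.
    by exists (pt b); [exists b | rewrite /pt psetE].
  have [|h1|[z [B [Bz sz]]]] := cP _ (pt @` S) (image_fin_ne _ fS).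
  - by move=> _ [b Sb <-]; apply: all; exact: SNF.
  - apply: coh_subsingleton => // b b' Sb Sb'.
    have : pt b = pt b' by apply: h1; [exists b | exists b'].
    by move=> /(congr1 (fun g : pmap _ => g x)); rewrite /pt !psetE => /Some_inj/Pt_inj.
  case: (z =P x) => zx.
    by move: Bz sz; rewrite zx psetE => -[<-]; rewrite Sx => -[].
  exfalso; apply: (strict_sub_false sz) => b b' [_ [k _ <-]] + [_ [k' _ <-]].
  rewrite /pt /pset; case: eqP => // _ -> /Some_inj/Pt_inj //.
pose c : rweb (interp (All A)) X := exist _ N cN.
by exists c => //; apply/(denot_all_nf _ (etyped_None ts Cx)) => W b; exact: all.
Qed.

End AllPoints.

(** * Collecting, splitting and gluing points of a promotion *)

Section Promotion.
Variables (n x : nat) (A : formula n) (L : sequent n) (P : term n).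
Hypotheses (Lx : whynots L x = None) (dP : der P (pset (whynots L) x A)).
Variable X : hcohs n.
Implicit Types (s t : env X) (T : env X -> Prop) (c : rweb (interp (Bang A)) X).

Definition ctx_bounded T := forall z B, plist L z = Some B ->
  exists d : rweb (interp (WhyNot B)) X, forall t e, T t ->
    t z = Some (Pt (A := WhyNot B) e) -> forall b, sval e b -> sval d b.

(** A strictly coherent multisection at a context name would be a subset of [d], which is a clique
    of the dual of [B]. So the context is never strict and the premise is decided at [A]. *)
Lemma ctx_bounded_coherence T : fin_ne T -> T `<=` @denot _ P X -> ctx_bounded T ->
  (forall t t', T t -> T t' -> t = t') \/ strict_coh (rstr (interp A) X) (eproj x A T).
Proof.
have [uP cP] := denot_sound dP.
move=> fT TP bT; apply: (promotion_coherence cP fT) => // z B Lz.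
have [d hd] := bT z B Lz; move=> /strict_whynot[_ [M [fM [_ M2] sM]]].
have [_ cd] := svalP d; have Md : M `<=` sval d.
  by move=> b /M2[e [t Tt te] eb]; exact: hd Tt te b eb.
by have [_] : perp_coh (rstr (interp B) X) M by exact: cd Md.
Qed.

Lemma sub_ctx_bounded T T' : (forall t, T' t -> T t) -> ctx_bounded T -> ctx_bounded T'.
Proof.
move=> TT bT z B Lz; have [d hd] := bT z B Lz.
by exists d => t e /TT; exact: hd.
Qed.

Lemma bang_web_sub (H : hcoh) (d : bang_web (str H)) (S : H -> Prop) :
  (forall b, S b -> sval d b) -> exists e : bang_web (str H), sval e = S.
Proof.
move=> Sd; have [fd cd] := svalP d.
have SP : finite_set S /\ clique (X := Hcoh (str H)) S.
  by split; [exact: sub_finite_set Sd fd | move=> U fU US; apply: cd => // b /US/Sd].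
by exists (exist _ S SP).
Qed.

Lemma collects_bounded T s c : collects x L T s c -> ctx_bounded T.
Proof.
move=> [_ h] z B Lz; have [d _ de] := h z B Lz; exists d => t e Tt te b eb.
by rewrite de; exists t => //; exists e.
Qed.

(** The bounds turn the unions on the context into finite cliques; for the promoted formula, any
    finite part of the collected set is the projection of a bounded subset of [T], hence
    coherent. *)
Lemma promote_exists T : finite_set T -> T `<=` @denot _ P X -> ctx_bounded T ->
  exists s c, etyped (whynots L) s /\ collects x L T s c.
Proof.
move=> fT TP bT.
have [c ce] : exists c, sval c = [set a | exists2 t, T t & t x = Some (Pt (A := A) a)].
  pose S a := exists2 t, T t & t x = Some (Pt (A := A) a).
  have SP : finite_set S /\ clique (X := Hcoh (rstr (interp A) X)) S.
    split; last first.
      move=> U fU US; pose T' t := T t /\ exists2 a, U a & t x = Some (Pt a).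
      have e : eproj x A T' = U.
        apply/seteqP; split=> [a [t [Tt [b Ub tb]] ta]|a Ua].
          by move: ta; rewrite tb => /Some_inj/Pt_inj <-.
        by have [t Tt ta] := US a Ua; exists t => //; split=> //; exists a.
      have [|||h|] := @ctx_bounded_coherence T'.
      - split; first by apply: sub_finite_set fT => t [].
        by have [_ [a Ua]] := fU; have [t Tt ta] := US a Ua; exists t; split=> //; exists a.
      - by move=> t [/TP].
      - by apply: sub_ctx_bounded bT => t [].
      - apply: coh_subsingleton => // a b; rewrite -e => -[t Tt ta] [t' Tt' tb].
        by move: tb; rewrite -(h t t') // ta => /Some_inj/Pt_inj.
      - by rewrite e => -[].
    have fi := finite_image (fun t : env X => t x) fT.
    apply: (finite_inj_on fi (f := fun a => Some (Pt (A := A) a))).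
      by move=> a [t Tt ta]; exists t.
    by move=> a b _ _ /Some_inj/Pt_inj.
  by exists (exist _ S SP).
have /choice[s sE] : forall z, exists o : option (point X), match plist L z with
    | Some B => exists2 d : rweb (interp (WhyNot B)) X, o = Some (Pt d) &
       sval d = [set b | exists2 t, T t & exists2 d : rweb (interp (WhyNot B)) X,
                    t z = Some (Pt d) & sval d b]
    | None => o = None end.
  move=> z; case Lz: (plist L z) => [B|]; last by exists None.
  have [d hd] := bT z B Lz.
  pose S (b : rweb (interp B) X) := exists2 t, T t &
    exists2 d : rweb (interp (WhyNot B)) X, t z = Some (Pt d) & sval d b.
  have Sd (b : rweb (interp B) X) : S b -> sval d b.
    by move=> [t Tt [e te eb]]; exact: hd Tt te b eb.
  have [e eS] := bang_web_sub (H := Hcoh (hperp (rstr (interp B) X))) (d := d) Sd.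
  by exists (Some (Pt (A := WhyNot B) e)), e.
exists s, c; split; last first.
  by split=> // z B Lz; have := sE z; rewrite Lz.
move=> z; have := sE z; rewrite whynotsE; case: (plist L z) => [B [d -> _]|->] //.
Qed.

Lemma collects_fun T s s' c c' : etyped (whynots L) s -> etyped (whynots L) s' ->
  collects x L T s c -> collects x L T s' c' -> s = s' /\ c = c'.
Proof.
move=> ts ts' [ce h] [ce' h']; split; last by apply: sval_inj; rewrite ce ce'.
apply: funext => z; have := ts z; have := ts' z; rewrite whynotsE.
case Lz: (plist L z) => [B|] /=; last by case: (s z) (s' z) => [?|] [?|].
move=> _ _; have [d sz de] := h z B Lz; have [d' sz' de'] := h' z B Lz.
by rewrite sz sz'; congr (Some (Pt _)); apply: sval_inj; rewrite de de'.
Qed.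

Lemma bang_sing (a : rweb (interp A) X) : exists c, sval c = [set a].
Proof.
have cP : finite_set [set a] /\ clique (X := Hcoh (rstr (interp A) X)) [set a].
  split; first exact: finite_set1.
  by move=> U fU Ua; apply: coh_subsingleton => // b b' /Ua -> /Ua ->.
by exists (exist (fun S => finite_set S /\ clique (X := Hcoh (rstr (interp A) X)) S) _ cP).
Qed.

(** All points of a set collected into [[set a]] project to [a], so that [ctx_bounded_coherence]
    makes them equal and the set is a single point of the premise. *)
Lemma denot_bang_sing s c a : etyped (whynots L) s -> sval c = [set a] ->
  denot (TBang x A L P) (pset s x (@Pt _ X (Bang A) c)) <-> denot P (pset s x (Pt a)).
Proof.
move=> ts ca; have sx := etyped_None ts Lx; rewrite (denot_bang _ _ Lx ts).
have coll1 t : etyped (whynots L) t -> collects x L [set pset t x (Pt a)] t c.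
  move=> tt; split.
    rewrite ca; apply/seteqP; split=> [_ ->|b [_ ->]]; last by rewrite psetE => /Some_inj/Pt_inj.
    by exists (pset t x (Pt a)) => //; rewrite psetE.
  move=> z B Lz; have [d td] := etyped_pt tt (plist_whynots Lz); exists d => //.
  have zx : z <> x by move=> zx; move: Lx; rewrite whynotsE -zx Lz.
  apply/seteqP; split=> [b db|b [_ -> [d' + db]]].
    by exists (pset t x (Pt a)) => //; exists d => //; rewrite /pset; case: eqP.
  by rewrite /pset; case: eqP => // _; rewrite td => /Some_inj/Pt_inj ->.
split=> [[T [fT TP cT]]|h]; last first.
  exists [set pset s x (Pt a)]; split; [exact: finite_set1 | by move=> _ -> | exact: coll1].
have [ce _] := cT; rewrite ca in ce.
have [t Tt ta] : (fun a => exists2 t, T t & t x = Some (Pt a)) a.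
  by have : [set a] a by []; rewrite ce.
have [|h|sT] := @ctx_bounded_coherence T _ TP (collects_bounded cT).
- by split=> //; exists t.
- have [u [b [ux tu te]]] := etyped_pset_inv Lx (denot_typed dP (TP t Tt)).
  move: ta; rewrite te psetE => /Some_inj/Pt_inj ba; rewrite ba in te.
  have TE : T = [set pset u x (Pt a)].
    by apply/seteqP; split=> [t' Tt'|_ ->]; [rewrite -te; apply: h | rewrite -te].
  rewrite TE in cT; have [-> _] := collects_fun ts tu cT (coll1 u tu).
  by rewrite -te; exact: TP.
exfalso; apply: (strict_sub_false sT) => b b' hb hb'.
have E k : eproj x A T k -> k = a.
  by move=> [t' Tt' tk]; have : [set a] k by rewrite ce; exists t'.
by rewrite (E b hb) (E b' hb').
Qed.

Definition union_env s s1 s2 := forall z B d, plist L z = Some B ->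
  s z = Some (Pt (A := WhyNot B) d) -> exists d1 d2 : rweb (interp (WhyNot B)) X,
   [/\ s1 z = Some (Pt d1), s2 z = Some (Pt d2) & sval d = sval d1 `|` sval d2].

Definition picks (T : env X -> Prop) (k : rweb (interp (Bang A)) X) : env X -> Prop :=
  [set t | T t /\ exists2 a, sval k a & t x = Some (Pt a)].

(** Keeping only the premise points over [k] shrinks the contexts, which therefore remain inside the
    same finite cliques and can be promoted again. *)
Lemma collects_part T s c k : finite_set T -> T `<=` @denot _ P X -> collects x L T s c ->
  (forall a, sval k a -> sval c a) ->
  exists s', [/\ etyped (whynots L) s', collects x L (picks T k) s' k &
    denot (TBang x A L P) (pset s' x (@Pt _ X (Bang A) k))].
Proof.
move=> fT TP cT kc; have [ce _] := cT; have TiT t : picks T k t -> T t by case.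
have fTi : finite_set (picks T k) by exact: sub_finite_set fT.
have TiP : picks T k `<=` @denot _ P X by move=> t /TiT/TP.
have [s' [k' [ts' ck]]] := promote_exists fTi TiP (sub_ctx_bounded TiT (collects_bounded cT)).
have kk : k' = k.
  apply: sval_inj; have [-> _] := ck.
  apply/seteqP; split=> [a [t [_ [b kb tb]] ta]|a ka].
    by move: ta; rewrite tb => /Some_inj/Pt_inj <-.
  have := kc a ka; rewrite ce => -[t Tt ta]; exists t => //.
  by split=> //; exists a.
rewrite kk in ck; exists s'; split=> //.
by apply/(denot_bang _ _ Lx ts'); exists (picks T k).
Qed.

Lemma denot_bang_split s c c1 c2 : etyped (whynots L) s ->
  sval c = sval c1 `|` sval c2 ->
  denot (TBang x A L P) (pset s x (@Pt _ X (Bang A) c)) ->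
  exists s1 s2, [/\ etyped (whynots L) s1, etyped (whynots L) s2, union_env s s1 s2 &
    denot (TBang x A L P) (pset s1 x (@Pt _ X (Bang A) c1)) /\
    denot (TBang x A L P) (pset s2 x (@Pt _ X (Bang A) c2))].
Proof.
move=> ts cc /(denot_bang _ _ Lx ts)[T [fT TP cT]]; have [ce hT] := cT.
have half := collects_part fT TP cT.
have [s1 [ts1 k1 h1]] := half c1 (fun a h => eq_ind_r (fun S : _ -> Prop => S a) (or_introl h) cc).
have [s2 [ts2 k2 h2]] := half c2 (fun a h => eq_ind_r (fun S : _ -> Prop => S a) (or_intror h) cc).
exists s1, s2; split=> // z B d Lz sz.
have [d1 sz1 de1] := k1.2 z B Lz; have [d2 sz2 de2] := k2.2 z B Lz; exists d1, d2; split=> //.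
have [d' + de] := hT z B Lz; rewrite sz => /Some_inj/Pt_inj dd; rewrite dd de de1 de2.
apply/seteqP; split=> [b [t Tt tb]|b [[t [Tt _] tb]|[t [Tt _] tb]]]; try by exists t.
have [a ta] := premise_pt dP (TP t Tt).
have : sval c a by rewrite ce; exists t.
by rewrite cc => -[ka|ka]; [left | right]; exists t => //; split=> //; exists a.
Qed.

Lemma denot_bang_merge s s1 s2 c1 c2 : etyped (whynots L) s ->
  etyped (whynots L) s1 -> etyped (whynots L) s2 -> union_env s s1 s2 ->
  denot (TBang x A L P) (pset s1 x (@Pt _ X (Bang A) c1)) ->
  denot (TBang x A L P) (pset s2 x (@Pt _ X (Bang A) c2)) ->
  exists2 c, sval c = sval c1 `|` sval c2 &
    denot (TBang x A L P) (pset s x (@Pt _ X (Bang A) c)).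
Proof.
move=> ts ts1 ts2 ss /(denot_bang _ _ Lx ts1)[T1 [fT1 TP1 [ce1 h1]]].
move=> /(denot_bang _ _ Lx ts2)[T2 [fT2 TP2 [ce2 h2]]].
pose T := T1 `|` T2.
have fT : finite_set T by rewrite finite_setU.
have TP : T `<=` @denot _ P X by move=> t [/TP1|/TP2].
have un z B : plist L z = Some B -> exists2 d : rweb (interp (WhyNot B)) X, s z = Some (Pt d) &
    sval d = [set b | exists2 t, T t & exists2 d : rweb (interp (WhyNot B)) X,
                    t z = Some (Pt d) & sval d b].
  move=> Lz; have [d sz] := etyped_pt ts (plist_whynots Lz); exists d => //.
  have [d1 [d2 [sz1 sz2 ->]]] := ss z B d Lz sz.
  have [e1 + de1] := h1 z B Lz; rewrite sz1 => /Some_inj/Pt_inj ->.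
  have [e2 + de2] := h2 z B Lz; rewrite sz2 => /Some_inj/Pt_inj ->; rewrite de1 de2.
  apply/seteqP; split=> [b [[t Tt tb]|[t Tt tb]]|b [t [Tt|Tt] tb]].
  - by exists t => //; left.
  - by exists t => //; right.
  - by left; exists t.
  - by right; exists t.
have bT : ctx_bounded T.
  move=> z B Lz; have [d _ de] := un z B Lz; exists d => t e Tt te b eb.
  by rewrite de; exists t => //; exists e.
have [s' [c [ts' cT]]] := promote_exists fT TP bT; have [ce _] := cT; exists c.
  rewrite ce ce1 ce2; apply/seteqP; split=> [b [t [Tt|Tt] tb]|b [[t Tt tb]|[t Tt tb]]].
  - by left; exists t.
  - by right; exists t.
  - by exists t => //; left.
  - by exists t => //; right.
apply/(denot_bang _ _ Lx ts); exists T; split=> //.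
Qed.

End Promotion.

(** * Commutation of cuts *)

Definition equi n (P Q : term n) := forall (X : hcohs n) (r : env X), denot P r <-> denot Q r.

Lemma typed_equi n (P Q : term n) E : der P E -> der Q E ->
  (forall (X : hcohs n) (r : env X), etyped E r -> denot P r <-> denot Q r) -> equi P Q.
Proof.
move=> dP dQ h X r; case: (pselect (etyped E r)) => [/h //|nr].
by split=> /denot_typed; [move=> /(_ _ dP) | move=> /(_ _ dQ)].
Qed.

Lemma pjoin_pset (T : Type) (k s : pmap T) z a : k z = None ->
  pjoin k (pset s z a) = pset (pjoin k s) z a.
Proof. by move=> kz; apply: funext => w; rewrite /pjoin /pset; case: eqP => // ->; rewrite kz. Qed.

Lemma pjoinA (T : Type) (r s t : pmap T) : pjoin r (pjoin s t) = pjoin (pjoin r s) t.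
Proof. by apply: funext => w; rewrite /pjoin; case: (r w). Qed.

Lemma pjoinC (T : Type) (s t : pmap T) : pdisjoint s t -> pjoin s t = pjoin t s.
Proof.
by move=> st; apply: funext => w; rewrite /pjoin; case: (st w) => ->; [case: (t w) | case: (s w)].
Qed.

Lemma pdisjointC (T : Type) (s t : pmap T) : pdisjoint s t -> pdisjoint t s.
Proof. by move=> st w; case: (st w); [right | left]. Qed.

(* The rules that act on a few formulas [K i] of their premises [P i], replace
   them by [Kc], and leave the rest of the context alone. *)
Definition local_rule n (I : Type) (R : (I -> term n) -> term n) (Kc : context n)
    (K : I -> context n) (rel : forall X : hcohs n, env X -> I -> env X -> Prop) :=
  (forall P E, der (R P) E -> exists C, [/\ pdisjoint Kc C, E = pjoin Kc C &
     forall i, pdisjoint (K i) C /\ der (P i) (pjoin (K i) C)]) /\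
  (forall P C, pdisjoint Kc C ->
     (forall i, pdisjoint (K i) C /\ der (P i) (pjoin (K i) C)) ->
     forall (X : hcohs n) (k s : env X), etyped Kc k -> etyped C s ->
     denot (R P) (pjoin k s) <->
     exists i k', [/\ etyped (K i) k', rel X k i k' & denot (P i) (pjoin k' s)]).

(** The name [z] is absent from the conclusion, hence from [Kc], and it sits in the part of the
    context shared by the premises, hence outside every [K i]. Both sides then ask for a branch [i],
    its active point and a cut point, chosen in a different order. *)
Lemma local_commute n (I : Type) (R : (I -> term n) -> term n) Kc K rel P z C Q E :
  local_rule R Kc K rel -> inhabited I ->
  der (Cut z C (R P) Q) E -> der (R (fun i => Cut z C (P i) Q)) E ->
  equi (Cut z C (R P) Q) (R (fun i => Cut z C (P i) Q)).
Proof.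
move=> [Rd RD] [i0] dl dr; apply: (typed_equi dl dr) => X r.
have [C1 [D1 [[C1z D1z CD1 El] [dR dQ]]]] := dl.
have [C2 [KC2 e2 dP]] := Rd _ _ dR; have [C0 [KC0 Er dc]] := Rd _ _ dr.
have Kcz : Kc z = None.
  by have := congr1 (fun f => f z) (etrans (esym Er) El); rewrite /pjoin C1z D1z; case: (Kc z).
pose C4 : context n := fun w => if w == z then None else C2 w.
have C4z : C4 z = None by rewrite /C4 eqxx.
have C2z : C2 z = Some C.
  by have := congr1 (fun f => f z) e2; rewrite /pset eqxx /pjoin Kcz.
have C2E : C2 = pset C4 z C.
  by apply: funext => w; rewrite /pset /C4; case: eqP => // ->.
have C1E : C1 = pjoin Kc C4.
  apply: funext => w; have := congr1 (fun f => f w) e2; rewrite /pset /pjoin /C4.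
  by case: eqP => // ->; rewrite Kcz C1z.
have KC4 : pdisjoint Kc C4.
  by move=> w; case: (KC2 w); [left | rewrite /C4; case: eqP; right].
have Kz i : K i z = None by have [/(_ z)[] //] := dP i; rewrite C2z.
have KC4' i : pdisjoint (K i) C4.
  by move=> w; have [/(_ w)[] h] := dP i; [left | rewrite /C4; case: eqP; right].
have C0E : C0 = pjoin C4 D1.
  apply: funext => w; have := congr1 (fun f => f w) (etrans (esym Er) El).
  have := CD1 w; have := KC0 w; have := KC4 w; rewrite C1E /pjoin.
  by case: (Kc w) (C4 w) (D1 w) (C0 w) => [?|] [?|] [?|] [?|] //=; intuition congruence.
have C4D1 : pdisjoint C4 D1.
  move=> w; have := CD1 w; have := KC4 w; rewrite C1E /pjoin.
  by case: (Kc w) (C4 w) (D1 w) => [?|] [?|] [?|] //=; intuition congruence.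
have KD1 i : pdisjoint (pjoin (K i) C4) D1.
  move=> w; have [/(_ w)] := dc i; have := C4D1 w; rewrite C0E /pjoin.
  by case: (K i w) (C4 w) (D1 w) => [?|] [?|] [?|] //=; intuition congruence.
have pz i : pjoin (K i) C4 z = None by exact: pjoin_None.
have dPi i : der (P i) (pset (pjoin (K i) C4) z C).
  by rewrite -pjoin_pset // -C2E; have [] := dP i.
rewrite Er => /(etyped_pjoin_inv KC0)[k [u [tk + _ ->]]].
rewrite C0E => /(etyped_pjoin_inv C4D1)[s [t [ts tt st ->]]].
have kz := etyped_None tk Kcz.
have [tks _] := etyped_pjoin KC4 tk ts.
rewrite {1}pjoinA (denot_cut C1z D1z CD1 dR dQ _ tt); last by rewrite C1E.
rewrite (RD _ C0 KC0 dc) //; last by rewrite C0E; have [] := etyped_pjoin C4D1 ts tt.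
have cutE i k' : etyped (K i) k' -> denot (Cut z C (P i) Q) (pjoin k' (pjoin s t)) <->
    exists a, denot (P i) (pjoin k' (pset s z (Pt (A := C) a))) /\
      denot Q (pset t z (Pt (dual_pt a))).
  move=> tk'; have [tks' _] := etyped_pjoin (KC4' i) tk' ts.
  rewrite pjoinA (denot_cut (pz i) D1z (KD1 i) (dPi i) dQ tks' tt).
  by have e := pjoin_pset s _ (etyped_None tk' (Kz i)); split=> -[a]; [rewrite -e | rewrite e]; exists a.
have RE a : denot (R P) (pset (pjoin k s) z (Pt (A := C) a)) <->
    exists i k', [/\ etyped (K i) k', rel X k i k' & denot (P i) (pjoin k' (pset s z (Pt a)))].
  rewrite -pjoin_pset // (RD _ C2 KC2 dP) //.
  by rewrite C2E; exact: etyped_pset.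
split=> [[a [/RE[i [k' [tk' kk' hP]]] hQ]]|[i [k' [tk' kk' /(cutE i k' tk')[a [hP hQ]]]]]].
  by exists i, k'; split=> //; apply/(cutE i k' tk'); exists a.
by exists a; split=> //; apply/RE; exists i, k'.
Qed.

Lemma pjoin_sing (T : Type) (C : pmap T) x a : pjoin (pset pempty x a) C = pset C x a.
Proof. by apply: funext => w; rewrite /pjoin /pset; case: eqP. Qed.

Lemma pdisjoint_sing (T : Type) (C : pmap T) x a :
  pdisjoint (pset pempty x a) C <-> C x = None.
Proof.
split=> [/(_ x)|Cx w]; first by rewrite psetE => -[].
by rewrite /pset; case: eqP => [->|_]; [right | left].
Qed.

Lemma pjoin_sing2 (T : Type) (C : pmap T) x y a b :
  pjoin (pset (pset pempty y b) x a) C = pset (pset C y b) x a.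
Proof. by apply: funext => w; rewrite /pjoin /pset; case: eqP => // _; case: eqP. Qed.

Lemma pdisjoint_sing2 (T : Type) (C : pmap T) x y a b :
  C x = None -> C y = None -> pdisjoint (pset (pset pempty y b) x a) C.
Proof.
move=> Cx Cy w; rewrite /pset; case: eqP => [->|_]; first by right.
by case: eqP => [->|_]; [right | left].
Qed.

(** * Rules acting on a bounded number of formulas *)

Section LocalRules.
Variable n : nat.
Implicit Types (A B C D : formula n) (P Q : term n) (E F : context n) (X : hcohs n).

Lemma etyped_sing X x B (k : env X) : etyped (pset pempty x B) k ->
  exists b, k = pset pempty x (Pt (A := B) b).
Proof.
move=> tk; have [s [b [_ ts ->]]] := etyped_pset_inv (C := pempty) erefl tk.
by exists b; congr (pset _ _ _); apply: funext => w; exact: (etyped_None ts).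
Qed.

Lemma etyped_pempty X (k : env X) : etyped pempty k -> k = pempty.
Proof. by move=> tk; apply: funext => w; exact: (etyped_None tk). Qed.

Lemma unary_commute (R : term n -> term n) x A B
    (rel : forall X, rweb (interp A) X -> rweb (interp B) X -> Prop) P z C Q E :
  (forall P E, der (R P) E ->
     exists F, [/\ F x = None, E = pset F x B & der P (pset F x A)]) ->
  (forall P X (s : env X) b, s x = None -> denot (R P) (pset s x (Pt b)) <->
     exists2 a, rel X a b & denot P (pset s x (Pt a))) ->
  der (Cut z C (R P) Q) E -> der (R (Cut z C P Q)) E ->
  equi (Cut z C (R P) Q) (R (Cut z C P Q)).
Proof.
move=> Rd RD dl dr; refine (@local_commute n unit (fun p => R (p tt)) (pset pempty x B)
  (fun=> pset pempty x A) (fun X k i k' => exists a b, [/\ k = pset pempty x (Pt b),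
     k' = pset pempty x (Pt a) & rel X a b]) (fun=> P) z C Q E _ (inhabits tt) dl dr).
split=> [P' E' /Rd[D [Dx -> dP]]|P' D /pdisjoint_sing Dx dP X k s /etyped_sing[b ->] ts].
  exists D; rewrite pjoin_sing; split=> //; first exact/pdisjoint_sing.
  by move=> [] /=; rewrite pjoin_sing; split=> //; exact/pdisjoint_sing.
rewrite pjoin_sing RD; last exact: etyped_None ts Dx.
split=> [[a ab h]|[[] [k' [_ [a [b' [/(congr1 (fun f : env X => f x))]]]]]]].
  exists tt, (pset pempty x (Pt a)); rewrite pjoin_sing; split=> //; last by exists a, b.
  exact: etyped_pset.
by rewrite !psetE => /Some_inj/Pt_inj <- -> ab; rewrite pjoin_sing; exists a.
Qed.

Lemma nullary_commute (R : term n -> term n) x B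
    (ok : forall X, rweb (interp B) X -> Prop) P z C Q E :
  (forall P E, der (R P) E -> exists F, [/\ F x = None, E = pset F x B & der P F]) ->
  (forall P X (s : env X) b, s x = None -> denot (R P) (pset s x (Pt b)) <->
     ok X b /\ denot P s) ->
  der (Cut z C (R P) Q) E -> der (R (Cut z C P Q)) E ->
  equi (Cut z C (R P) Q) (R (Cut z C P Q)).
Proof.
move=> Rd RD dl dr; refine (@local_commute n unit (fun p => R (p tt)) (pset pempty x B)
  (fun=> pempty) (fun X k i k' => exists2 b, k = pset pempty x (Pt b) & ok X b) (fun=> P) z C Q E _ (inhabits tt) dl dr).
split=> [P' E' /Rd[D [Dx -> dP]]|P' D /pdisjoint_sing Dx dP X k s /etyped_sing[b ->] ts].
  exists D; rewrite pjoin_sing; split=> //; first exact/pdisjoint_sing.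
  by move=> [] /=; split=> // w; left.
rewrite pjoin_sing RD; last exact: etyped_None ts Dx.
split=> [[ob h]|[[] [k' [/etyped_pempty -> [b' /(congr1 (fun f : env X => f x))]]]]].
  by exists tt, pempty; split=> //; exists b.
by rewrite !psetE => /Some_inj/Pt_inj <-.
Qed.

Lemma binary_commute (R : term n -> term n) x y A B D
    (rel : forall X, rweb (interp A) X -> rweb (interp B) X -> rweb (interp D) X -> Prop) P z C Q E :
  x <> y ->
  (forall P E, der (R P) E -> exists E0, [/\ E0 x = None, E0 y = None, E = pset E0 x D &
     der P (pset (pset E0 y B) x A)]) ->
  (forall P X (s : env X) d, s x = None -> s y = None -> denot (R P) (pset s x (Pt d)) <->
     exists a b, rel X a b d /\ denot P (pset (pset s y (Pt b)) x (Pt a))) ->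
  der (Cut z C (R P) Q) E -> der (R (Cut z C P Q)) E ->
  equi (Cut z C (R P) Q) (R (Cut z C P Q)).
Proof.
move=> xy Rd RD dl dr; refine (@local_commute n unit (fun p => R (p tt)) (pset pempty x D)
  (fun=> pset (pset pempty y B) x A) (fun X k i k' => exists a b d, [/\ k = pset pempty x (Pt d),
     k' = pset (pset pempty y (Pt b)) x (Pt a) & rel X a b d]) (fun=> P) z C Q E _ (inhabits tt) dl dr).
split=> [P' E' /Rd[E0 [E0x E0y -> dP]]|P' E0 /pdisjoint_sing E0x dP X k s /etyped_sing[d ->] ts].
  exists E0; rewrite pjoin_sing; split=> //; first exact/pdisjoint_sing.
  by move=> [] /=; rewrite pjoin_sing2; split=> //; exact: pdisjoint_sing2.
have E0y : E0 y = None.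
  have [/(_ y) + _] := dP tt; rewrite /pset; case: (y =P x) => [yx|_]; first by case: xy.
  by rewrite eqxx => -[].
rewrite pjoin_sing RD; [|exact: etyped_None ts E0x|exact: etyped_None ts E0y].
split=> [[a [b [ab h]]]|[[] [k' [_ [a [b [d' [/(congr1 (fun f : env X => f x))]]]]]]]].
  exists tt, (pset (pset pempty y (Pt b)) x (Pt a)); rewrite pjoin_sing2; split=> //.
    by apply: etyped_pset; exact: etyped_pset.
  by exists a, b, d.
by rewrite !psetE => /Some_inj/Pt_inj <- -> ab; rewrite pjoin_sing2; exists a, b.
Qed.

Lemma commute_bot z C x P Q E : der (Cut z C (TBot x P) Q) E -> der (TBot x (Cut z C P Q)) E ->
  equi (Cut z C (TBot x P) Q) (TBot x (Cut z C P Q)).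
Proof.
apply: (@nullary_commute (@TBot n x) x Bot (fun _ _ => True)) => // P' X s [] sx.
by rewrite denot_bot //; split=> [|[]].
Qed.

Lemma commute_weak z C x A P Q E :
  der (Cut z C (TWeak x A P) Q) E -> der (TWeak x A (Cut z C P Q)) E ->
  equi (Cut z C (TWeak x A P) Q) (TWeak x A (Cut z C P Q)).
Proof.
apply: (@nullary_commute (@TWeak n x A) x (WhyNot A) (fun X c => sval c = set0)) => //.
by move=> P' X s b sx; exact: denot_weak.
Qed.

Lemma commute_plus1 z C x A B P Q E :
  der (Cut z C (TPlus1 x A B P) Q) E -> der (TPlus1 x A B (Cut z C P Q)) E ->
  equi (Cut z C (TPlus1 x A B P) Q) (TPlus1 x A B (Cut z C P Q)).
Proof.
apply: (@unary_commute (@TPlus1 n x A B) x A (Plus A B) (fun X a c => c = inl a)) => //.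
by move=> P' X s b sx; exact: denot_plus1.
Qed.

Lemma commute_plus2 z C x A B P Q E :
  der (Cut z C (TPlus2 x A B P) Q) E -> der (TPlus2 x A B (Cut z C P Q)) E ->
  equi (Cut z C (TPlus2 x A B P) Q) (TPlus2 x A B (Cut z C P Q)).
Proof.
apply: (@unary_commute (@TPlus2 n x A B) x B (Plus A B) (fun X a c => c = inr a)) => //.
by move=> P' X s b sx; exact: denot_plus2.
Qed.

Lemma commute_der z C x A P Q E :
  der (Cut z C (TDer x A P) Q) E -> der (TDer x A (Cut z C P Q)) E ->
  equi (Cut z C (TDer x A P) Q) (TDer x A (Cut z C P Q)).
Proof.
apply: (@unary_commute (@TDer n x A) x A (WhyNot A) (fun X a c => sval c = [set a])) => //.
by move=> P' X s b sx; exact: denot_der.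
Qed.

Lemma commute_ex z C x (A : formula n.+1) B P Q E :
  der (Cut z C (TEx x A B P) Q) E -> der (TEx x A B (Cut z C P Q)) E ->
  equi (Cut z C (TEx x A B P) Q) (TEx x A B (Cut z C P Q)).
Proof.
apply: (@unary_commute (@TEx n x A B) x (inst A B) (Ex A)
  (fun X a c => nf_of (partial_f (interp A) X) (inst_pt a) (sval c))) => //.
by move=> P' X s b sx; exact: denot_ex.
Qed.

Lemma commute_par z C x y A B P Q E :
  der (Cut z C (TPar x y A B P) Q) E -> der (TPar x y A B (Cut z C P Q)) E ->
  equi (Cut z C (TPar x y A B P) Q) (TPar x y A B (Cut z C P Q)).
Proof.
move=> dl dr; have [_ [[_ _ xy _] _]] := dr; move: dl dr.
apply: (@binary_commute (@TPar n x y A B) x y A B (Par A B) (fun X a b d => d = (a, b))) => //.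
  by move=> P' E' [D [[Dx Dy _ ->] dP]]; exists D.
move=> P' X s [a b] sx sy; rewrite denot_par //; split=> [h|[_ [_ [[<- <-]]]] //].
by exists a, b.
Qed.

Lemma commute_contr z C x y A P Q E :
  der (Cut z C (TContr x y A P) Q) E -> der (TContr x y A (Cut z C P Q)) E ->
  equi (Cut z C (TContr x y A P) Q) (TContr x y A (Cut z C P Q)).
Proof.
move=> dl dr; have [_ [[_ _ xy _] _]] := dr; move: dl dr.
apply: (@binary_commute (@TContr n x y A) x y (WhyNot A) (WhyNot A) (WhyNot A)
  (fun X c d e => sval e = sval c `|` sval d)) => //.
  by move=> P' E' [D [[Dx Dy _ ->] dP]]; exists D.
by move=> P' X s e sx sy; exact: denot_contr.
Qed.

Lemma commute_with z C x A B P P' Q E :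
  der (Cut z C (TWith x A B P P') Q) E -> der (TWith x A B (Cut z C P Q) (Cut z C P' Q)) E ->
  equi (Cut z C (TWith x A B P P') Q) (TWith x A B (Cut z C P Q) (Cut z C P' Q)).
Proof.
pose br (i : bool) := if i then P else P'.
move=> dl dr; refine (@local_commute n bool (fun p => TWith x A B (p true) (p false)) (pset pempty x (With A B))
  (fun i => pset pempty x (if i then A else B))
  (fun X k i k' => if i then exists a, k = pset pempty x (@Pt _ X (With A B) (inl a)) /\
       k' = pset pempty x (Pt a)
     else exists b, k = pset pempty x (@Pt _ X (With A B) (inr b)) /\
       k' = pset pempty x (Pt b)) br z C Q E _ (inhabits true) dl dr).
split=> [R E' [D [Dx -> d1 d2]]|R D /pdisjoint_sing Dx dR X k s /etyped_sing[c ->] ts].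
  exists D; rewrite pjoin_sing; split=> //; first exact/pdisjoint_sing.
  by move=> [] /=; rewrite pjoin_sing; split=> //; exact/pdisjoint_sing.
have key A0 (d : rweb (interp A0) X) e : pset pempty x (Pt d) = pset pempty x (Pt e) -> d = e.
  by move=> /(congr1 (fun f : env X => f x)); rewrite !psetE => /Some_inj/Pt_inj.
rewrite pjoin_sing denot_with; last exact: etyped_None ts Dx.
case: c => a; split=> [h|[[] [k' [_ [b [/key + ->]]]]]]; rewrite ?pjoin_sing //.
- exists true, (pset pempty x (Pt a)); rewrite pjoin_sing; split=> //; last by exists a.
  exact: etyped_pset.
- by case=> ->.
- exists false, (pset pempty x (Pt a)); rewrite pjoin_sing; split=> //; last by exists a.
  exact: etyped_pset.
- by case=> ->.
Qed.

End LocalRules.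

(** * Commutation into one premise of a cut or a tensor *)

Section TwoPremises.
Variable n : nat.
Implicit Types (A B C : formula n) (P Q : term n) (E F G : context n) (X : hcohs n).

(** Seen as a unary rule on [P]: the premise [P'] is frozen, its context [D'] plays the role of the
    principal formulas and its denotation that of [rel]. By [der_unique] every inversion finds the
    same [D']. *)
Lemma commute_cut1 z C x A P P' Q E :
  der (Cut z C (Cut x A P P') Q) E -> der (Cut x A (Cut z C P Q) P') E ->
  equi (Cut z C (Cut x A P P') Q) (Cut x A (Cut z C P Q) P').
Proof.
move=> dl dr; have [_ [D' [[_ D'x _ _] [_ dP']]]] := dr.
refine (@local_commute n unit (fun p => Cut x A (p tt) P') D' (fun=> pset pempty x A)
  (fun X k i k' => exists2 a, k' = pset pempty x (Pt (A := A) a) &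
     denot P' (pset k x (Pt (dual_pt a)))) (fun=> P) z C Q E _ (inhabits tt) dl dr).
split=> [R E' [F [G [[Fx Gx FG ->] [dR dP'']]]]|R F D'F dR X k s tk ts].
  have [GD _] := pset_inj Gx D'x (der_unique dP'' dP'); rewrite {}GD in FG *.
  exists F; split; [exact: pdisjointC | exact: pjoinC | move=> [] /=].
  by rewrite pjoin_sing; split=> //; exact/pdisjoint_sing.
have [+ dR1] := dR tt; rewrite pjoin_sing in dR1; move=> /pdisjoint_sing Fx.
have [_ ks] := etyped_pjoin D'F tk ts.
rewrite (pjoinC ks) (denot_cut Fx D'x (pdisjointC D'F) dR1 dP' ts tk).
split=> [[a [h h']]|[[] [k' [_ [a -> h']]]]]; last by rewrite pjoin_sing; exists a.
exists tt, (pset pempty x (Pt a)); rewrite pjoin_sing; split=> //; last by exists a.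
exact: etyped_pset.
Qed.

Lemma commute_cut2 z C x A P P' Q E :
  der (Cut z C (Cut x A P P') Q) E -> der (Cut x A P (Cut z C P' Q)) E ->
  equi (Cut z C (Cut x A P P') Q) (Cut x A P (Cut z C P' Q)).
Proof.
move=> dl dr; have [C' [_ [[C'x _ _ _] [dP _]]]] := dr.
refine (@local_commute n unit (fun p => Cut x A P (p tt)) C' (fun=> pset pempty x (dual A))
  (fun X k i k' => exists2 a, k' = pset pempty x (Pt (dual_pt (A := A) a)) &
     denot P (pset k x (Pt a))) (fun=> P') z C Q E _ (inhabits tt) dl dr).
split=> [R E' [F [G [[Fx Gx FG ->] [dP1 dR]]]]|R F C'F dR X k s tk ts].
  have [FC _] := pset_inj Fx C'x (der_unique dP1 dP); rewrite {}FC in FG *.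
  exists G; split=> // -[] /=.
  by rewrite pjoin_sing; split=> //; exact/pdisjoint_sing.
have [+ dR1] := dR tt; rewrite pjoin_sing in dR1; move=> /pdisjoint_sing Fx.
rewrite (denot_cut C'x Fx C'F dP dR1 tk ts).
split=> [[a [h h']]|[[] [k' [_ [a -> h']]]]]; last by rewrite pjoin_sing => ?; exists a.
exists tt, (pset pempty x (Pt (dual_pt a))); rewrite pjoin_sing; split=> //; last by exists a.
exact: etyped_pset.
Qed.

Lemma pjoin_psetl (T : Type) (k s : pmap T) x a : pjoin (pset k x a) s = pset (pjoin k s) x a.
Proof. by apply: funext => w; rewrite /pjoin /pset; case: eqP. Qed.

Lemma pdisjoint_pset (T : Type) (k s : pmap T) x a : k x = None ->
  pdisjoint (pset k x a) s -> pdisjoint k s /\ s x = None.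
Proof.
move=> kx ks; split=> [w|]; last by case: (ks x) => //; rewrite psetE.
by case: (w =P x) => [->|wx]; [left | have := ks w; rewrite /pset; case: eqP].
Qed.

Lemma pset_pdisjoint (T : Type) (k s : pmap T) x a : pdisjoint k s ->
  s x = None -> pdisjoint (pset k x a) s.
Proof. by move=> ks sx w; rewrite /pset; case: eqP => [->|_]; [right | exact: ks]. Qed.

Lemma commute_tensor1 z C x A B P P' Q E :
  der (Cut z C (TTensor x A B P P') Q) E -> der (TTensor x A B (Cut z C P Q) P') E ->
  equi (Cut z C (TTensor x A B P P') Q) (TTensor x A B (Cut z C P Q) P').
Proof.
move=> dl dr; have [_ [D' [[_ D'x _ _] [_ dP']]]] := dr.
refine (@local_commute n unit (fun p => TTensor x A B (p tt) P') (pset D' x (Tensor A B))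
  (fun=> pset pempty x A)
  (fun X k i k' => exists a b t, [/\ t x = None, k' = pset pempty x (Pt (A := A) a),
     k = pset t x (@Pt _ X (Tensor A B) (a, b)) &
     denot P' (pset t x (Pt b))]) (fun=> P) z C Q E _ (inhabits tt) dl dr).
split=> [R E' [F [G [[Fx Gx FG ->] [dR dP'']]]]|R F + dR X k s + ts].
  have [GD _] := pset_inj Gx D'x (der_unique dP'' dP'); rewrite {}GD in FG *.
  exists F; split; first by apply: pset_pdisjoint => //; exact: pdisjointC.
    by rewrite (pjoinC FG) pjoin_psetl.
  by move=> [] /=; rewrite pjoin_sing; split=> //; exact/pdisjoint_sing.
move=> /(pdisjoint_pset D'x)[D'F Fx] /(etyped_pset_inv D'x)[t [[a b] [tx tt' ->]]].
have [_ dR1] := dR tt; rewrite pjoin_sing in dR1.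
have [_ ks] := etyped_pjoin D'F tt' ts.
rewrite pjoin_psetl (pjoinC ks) (denot_tensor a b Fx D'x (pdisjointC D'F) dR1 dP' ts tt').
split=> [[h h']|[[] [k' [_ [a' [b' [t' [tx' ke e h']]]]]]]].
  exists tt, (pset pempty x (Pt a)); rewrite pjoin_sing; split=> //; last by exists a, b, t.
  exact: etyped_pset.
have [-> /Pt_inj[-> ->]] := pset_inj tx tx' e.
by rewrite ke pjoin_sing.
Qed.

Lemma commute_tensor2 z C x A B P P' Q E :
  der (Cut z C (TTensor x A B P P') Q) E -> der (TTensor x A B P (Cut z C P' Q)) E ->
  equi (Cut z C (TTensor x A B P P') Q) (TTensor x A B P (Cut z C P' Q)).
Proof.
move=> dl dr; have [C' [_ [[C'x _ _ _] [dP _]]]] := dr.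
refine (@local_commute n unit (fun p => TTensor x A B P (p tt)) (pset C' x (Tensor A B))
  (fun=> pset pempty x B)
  (fun X k i k' => exists a b t, [/\ t x = None, k' = pset pempty x (Pt (A := B) b),
     k = pset t x (@Pt _ X (Tensor A B) (a, b)) &
     denot P (pset t x (Pt a))]) (fun=> P') z C Q E _ (inhabits tt) dl dr).
split=> [R E' [F [G [[Fx Gx FG ->] [dP1 dR]]]]|R F + dR X k s + ts].
  have [FC _] := pset_inj Fx C'x (der_unique dP1 dP); rewrite {}FC in FG *.
  exists G; split; [exact: pset_pdisjoint | by rewrite pjoin_psetl |].
  by move=> [] /=; rewrite pjoin_sing; split=> //; exact/pdisjoint_sing.
move=> /(pdisjoint_pset C'x)[C'F Fx] /(etyped_pset_inv C'x)[t [[a b] [tx tt' ->]]].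
have [_ dR1] := dR tt; rewrite pjoin_sing in dR1.
rewrite pjoin_psetl (denot_tensor a b C'x Fx C'F dP dR1 tt' ts).
split=> [[h h']|[[] [k' [_ [a' [b' [t' [tx' ke e h']]]]]]]].
  exists tt, (pset pempty x (Pt b)); rewrite pjoin_sing; split=> //; last by exists a, b, t.
  exact: etyped_pset.
have [-> /Pt_inj[-> ->]] := pset_inj tx tx' e.
by rewrite ke pjoin_sing.
Qed.

Lemma commute_top z C x L L' Q :
  equi (Cut z C (TTop x L) Q) (TTop x L').
Proof. by move=> X r; split=> // -[? [? [? [_ [[]]]]]]. Qed.

Lemma cut_sym x A P Q : equi (Cut x A P Q) (Cut x (dual A) Q P).
Proof.
move=> X r; split=> [[a [s [t [[sx tx st ->] [hP hQ]]]]]|[a' [s [t [[sx tx st ->] [hP hQ]]]]]].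
  exists (dual_pt a), t, s; split; last by rewrite dual_ptK.
  by split; [| | exact: pdisjointC | exact: pjoinC].
have [a ea] := dual_pt_surj a'; rewrite -ea dual_ptK in hP hQ.
exists a, t, s; split=> //.
by split; [| | exact: pdisjointC | exact: pjoinC].
Qed.

End TwoPremises.

(** * Key cases of cut elimination *)

Lemma via_fix (T : Type) u v (f : pmap T) : f u = None -> f v = None -> via u v f = f.
Proof.
move=> fu fv; apply: funext => w; rewrite /via /transp.
by case: eqP => [->|_]; [rewrite fu | case: eqP => [->|_]; rewrite ?fu].
Qed.

Lemma transp_l u v : transp u v u = v.
Proof. by rewrite /transp eqxx. Qed.

Lemma transp_r u v : transp u v v = u.
Proof. by rewrite /transp eqxx; case: eqP. Qed.

Lemma transp_other u v w : w <> u -> w <> v -> transp u v w = w.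
Proof. by move=> wu wv; rewrite /transp; do 2 case: eqP => //. Qed.

Section KeySteps.
Variable n : nat.
Implicit Types (A B C : formula n) (P Q R : term n) (E F G : context n) (X : hcohs n).

Lemma denot_swap_pset u v P X (s : env X) p : s u = None -> s v = None ->
  denot (swap u v P) (pset s v p) <-> denot P (pset s u p).
Proof. by move=> su sv; rewrite denot_swap via_pset transp_r via_fix. Qed.

Lemma cut_inv x A P Q E : der (Cut x A P Q) E -> exists F G,
  [/\ F x = None, G x = None, pdisjoint F G & E = pjoin F G] /\
  der P (pset F x A) /\ der Q (pset G x (dual A)).
Proof. by []. Qed.

Lemma rename_cut x y A P Q E :
  der (Cut x A P Q) E -> der (Cut y A (swap x y P) (swap x y Q)) E ->
  equi (Cut x A P Q) (Cut y A (swap x y P) (swap x y Q)).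
Proof.
move=> dl dr; apply: (typed_equi dl dr) => X r.
have [F [G [[Fx Gx FG El] [dP dQ]]]] := cut_inv dl; have [F' [G' [[Fy Gy FG' Er] [dP' dQ']]]] := dr.
have Ey : E y = None by rewrite Er pjoin_None.
have [Fy0 Gy0] : F y = None /\ G y = None.
  by move: Ey; rewrite El /pjoin; case: (F y).
rewrite El => /(etyped_pjoin_inv FG)[s [t [ts tt _ ->]]].
have := der_swap x y dP; have := der_swap x y dQ; rewrite !via_pset !transp_l !via_fix //.
move=> sQ sP; rewrite (denot_cut Fx Gx FG dP dQ ts tt) (denot_cut Fy0 Gy0 FG sP sQ ts tt).
have sx := etyped_None ts Fx; have sy := etyped_None ts Fy0.
have tx := etyped_None tt Gx; have ty := etyped_None tt Gy0.
by split=> -[a [hP hQ]]; exists a; move: hP hQ; rewrite !denot_swap_pset.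
Qed.

Lemma via_pset2 (T : Type) x y z (s : pmap T) p q : x <> y -> x <> z -> s y = None -> s z = None ->
  via y z (pset (pset s z q) x p) = pset (pset s y q) x p.
Proof. by move=> xy xz sy sz; rewrite !via_pset (transp_other xy xz) transp_r via_fix. Qed.

Lemma rename_par x y z A B P E : der (TPar x y A B P) E -> der (TPar x z A B (swap y z P)) E ->
  equi (TPar x y A B P) (TPar x z A B (swap y z P)).
Proof.
move=> dl dr; apply: (typed_equi dl dr) => X r.
have [F [[Fx Fy xy El] dP]] := dl; have [F' [[Fx' Fz xz Er] dP']] := dr.
have [FF _] := pset_inj Fx Fx' (etrans (esym El) Er); rewrite -FF in Fz.
rewrite El => /(etyped_pset_inv Fx)[s [[a b] [sx ts ->]]].
have sy := etyped_None ts Fy; have sz := etyped_None ts Fz.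
by rewrite !denot_par // denot_swap via_pset2.
Qed.

Lemma rename_contr x y z A P E : der (TContr x y A P) E -> der (TContr x z A (swap y z P)) E ->
  equi (TContr x y A P) (TContr x z A (swap y z P)).
Proof.
move=> dl dr; apply: (typed_equi dl dr) => X r.
have [F [[Fx Fy xy El] dP]] := dl; have [F' [[Fx' Fz xz Er] dP']] := dr.
have [FF _] := pset_inj Fx Fx' (etrans (esym El) Er); rewrite -FF in Fz.
rewrite El => /(etyped_pset_inv Fx)[s [e [sx ts ->]]].
have sy := etyped_None ts Fy; have sz := etyped_None ts Fz.
rewrite !denot_contr //.
by split=> -[c [d [ce h]]]; exists c, d; split=> //; move: h; rewrite denot_swap via_pset2.
Qed.

Lemma cut_link1 x y A B Q E : der (Cut x A (Link x y B) Q) E -> der (swap x y Q) E ->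
  equi (Cut x A (Link x y B) Q) (swap x y Q).
Proof.
move=> dl dr; apply: (typed_equi dl dr) => X r.
have [F [G [[Fx Gx FG El] [dP dQ]]]] := cut_inv dl; have [xy eL] := dP.
have Lx : pset pempty y (dual B) x = None by rewrite /pset; case: eqP.
have [FE AB] := pset_inj Fx Lx eL.
subst B;
have Gy : G y = None by have := FG y; rewrite FE psetE => -[].
rewrite El => /(etyped_pjoin_inv FG)[s [t [ts tt _ ->]]].
rewrite (denot_cut Fx Gx FG dP dQ ts tt).
move: ts; rewrite FE => /etyped_sing[b ->].
rewrite pjoin_sing denot_swap_pset ?(etyped_None tt) //.
have Bx (p : point X) : pset pempty y p x = None by rewrite /pset; case: eqP.
split=> [[a [[a' e] h]]|h].
  have [e1 /Pt_inj e2] := pset_inj (Bx _) (Bx _) e; rewrite e2 in h.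
  have := congr1 (fun f : env X => f y) e1.
  by rewrite !psetE => /Some_inj/Pt_inj ->.
have [a ea] := dual_pt_surj b; exists a; rewrite ea; split=> //.
by exists a; rewrite ea.
Qed.

Lemma cut_link2 x y A B Q E : der (Cut x A (Link y x B) Q) E -> der (swap x y Q) E ->
  equi (Cut x A (Link y x B) Q) (swap x y Q).
Proof.
move=> dl dr; apply: (typed_equi dl dr) => X r.
have [F [G [[Fx Gx FG El] [dP dQ]]]] := cut_inv dl; have [yx eL] := dP.
have psetC (T : Type) (p q : T) : pset (pset pempty x p) y q = pset (pset pempty y q) x p.
  apply: funext => w; rewrite /pset; case: (w =P y) => [wy|//]; case: (w =P x) => // wx.
  by case: yx; rewrite -wy.
rewrite psetC in eL.
have Lx : pset pempty y B x = None by rewrite /pset; case: eqP => // e; case: yx.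
have [FE AB] := pset_inj Fx Lx eL.
subst A;
have Gy : G y = None by have := FG y; rewrite FE psetE => -[].
rewrite El => /(etyped_pjoin_inv FG)[s [t [ts tt _ ->]]].
rewrite (denot_cut Fx Gx FG dP dQ ts tt).
move: ts; rewrite FE => /etyped_sing[b ->].
rewrite pjoin_sing denot_swap_pset ?(etyped_None tt) //.
have Bx (p : point X) : pset pempty y p x = None by rewrite /pset; case: eqP => // e; case: yx.
split=> [[a [[a' e] h]]|h].
  rewrite psetC in e.
  have [e1 /Pt_inj e2] := pset_inj (Bx _) (Bx _) e; rewrite e2 dual_ptK in h.
  have := congr1 (fun f : env X => f y) e1.
  by rewrite !psetE => /Some_inj/Pt_inj ->.
exists (dual_pt b); rewrite dual_ptK; split=> //.
by exists b; rewrite psetC.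
Qed.

Lemma cut_unit x A P E : der (Cut x A (TOne n x) (TBot x P)) E -> der P E ->
  equi (Cut x A (TOne n x) (TBot x P)) P.
Proof.
move=> dl dr; apply: (typed_equi dl dr) => X r.
have [F [G [[Fx Gx FG El] [dP dQ]]]] := cut_inv dl.
have [FE AB] := pset_inj (b := One) Fx (erefl (pempty x)) dP.
subst A;
rewrite El => /(etyped_pjoin_inv FG)[s [t [ts tt _ ->]]].
rewrite (denot_cut Fx Gx FG dP dQ ts tt).
move: ts; rewrite FE => /etyped_pempty ->.
have -> : pjoin pempty t = t by [].
have bot (a : rweb (interp One) X) : Pt (dual_pt a) = @Pt _ X Bot Datatypes.tt.
  by case: (dual_pt a : rweb (interp Bot) X).
have tx := etyped_None tt Gx.
split=> [[a [_]]|h]; first by rewrite bot denot_bot.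
by exists Datatypes.tt; rewrite bot denot_bot.
Qed.

End KeySteps.

(** * Multiplicative, additive and dereliction key cases *)

Section LogicalSteps.
Variable n : nat.
Implicit Types (A B C : formula n) (P Q R : term n) (E F G : context n) (X : hcohs n).

(** A cut point of the tensor is a pair, one component for each of the two new cuts. Most of the
    proof identifies the contexts found by inverting both sides and extracts from the typing of the
    reduct that [y] is fresh. *)
Lemma cut_mult x y C A B A' B' P Q R E :
  der (Cut x C (TTensor x A B P Q) (TPar x y A' B' R)) E ->
  der (Cut y B (swap x y Q) (Cut x A P R)) E ->
  equi (Cut x C (TTensor x A B P Q) (TPar x y A' B' R))
       (Cut y B (swap x y Q) (Cut x A P R)).
Proof.
move=> dl dr; apply: (typed_equi dl dr) => X r.
have [F [G [[Fx Gx FG El] [dT dU]]]] := cut_inv dl.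
have [F1 [F2 [[F1x F2x F12 eT] [d1 d2]]]] := dT.
have [FE CE] := pset_inj Fx (pjoin_None F1x F2x) eT; subst C.
have [G1 [[G1x G1y xy eU] d3]] := dU.
have [GE /Par_inj[AE BE]] := pset_inj Gx G1x eU; subst A' B' G1; rename G1y into Gy.
have [F3 [G3 [[F3y G3y FG3 Er] [dS dC]]]] := cut_inv dr.
have [F4 [G4 [[F4x G4x FG4 e4] [d1' d3']]]] := cut_inv dC.
have [F41 _] := pset_inj F4x F1x (der_unique d1' d1); rewrite {}F41 in F4x FG4 e4 d1' *.
have G2x : pset G y (dual B) x = None by rewrite /pset; case: eqP.
have [G4E _] := pset_inj G4x G2x (der_unique d3' d3); rewrite {}G4E in G4x FG4 e4 d3' *.
have F1y : F1 y = None by have := FG4 y; rewrite psetE => -[].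
have F2y : F2 y = None.
  have := congr1 (fun f => f y) (etrans (esym El) Er).
  by rewrite FE /pjoin F1y F3y G3y; case: (F2 y).
have F1G : pdisjoint F1 G.
  by move=> w; have := FG w; rewrite FE /pjoin; case: (F1 w); intuition.
have F2G : pdisjoint F2 G.
  move=> w; have := FG w; have := F12 w; rewrite FE /pjoin.
  by case: (F1 w) (F2 w) => [?|] [?|] /=; intuition congruence.
have F2FG : pdisjoint F2 (pjoin F1 G).
  by move=> w; have := F12 w; have := F2G w; rewrite /pjoin; case: (F1 w) => [?|]; intuition.
have := der_swap x y d2; rewrite via_pset transp_l via_fix // => d2'.
have FGy : pjoin F1 G y = None by exact: pjoin_None.
have dC' : der (Cut x A P R) (pset (pjoin F1 G) y (dual B)).
  by exists F1, (pset G y (dual B)); rewrite pjoin_pset.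
have EE : E = pjoin F2 (pjoin F1 G).
  by rewrite El FE -pjoinA (pjoinC F2FG) -pjoinA (pjoinC F2G).
rewrite EE => /(etyped_pjoin_inv F2FG)[t [su [tt tsu t_su ->]]].
have [s [u [ts tu su_ suE]]] := etyped_pjoin_inv F1G tsu.
rewrite (denot_cut F2y FGy F2FG d2' dC' tt tsu).
have s_t := (etyped_pjoin F12 ts tt).2; have tst := (etyped_pjoin F12 ts tt).1.
have -> : pjoin t su = pjoin (pjoin s t) u.
  by rewrite suE pjoinA (pjoinC (pdisjointC s_t)).
have tst' : etyped F (pjoin s t) by rewrite FE.
rewrite (denot_cut Fx Gx FG dT dU tst' tu).
have sy := etyped_None ts F1y; have ty := etyped_None tt F2y; have tx := etyped_None tt F2x.
have ux := etyped_None tu Gx; have uy := etyped_None tu Gy.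
have cutE b : denot (Cut x A P R) (pset su y (Pt (dual_pt (A := B) b))) <-> exists a,
    denot P (pset s x (Pt (A := A) a)) /\
    denot R (pset (pset u y (Pt (dual_pt b))) x (Pt (dual_pt a))).
  rewrite suE -pjoin_pset // (denot_cut F1x G2x FG4 d1 d3 ts); last exact: etyped_pset.
  by [].
have parE a b : denot (TPar x y (dual A) (dual B) R)
     (pset u x (Pt (dual_pt (A := Tensor A B) (a, b)))) <->
   denot R (pset (pset u y (Pt (dual_pt b))) x (Pt (dual_pt a))).
  by rewrite dual_tensor denot_par.
split=> [[[a b] [h1 h2]]|[b [h1 h2]]].
  have [hP hQ] := (proj1 (denot_tensor a b F1x F2x F12 d1 d2 ts tt) h1).
  exists b; split; first by rewrite denot_swap_pset.
  by apply/cutE; exists a; split=> //; exact/parE.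
move: h1; rewrite denot_swap_pset // => hQ; have [a [hP hR]] := proj1 (cutE b) h2.
exists (a, b); split; last exact/parE.
by apply/(denot_tensor a b F1x F2x F12 d1 d2 ts tt).
Qed.

Lemma cut_add1 x C A B A' B' P Q R E :
  der (Cut x C (TPlus1 x A B P) (TWith x A' B' Q R)) E -> der (Cut x A P Q) E ->
  equi (Cut x C (TPlus1 x A B P) (TWith x A' B' Q R)) (Cut x A P Q).
Proof.
move=> dl dr; apply: (typed_equi dl dr) => X r.
have [F [G [[Fx Gx FG El] [dT dU]]]] := cut_inv dl.
have [F1 [F1x eT d1]] := dT; have [FE CE] := pset_inj Fx F1x eT; subst C F1.
have [G1 [G1x eU d2 d3]] := dU.
have [GE /With_inj[AE BE]] := pset_inj Gx G1x eU; subst A' B' G1.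
rewrite El => /(etyped_pjoin_inv FG)[s [t [ts tt _ ->]]].
rewrite (denot_cut Fx Gx FG dT dU ts tt) (denot_cut Fx Gx FG d1 d2 ts tt).
have sx := etyped_None ts Fx; have tx := etyped_None tt Gx.
split=> [[c]|[a [hP hQ]]].
  by rewrite denot_plus1 // => -[[a -> hP]]; rewrite dual_plus1 denot_with // => hQ; exists a.
by exists (inl a); rewrite denot_plus1 // dual_plus1 denot_with //; split=> //; exists a.
Qed.

Lemma cut_add2 x C A B A' B' P Q R E :
  der (Cut x C (TPlus2 x A B P) (TWith x A' B' Q R)) E -> der (Cut x B P R) E ->
  equi (Cut x C (TPlus2 x A B P) (TWith x A' B' Q R)) (Cut x B P R).
Proof.
move=> dl dr; apply: (typed_equi dl dr) => X r.
have [F [G [[Fx Gx FG El] [dT dU]]]] := cut_inv dl.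
have [F1 [F1x eT d1]] := dT; have [FE CE] := pset_inj Fx F1x eT; subst C F1.
have [G1 [G1x eU d2 d3]] := dU.
have [GE /With_inj[AE BE]] := pset_inj Gx G1x eU; subst A' B' G1.
rewrite El => /(etyped_pjoin_inv FG)[s [t [ts tt _ ->]]].
rewrite (denot_cut Fx Gx FG dT dU ts tt) (denot_cut Fx Gx FG d1 d3 ts tt).
have sx := etyped_None ts Fx; have tx := etyped_None tt Gx.
split=> [[c]|[a [hP hQ]]].
  by rewrite denot_plus2 // => -[[a -> hP]]; rewrite dual_plus2 denot_with // => hQ; exists a.
by exists (inr a); rewrite denot_plus2 // dual_plus2 denot_with //; split=> //; exists a.
Qed.

Lemma dual_bang_sing X A (c : rweb (interp (Bang A)) X) a :
  sval (@dual_pt n X (Bang A) c : rweb (interp (WhyNot (dual A))) X) = [set dual_pt a] <->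
  sval c = [set a].
Proof.
split=> e; apply/seteqP; split=> b.
- by move/dual_bang; rewrite e => /dual_pt_inj.
- by move=> ->; apply/dual_bang; rewrite e.
- by have [b' <-] := dual_pt_surj b; move/dual_bang; rewrite e => ->.
- by move=> ->; apply/dual_bang; rewrite e.
Qed.

Lemma cut_der x C A A' L P Q E :
  der (Cut x C (TBang x A L P) (TDer x A' Q)) E -> der (Cut x A P Q) E ->
  equi (Cut x C (TBang x A L P) (TDer x A' Q)) (Cut x A P Q).
Proof.
move=> dl dr; apply: (typed_equi dl dr) => X r.
have [F [G [[Fx Gx FG El] [dT dU]]]] := cut_inv dl.
have [Lx uL eT d1] := dT; have [FE CE] := pset_inj Fx Lx eT; subst C F.
have [G1 [G1x eU d2]] := dU.
have [GE /WhyNot_inj AE] := pset_inj Gx G1x eU; subst A' G1.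
rewrite El => /(etyped_pjoin_inv FG)[s [t [ts tt _ ->]]].
rewrite (denot_cut Fx Gx FG dT dU ts tt) (denot_cut Fx Gx FG d1 d2 ts tt).
have tx := etyped_None tt Gx.
split=> [[c [hP]]|[a [hP hQ]]].
  rewrite denot_der // => -[a']; have [a <-] := dual_pt_surj a'.
  by move=> /dual_bang_sing ca hQ; exists a; split=> //; apply/(denot_bang_sing Lx d1 ts ca).
have [c ca] := bang_sing a; exists c; split; first exact/(denot_bang_sing Lx d1 ts ca).
by rewrite denot_der //; exists (dual_pt a) => //; exact/dual_bang_sing.
Qed.

End LogicalSteps.

Lemma nf_perp (F F' : rawfun 1) (e : F = perp_f F') (c : trace_web F)
    (c' : trace_web (perp_f F')) (V : hcohs 1) (x : rweb F V) (x' : rweb F' V) :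
  existT id (trace_web F) c = existT id (trace_web (perp_f F')) c' ->
  existT id (rweb F V) x = existT id (rweb F' V) x' ->
  nf_of F (Y := V) x (sval c) <-> nf_of F' (Y := V) x' (sval c').
Proof.
subst F => h hx; have -> : c = c' by exact: (existT_inj h).
by have -> : x = x' by exact: (existT_inj hx).
Qed.

(** * Weakening and quantifiers *)

Section StructuralSteps.
Variable n : nat.
Implicit Types (B C : formula n) (Q R : term n) (E F G : context n) (X : hcohs n).

Definition all_empty X (L : sequent n) (s : env X) := forall z B d, plist L z = Some B ->
  s z = Some (Pt (A := WhyNot B) d) -> sval d = set0.

Lemma whynots_cons x B (L : sequent n) : whynots ((x, B) :: L) = pset (whynots L) x (WhyNot B).
Proof. by []. Qed.

Lemma whynots_notin x (L : sequent n) : x \notin map fst L -> whynots L x = None.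
Proof.
elim: L => //= -[y B] L IH; rewrite inE negb_or => /andP[xy /IH].
by rewrite whynots_cons /pset (negbTE xy).
Qed.

Lemma denot_weaken_list X L Q (s t : env X) : uniq (map fst L) -> etyped (whynots L) s ->
  pdisjoint s t -> denot (weaken_list L Q) (pjoin s t) <-> all_empty L s /\ denot Q t.
Proof.
elim: L s => [|[x B] L IH] s.
  by move=> _ /etyped_pempty -> _; split=> [|[]].
rewrite -[weaken_list _ _]/(TWeak x B (weaken_list L Q)) => /andP[/whynots_notin Lx uL]; rewrite whynots_cons => /(etyped_pset_inv Lx).
move=> [s' [d [sx ts ->]]] st; have [s't tx] := pdisjoint_pset sx st.
rewrite pjoin_psetl (denot_weak _ _ (pjoin_None sx tx)) (IH s' uL ts s't).
have Lx0 : plist L x = None by move: Lx; rewrite whynotsE; case: (plist L x).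
split=> [[d0 [es h]]|[es h]].
  split=> // z B' d'; rewrite /= /pset; case: eqP => [_ /Some_inj eB|_]; last exact: es.
  by subst B' => /Some_inj/Pt_inj <-.
split; first by apply: (es x B d); rewrite /= psetE.
split=> // z B' d' Lz sz; apply: (es z B' d'); rewrite /= /pset; case: eqP => // zx.
- by move: Lz; rewrite zx Lx0.
- by move: sz; rewrite zx sx.
Qed.

(** The cut point is the empty clique. A set of premise points collected into it is empty, since
    each of them has a component at [x], and then all context cliques are empty; conversely the
    empty set of premise points can be promoted. *)
Lemma cut_weak x C A A' L (P Q : term n) E :
  der (Cut x C (TBang x A L P) (TWeak x A' Q)) E ->
  der (weaken_list L Q) E ->
  equi (Cut x C (TBang x A L P) (TWeak x A' Q)) (weaken_list L Q).
Proof.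
move=> dl dr; apply: (typed_equi dl dr) => X r.
have [F [G [[Fx Gx FG El] [dT dU]]]] := cut_inv dl.
have [Lx uL eT dP] := dT; have [FE CE] := pset_inj Fx Lx eT; subst C F.
have [G1 [G1x eU dQ]] := dU.
have [GE /WhyNot_inj AE] := pset_inj Gx G1x eU; subst A' G1.
rewrite El => /(etyped_pjoin_inv FG)[s [t [ts tt st ->]]].
rewrite (denot_cut Fx Gx FG dT dU ts tt) (denot_weaken_list _ uL ts st).
have tx := etyped_None tt Gx.
have dual0 (c : rweb (interp (Bang A)) X) :
    sval (@dual_pt n X (Bang A) c : rweb (interp (WhyNot (dual A))) X) = set0 <->
    sval c = set0.
  split=> e; apply/seteqP; split=> // b; first by move=> /dual_bang; rewrite e.
  by have [b' <-] := dual_pt_surj b; move/dual_bang; rewrite e.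
split=> [[c [/(denot_bang _ _ Lx ts)[T [fT TP [ce hT]]]]]|[es h]].
  rewrite denot_weak // => -[/dual0 c0 h]; split=> // z B d Lz sz.
  have [d' + de] := hT z B Lz; rewrite sz => /Some_inj/Pt_inj dd.
  rewrite dd de; apply/seteqP; split=> // b [t' Tt' _].
  have [a ta] := premise_pt dP (TP t' Tt').
  by have : set0 a by rewrite -c0 ce; exists t'.
have cP : finite_set (@set0 (rweb (interp A) X)) /\
    clique (X := Hcoh (rstr (interp A) X)) set0.
  by split; [exact: finite_set0 | move=> U [_ [u Uu]] /(_ u Uu)].
pose c : rweb (interp (Bang A)) X := exist _ _ cP.
exists c; split; last by rewrite denot_weak //; split=> //; exact/dual0.
apply/(denot_bang _ _ Lx ts); exists set0; split; [exact: finite_set0 | by [] | split].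
  by apply/seteqP; split=> // a [].
move=> z B Lz; have [d sz] := etyped_pt ts (plist_whynots Lz); exists d => //.
by rewrite (es z B d Lz sz); apply/seteqP; split=> // b [].
Qed.

Lemma csubst_inst1 B F : csubst (inst1 B) (ctx_wk F) = F.
Proof.
apply: funext => w; rewrite /csubst /ctx_wk; case: (F w) => //= A.
by rewrite /wk subst_rename subst_var.
Qed.

(** The bound parameter is evaluated at [interp B]. From left to right, the premise holds at every
    point with the normal form of the witness; from right to left, [trace_point] supplies a class of
    the trace containing the given instance. *)
Lemma cut_quant x C A A' B (P : term n.+1) Q E :
  der (Cut x C (TAll x A P) (TEx x A' B Q)) E ->
  der (Cut x (inst A B) (tsubst P (inst1 B)) Q) E ->
  equi (Cut x C (TAll x A P) (TEx x A' B Q)) (Cut x (inst A B) (tsubst P (inst1 B)) Q).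
Proof.
move=> dl dr; apply: (typed_equi dl dr) => X r.
have [F [G [[Fx Gx FG El] [dT dU]]]] := cut_inv dl.
have [F1 [F1x eT dP]] := dT; have [FE CE] := pset_inj Fx F1x eT; subst C F1.
have [G1 [G1x eU dQ]] := dU.
have [GE /Ex_inj AE] := pset_inj Gx G1x eU.
have {}AE : A' = dual A by []; subst A' G1.
have dE : dual (inst A B) = inst (dual A) B by exact: dual_subst.
have dQ' : der Q (pset G x (dual (inst A B))) by rewrite dE.
have := der_subst (inst1 B) dP; rewrite csubst_pset csubst_inst1 => dP'.
rewrite El => /(etyped_pjoin_inv FG)[s [t [ts tt _ ->]]].
rewrite (denot_cut Fx Gx FG dT dU ts tt) (denot_cut Fx Gx FG dP' dQ' ts tt).
have sx := etyped_None ts Fx; have tx := etyped_None tt Gx.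
have ePp : partial_f (interp A) X = perp_f (partial_f (interp (dual A)) X).
  by rewrite {1}interp_perp_dual.
have key (c : rweb (interp (All A)) X) (a : rweb (interp (inst A B)) X)
    (b : rweb (interp (inst (dual A) B)) X) : Pt (dual_pt a) = Pt b ->
    nf_of (partial_f (interp A) X) (inst_pt a) (sval c) <->
    nf_of (partial_f (interp (dual A)) X) (inst_pt b)
      (sval (@dual_pt n X (All A) c : rweb (interp (Ex (dual A))) X)).
  move=> ab; apply: (nf_perp ePp (V := fun=> robj (interp B) X)).
    exact (esym (jv_dual (A := All A) c)).
  rewrite /inst_pt (jv_cast (interp_inst A B)) (jv_cast (interp_inst (dual A) B)).
  by rewrite -[RHS]/(jv (Pt b)) -ab jv_dual.
split=> [[c [hP]]|[a [hP hQ]]].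
  rewrite denot_ex // => -[b cb hQ].
  have [a' ea] := Pt_tag (p := Pt b) (esym dE); have [a aa] := dual_pt_surj a'.
  exists a; rewrite aa -ea; split=> //.
  have nfa : nf_of (partial_f (interp A) X) (Y := fun=> robj (interp B) X)
      (inst_pt a) (sval c) by apply/(key c a b) => //; rewrite aa ea.
  apply/(denot_inst a Fx dP ts).
  exact (proj1 (denot_all_nf dP c sx) hP (fun=> robj (interp B) X) (inst_pt a) nfa).
have hP' := proj1 (denot_inst a Fx dP ts) hP.
have [c ac hc] := trace_point Fx dP (V := fun=> robj (interp B) X) ts hP'.
exists c; split=> //; rewrite denot_ex //.
have [b eb] := Pt_tag (p := Pt (dual_pt a)) dE.
by exists b; [exact/(key c a b) | rewrite -eb].
Qed.

Lemma wk_env_pset X V (s : env X) x p : wk_env V (pset s x p) = pset (wk_env V s) x (wk_pt V p).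
Proof. by apply: funext => w; rewrite /wk_env /pset; case: eqP. Qed.

Lemma wk_env_pjoin X V (s t : env X) : wk_env V (pjoin s t) = pjoin (wk_env V s) (wk_env V t).
Proof. by apply: funext => w; rewrite /wk_env /pjoin; case: (s w). Qed.

Lemma psetC (T : Type) (s : pmap T) x z p q : x <> z ->
  pset (pset s x p) z q = pset (pset s z q) x p.
Proof. by move=> xz; apply: funext => w; rewrite /pset; case: (w =P z) => [->|//]; case: eqP => // zx; case: xz. Qed.

(** Outside the scope of [local_commute], whose premises have as many variables as the conclusion:
    here the cut moves under the binder, and [denot_twk] compares [twk Q] with [Q]. *)
Lemma commute_all z C x A (P : term n.+1) Q E :
  der (Cut z C (TAll x A P) Q) E -> der (TAll x A (Cut z (wk C) P (twk Q))) E ->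
  equi (Cut z C (TAll x A P) Q) (TAll x A (Cut z (wk C) P (twk Q))).
Proof.
move=> dl dr; apply: (typed_equi dl dr) => X r.
have [F [G [[Fz Gz FG El] [dT dQ]]]] := cut_inv dl.
have [F1 [F1x eT dP]] := dT; have [E0 [E0x Er dC]] := dr.
have [F3 [G3 [[F3z G3z FG3 e3] [dP' dQ']]]] := cut_inv dC.
have xz : x <> z.
  move=> xz; have := congr1 (fun f => f z) (etrans (esym El) Er).
  by rewrite /pjoin Fz Gz -xz psetE.
pose F4 : context n := fun w => if w == z then None else F1 w.
have F4z : F4 z = None by rewrite /F4 eqxx.
have F1z : F1 z = Some C.
  by have := congr1 (fun f => f z) eT; rewrite psetE /pset; case: eqP => // zx; case: xz.
have F1E : F1 = pset F4 z C by apply: funext => w; rewrite /pset /F4; case: eqP => // ->.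
have F4x : F4 x = None by rewrite /F4; case: eqP.
have FE : F = pset F4 x (All A).
  have Fz' : pset F4 x (All A) z = None by rewrite /pset; case: eqP => // zx; case: xz.
  have e : pset F z C = pset (pset F4 x (All A)) z C by rewrite eT F1E [RHS]psetC.
  by have [] := pset_inj Fz Fz' e.
have Gx : G x = None by have := FG x; rewrite FE psetE => -[].
have F4G : pdisjoint F4 G.
  move=> w; have := FG w; rewrite FE /pset; case: eqP => [->|//]; by left.
have E0E : E0 = pjoin F4 G.
  have e : pset E0 x (All A) = pset (pjoin F4 G) x (All A) by rewrite -Er El FE pjoin_psetl.
  by have [] := pset_inj E0x (pjoin_None F4x Gx) e.
have F3E : F3 = pset (ctx_wk F4) x A.
  have wz : pset (ctx_wk F4) x A z = None.
    by rewrite /pset /ctx_wk F4z; case: eqP => // zx; case: xz.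
  have e : pset F3 z (wk C) = pset (pset (ctx_wk F4) x A) z (wk C).
    rewrite (der_unique dP' dP) F1E [RHS]psetC //; congr pset.
    by apply: funext => w; rewrite /ctx_wk /pset; case: eqP.
  by have [] := pset_inj F3z wz e.
have dW : dual (wk C) = wk (dual C) by rewrite /wk dual_rename.
have dQw := der_twk dQ; have ewk : ctx_wk (pset G z (dual C)) = pset (ctx_wk G) z (dual (wk C)).
  by rewrite dW; apply: funext => w; rewrite /ctx_wk /pset; case: eqP.
rewrite ewk in dQw.
have Gwz : ctx_wk G z = None by rewrite /ctx_wk Gz.
have [G3E _] := pset_inj G3z Gwz (der_unique dQ' dQw).
rewrite Er => /(etyped_pset_inv E0x)[r0 [c [ux tu ->]]].
move: tu ux; rewrite E0E => /(etyped_pjoin_inv F4G)[s [t [ts tt st ->]]] ux.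
have sx := etyped_None ts F4x; have sz := etyped_None ts F4z.
have tz := etyped_None tt Gz; have tx := etyped_None tt Gx.
have tsc : etyped F (pset s x (Pt (A := All A) c)) by rewrite FE; exact: etyped_pset.
rewrite (denot_all (A := A) c _ ux) -pjoin_psetl (denot_cut Fz Gz FG dT dQ tsc tt).
have wkx p : pset s z p x = None by rewrite /pset; case: eqP.
have cutE (u : rep (partial_f (interp A) X)) (V := rep_base u None) :
   denot (Cut z (wk C) P (twk Q))
      (pset (wk_env V (pjoin s t)) x (@Pt _ (ext X V) A (rep_point u))) <->
   exists d, denot P (pset (wk_env V (pset s z (Pt (A := C) d))) x
                   (@Pt _ (ext X V) A (rep_point u))) /\
             denot Q (pset t z (Pt (dual_pt d))).
  rewrite wk_env_pjoin -pjoin_psetl.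
  have ts3 : etyped F3 (pset (wk_env V s) x (@Pt _ (ext X V) A (rep_point u))).
    by rewrite F3E; apply: etyped_pset; exact: wk_env_typed.
  have tt3 : etyped G3 (wk_env V t) by rewrite G3E; exact: wk_env_typed.
  rewrite (denot_cut F3z G3z FG3 dP' dQ' ts3 tt3).
  have key (d : rweb (interp C) X) d' : wk_pt V (Pt d) = Pt (A := wk C) d' ->
     (denot P (pset (pset (wk_env V s) x (@Pt _ (ext X V) A (rep_point u))) z (Pt d')) <->
      denot P (pset (wk_env V (pset s z (Pt d))) x (@Pt _ (ext X V) A (rep_point u)))) /\
     (denot (twk Q) (pset (wk_env V t) z (Pt (dual_pt d'))) <->
      denot Q (pset t z (Pt (dual_pt d)))).
    move=> dd; split; first by rewrite wk_env_pset dd psetC.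
    have tQ : etyped (pset G z (dual C)) (pset t z (Pt (dual_pt d))) by exact: etyped_pset.
    rewrite -(denot_twk V dQ tQ) wk_env_pset.
    suff -> : Pt (dual_pt d') = wk_pt V (Pt (dual_pt d)) by [].
    apply: point_ext; first by rewrite /= dW.
    by rewrite jv_dual -dd !jv_wk jv_dual.
  split=> -[d [h1 h2]].
    have [d0 e0] := cast_surj (esym (interp_wk C)) (X := ext X V) d.
    have [k1 k2] := key d0 d (congr1 (Pt (A := wk C)) e0).
    by exists d0; split; [exact/k1 | exact/k2].
  have [k1 k2] := key d _ (erefl (wk_pt V (Pt d))).
  exists (cast (F := wk_f (interp C)) (esym (interp_wk C)) (X := ext X V) d).
  by split; [exact/k1 | exact/k2].
have allE d : denot (TAll x A P) (pset (pset s x (Pt (A := All A) c)) z (Pt (A := C) d)) <->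
  exists2 u : rep (partial_f (interp A) X), sval c u
        & @denot _ P (ext X (rep_base u None))
            (pset (wk_env (rep_base u None) (pset s z (Pt d))) x
               (@Pt _ (ext X (rep_base u None)) A (rep_point u))).
  by rewrite psetC // denot_all ?wkx.
split=> [[d [/allE[v cv hP] hQ]]|[v cv /cutE[d [hP hQ]]]].
  by exists v => //; apply/cutE; exists d.
by exists d; split=> //; apply/allE; exists v.
Qed.

End StructuralSteps.

(** * Cut against a contraction *)

Section Relabelling.
Variable n : nat.
Implicit Types (L K M : sequent n) (l k : seq nat).

(* Environments of [swap_list L l P] are those of [P] transported by [pull L l]. *)
Definition pull (T : Type) L l (f : pmap T) : pmap T :=
  foldr (fun q g => via q.1.1 q.2 g) f (zip L l).

Definition pull_seq L l M := foldr (fun q K => transp_list q.1.1 q.2 K) M (zip L l).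

Definition fresh x L l := x \notin map fst L /\ x \notin l.

Lemma fresh_cons x a B L b l : fresh x ((a, B) :: L) (b :: l) <->
  [/\ x <> a, x <> b & fresh x L l].
Proof.
rewrite /fresh /= !inE !negb_or; split=> [[/andP[/eqP xa xL] /andP[/eqP xb xl]]|[/eqP xa /eqP xb [xL xl]]].
  by split.
by split; apply/andP.
Qed.

Lemma pull_pset (T : Type) L l (f : pmap T) x a : fresh x L l ->
  pull L l (pset f x a) = pset (pull L l f) x a.
Proof.
elim: L l => [|[z B] L IH] [|z' l] //= /fresh_cons[xz xz' xL].
by rewrite -[LHS]/(via z z' (pull L l _)) IH // via_pset transp_other.
Qed.

Lemma pull_seq_cons L l M x (A : formula n) : fresh x L l ->
  pull_seq L l ((x, A) :: M) = (x, A) :: pull_seq L l M.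
Proof.
elim: L l => [|[z B] L IH] [|z' l] //= /fresh_cons[xz xz' xL].
rewrite -[LHS]/(transp_list z z' (pull_seq L l _)) IH //=.
by rewrite transp_other.
Qed.

Lemma pull_whynots L l M : pull L l (whynots M) = whynots (pull_seq L l M).
Proof.
elim: L l => [|[z B] L IH] [|z' l] //=.
by rewrite -[LHS]/(via z z' (pull L l _)) IH via_whynots.
Qed.

Lemma pull_etyped L l (X : hcohs n) C (s : env X) :
  etyped C s -> etyped (pull L l C) (pull L l s).
Proof.
move=> ts; elim: L l => [|[z B] L IH] [|z' l] //= w.
exact: (IH l (transp z z' w)).
Qed.

Lemma transp_list_fix u v M : u \notin map fst M -> v \notin map fst M -> transp_list u v M = M.
Proof.
elim: M => //= -[z B] M IH; rewrite !inE !negb_or => /andP[/eqP uz uM] /andP[/eqP vz vM].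
by rewrite transp_other; [rewrite IH | move=> zu; apply: uz | move=> zv; apply: vz].
Qed.

Definition all_fresh L l := [/\ uniq (map fst L), uniq l &
  forall z, z \in l -> z \notin map fst L].

Lemma relabel_names L l : size l = size L -> map fst (relabel L l) = l.
Proof. by move=> sl; rewrite /relabel -/unzip1 unzip1_zip // size_map sl. Qed.

Lemma all_fresh_cons a B L b l : all_fresh ((a, B) :: L) (b :: l) ->
  [/\ a <> b, fresh a L l, fresh b L l & all_fresh L l].
Proof.
move=> [/= /andP[aL uL] /andP[bl ul] h].
have := h b (mem_head _ _); rewrite inE negb_or => /andP[/eqP ba bL].
have al : a \notin l.
  apply/negP => al; have := h a; rewrite !inE al orbT eqxx => /(_ isT) //.
split; [by move=> ab; apply: ba | by split | by split | split=> // z zl].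
by have := h z; rewrite !inE zl orbT => /(_ isT); rewrite negb_or => /andP[].
Qed.

Lemma pull_seq_relabel L l : size l = size L -> all_fresh L l -> pull_seq L l L = relabel L l.
Proof.
elim: L l => [|[a B] L IH] [|b l] //= [sl] /all_fresh_cons[ab aL bL fL].
rewrite -[LHS]/(transp_list a b (pull_seq L l _)) pull_seq_cons // IH //=.
rewrite transp_l transp_list_fix //.
  by rewrite relabel_names //; case: aL.
by rewrite relabel_names //; case: bL.
Qed.

Lemma swap_list_bang L l x A M (P : term n) : fresh x L l ->
  swap_list L l (TBang x A M P) = TBang x A (pull_seq L l M) (swap_list L l P).
Proof.
elim: L l => [|[z B] L IH] [|z' l] //= /fresh_cons[xz xz' xL].
rewrite -[LHS]/(swap z z' (swap_list L l _)) IH //=.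
by rewrite transp_other.
Qed.

Lemma denot_swap_list L l (P : term n) (X : hcohs n) (r : env X) :
  denot (swap_list L l P) (pull L l r) <-> denot P r.
Proof.
elim: L l => [|[z B] L IH] [|z' l] //=.
rewrite -[swap_list _ _ _]/(swap z z' (swap_list L l P)).
rewrite -[pull _ _ _]/(via z z' (pull L l r)).
by rewrite denot_swap viaK.
Qed.

Lemma notin_whynots L z : whynots L z = None -> z \notin map fst L.
Proof.
elim: L => //= -[c D] M IHM; rewrite inE whynots_cons /pset.
by case: eqP => // _ /IHM.
Qed.

(** The reduction step only relates the lengths of [L] and [l]; freshness and distinctness of the
    names in [l] are recovered from the typability of the contractions. *)
Lemma contract_inv L l (R : term n) G : size l = size L -> uniq (map fst L) ->
  pdisjoint (whynots L) G -> der (contract_list L l R) (pjoin (whynots L) G) ->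
  [/\ all_fresh L l, forall z, z \in l -> G z = None & exists E, der R E].
Proof.
elim: L l G => [|[a B] L IH] [|b l] G //.
  by move=> _ _ _ dR; split=> //; exists G.
rewrite -[contract_list _ _ _]/(TContr a b B (contract_list L l R)).
move=> [sl] /andP[aL uL]; have La := whynots_notin aL; rewrite whynots_cons pjoin_psetl => LG.
have [L_G Ga] := pdisjoint_pset La LG.
move=> [F [[Fa Fb ab e] dR]].
have [FE _] := pset_inj (pjoin_None La Ga) Fa e; rewrite -{}FE in Fb dR.
have [Lb Gb] : whynots L b = None /\ G b = None.
  by move: Fb; rewrite /pjoin; case: (whynots L b).
rewrite -!pjoin_pset // in dR.
have LG' : pdisjoint (whynots L) (pset (pset G b (WhyNot B)) a (WhyNot B)).
  apply: pdisjointC; apply: pset_pdisjoint => //; apply: pset_pdisjoint => //.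
  exact: pdisjointC.
have [[_ ul fl] Gl Rd] := IH l _ sl uL LG' dR.
have ne z : z \in l -> [/\ z <> a, z <> b & G z = None].
  by move=> /Gl; rewrite /pset; case: eqP => // za; case: eqP.
have bL := notin_whynots Lb.
split=> //.
- split=> /=; [by rewrite aL | | move=> z].
    rewrite ul andbT; apply/negP => /ne[_ /(_ erefl)] //.
  rewrite !inE negb_or => /orP[/eqP ->|zl].
    by rewrite bL andbT; apply/eqP => ba; apply: ab.
  by rewrite fl // andbT; apply/eqP; have [] := ne z zl.
- by move=> z; rewrite inE => /orP[/eqP -> //|/ne[]].
Qed.

End Relabelling.

(** * Iterated contractions and the duplication of a promotion *)

Section Contraction.
Variable n : nat.
Implicit Types (L : sequent n) (l : seq nat).

Lemma pull_at_fresh (T : Type) L l (f : pmap T) z : fresh z L l -> pull L l f z = f z.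
Proof.
elim: L l => [|[a B] L IH] [|b l] //= /fresh_cons[za zb zL].
by rewrite -[LHS]/(pull L l f (transp a b z)) transp_other // IH.
Qed.

(** The second copy of the context is kept under its original names as [s2] and moved to the names
    [l] by [pull], so that both copies can be compared with points of the same promotion. *)
Lemma denot_contract_list L l (R : term n) G (X : hcohs n) (s t : env X) :
  size l = size L -> all_fresh L l -> (forall z, z \in l -> G z = None) ->
  pdisjoint (whynots L) G -> etyped (whynots L) s -> etyped G t ->
  denot (contract_list L l R) (pjoin s t) <->
  exists s1 s2, [/\ etyped (whynots L) s1, etyped (whynots L) s2, union_env L s s1 s2 &
    denot R (pjoin s1 (pjoin (pull L l s2) t))].
Proof.
elim: L l G s t => [|[a B] L IH] [|b l] G s t //.
  move=> _ _ _ _ /etyped_pempty -> tt.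
  split=> [h|[s1 [s2 [/etyped_pempty -> /etyped_pempty -> _ h]]]]; last exact: h.
  by exists pempty, pempty; split=> // z C d.
rewrite -[contract_list _ _ _]/(TContr a b B (contract_list L l R)).
move=> [sl] /all_fresh_cons[ab fa fb fL] Gl; have [aL al] := fa; have [bL bl] := fb.
have La := whynots_notin aL; have Lb := whynots_notin bL.
rewrite whynots_cons => LG.
have [L_G Ga] := pdisjoint_pset La LG; have Gb := Gl b (mem_head _ _).
move=> /(etyped_pset_inv La)[s' [e [sa ts ->]]] tt.
have ta := etyped_None tt Ga; have tb := etyped_None tt Gb; have sb := etyped_None ts Lb.
rewrite pjoin_psetl denot_contr ?pjoin_None //.
pose G' := pset (pset G b (WhyNot B)) a (WhyNot B).
have LG' : pdisjoint (whynots L) G'.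
  apply: pdisjointC; apply: pset_pdisjoint => //; apply: pset_pdisjoint => //.
  exact: pdisjointC.
have Gl' z : z \in l -> G' z = None.
  move=> zl; rewrite /G' /pset; case: eqP => [za|_]; first by rewrite -za zl in al.
  case: eqP => [zb|_]; first by rewrite -zb zl in bl.
  by apply: Gl; rewrite inE zl orbT.
have Lab (f : env X) p : etyped (whynots L) f ->
    pull ((a, B) :: L) (b :: l) (pset f a p) = pset (pull L l f) b p.
  move=> tf; rewrite -[LHS]/(via a b (pull L l (pset f a p))) pull_pset // via_pset transp_l.
  by rewrite via_fix // pull_at_fresh // (etyped_None tf).
have joinE c d s1 s2 : etyped (whynots L) s1 -> etyped (whynots L) s2 ->
    pjoin s1 (pjoin (pull L l s2) (pset (pset t b (Pt (A := WhyNot B) d)) a (Pt (A := WhyNot B) c))) =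
    pjoin (pset s1 a (Pt c)) (pjoin (pull ((a, B) :: L) (b :: l) (pset s2 a (Pt d))) t).
  move=> t1 t2; have W z : fresh z L l -> whynots L z = None -> pull L l s2 z = None.
    by move=> fz Lz; rewrite pull_at_fresh // (etyped_None t2).
  have s1a := etyped_None t1 La; have s1b := etyped_None t1 Lb.
  have Wa := W a fa La; have Wb := W b fb Lb.
  by rewrite Lab // !pjoin_psetl !pjoin_pset.
have key c d := IH l G' s' (pset (pset t b (Pt (A := WhyNot B) d)) a (Pt (A := WhyNot B) c))
  sl fL Gl' LG' ts (etyped_pset a c (etyped_pset b d tt)).
have La0 : plist L a = None by move: La; rewrite whynotsE; case: (plist L a).
split=> [[c [d [ecd]]]|[s1 [s2 [+ + ss h]]]].
  rewrite -!pjoin_pset // => /key[s1 [s2 [t1 t2 ss h]]].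
  exists (pset s1 a (Pt c)), (pset s2 a (Pt d)); rewrite -joinE //.
  split=> //; [exact: etyped_pset | exact: etyped_pset |].
  move=> z C e'; rewrite /= /pset; case: eqP => [_ /Some_inj eC|_]; last exact: ss.
  by subst C => /Some_inj/Pt_inj <-; exists c, d.
move=> /(etyped_pset_inv La)[s1' [c [s1a t1 e1]]] /(etyped_pset_inv La)[s2' [d [s2a t2 e2]]].
subst s1 s2; rewrite -joinE // in h; exists c, d; split.
  have [||c' [d' [+ + E]]] := ss a B e; rewrite /= ?psetE //.
  by move=> /Some_inj/Pt_inj -> /Some_inj/Pt_inj ->.
rewrite -!pjoin_pset //; apply/key; exists s1', s2'; split=> // z C e' Lz sz.
have za : z <> a by move=> za; rewrite za La0 in Lz.
have := ss z C e'; rewrite /= /pset; case: eqP => // _; exact.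
Qed.

(** A contracted cut point is a union of two cliques. [denot_bang_split] cuts the promotion
    accordingly and [denot_bang_merge] glues two promotions back. *)
Lemma cut_contr x y C (A A' : formula n) L l P Q E : size l = size L ->
  der (Cut x C (TBang x A L P) (TContr x y A' Q)) E ->
  der (contract_list L l (Cut x (Bang A) (TBang x A L P)
         (Cut y (Bang A) (TBang y A (relabel L l) (swap x y (swap_list L l P))) Q))) E ->
  equi (Cut x C (TBang x A L P) (TContr x y A' Q))
    (contract_list L l (Cut x (Bang A) (TBang x A L P)
       (Cut y (Bang A) (TBang y A (relabel L l) (swap x y (swap_list L l P))) Q))).
Proof.
move=> sl dl dr; apply: (typed_equi dl dr) => X r.
have [F [G [[Fx Gx FG El] [dT dU]]]] := cut_inv dl.
have [Lx uL eT dP] := dT; have [FE CE] := pset_inj Fx Lx eT; subst C F.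
have [G1 [[G1x Gy xy eU] dQ]] := dU.
have [GE /WhyNot_inj AE] := pset_inj Gx G1x eU; subst G1.
have {}AE : A' = dual A by []; subst A'.
rewrite El in dr; have [fL Gl [ER dR]] := contract_inv sl uL FG dr.
have [F3 [G3 [[F3x G3x FG3 _] [dT3 dC]]]] := cut_inv dR.
have [_ _ e3 _] := dT3; have [F3E _] := pset_inj F3x Lx e3; subst F3.
have [F5 [G5 [[F5y G5y FG5 e5] [dT5 dQ5]]]] := cut_inv dC.
have [rLy urL e6 dS] := dT5; have [F5E _] := pset_inj F5y rLy e6; subst F5.
have Gx_y : pset G x (WhyNot (dual A)) y = None.
  by rewrite /pset; case: eqP => // yx; case: xy.
have yx : y <> x by move=> yx; apply: xy.
have e5' : pset G5 y (dual (Bang A)) = pset (pset G x (WhyNot (dual A))) y (WhyNot (dual A)).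
  by rewrite (der_unique dQ5 dQ) psetC.
have [G5E _] := pset_inj G5y Gx_y e5'; subst G5.
have rLx : whynots (relabel L l) x = None.
  by have := FG5 x; rewrite psetE => -[].
have G3E : G3 = pjoin (whynots (relabel L l)) G.
  have e3' : pset G3 x (dual (Bang A)) =
      pset (pjoin (whynots (relabel L l)) G) x (WhyNot (dual A)) by rewrite -pjoin_pset.
  by have [] := pset_inj G3x (pjoin_None rLx Gx) e3'.
have rLn := notin_whynots rLx; have rLn' := notin_whynots rLy.
rewrite relabel_names // in rLn rLn'.
have xfresh : fresh x L l by split=> //; exact: notin_whynots Lx.
have rLG : pdisjoint (whynots (relabel L l)) G.
  by have [] := pdisjoint_pset Gx (pdisjointC FG5) => /pdisjointC.
(* The duplicated promotion is literally the first one under new names, so that its points are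
   transported points of the first. *)
have bangE : TBang y A (relabel L l) (swap x y (swap_list L l P)) =
    swap x y (swap_list L l (TBang x A L P)).
  rewrite swap_list_bang // pull_seq_relabel //= transp_l transp_list_fix //;
  by rewrite relabel_names.
rewrite El => /(etyped_pjoin_inv FG)[s [t [ts tt st ->]]].
rewrite (denot_cut Lx Gx FG dT dU ts tt) (denot_contract_list _ sl fL Gl FG ts tt).
have tx := etyped_None tt Gx; have ty := etyped_None tt Gy.
have pullE (s2 : env X) : etyped (whynots L) s2 -> etyped (whynots (relabel L l)) (pull L l s2).
  by move=> /(pull_etyped L l); rewrite pull_whynots pull_seq_relabel.
have cutE (s1 s2 : env X) : etyped (whynots L) s1 -> etyped (whynots L) s2 ->
    denot (Cut x (Bang A) (TBang x A L P)
         (Cut y (Bang A) (TBang y A (relabel L l) (swap x y (swap_list L l P))) Q))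
      (pjoin s1 (pjoin (pull L l s2) t)) <->
    exists c1 c2, [/\ denot (TBang x A L P) (pset s1 x (@Pt _ X (Bang A) c1)),
      denot (TBang x A L P) (pset s2 x (@Pt _ X (Bang A) c2)) &
      denot Q (pset (pset t y (@Pt _ X (dual (Bang A)) (dual_pt c2))) x (Pt (dual_pt c1)))].
  move=> t1 t2; have tG3 : etyped G3 (pjoin (pull L l s2) t).
    by rewrite G3E; have [] := etyped_pjoin rLG (pullE s2 t2) tt.
  rewrite (denot_cut Lx G3x FG3 dT dC t1 tG3).
  have s2x := etyped_None (pullE s2 t2) rLx; have s2y := etyped_None (pullE s2 t2) rLy.
  have key c1 : denot (Cut y (Bang A) (TBang y A (relabel L l) (swap x y (swap_list L l P))) Q)
      (pset (pjoin (pull L l s2) t) x (Pt (dual_pt (A := Bang A) c1))) <->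
    exists c2, denot (TBang x A L P) (pset s2 x (@Pt _ X (Bang A) c2)) /\
      denot Q (pset (pset t y (@Pt _ X (dual (Bang A)) (dual_pt c2))) x (Pt (dual_pt c1))).
    rewrite -pjoin_pset // (denot_cut rLy Gx_y FG5 dT5 dQ5 (pullE s2 t2)); last exact: etyped_pset.
    by split=> -[c2 [h1 h2]]; exists c2; move: h1 h2;
      rewrite bangE denot_swap_pset // -pull_pset // denot_swap_list psetC.
  split=> [[c1 [h1 /key[c2 [h2 h3]]]]|[c1 [c2 [h1 h2 h3]]]]; first by exists c1, c2.
  by exists c1; split=> //; apply/key; exists c2.
have unionE (c c1 c2 : rweb (interp (Bang A)) X) : sval c = sval c1 `|` sval c2 <->
   sval (dual_pt c : rweb (interp (WhyNot (dual A))) X) =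
   sval (dual_pt c1 : rweb (interp (WhyNot (dual A))) X) `|`
   sval (dual_pt c2 : rweb (interp (WhyNot (dual A))) X).
  split=> e; apply/seteqP; split=> b.
  - have [a <-] := dual_pt_surj b; move/dual_bang; rewrite e => -[h|h]; [left|right]; exact/dual_bang.
  - have [a <-] := dual_pt_surj b; move=> [] /dual_bang h; apply/dual_bang; rewrite e; by [left|right].
  - by move/dual_bang; rewrite e => -[/dual_bang h|/dual_bang h]; [left|right].
  - by move=> [] h; apply/dual_bang; rewrite e; [left|right]; exact/dual_bang.
split=> [[c [hP]]|[s1 [s2 [t1 t2 ss /(cutE _ _ t1 t2)[c1 [c2 [h1 h2 h3]]]]]]].
  rewrite denot_contr // => -[d1 [d2 [dd h]]].
  have [c1 e1] := dual_pt_surj (A := Bang A) d1; have [c2 e2] := dual_pt_surj (A := Bang A) d2.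
  rewrite -e1 -e2 in dd h; move/unionE: dd => cc.
  have [s1 [s2 [t1 t2 ss [h1 h2]]]] := denot_bang_split Lx dP ts cc hP.
  by exists s1, s2; split=> //; apply/(cutE _ _ t1 t2); exists c1, c2.
have [c cc h] := denot_bang_merge Lx dP ts t1 t2 ss h1 h2.
exists c; split=> //; rewrite denot_contr //.
by exists (dual_pt c1), (dual_pt c2); split=> //; exact/unionE.
Qed.

End Contraction.

(** * Cut of two promotions *)

Section PromotionCut.
Variables (n : nat) (X : hcohs n).
Implicit Types (B : formula n) (L M : sequent n) (T U : env X -> Prop) (w : nat).

(** Membership is compared through points because [dual (dual B)] and [B] have equal,
    non-convertible interpretations. *)
Lemma whynot_pt_mem B B' (k : rweb (interp (WhyNot B)) X) (k' : rweb (interp (WhyNot B')) X) b b' :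
  Pt k' = Pt k -> Pt b' = Pt b -> sval k' b' <-> sval k b.
Proof.
move=> kk bb; have e : B' = B by have := congr1 tag bb.
by subst B'; rewrite (Pt_inj kk) (Pt_inj bb).
Qed.

Lemma dual_whynot_mem B (k : rweb (interp (WhyNot B)) X) b :
  sval (@dual_pt n X (WhyNot B) k : rweb (interp (Bang (dual B))) X) (dual_pt b) <-> sval k b.
Proof.
rewrite -dual_bang; apply: whynot_pt_mem; last exact: dual_ptK.
exact: (dual_ptK (A := WhyNot B)).
Qed.

Lemma whynots_plist L w B : whynots L w = Some (WhyNot B) -> plist L w = Some B.
Proof. by rewrite whynotsE; case: (plist L w) => //= B' /Some_inj/WhyNot_inj ->. Qed.

Definition unions B T w : rweb (interp B) X -> Prop :=
  [set b | exists2 t, T t & exists2 d : rweb (interp (WhyNot B)) X, t w = Some (Pt d) & sval d b].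

End PromotionCut.

(** * Moving a cut inside a promotion *)

Section CommuteBang.
Variables (n : nat) (X : hcohs n) (z x : nat) (A B : formula n) (L L' M : sequent n) (P Q : term n).
Variable F : context n.
Hypotheses (Lx : whynots L x = None) (L'x : whynots L' x = None) (Mz : whynots M z = None).
Hypotheses (xz : x <> z) (Fz : F z = None) (Fx : F x = None).
Hypotheses (LE : whynots L = pset F z (WhyNot B)) (L'E : whynots L' = pjoin F (whynots M)).
Hypothesis FM : pdisjoint F (whynots M).
Hypotheses (dP : der P (pset (whynots L) x A)).
Hypotheses (dQ : der Q (pset (whynots M) z (dual B))).
Hypothesis (dU : der (TBang z (dual B) M Q) (pset (whynots M) z (dual (WhyNot B)))).
Variables (s t : env X) (c : rweb (interp (Bang A)) X).
Hypotheses (ts : etyped F s) (tt : etyped (whynots M) t).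

Local Notation cutPQ := (Cut z (WhyNot B) P (TBang z (dual B) M Q)).

Let Mx : whynots M x = None.
Proof. by move: L'x; rewrite L'E /pjoin Fx. Qed.

Let sz : s z = None. Proof. exact: etyped_None ts Fz. Qed.

Let F3 := pset F x A.

Let F3z : F3 z = None. Proof. by rewrite /F3 /pset; case: eqP => // zx; case: xz. Qed.

Let F3M : pdisjoint F3 (whynots M). Proof. exact: pset_pdisjoint. Qed.

Let dP3 : der P (pset F3 z (WhyNot B)).
Proof. by rewrite /F3 psetC // -LE. Qed.

Let cutE (u v : env X) : etyped F3 u -> etyped (whynots M) v ->
  denot cutPQ (pjoin u v) <-> exists k, denot P (pset u z (Pt (A := WhyNot B) k)) /\
    denot (TBang z (dual B) M Q) (pset v z (Pt (dual_pt k))).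
Proof. exact: (denot_cut F3z Mz F3M dP3 dU). Qed.

(** Each [u] in [T] has a component [k0] inside [k] at the cut formula; it is cut against the
    promotion of the points of [U] lying over [k0]. As [k] is the union of these [k0], every point
    of [U] is used by some [u], and no context element is lost. *)
Lemma promote_cut k T : finite_set T -> T `<=` @denot _ P X ->
  collects x L T (pset s z (Pt (A := WhyNot B) k)) c ->
  denot (TBang z (dual B) M Q) (pset t z (Pt (dual_pt k))) ->
  denot (TBang x A L' cutPQ) (pset (pjoin s t) x (Pt (A := Bang A) c)).
Proof.
move=> fT TP [ce hL] /(denot_bang (A := dual B) _ _ Mz tt)[U [fU UQ cU]]; have [ke hM] := cU.
pose kd (k0 : rweb (interp (WhyNot B)) X) : rweb (interp (Bang (dual B))) X :=
  @dual_pt n X (WhyNot B) k0.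
have Lz : plist L z = Some B by apply: whynots_plist; rewrite LE psetE.
pose spec (u v : env X) := [/\ denot cutPQ v, v x = u x,
  forall w, F w <> None -> v w = u w & exists2 k0, u z = Some (Pt (A := WhyNot B) k0) &
  forall w D, plist M w = Some D -> exists2 d : rweb (interp (WhyNot D)) X,
    v w = Some (Pt d) & sval d = unions (picks z U (kd k0)) w].
have /choice[f fE] : forall u, exists v, T u -> spec u v.
  move=> u; case: (pselect (T u)) => [Tu|]; last by exists u.
  have tu := denot_typed dP3 (TP u Tu).
  have [u' [k0 [u'z tu' ue]]] := etyped_pset_inv F3z tu.
  have k0k a : sval (kd k0) a -> sval (kd k) a.
    have [b <-] := dual_pt_surj a; move=> /dual_whynot_mem kb; apply/dual_whynot_mem.
    have [k' + k'e] := hL z B Lz; rewrite psetE => /Some_inj/Pt_inj ->; rewrite k'e.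
    by exists u => //; exists k0 => //; rewrite ue psetE.
  have [v [tv [_ hv] hQ]] := collects_part (A := dual B) Mz dQ fU UQ cU k0k.
  exists (pjoin u' v) => _; split.
  - apply/(cutE tu' tv); exists k0; split; last exact: hQ.
    by rewrite -ue; exact: TP.
  - have [a ua] := etyped_pt tu' (psetE _ _ _).
    by rewrite /pjoin ua ue /pset ua; case: eqP => // e; case: xz.
  - move=> w; case Fw: (F w) => [D|] // _.
    have wz : w <> z by move=> wz; rewrite wz Fz in Fw.
    have wx : w <> x by move=> wx; rewrite wx Fx in Fw.
    have Fw3 : F3 w = Some D by rewrite /F3 /pset; case: eqP.
    have [a ua] := etyped_pt tu' Fw3.
    by rewrite /pjoin ua ue /pset; case: eqP.
  exists k0; first by rewrite ue psetE.
  move=> w D Mw; have [d vd de] := hv w D Mw; exists d => //.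
  have u'w : u' w = None.
    by apply: (etyped_None tu'); have := F3M w; rewrite (plist_whynots Mw) => -[].
  by rewrite /pjoin u'w.
have tst : etyped (whynots L') (pjoin s t) by rewrite L'E; have [] := etyped_pjoin FM ts tt.
apply/(denot_bang _ _ L'x tst); exists (f @` T); split.
- exact: finite_image.
- by move=> _ [u Tu <-]; have [] := fE u Tu.
split.
  rewrite ce; apply/seteqP; split=> [a [u Tu ua]|a [_ [u Tu <-] va]]; have [_ vx _ _] := fE u Tu.
    by exists (f u); [exists u | rewrite vx].
  by exists u => //; rewrite -vx.
move=> w D /plist_whynots; rewrite L'E /pjoin; case Fw: (F w) => [D'|].
  move=> /Some_inj eD; subst D'.
  have wz : w <> z by move=> wz; rewrite wz Fz in Fw.
  have Lw : plist L w = Some D.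
    by apply: whynots_plist; rewrite LE /pset; case: eqP => // _; rewrite Fw.
  have [d + de] := hL w D Lw; rewrite /pset; case: eqP => // _ sd; rewrite sd; exists d => //.
  have FwN : F w <> None by rewrite Fw.
  rewrite de; apply/seteqP; split=> [b [u Tu ub]|b [_ [u Tu <-] ub]];
    have [_ _ /(_ w FwN) vw _] := fE u Tu.
    by exists (f u); [exists u | rewrite vw].
  by exists u => //; rewrite -vw.
move=> /whynots_plist Mw; rewrite (etyped_None ts Fw).
have [d td de] := hM w D Mw; exists d => //; rewrite de; apply/seteqP; split=> b.
  move=> [v Uv [d' vd db]]; have [a va] := premise_pt dQ (UQ v Uv).
  have : sval (kd k) a by rewrite ke; exists v.
  have [b0 eb] := dual_pt_surj a; rewrite -eb => /dual_whynot_mem.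
  have [k' + k'e] := hL z B Lz; rewrite psetE => /Some_inj/Pt_inj ->; rewrite k'e.
  move=> [u Tu [k0 uk kb]]; have [_ _ _ [k1 uk1 h]] := fE u Tu.
  move: uk1; rewrite uk => /Some_inj/Pt_inj kk; rewrite -{k1}kk in h.
  have [d1 fd d1e] := h w D Mw; exists (f u); first by exists u.
  exists d1 => //; rewrite d1e; exists v; last by exists d'.
  by split=> //; exists (dual_pt b0); [exact/dual_whynot_mem | rewrite va -eb].
move=> [_ [u Tu <-] [d' ud db]]; have [_ _ _ [k0 _ h]] := fE u Tu.
have [d1 fd d1e] := h w D Mw; move: ud; rewrite fd => /Some_inj/Pt_inj dd.
by move: db; rewrite -dd d1e => -[v [Uv _] hv]; exists v.
Qed.

(** Each point of the inner cut yields a point of [P] and a finite set of points of [Q]. Uniting the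
    latter gives [U], whose contexts stay inside the cliques of [t]; it can therefore be promoted,
    and the cut point [k] is the result. *)
Lemma promote_cut_inv :
  denot (TBang x A L' cutPQ) (pset (pjoin s t) x (Pt (A := Bang A) c)) ->
  exists k T, [/\ finite_set T, T `<=` @denot _ P X,
    collects x L T (pset s z (Pt (A := WhyNot B) k)) c &
    denot (TBang z (dual B) M Q) (pset t z (Pt (dual_pt k)))].
Proof.
have tst : etyped (whynots L') (pjoin s t) by rewrite L'E; have [] := etyped_pjoin FM ts tt.
move=> /(denot_bang _ _ L'x tst)[S [fS SC [ce hL']]].
pose kd (k0 : rweb (interp (WhyNot B)) X) : rweb (interp (Bang (dual B))) X :=
  @dual_pt n X (WhyNot B) k0.
pose spec v u (U : env X -> Prop) := [/\ denot P u, u x = v x,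
  forall w, F w <> None -> u w = v w, finite_set U /\ U `<=` @denot _ Q X &
  exists2 k0, u z = Some (Pt (A := WhyNot B) k0) & collects z M U v (kd k0)].
have /choice[g gE] : forall v, exists uU : env X * (env X -> Prop), S v -> spec v uU.1 uU.2.
  move=> v; case: (pselect (S v)) => [Sv|]; last by exists (v, set0).
  have tv : etyped (pjoin F3 (whynots M)) v.
    apply: (denot_typed (P := cutPQ) _ (SC v Sv)).
    by exists F3, (whynots M); split=> //; split=> //; exact: dP3.
  have [u [v' [tu tv' uv ve]]] := etyped_pjoin_inv F3M tv.
  have := SC v Sv; rewrite ve => /(cutE tu tv')[k0 [hP]].
  move=> /(denot_bang (A := dual B) _ _ Mz tv')[U [fU UQ [ke hM]]].
  exists (pset u z (Pt k0), U) => _; split=> //=.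
  - have [a ua] := etyped_pt tu (psetE _ _ _).
    by rewrite /pjoin ua /pset ua; case: eqP => // e; case: xz.
  - move=> w; case Fw: (F w) => [D|] // _.
    have wz : w <> z by move=> wz; rewrite wz Fz in Fw.
    have wx : w <> x by move=> wx; rewrite wx Fx in Fw.
    have Fw3 : F3 w = Some D by rewrite /F3 /pset; case: eqP.
    have [a ua] := etyped_pt tu Fw3.
    by rewrite /pjoin ua /pset ua; case: eqP.
  exists k0; first by rewrite psetE.
  split; first exact: ke.
  move=> w D Mw; have [d vd de] := hM w D Mw; exists d => //.
  have uw : u w = None.
    by apply: (etyped_None tu); have := F3M w; rewrite (plist_whynots Mw) => -[].
  by rewrite /pjoin uw.
pose T := (fun v => (g v).1) @` S; pose U : env X -> Prop := [set u | exists2 v, S v & (g v).2 u].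
have fU : finite_set U.
  rewrite (_ : U = \bigcup_(v in S) (g v).2); last by apply/seteqP; split=> u [v]; exists v.
  by apply: bigcup_finite => // v /gE[_ _ _ []].
have UQ : U `<=` @denot _ Q X by move=> u [v /gE[_ _ _ [_ h] _]]; exact: h.
have tM w D : plist M w = Some D -> exists2 d : rweb (interp (WhyNot D)) X,
    t w = Some (Pt d) & sval d = unions U w.
  move=> Mw; have Fw : F w = None by have := FM w; rewrite (plist_whynots Mw) => -[].
  have L'w : plist L' w = Some D.
    by apply: whynots_plist; rewrite L'E /pjoin Fw; exact: plist_whynots.
  have [d + de] := hL' w D L'w; rewrite /pjoin (etyped_None ts Fw) => td; exists d => //.
  rewrite de; apply/seteqP; split=> b.
    move=> [v Sv [d' vd db]]; have [_ _ _ _ [k0 _ [_ h]]] := gE v Sv.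
    have [d1 + d1e] := h w D Mw; rewrite vd => /Some_inj/Pt_inj dd.
    by move: db; rewrite dd d1e => -[u Uu hu]; exists u => //; exists v.
  move=> [u [v Sv Uu] hu]; have [_ _ _ _ [k0 _ [_ h]]] := gE v Sv.
  have [d1 vd d1e] := h w D Mw; exists v => //; exists d1 => //.
  by rewrite d1e; exists u.
have bU : ctx_bounded M U.
  move=> w D Mw; have [d _ de] := tM w D Mw; exists d => u e Uu ue b eb.
  by rewrite de; exists u => //; exists e.
have [_ [k' [_ [k'e _]]]] := promote_exists (A := dual B) dQ fU UQ bU.
have [k ek] := dual_pt_surj (A := WhyNot B) k'.
exists k, T; split.
- exact: finite_image.
- by move=> _ [v Sv <-]; have [] := gE v Sv.
- split.
    rewrite ce; apply/seteqP; split=> [a [v Sv va]|a [_ [v Sv <-] ua]]; have [_ ux _ _ _] := gE v Sv.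
      by exists (g v).1; [exists v | rewrite ux].
    by exists v => //; rewrite -ux.
  move=> w D Lw; have [wz|wz] := eqVneq w z.
    have eD : D = B.
      by have := plist_whynots Lw; rewrite LE wz psetE => /Some_inj/WhyNot_inj.
    subst D w; exists k; first by rewrite psetE.
    apply/seteqP; split=> b.
      move=> /dual_whynot_mem; rewrite [dual_pt k]ek k'e => -[u [v Sv Uu] ub].
      have [_ _ _ _ [k0 uk0 [k0e _]]] := gE v Sv; exists (g v).1; first by exists v.
      exists k0 => //; apply/dual_whynot_mem; rewrite [dual_pt k0](_ : _ = kd k0) // k0e.
      by exists u.
    move=> [_ [v Sv <-] [k1 uk1 k1b]].
    have [_ _ _ _ [k0 + [k0e _]]] := gE v Sv; rewrite uk1 => /Some_inj/Pt_inj kk.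
    apply/dual_whynot_mem; rewrite [dual_pt k]ek k'e.
    have : sval (kd k0) (dual_pt b) by apply/dual_whynot_mem; rewrite -kk.
    by rewrite k0e => -[u Uu ub]; exists u => //; exists v.
  have Fw : F w = Some (WhyNot D).
    by have := plist_whynots Lw; rewrite LE /pset (negbTE wz).
  have L'w : plist L' w = Some D by apply: whynots_plist; rewrite L'E /pjoin Fw.
  have [d + de] := hL' w D L'w; have [d0 sd0] := etyped_pt ts Fw.
  rewrite /pjoin sd0 => dd; exists d; first by rewrite /pset (negbTE wz) sd0.
  have FwN : F w <> None by rewrite Fw.
  rewrite de; apply/seteqP; split=> [b [v Sv vb]|b [_ [v Sv <-] vb]];
    have [_ _ /(_ w FwN) uw _ _] := gE v Sv.
    by exists (g v).1; [exists v | rewrite uw].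
  by exists v => //; rewrite -uw.
apply/(denot_bang (A := dual B) _ _ Mz tt); exists U; split=> //; split=> //.
by rewrite [dual_pt k]ek.
Qed.

End CommuteBang.

(** * Cut elimination *)

Lemma commute_bang n z (C D : formula n) x A L L' M P Q E :
  der (Cut z C (TBang x A L P) (TBang z D M Q)) E ->
  der (TBang x A L' (Cut z C P (TBang z D M Q))) E ->
  equi (Cut z C (TBang x A L P) (TBang z D M Q))
       (TBang x A L' (Cut z C P (TBang z D M Q))).
Proof.
move=> dl dr; apply: (typed_equi dl dr) => X r.
have [F [G [[Fz Gz FG El] [dT dU]]]] := cut_inv dl.
have [Lx uL eT dP] := dT; have [Mz uM eU dQ] := dU.
have [GE CE] := pset_inj Gz Mz eU; subst G.
(* The cut formula is only known through its dual [Bang D]; taking [B] as the dual of [D] gives it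
   the form [WhyNot B], with [dual B] for [D]. *)
pose B := dual D; have DE : D = dual B by rewrite /B dualK.
have {CE} CE : C = WhyNot B by rewrite -[C]dualK CE.
clearbody B; subst C D.
have [L'x uL' Er dC] := dr; have [F3 [G3 [[F3z G3z FG3 e3] [dP' dU']]]] :=
  cut_inv (dC : der (Cut z (WhyNot B) P (TBang z (dual B) M Q)) _).
have [_ _ e4 _] := dU'; have [G3E _] := pset_inj G3z Mz e4; subst G3.
have xz : x <> z.
  move=> xz; have := congr1 (fun f => f z) (etrans (esym El) Er).
  by rewrite /pjoin Fz Gz -xz psetE.
have zx : z <> x by move=> zx; apply: xz.
pose F4 : context n := fun w => if w == z then None else whynots L w.
have F4z : F4 z = None by rewrite /F4 eqxx.
have F4x : F4 x = None by rewrite /F4; case: eqP.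
have Lz : whynots L z = Some (WhyNot B).
  by have := congr1 (fun f => f z) eT; rewrite psetE /pset; case: eqP.
have LE : whynots L = pset F4 z (WhyNot B).
  by apply: funext => w; rewrite /pset /F4; case: eqP => // ->.
have FE : F = pset F4 x (Bang A).
  have Fz' : pset F4 x (Bang A) z = None by rewrite /pset; case: eqP.
  have e : pset F z (WhyNot B) = pset (pset F4 x (Bang A)) z (WhyNot B).
    by rewrite eT LE [RHS]psetC.
  by have [] := pset_inj Fz Fz' e.
have F3E : F3 = pset F4 x A.
  have wz : pset F4 x A z = None by rewrite /pset; case: eqP.
  have e : pset F3 z (WhyNot B) = pset (pset F4 x A) z (WhyNot B).
    by rewrite (der_unique dP' dP) LE [RHS]psetC.
  by have [] := pset_inj F3z wz e.
have Mx : whynots M x = None by have := FG x; rewrite FE psetE => -[].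
have FM : pdisjoint F4 (whynots M) by have [] := pdisjoint_pset F4x (eq_ind _ (fun f => pdisjoint f _) FG _ FE).
have L'E : whynots L' = pjoin F4 (whynots M).
  have e : pset (whynots L') x A = pset (pjoin F4 (whynots M)) x A.
    by rewrite e3 F3E pjoin_psetl.
  by have [] := pset_inj L'x (pjoin_None F4x Mx) e.
rewrite Er => /(etyped_pset_inv L'x)[r0 [c [_ + ->]]].
rewrite L'E => /(etyped_pjoin_inv FM)[s [t [ts tt _ ->]]].
have tsc : etyped F (pset s x (Pt (A := Bang A) c)) by rewrite FE; exact: etyped_pset.
have sz := etyped_None ts F4z.
rewrite -{1}pjoin_psetl (denot_cut Fz Gz FG dT dU tsc tt).
have tsk k : etyped (whynots L) (pset s z (Pt (A := WhyNot B) k)).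
  by rewrite LE; exact: etyped_pset.
split=> [[k [h hQ]]|h].
  move: h; rewrite psetC // => /(denot_bang _ _ Lx (tsk k))[T [fT TP cT]].
  exact (promote_cut L'x Mz xz F4z F4x LE L'E FM dP dQ dU ts tt fT TP cT hQ).
have [k [T [fT TP cT hQ]]] := promote_cut_inv L'x Mz xz F4z F4x LE L'E FM dP dQ dU ts tt h.
exists k; split=> //; rewrite psetC //; apply/(denot_bang _ _ Lx (tsk k)).
by exists T.
Qed.

Theorem step_sound n (P Q : term n) E : der P E -> der Q E -> step P Q -> equi P Q.
Proof.
move=> dP dQ pq; case: pq dP dQ => {P Q}.
- by move=> *; apply: rename_cut; eassumption.
- by move=> *; apply: rename_par; eassumption.
- by move=> *; apply: rename_contr; eassumption.
- by move=> *; apply: cut_sym.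
- by move=> *; apply: cut_link1; eassumption.
- by move=> *; apply: cut_link2; eassumption.
- by move=> *; apply: cut_unit; eassumption.
- by move=> *; apply: cut_mult; eassumption.
- by move=> *; apply: cut_add1; eassumption.
- by move=> *; apply: cut_add2; eassumption.
- by move=> *; apply: cut_der; eassumption.
- by move=> *; apply: cut_weak; eassumption.
- by move=> *; apply: cut_contr; eassumption.
- by move=> *; apply: cut_quant; eassumption.
- by move=> *; apply: commute_cut1; eassumption.
- by move=> *; apply: commute_cut2; eassumption.
- by move=> *; apply: commute_bot; eassumption.
- by move=> *; apply: commute_tensor1; eassumption.
- by move=> *; apply: commute_tensor2; eassumption.
- by move=> *; apply: commute_par; eassumption.
- by move=> *; apply: commute_plus1; eassumption.
- by move=> *; apply: commute_plus2; eassumption.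
- by move=> *; apply: commute_with; eassumption.
- by move=> *; apply: commute_top.
- by move=> *; apply: commute_bang; eassumption.
- by move=> *; apply: commute_der; eassumption.
- by move=> *; apply: commute_weak; eassumption.
- by move=> *; apply: commute_contr; eassumption.
- by move=> *; apply: commute_all; eassumption.
- by move=> *; apply: commute_ex; eassumption.
Qed.

Theorem red_sound n (P Q : term n) : red P Q -> denot P = denot Q.
Proof.
elim=> {n P Q} /=; try by move=> *; repeat match goal with H : _ = _ |- _ => rewrite {}H end.
move=> n C P Q /derives_der dP /derives_der dQ /(step_sound dP dQ) PQ.
by apply: functional_extensionality_dep => X; apply: funext => r; exact: propext.
Qed.

Theorem theorem40 :
  (* a formula with n free variables is interpreted by an n-parameter variable
     hypercoherence *)
  (forall (n : nat) (A : formula n), variable_hypercoherence (interp A)) /\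
  (* a proof of a sequent is interpreted by a uniform family of cliques *)
  (forall (n : nat) (x : nat) (A : formula n) (L : sequent n) (P : term n),
     proves ((x, A) :: L) P ->
     uniform_clique_family (interp (par_list A L)) (denotation x A L P)) /\
  (* denotations are invariant under cut elimination *)
  (forall (n : nat) (x : nat) (A : formula n) (L : sequent n) (P Q : term n),
     proves ((x, A) :: L) P -> red P Q ->
     denotation x A L P = denotation x A L Q) /\
  (* MALL2 formulas are interpreted by weakly finite variable hypercoherences *)
  (forall (n : nat) (A : formula n), mall A -> weakly_finite (interp A)) /\
  (* a weakly finite variable hypercoherence has finitely many uniform families
     of cliques *)
  (forall (n : nat) (F : rawfun n), variable_hypercoherence F -> weakly_finite F ->
     finite_set [set c | uniform_clique_family F c]) /\
  (* finiteness of the semantics of MALL2 *)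
  (forall (n : nat) (x : nat) (A : formula n), mall A ->
     finite_set [set d | exists P : term n,
       [/\ mall_term P, proves [:: (x, A)] P & d = denotation x A [::] P]]).
Proof.
split; first by move=> n A; exact: normal_variable (normal_interp A).
split; first exact: uniform_clique_denotation.
split; first by move=> n x A L P Q _ /red_sound PQ; rewrite /denotation PQ.
split; first exact: weakly_finite_interp.
split; [exact: finite_uniform_families | exact: finite_denotations].
Qed.
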